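(* Let $(M,g,f)$ be a 4-dimensional complete noncompact shrinking gradient Ricci soliton. If $M$ has constant scalar curvature $R=1$, then $(M,g)$ is isometric to a finite quotient of $\mathbb{R}^2\times \mathbb{S}^2$.
   Context: A shrinking gradient Ricci soliton is a triple $(M,g,f)$ where $(M,g)$ is a complete (connected) Riemannian manifold and $f$ is a smooth function on $M$ with $Ric+\mathrm{Hess}\,f=\frac12 g$. $R$ is the scalar curvature (trace of $Ric$). $\mathbb{R}^2\times\mathbb{S}^2$ is the Riemannian product of the flat plane with the round 2-sphere normalized so that $Ric=\frac12 g$ on $\mathbb{S}^2$ (radius $\sqrt2$). A finite quotient means the quotient by a finite group of isometries acting freely. *)

(* Defs.v *)
From HB Require Import structures.
From mathcomp Require Import all_boot all_order all_algebra all_fingroup.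
From mathcomp Require Import ring.
From mathcomp Require Import all_classical all_reals all_analysis.
Set Implicit Arguments.
Unset Strict Implicit.
Unset Printing Implicit Defensive.
Import Order.TTheory GRing.Theory Num.Theory numFieldNormedType.Exports.
Local Open Scope classical_set_scope.
Local Open Scope ring_scope.

Definition partial (R : realType) n (a : 'I_n) (F : 'rV[R]_n -> R)
  (x : 'rV[R]_n) : R := 'D_(delta_mx 0 a) F x.

(* The derivatives at a point only depend on the germ of the function there, so
   on an open set U these notions do not see the values of F outside of U. *)
Fixpoint Ck_on (R : realType) n k (U : set 'rV[R]_n) (F : 'rV[R]_n -> R) :=
  (forall x, U x -> {for x, continuous F}) /\
  if k is k'.+1 then
    forall a, (forall x, U x -> derivable F x (delta_mx 0 a)) /\
              Ck_on k' U (partial a F)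
  else True.

Definition smooth_on (R : realType) n (U : set 'rV[R]_n) (F : 'rV[R]_n -> R) :=
  forall k, Ck_on k U F.

(* Local tensor calculus for a metric given by its matrix G in coordinates. *)

Definition christoffel (R : realType) n (G : 'rV[R]_n -> 'M[R]_n)
    (k a b : 'I_n) (x : 'rV[R]_n) : R :=
  2^-1 * \sum_l invmx (G x) k l *
    (partial a (fun y => G y b l) x + partial b (fun y => G y a l) x
     - partial l (fun y => G y a b) x).

(* The coefficient along d_l of Rm(d_a, d_b) d_c, with
   Rm(X, Y) Z = D_X D_Y Z - D_Y D_X Z - D_[X, Y] Z. *)
Definition riemann (R : realType) n (G : 'rV[R]_n -> 'M[R]_n)
    (l c a b : 'I_n) (x : 'rV[R]_n) : R :=
  partial a (christoffel G l b c) x - partial b (christoffel G l a c) x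
  + \sum_m (christoffel G l a m x * christoffel G m b c x
            - christoffel G l b m x * christoffel G m a c x).

(* Ric(Y, Z) is the trace of X |-> Rm(X, Y) Z. *)
Definition ricci (R : realType) n (G : 'rV[R]_n -> 'M[R]_n)
    (x : 'rV[R]_n) : 'M[R]_n :=
  \matrix_(b, c) \sum_a riemann G a c a b x.

Definition scalar_curvature (R : realType) n (G : 'rV[R]_n -> 'M[R]_n)
    (x : 'rV[R]_n) : R :=
  \sum_a \sum_b invmx (G x) a b * ricci G x a b.

Definition hessian (R : realType) n (G : 'rV[R]_n -> 'M[R]_n)
    (F : 'rV[R]_n -> R) (x : 'rV[R]_n) : 'M[R]_n :=
  \matrix_(a, b) (partial a (partial b F) x
                  - \sum_k christoffel G k a b x * partial k F x).

(* A space with an atlas and a metric tensor in each chart; the axioms are in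
   is_riemannian. The functions are total, but [chart i] is only meaningful on
   [dom i], and [param i] (the inverse of [chart i]) and [metric i] only on the
   image [cod i]. *)
Record riemannian_data (R : realType) (n : nat) := RiemannianData {
  space :> topologicalType;
  chart_index : Type;
  dom : chart_index -> set space;
  chart : chart_index -> space -> 'rV[R]_n;
  param : chart_index -> 'rV[R]_n -> space;
  metric : chart_index -> 'rV[R]_n -> 'M[R]_n }.

Definition cod (R : realType) n (M : riemannian_data R n) (i : chart_index M)
  : set 'rV[R]_n := chart i @` dom i.

Definition smooth_fun (R : realType) n (M : riemannian_data R n) (f : M -> R) :=
  forall i, smooth_on (cod i) (f \o param i).

(* The local expression of F in the charts i and j, and its domain. *)
Definition local_expr (R : realType) m n (M : riemannian_data R m)
    (N : riemannian_data R n) (F : M -> N) (i : chart_index M)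
    (j : chart_index N) : 'rV[R]_m -> 'rV[R]_n := chart j \o F \o param i.

Definition local_dom (R : realType) m n (M : riemannian_data R m)
    (N : riemannian_data R n) (F : M -> N) (i : chart_index M)
    (j : chart_index N) : set 'rV[R]_m := chart i @` (dom i `&` F @^-1` dom j).

Definition smooth_map (R : realType) m n (M : riemannian_data R m)
    (N : riemannian_data R n) (F : M -> N) :=
  continuous F /\
  forall i j k, smooth_on (local_dom F i j) (fun x => local_expr F i j x 0 k).

(* Row-vector convention: row a is the image of the a-th coordinate field. *)
Definition jacobian_mx (R : realType) m n (H : 'rV[R]_m -> 'rV[R]_n)
    (x : 'rV[R]_m) : 'M[R]_(m, n) :=
  \matrix_(a, k) partial a (fun y => H y 0 k) x.

Definition preserves_metric (R : realType) m n (M : riemannian_data R m)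
    (N : riemannian_data R n) (F : M -> N) :=
  forall i j x, local_dom F i j x ->
    let J := jacobian_mx (local_expr F i j) x in
    metric i x = J *m metric j (local_expr F i j x) *m J^T.

Definition is_manifold (R : realType) n (M : riemannian_data R n) :=
  [/\ hausdorff_space M /\ @second_countable M,
      forall p : M, exists i : chart_index M, dom i p,
      forall i : chart_index M, open (dom i) /\ open (cod i),
      forall i : chart_index M,
        [/\ forall p, dom i p -> param i (chart i p) = p,
            forall p, dom i p -> {for p, continuous (chart i)}
          & forall x, cod i x -> {for x, continuous (param i)}]
    & smooth_map (@id M)].

(* The last condition is the compatibility of the local expressions of the
   metric under changes of charts. *)
Definition is_riemannian (R : realType) n (M : riemannian_data R n) :=
  [/\ is_manifold M,
      forall (i : chart_index M) a b,
        smooth_on (cod i) (fun x => metric i x a b),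
      forall (i : chart_index M) x, cod i x ->
        (metric i x)^T = metric i x /\
        forall v : 'rV[R]_n, v != 0 -> 0 < (v *m metric i x *m v^T) 0 0
    & preserves_metric (@id M)].

Definition local_isometry (R : realType) n (M N : riemannian_data R n)
  (F : M -> N) := smooth_map F /\ preserves_metric F.

Definition isometry (R : realType) n (M N : riemannian_data R n) (F : M -> N) :=
  local_isometry F /\
  exists F' : N -> M, [/\ cancel F F', cancel F' F & local_isometry F'].

Definition isometric (R : realType) n (M N : riemannian_data R n) :=
  exists F : M -> N, isometry F.

Definition geodesic (R : realType) n (M : riemannian_data R n) (c : R -> M) :=
  continuous c /\
  forall (i : chart_index M) (t : R), dom i (c t) ->
    let x (k : 'I_n) (s : R) : R := chart i (c s) 0 k in
    forall k, [/\ derivable (x k) t 1, derivable (derive1 (x k)) t 1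
      & derive1 (derive1 (x k)) t
        + \sum_a \sum_b christoffel (metric i) k a b (chart i (c t))
                        * derive1 (x a) t * derive1 (x b) t = 0].

(* Every initial velocity is that of a geodesic defined on the whole line. *)
Definition geodesically_complete (R : realType) n (M : riemannian_data R n) :=
  forall (i : chart_index M) (p : M) (v : 'rV[R]_n), dom i p ->
    exists c : R -> M,
      [/\ geodesic c, c 0 = p
        & forall k, derive1 (fun s => chart i (c s) 0 k : R) 0 = v 0 k].

Definition shrinking_gradient_ricci_soliton (R : realType) n
    (M : riemannian_data R n) (f : M -> R) :=
  [/\ is_riemannian M, connected [set: M], geodesically_complete M, smooth_fun f
    & forall (i : chart_index M) x, cod i x ->
        ricci (metric i) x + hessian (metric i) (f \o param i) x
        = 2^-1 *: metric i x].

Definition constant_scalar_curvature (R : realType) n (M : riemannian_data R n)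
    (c : R) :=
  forall (i : chart_index M) x, cod i x -> scalar_curvature (metric i) x = c.

Definition riemannian_product (R : realType) m n (M : riemannian_data R m)
    (N : riemannian_data R n) : riemannian_data R (m + n) :=
  @RiemannianData R (m + n) (M * N)%type (chart_index M * chart_index N)%type
    (fun i => dom i.1 `*` dom i.2)
    (fun i p => row_mx (chart i.1 p.1) (chart i.2 p.2))
    (fun i x => (param i.1 (lsubmx x), param i.2 (rsubmx x)))
    (fun i x => block_mx (metric i.1 (lsubmx x)) 0 0 (metric i.2 (rsubmx x))).

Definition euclidean (R : realType) n : riemannian_data R n :=
  @RiemannianData R n 'rV[R]_n unit (fun=> setT) (fun=> id) (fun=> id)
    (fun _ _ => 1%:M).

Definition sqnorm (R : realType) n (x : 'rV[R]_n) : R := \sum_k x 0 k ^+ 2.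

Definition sphere_set (R : realType) n (r : R) : set 'rV[R]_(n + 1) :=
  [set y | sqnorm y = r ^+ 2].

(* The height of y along the pole (0, ..., 0, r) if s is false, and along the
   opposite pole if s is true. *)
Definition height (R : realType) n (s : bool) (y : 'rV[R]_(n + 1)) : R :=
  (-1) ^+ s * y 0 (rshift n 0).

(* Stereographic projection from that pole onto the equatorial hyperplane, and
   its inverse. *)
Definition stereo (R : realType) n (r : R) (s : bool) (y : 'rV[R]_(n + 1))
  : 'rV[R]_n := (r / (r - height s y)) *: lsubmx y.

Definition stereo_inv (R : realType) n (r : R) (s : bool) (u : 'rV[R]_n)
  : 'rV[R]_(n + 1) :=
  (sqnorm u + r ^+ 2)^-1 *:
    row_mx (2 * r ^+ 2 *: u) ((-1) ^+ s * r * (sqnorm u - r ^+ 2))%:M.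

Lemma sqnorm_ge0 (R : realType) n (x : 'rV[R]_n) : 0 <= sqnorm x.
Proof. by apply: sumr_ge0 => k _; exact: sqr_ge0. Qed.

Lemma stereo_inv_sphere (R : realType) n (r : R) s (u : 'rV[R]_n) :
  stereo_inv r s u \in @sphere_set R n r.
Proof.
apply/mem_set; rewrite /sphere_set /= /stereo_inv.
set q := sqnorm u; pose d := q + r ^+ 2.
have -> : sqnorm ((q + r ^+ 2)^-1 *: row_mx (2 * r ^+ 2 *: u)
    ((-1) ^+ s * r * (q - r ^+ 2))%:M)
  = d ^- 2 * (4 * r ^+ 4 * q + r ^+ 2 * (q - r ^+ 2) ^+ 2).
  rewrite {1}/sqnorm big_split_ord big_ord1 [RHS]mulrDr; congr (_ + _); last first.
    by rewrite mxE row_mxEr mxE eqxx mulr1n !exprMn sqrr_sign mul1r exprVn.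
  rewrite /q /sqnorm !mulr_sumr; apply: eq_bigr => k _.
  by rewrite mxE row_mxEl mxE /d -/q -!exprVn; ring.
have q0 : 0 <= q := sqnorm_ge0 u.
have [d0|d0] := eqVneq d 0; last by rewrite /d in d0 *; field.
have r0 : r ^+ 2 = 0.
  by apply/eqP; rewrite eq_le sqr_ge0 andbT -d0 /d lerDr.
by rewrite d0 r0 expr0n invr0 mul0r.
Qed.

(* The metric is the one induced by the Euclidean metric of the ambient space. *)
Definition round_sphere (R : realType) n (r : R) : riemannian_data R n :=
  let pt s u : set_type (@sphere_set R n r) :=
    exist _ (stereo_inv r s u) (stereo_inv_sphere r s u) in
  @RiemannianData R n (set_type (@sphere_set R n r)) bool
    (fun s => [set p | height s (val p) != r])
    (fun s p => stereo r s (val p))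
    pt
    (fun s u => let J := jacobian_mx (fun v => val (pt s v)) u in J *m J^T).

(* The Riemannian manifold Q, with projection proj, is the quotient of N by the
   action of the finite group gT, which is free and isometric. *)
Definition finite_quotient_by (R : realType) n (N Q : riemannian_data R n)
    (gT : finGroupType) (to : {action gT &-> N}) (proj : N -> Q) :=
  [/\ is_riemannian Q,
      forall a, isometry (fun p : N => to p a : N),
      forall a p, to p a = p -> a = 1%g
    & [/\ local_isometry proj, forall q, exists p, proj p = q
        & forall p p', proj p = proj p' <-> exists a, p' = to p a]].

Definition finite_quotient (R : realType) n (N Q : riemannian_data R n) :=
  exists (gT : finGroupType) (to : {action gT &-> N}) (proj : N -> Q),
    finite_quotient_by to proj.

(* Main.v *)
(** Scalar curvature 1 and the soliton equation force an algebraic relation for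
    the third symmetric function of the Ricci tensor along the gradient flow;
    it makes Ric parallel with eigenvalues 0, 0, 1/2, 1/2. The linear system
    dA = Gamma A - Ric y, dy = 2 S A (S the Ricci endomorphism) is then flat, and
    its solutions are local isometries into R^2 x S^2(sqrt 2) inside R^5; the
    gradient of the potential normalizes them, up to O(2) x O(3). By completeness
    they can be inverted along geodesics, which yields a global covering map
    R^2 x S^2 -> M. Its deck transformations act linearly and freely; as a
    rotation of R^3 has an axis, there are at most two of them. *)
From HB Require Import structures.
From mathcomp Require Import all_boot all_order all_algebra all_fingroup.
From mathcomp Require Import ring lra.
From mathcomp Require Import all_classical all_reals all_analysis.
Require Import Defs.

Set Implicit Arguments.
Unset Strict Implicit.
Unset Printing Implicit Defensive.
Import Order.TTheory GRing.Theory Num.Theory numFieldNormedType.Exports.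
Local Open Scope classical_set_scope.
Local Open Scope ring_scope.

(** Let u be that symmetric function, N the gradient of the potential and D = N(u). Differentiating
    the soliton equation gives Ric(N) = 0, |Ric|^2 = 1/2 and |DRic|^2 = 2 Rm(Ric, Ric) - 1/2. Where
    N is nonzero, Ric lives on a complement of dimension 3, where the curvature is an algebraic
    function of its Ricci contraction; so |N|^2 |DRic|^2 = 4 D + 2 u - 12 |N|^2 u, while
    Cauchy-Schwarz yields D^2 <= u |N|^2 |DRic|^2. Hence D + u >= 0, and u = 0 where |N| >= 1. The
    geodesic issuing from a noncritical point along N is a gradient line on which |N| grows
    linearly; it reaches |N| >= 1 in finite time, and monotonicity of |N|^2 u brings u = 0 back to
    its starting point. Critical points have empty interior. No estimate at infinity is involved.
    Globally, geodesics are chosen without any control on their dependence on the initial velocity: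
    the explicit geodesics of the model supply it, and continuation takes place along segments, for
    predicates that are locally constant there. *)

(** * Row vectors and one-variable mean value theorems *)

Section RowNorm.
Variables (R : realType) (n : nat).
Implicit Types (x y v : 'rV[R]_n) (e : R).

Lemma coord_le_norm x k : `|x 0 k| <= `|x|.
Proof.
rewrite [leRHS]/Num.Def.normr/= mx_normrE.
by rewrite (le_trans _ (le_bigmax _ _ (0, k))).
Qed.

Lemma norm_rV_le x e : 0 <= e -> (forall k, `|x 0 k| <= e) -> `|x| <= e.
Proof.
move=> e0 xe; rewrite [leLHS]/Num.Def.normr/= mx_normrE.
by apply: bigmax_le => // -[i j] _ /=; rewrite ord1.
Qed.

Lemma norm_delta_mx_le (a : 'I_n) : `|delta_mx 0 a : 'rV[R]_n| <= 1.
Proof.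
apply: norm_rV_le => // k; rewrite mxE eqxx /=.
by case: eqP => _; rewrite ?normr1 ?normr0.
Qed.

Lemma open_rV_ball (U : set 'rV[R]_n) x : open U -> U x ->
  exists2 e, 0 < e & forall y, `|y - x| < e -> U y.
Proof.
move=> oU Ux; have /nbhs_ballP[e /= e0 He] := open_nbhs_nbhs (conj oU Ux).
by exists e => // y yx; apply: He; rewrite -ball_normE /= distrC.
Qed.

Lemma nbhs_rV_ball (P : set 'rV[R]_n) x : nbhs x P ->
  exists2 e, 0 < e & forall y, `|y - x| < e -> P y.
Proof.
move=> /nbhs_ballP[e /= e0 He].
by exists e => // y yx; apply: He; rewrite -ball_normE /= distrC.
Qed.

Lemma rV_ball_nbhs (P : set 'rV[R]_n) x e : 0 < e ->
  (forall y, `|y - x| < e -> P y) -> nbhs x P.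
Proof.
move=> e0 H; apply/nbhs_ballP; exists e => // y; rewrite -ball_normE /= => yx.
by apply: H; rewrite distrC.
Qed.

Lemma rV_ball_open x e : open [set y | `|y - x| < e].
Proof.
rewrite openE => y /= yx; rewrite /interior; apply: (@rV_ball_nbhs _ _ (e - `|y - x|)).
  by rewrite subr_gt0.
move=> z zy /=; rewrite -(subrK y z) -addrA (le_lt_trans (ler_normD _ _)) //.
by rewrite -ltrBrDr.
Qed.

End RowNorm.

Section MeanValue.
Variable R : realType.

(** The intermediate point is located by its absolute value, so that both signs of h are covered at
    once. *)
Lemma mvt0 (g dg : R -> R) (h : R) :
  (forall t : R, `|t| <= `|h| -> is_derive t 1 g (dg t)) ->
  exists2 c, `|c| <= `|h| & g h - g 0 = dg c * h.
Proof.
move=> H; have [h0|h0|->] := ltgtP h 0; last first.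
- by exists 0; rewrite ?normr0 // subrr mulr0.
- have [x|x|c] := @MVT R g dg 0 h h0.
  + rewrite in_itv /= => /andP[x0 xh]; apply: H.
    by rewrite !ger0_norm // ltW.
  + apply: derivable_within_continuous => y; rewrite in_itv /= => /andP[y0 yh].
    by apply: (@ex_derive _ _ _ _ _ _ _ (H y _)); rewrite !ger0_norm // ltW.
  + rewrite in_itv /= subr0 => /andP[c0 ch] E; exists c => //.
    by rewrite !ger0_norm // ltW.
- have [x|x|c] := @MVT R g dg h 0 h0.
  + rewrite in_itv /= => /andP[x0 xh]; apply: H.
    by rewrite !ltr0_norm // lerN2 ltW.
  + apply: derivable_within_continuous => y; rewrite in_itv /= => /andP[y0 yh].
    by apply: (@ex_derive _ _ _ _ _ _ _ (H y _)); rewrite !ler0_norm ?lerN2 // ltW.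
  + rewrite in_itv /= sub0r => /andP[c0 ch] E; exists c.
      by rewrite !ltr0_norm // lerN2 ltW.
    by rewrite -opprB E mulrN opprK.
Qed.

Lemma is_derive1_const_on (g : R -> R) a b : a <= b ->
  (forall t : R, a <= t <= b -> is_derive t 1 g 0) -> g b = g a.
Proof.
move=> ab H; have [x|x|c] := @MVT_segment R g (cst 0) a b ab.
- by rewrite in_itv /= => /andP[x0 xh]; apply: H; rewrite !ltW.
- apply: derivable_within_continuous => y; rewrite in_itv /= => yab.
  exact: (@ex_derive _ _ _ _ _ _ _ (H y _)).
- by move=> _; rewrite mul0r => /eqP; rewrite subr_eq0 => /eqP.
Qed.

Lemma is_derive1_ge0_le (g dg : R -> R) a b : a <= b ->
  (forall t : R, a <= t <= b -> is_derive t 1 g (dg t)) ->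
  (forall t, a <= t <= b -> 0 <= dg t) -> g a <= g b.
Proof.
move=> ab H H0; have [x|x|c] := @MVT_segment R g dg a b ab.
- by rewrite in_itv /= => /andP[x0 xh]; apply: H; rewrite !ltW.
- apply: derivable_within_continuous => y; rewrite in_itv /= => yab.
  exact: (@ex_derive _ _ _ _ _ _ _ (H y _)).
- rewrite in_itv /= => cab E.
  by rewrite -subr_ge0 E mulr_ge0 ?subr_ge0 // H0.
Qed.

End MeanValue.

(** * Differentiable and smooth functions of several variables *)

Section Differentiability.
Variables (R : realType) (n : nat).
Implicit Types (F : 'rV[R]_n -> R) (x : 'rV[R]_n).

Lemma diff_of_estimate (V W : normedModType R) (F : V -> W) (df : {linear V -> W}) (x : V) :
  continuous df ->
  (forall e, 0 < e -> \forall h \near 0, `|F (h + x) - F x - df h| <= e * `|h|) ->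
  differentiable F x /\ 'd F x = df :> (V -> W).
Proof.
move=> cdf H.
have E : F \o shift x = cst (F x) + df +o_ 0 id.
  apply/eqaddoP => e e0; near=> h.
  have -> : (F \o shift x - (cst (F x) + df)) h = F (h + x) - F x - df h.
    by rewrite /= !fctE /= opprD addrA.
  by near: h; exact: H.
have D := diff_unique cdf E.
by split => //; apply/diff_locallyP; rewrite D.
Unshelve. all: by end_near. Qed.

Definition gradient_map F x (v : 'rV[R]_n) : R := \sum_k v 0 k * partial k F x.

Lemma gradient_map_is_linear F x : linear (gradient_map F x).
Proof.
move=> c u v; rewrite /gradient_map scaler_sumr -big_split; apply: eq_bigr => k _ /=.
by rewrite !mxE mulrDl /GRing.scale /= mulrA.
Qed.

HB.instance Definition _ F x :=
  GRing.isLinear.Build R 'rV[R]_n R _ (gradient_map F x) (gradient_map_is_linear F x).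

Lemma gradient_map_continuous F x : continuous (gradient_map F x).
Proof.
move=> v; apply: differentiable_continuous.
have -> : gradient_map F x = \sum_k ((fun v : 'rV[R]_n => v 0 k) * cst (partial k F x)).
  apply/funext => u; rewrite fct_sumE; apply: eq_bigr => k _ //.
apply: differentiable_sum => k.
exact/differentiableM/differentiable_cst/differentiable_coord.
Qed.

Lemma derive_shift_line F y k (t : R) :
  derivable F (y + t *: delta_mx 0 k) (delta_mx 0 k) ->
  is_derive t 1 (fun u => F (y + u *: delta_mx 0 k)) (partial k F (y + t *: delta_mx 0 k)).
Proof. 
move=> dF.
have E : (fun h : R => h^-1 *: (((fun u => F (y + u *: delta_mx 0 k)) \o shift t) (h *: 1)
      - F (y + t *: delta_mx 0 k)))
  = (fun h => h^-1 *: ((F \o shift (y + t *: delta_mx 0 k)) (h *: delta_mx 0 k)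
      - F (y + t *: delta_mx 0 k))).
  by apply/funext => h /=; rewrite addrCA -scalerDl /GRing.scale /= mulr1.
by split; rewrite /derivable /partial /derive E.
Qed.

(* Telescoping along the coordinate segments from x to x + h. *)
Lemma C1_differentiable (U : set 'rV[R]_n) F x : open U -> U x ->
  (forall k y, U y -> derivable F y (delta_mx 0 k)) ->
  (forall k, {for x, continuous (partial k F)}) ->
  differentiable F x /\ 'd F x = gradient_map F x :> ('rV[R]_n -> R).
Proof.
move=> oU Ux dF cF; apply: (@diff_of_estimate _ _ F (gradient_map F x : {linear _ -> _}) x); first exact: gradient_map_continuous.
move=> e e0; have [r r0 Hr] := open_rV_ball oU Ux.
(* The error is shared among the n coordinate segments; n + 1 avoids a zero denominator. *)
pose e' := e / (n%:R + 1).
have n0 : 0 < n%:R + 1 :> R by rewrite ltr_wpDl.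
have e'0 : 0 < e' by rewrite divr_gt0.
have : \forall y \near x, forall k, `|partial k F x - partial k F y| <= e'.
  refine (@filter_forall _ _ (fun k y => `|partial k F x - partial k F y| <= e') (nbhs x) _ _) => k.
  by have /cvgrPdist_le /(_ e' e'0) := cF k.
move=> /nbhs_rV_ball[d d0 Hd].
apply: (@rV_ball_nbhs _ _ _ _ (Num.min r d)) => [|h]; first by rewrite lt_min r0.
rewrite subr0 lt_min => /andP[hr hd].
pose tr m : 'rV[R]_n := \row_k (if (k < m)%N then h 0 k else 0).
have tr0 : tr 0 = 0 by apply/rowP => k; rewrite !mxE ltn0.
have trn : tr n = h by apply/rowP => k; rewrite !mxE ltn_ord.
have trS (k : 'I_n) : tr k.+1 = tr k + h 0 k *: delta_mx 0 k.
  apply/rowP => j; rewrite !mxE eqxx ltnS leq_eqVlt /=.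
  by have [->|jk] := eqVneq j k; rewrite ?eqxx ?ltnn ?mulr1 ?add0r //= (inj_eq val_inj) (negbTE jk) mulr0 addr0.
have trle (k : 'I_n) t : `|t| <= `|h 0 k| -> `|tr k + t *: delta_mx 0 k| <= `|h|.
  move=> th; apply: norm_rV_le => // j; rewrite !mxE eqxx /=.
  have [->|jk] := eqVneq j k; first by rewrite ltnn mulr1 add0r (le_trans th) // coord_le_norm.
  by rewrite mulr0 addr0; case: ifP => _; rewrite ?normr0 ?coord_le_norm.
have step (k : 'I_n) : `|F (x + tr k.+1) - F (x + tr k) - h 0 k * partial k F x| <= e' * `|h|.
  have [t ht|c ch] := @mvt0 R (fun t => F (x + tr k + t *: delta_mx 0 k))
    (fun t => partial k F (x + tr k + t *: delta_mx 0 k)) (h 0 k).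
    apply: derive_shift_line; apply: dF; apply: Hr.
    by rewrite -(addrA x) (addrC x) addrK (le_lt_trans _ hr) // trle.
  rewrite scale0r addr0 -addrA -trS => ->.
  rewrite mulrC -mulrBr normrM mulrC ler_pM //; last exact: coord_le_norm.
  rewrite distrC; apply: Hd.
  by rewrite -(addrA x) (addrC x) addrK (le_lt_trans _ hd) // trle.
have -> : F (h + x) - F x - gradient_map F x h =
  \sum_(k < n) (F (x + tr k.+1) - F (x + tr k) - h 0 k * partial k F x).
  have := telescope_sumr (fun m => F (x + tr m)) (leq0n n).
  rewrite big_mkord trn tr0 addr0 => T; rewrite [in RHS]sumrB T [h + x]addrC.
  by [].
apply: (le_trans (ler_norm_sum _ _ _)).
apply: (le_trans (ler_sum _ (fun k _ => step k))).
rewrite sumr_const card_ord -mulr_natl mulrA ler_wpM2r //.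
by rewrite /e' mulrCA ger_pMr // ler_pdivrMr // mul1r lerDl.
Qed.

(* Chain rule along a direction: the inner map only needs to be derivable in that direction. *)
Lemma is_derive_comp (V : normedModType R) F (H : V -> 'rV[R]_n) z v :
  differentiable F (H z) -> 'd F (H z) = gradient_map F (H z) :> ('rV[R]_n -> R) ->
  (forall k, derivable (fun u => H u 0 k) z v) ->
  is_derive z v (F \o H) (\sum_k 'D_v (fun u => H u 0 k) z * partial k F (H z)).
Proof.
move=> dF EF dH.
have dHz : derivable H z v by apply/derivable_mxP => i j; rewrite ord1; exact: dH.
pose L := fun t : R => H (t *: v + z).
have dL : derivable L 0 1 by move/derivable1P : dHz.
have DL : differentiable L 0 by apply/derivable1_diffP.
have L0 : L 0 = H z by rewrite /L scale0r add0r.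
have dFL : differentiable F (L 0) by rewrite L0.
have DFL : differentiable (F \o L) 0 by exact: (differentiable_comp DL dFL).
have shiftE (W : normedModType R) (K : V -> W) : 'D_v K z = 'D_1 (fun t : R => K (t *: v + z)) 0.
  have E : (fun h : R => h^-1 *: ((K \o shift z) (h *: v) - K z)) =
    (fun h => h^-1 *: (((fun t : R => K (t *: v + z)) \o shift 0) (h *: 1) - K (0 *: v + z))).
    by apply/funext => h /=; rewrite addr0 scale0r add0r [_%:A]mulr1.
  by rewrite /derive E.
split.
  by apply/derivable1P/derivable1_diffP.
rewrite shiftE (_ : (fun t : R => _) = F \o L) // deriveE // diff_comp //= L0 EF.
rewrite /gradient_map; apply: eq_bigr => k _; congr (_ * _).
rewrite -deriveE // (derive_mx dL) mxE shiftE //.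
Qed.

End Differentiability.

Section CkClosure.
Variables (R : realType).

Lemma partial_eq_on n (U : set 'rV[R]_n) (F F' : 'rV[R]_n -> R) a x :
  open U -> (forall y, U y -> F y = F' y) -> U x -> partial a F x = partial a F' x.
Proof.
move=> oU E Ux; apply: near_eq_derive.
by apply: filterS (open_nbhs_nbhs (conj oU Ux)) => y Uy; exact: E.
Qed.

Lemma derivable_eq_on n (U : set 'rV[R]_n) (F F' : 'rV[R]_n -> R) v x :
  open U -> (forall y, U y -> F y = F' y) -> U x -> derivable F x v -> derivable F' x v.
Proof.
move=> oU E Ux; apply: near_eq_derivable.
by apply: filterS (open_nbhs_nbhs (conj oU Ux)) => y Uy; exact: E.
Qed.

Lemma continuous_eq_on n (T : topologicalType) (U : set 'rV[R]_n) (F F' : 'rV[R]_n -> T) x :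
  open U -> (forall y, U y -> F y = F' y) -> U x ->
  {for x, continuous F} -> {for x, continuous F'}.
Proof.
move=> oU E Ux cF; rewrite /prop_for /continuous_at -(E _ Ux).
have nE : nbhs x (fun y => F y = F' y).
  by apply: filterS (open_nbhs_nbhs (conj oU Ux)) => y Uy; exact: E.
exact: cvg_trans (near_eq_cvg nE) cF.
Qed.

Section Fixed.
Variables (n : nat) (U : set 'rV[R]_n).
Hypothesis oU : open U.
Implicit Types F G : 'rV[R]_n -> R.

Lemma Ck_continuous k F x : Ck_on k U F -> U x -> {for x, continuous F}.
Proof. by case: k => [|k] [cF _]; exact: cF. Qed.

Lemma Ck_ext k F G : (forall y, U y -> F y = G y) -> Ck_on k U F -> Ck_on k U G.
Proof.
elim: k F G => [|k IH] F G E [cF HF].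
  by split => // x Ux; exact: (continuous_eq_on oU E Ux (cF _ Ux)).
split=> [x Ux|a]; first exact: (continuous_eq_on oU E Ux (cF _ Ux)).
have [dF CF] := HF a; split=> [x Ux|]; first exact: (derivable_eq_on oU E Ux (dF _ Ux)).
by apply: IH CF => y Uy; exact: (partial_eq_on a oU E Uy).
Qed.

Lemma Ck_sub k (V : set 'rV[R]_n) F : V `<=` U -> Ck_on k U F -> Ck_on k V F.
Proof.
move=> VU; elim: k F => [|k IH] F [cF HF]; first by split=> // x /VU /cF.
split=> [x /VU /cF //|a]; have [dF CF] := HF a.
by split=> [x /VU /dF //|]; exact: IH.
Qed.

Lemma CkS k F : Ck_on k.+1 U F -> Ck_on k U F.
Proof.
elim: k F => [|k IH] F [cF HF]; first by split.
by split=> // a; have [dF CF] := HF a; split => //; exact: IH.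
Qed.

Lemma Ck_cst k c : Ck_on k U (cst c).
Proof.
elim: k c => [|k IH] c; first by split => // x _; exact: cst_continuous.
split=> [x _|a]; first exact: cst_continuous.
split=> [x _|]; first exact: derivable_cst.
apply: Ck_ext (IH 0) => y _; by rewrite /partial derive_cst.
Qed.

Lemma CkD k F G : Ck_on k U F -> Ck_on k U G -> Ck_on k U (F + G).
Proof.
elim: k F G => [|k IH] F G [cF HF] [cG HG].
  by split=> // x Ux; apply: continuousD; [exact: cF|exact: cG].
split=> [x Ux|a]; first by apply: continuousD; [exact: cF|exact: cG].
have [dF CF] := HF a; have [dG CG] := HG a.
split=> [x Ux|]; first by apply: derivableD; [exact: dF|exact: dG].
apply: Ck_ext (IH _ _ CF CG) => y Uy; rewrite /partial deriveD //; [exact: dF|exact: dG].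
Qed.

Lemma CkM k F G : Ck_on k U F -> Ck_on k U G -> Ck_on k U (F * G).
Proof.
elim: k F G => [|k IH] F G CF0 CG0; have [cF HF] := CF0; have [cG HG] := CG0.
  by split=> // x Ux; apply: continuousM; [exact: cF|exact: cG].
split=> [x Ux|a]; first by apply: continuousM; [exact: cF|exact: cG].
have [dF CF] := HF a; have [dG CG] := HG a.
split=> [x Ux|]; first by apply: derivableM; [exact: dF|exact: dG].
apply: Ck_ext (CkD (IH _ _ (CkS CF0) CG) (IH _ _ (CkS CG0) CF)) => y Uy.
by rewrite /partial deriveM //; [exact: dF|exact: dG].
Qed.

Lemma Ck_inv k F : (forall x, U x -> F x != 0) -> Ck_on k U F ->
  Ck_on k U (fun x => (F x)^-1).
Proof.
move=> F0; elim: k => [|k IH] CF0; have [cF HF] := CF0.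
  by split=> // x Ux; apply: continuousV; [exact: F0|exact: cF].
split=> [x Ux|a]; first by apply: continuousV; [exact: F0|exact: cF].
have [dF CF] := HF a.
split=> [x Ux|]; first by apply: derivableV; [exact: F0|exact: dF].
have I := IH (CkS CF0).
apply: Ck_ext (CkM (Ck_cst k (-1)) (CkM (CkM I I) CF)) => y Uy.
rewrite /partial deriveV; [|exact: F0|exact: dF].
by rewrite /GRing.scale /= -exprVn expr2 mulN1r mulNr.
Qed.

Lemma C1_diff F x : Ck_on 1 U F -> U x ->
  differentiable F x /\ 'd F x = gradient_map F x :> ('rV[R]_n -> R).
Proof.
move=> [cF HF] Ux; apply: (C1_differentiable oU) => // k.
  by move=> y Uy; exact: (proj1 (HF k)).
by have [_ [c _]] := HF k; exact: c.
Qed.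

(** The mean value theorem is applied in direction a, then in direction b. The step r / 3 keeps the
    whole parallelogram inside the ball of radius r. *)
Lemma second_difference F x a b (r : R) : Ck_on 2 U F -> 0 < r ->
  (forall y, `|y - x| < r -> U y) -> exists2 y, `|y - x| < r &
  F (x + (r / 3) *: delta_mx 0 a + (r / 3) *: delta_mx 0 b)
  - F (x + (r / 3) *: delta_mx 0 a) - (F (x + (r / 3) *: delta_mx 0 b) - F x)
  = partial b (partial a F) y * (r / 3) * (r / 3).
Proof.
move=> [cF HF] r0 HU; set h := r / 3.
have h0 : 0 < h by rewrite divr_gt0.
have near2 (s t : R) : `|s| <= h -> `|t| <= h ->
    `|x + s *: delta_mx 0 a + t *: delta_mx 0 b - x| < r.
  move=> sh th; rewrite -(addrA x) (addrC x) addrK (le_lt_trans (ler_normD _ _)) //.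
  have H (c : R) k : `|c| <= h -> `|c *: (delta_mx 0 k : 'rV[R]_n)| <= h.
    by move=> ch; rewrite normrZ (le_trans _ ch) // ler_piMr // norm_delta_mx_le.
  rewrite (le_lt_trans (lerD (H _ _ sh) (H _ _ th))) // /h; lra.
have [dFa [_ /(_ b)[dFab _]]] := HF a.
have hh : `|h| <= h by rewrite gtr0_norm.
have [t th|c ch Ec] := @mvt0 R (fun t => F (x + h *: delta_mx 0 b + t *: delta_mx 0 a)
     - F (x + t *: delta_mx 0 a))
   (fun t => partial a F (x + h *: delta_mx 0 b + t *: delta_mx 0 a)
     - partial a F (x + t *: delta_mx 0 a)) h.
  rewrite (gtr0_norm h0) in th.
  apply: is_deriveB; apply: derive_shift_line; apply: dFa; apply: HU.
    by rewrite (addrAC x (h *: _)); exact: near2.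
  by have := near2 _ _ th (_ : `|0| <= h); rewrite scale0r addr0; apply; rewrite normr0 ltW.
rewrite (gtr0_norm h0) in ch.
have [t th|c' ch' Ec'] := @mvt0 R (fun t => partial a F (x + c *: delta_mx 0 a + t *: delta_mx 0 b))
   (fun t => partial b (partial a F) (x + c *: delta_mx 0 a + t *: delta_mx 0 b)) h.
  rewrite (gtr0_norm h0) in th.
  by apply: derive_shift_line; apply: dFab; apply: HU; exact: near2.
rewrite (gtr0_norm h0) in ch'.
exists (x + c *: delta_mx 0 a + c' *: delta_mx 0 b); first exact: near2.
rewrite scale0r addr0 in Ec'; rewrite -Ec' -(addrAC x (h *: delta_mx 0 b)).
by rewrite !scale0r !addr0 in Ec; rewrite Ec (addrAC x (h *: delta_mx 0 b) (c *: _)).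
Qed.

(** The second difference is symmetric in a and b, so each mixed derivative takes the same value at
    some point of any small ball around x; continuity brings both to x. *)
Lemma partial_comm F x a b : Ck_on 2 U F -> U x ->
  partial a (partial b F) x = partial b (partial a F) x.
Proof.
move=> CF Ux; have [cF HF] := CF.
have [_ [_ /(_ b)[_ cab]]] := HF a; have [_ [_ /(_ a)[_ cba]]] := HF b.
apply/eqP; rewrite -subr_eq0 -normr_le0; apply/ler_addgt0Pr => e e0; rewrite add0r.
have e20 : 0 < e / 2 by rewrite divr_gt0.
have /cvgrPdist_le/(_ _ e20)/nbhs_rV_ball[d1 d10 H1] := proj1 cab _ Ux.
have /cvgrPdist_le/(_ _ e20)/nbhs_rV_ball[d2 d20 H2] := proj1 cba _ Ux.
have [d3 d30 H3] := open_rV_ball oU Ux.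
pose r := Num.min d3 (Num.min d1 d2).
have r0 : 0 < r by rewrite !lt_min d30 d10.
have HU y : `|y - x| < r -> U y by rewrite lt_min => /andP[yr _]; exact: H3.
have [y1 y1r E1] := second_difference a b CF r0 HU.
have [y2 y2r E2] := second_difference b a CF r0 HU.
have r3 : r / 3 != 0 by rewrite mulf_neq0 ?gt_eqF ?invr_gt0.
have E : partial b (partial a F) y1 = partial a (partial b F) y2.
  apply: (mulIf r3 (mulIf r3 (etrans (esym E1) (etrans _ E2)))).
  have sw (p q s t : R) : p - q - (s - t) = p - s - (q - t) by ring.
  by rewrite (addrAC x (r / 3 *: delta_mx 0 a)) sw.
move: y1r y2r; rewrite !lt_min => /and3P[_ /H1 h1 _] /and3P[_ _ /H2 h2].
rewrite -E in h2; rewrite -(subrKA (partial b (partial a F) y1)).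
rewrite distrC in h1; have := lerD h2 h1; rewrite -splitr; apply: le_trans.
exact: ler_normD.
Qed.

End Fixed.

Lemma partial_comp m n (U : set 'rV[R]_m) (V : set 'rV[R]_n) (F : 'rV[R]_n -> R)
    (H : 'rV[R]_m -> 'rV[R]_n) x a :
  open U -> open V -> Ck_on 1 V F -> (forall k, Ck_on 1 U (fun y => H y 0 k)) ->
  U x -> V (H x) ->
  is_derive x (delta_mx 0 a) (F \o H)
    (\sum_k partial a (fun y => H y 0 k) x * partial k F (H x)).
Proof.
move=> oU oV CF CH Ux Vx; have [dF EF] := C1_diff oV CF Vx.
apply: is_derive_comp => // k; have [_ /(_ a)[dH _]] := CH k; exact: dH.
Qed.

Lemma rV_continuous (T : topologicalType) n (H : T -> 'rV[R]_n) x :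
  (forall k, {for x, continuous (fun y => H y 0 k)}) -> {for x, continuous H}.
Proof.
move=> cH; apply/cvgrPdist_le => e e0.
have : nbhs x (fun y => forall k, `|H x 0 k - H y 0 k| <= e).
  refine (@filter_forall _ _ (fun k y => `|H x 0 k - H y 0 k| <= e) (nbhs x) _ _) => k.
  by have /cvgrPdist_le/(_ e e0) := cH k.
apply: filterS => y Hy; apply: norm_rV_le (ltW e0) _ => k.
by rewrite !mxE.
Qed.

(** By induction on k: a partial derivative of the composite is a sum of products of a partial
    derivative of H with one of F composed with H. *)
Lemma Ck_comp m n k (U : set 'rV[R]_m) (V : set 'rV[R]_n) (F : 'rV[R]_n -> R)
    (H : 'rV[R]_m -> 'rV[R]_n) :
  open U -> open V -> Ck_on k V F -> (forall l, Ck_on k U (fun y => H y 0 l)) ->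
  (forall x, U x -> V (H x)) -> Ck_on k U (F \o H).
Proof.
move=> oU oV + + HUV; elim: k F => [|k IH] F CF CH.
  have [cF _] := CF; split=> // x Ux; apply: continuous_comp (cF _ (HUV _ Ux)).
  by apply: rV_continuous => l; have [cH _] := CH l; exact: cH.
have [cF HF] := CF; split=> [x Ux|a].
  apply: continuous_comp (cF _ (HUV _ Ux)).
  by apply: rV_continuous => l; have [cH _] := CH l; exact: cH.
have C1 j W (K : 'rV[R]_j -> R) : Ck_on k.+1 W K -> Ck_on 1 W K.
  by move=> CK; elim: {IH CF CH HF} k CK => // k IHk /CkS; exact: IHk.
have D x : U x -> is_derive x (delta_mx 0 a) (F \o H)
    (\sum_k partial a (fun y => H y 0 k) x * partial k F (H x)).
  move=> Ux; apply: (partial_comp a oU oV) => //; [exact: C1|move=> l; exact: C1|exact: HUV].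
split=> [x /D []//|].
apply: (@Ck_ext _ _ oU _ (\sum_k ((fun x => partial a (fun y => H y 0 k) x) *
   (partial k F \o H)))).
  move=> y /D [_ E]; rewrite /partial E fct_sumE; exact: eq_bigr.
elim/big_ind: _ => [|F1 F2|l _]; [exact: Ck_cst|exact: CkD| ].
apply: CkM => //; first by have [_ /(_ a)[]] := CH l.
apply: IH; first by have [] := HF l.
by move=> j; exact: CkS.
Qed.

End CkClosure.

(* Smooth functions on an open set U, as a ring. A function is made to take
   outside of U its value at a base point of U, so that two elements of the ring
   are equal as soon as they agree on U. *)
Section SmoothRing.
Variables (R : realType) (n : nat).

Record open_set := OpenSet {
  oset :> set 'rV[R]_n; openP : open oset; obase : 'rV[R]_n; obaseP : oset obase }.
Arguments openP : clear implicits.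
Arguments obaseP : clear implicits.

Variable U : open_set.

Definition ext_base (F : 'rV[R]_n -> R) (x : 'rV[R]_n) : R :=
  if `[< oset U x >] then F x else F (obase U).

Lemma ext_baseE F x : oset U x -> ext_base F x = F x.
Proof. by move=> Ux; rewrite /ext_base asboolT. Qed.

Lemma ext_base_smooth F : smooth_on U F -> smooth_on U (ext_base F).
Proof.
move=> sF k; apply: (Ck_ext (openP U) _ (sF k)) => y Uy.
by rewrite ext_baseE.
Qed.

Definition smoothb : {pred 'rV[R]_n -> R} :=
  fun F => `[< smooth_on U F /\ forall x, ~ oset U x -> F x = F (obase U) >].

Lemma smoothb_subring : subring_closed smoothb.
Proof.
split=> [|F G /asboolP[CF EF] /asboolP[CG EG]|F G /asboolP[CF EF] /asboolP[CG EG]];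
  apply/asboolP; split=> [k|x Ux] //.
- rewrite (_ : 1 = cst 1); last by apply/funext.
  exact: (Ck_cst (openP U) k 1).
- apply: (CkD (openP U) (CF k)).
  have -> : - G = cst (-1) * G by apply/funext => x; rewrite !fctE mulN1r.
  exact: (CkM (openP U) (Ck_cst (openP U) k (-1)) (CG k)).
- by rewrite !fctE EF ?EG.
- exact: (CkM (openP U) (CF k) (CG k)).
- by rewrite !fctE EF ?EG.
Qed.

HB.instance Definition _ := GRing.isSubringClosed.Build ('rV[R]_n -> R) smoothb smoothb_subring.

Record smoothfun := SmoothFun { sfun :> 'rV[R]_n -> R; sfunP : sfun \in smoothb }.

HB.instance Definition _ := [isSub for sfun].
HB.instance Definition _ := [Choice of smoothfun by <:].
HB.instance Definition _ := [SubChoice_isSubComNzRing of smoothfun by <:].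

Lemma smoothfunP (F : smoothfun) : smooth_on U F.
Proof. by have /asboolP[] := sfunP F. Qed.

Lemma smoothfun_eq (F G : smoothfun) : (forall x, oset U x -> F x = G x) -> F = G.
Proof.
move=> E; apply/val_inj/funext => x /=; have [Ux|nUx] := pselect (oset U x); first exact: E.
have /asboolP[_ ->] // := sfunP F; have /asboolP[_ ->] // := sfunP G.
exact/E/obaseP.
Qed.

Lemma mksmooth_subproof (F : 'rV[R]_n -> R) (sF : smooth_on U F) : ext_base F \in smoothb.
Proof.
apply/asboolP; split; first exact: ext_base_smooth.
by move=> x nU; rewrite /ext_base asboolF // asboolT //; exact: obaseP.
Qed.

Definition mksmooth F sF : smoothfun := SmoothFun (@mksmooth_subproof F sF).

Lemma mksmoothE F sF x : oset U x -> @mksmooth F sF x = F x.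
Proof. exact: ext_baseE. Qed.

Definition evs (x : 'rV[R]_n) (F : smoothfun) : R := F x.

Lemma evs_is_zmod_morphism x : zmod_morphism (evs x).
Proof. by []. Qed.

Lemma evs_is_monoid_morphism x : monoid_morphism (evs x).
Proof. by []. Qed.

HB.instance Definition _ x := GRing.isZmodMorphism.Build smoothfun R (evs x) (evs_is_zmod_morphism x).
HB.instance Definition _ x := GRing.isMonoidMorphism.Build smoothfun R (evs x) (evs_is_monoid_morphism x).

Lemma partial_smooth_on a (F : 'rV[R]_n -> R) : smooth_on U F -> smooth_on U (partial a F).
Proof. by move=> sF k; have [_ /(_ a)[_ CF]] := sF k.+1. Qed.

Definition sder a (F : smoothfun) : smoothfun := mksmooth (partial_smooth_on a (smoothfunP F)).

Lemma sderE a F x : oset U x -> sder a F x = partial a F x.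
Proof. exact: mksmoothE. Qed.

Lemma smooth_derivable a F x : smooth_on U F -> oset U x -> derivable F x (delta_mx 0 a).
Proof. by move=> sF Ux; have [_ /(_ a)[dF _]] := sF 1; exact: dF. Qed.

Lemma sderD a F G : sder a (F + G) = sder a F + sder a G.
Proof.
apply/smoothfun_eq => x Ux; rewrite [RHS]/(sder a F x + sder a G x) !sderE //.
by rewrite /partial deriveD //; exact: smooth_derivable (smoothfunP _) Ux.
Qed.

Lemma sderM a F G : sder a (F * G) = sder a F * G + F * sder a G.
Proof.
apply/smoothfun_eq => x Ux; rewrite [RHS]/(sder a F x * G x + F x * sder a G x) !sderE //.
rewrite /partial deriveM; [|exact: smooth_derivable (smoothfunP _) Ux..].
by rewrite /GRing.scale /= addrC (mulrC (G x)).
Qed.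

Lemma sderC a b F : sder a (sder b F) = sder b (sder a F).
Proof.
apply/smoothfun_eq => x Ux.
have E c d : sder c (sder d F) x = partial c (partial d F) x.
  rewrite sderE //; apply: (partial_eq_on _ (openP U) _ Ux) => y Uy.
  by rewrite sderE.
by rewrite !E (partial_comm (openP U) _ _ (smoothfunP F 2) Ux).
Qed.

Lemma const_smooth (c : R) : smooth_on U (cst c).
Proof. by move=> k; exact: (Ck_cst (openP U) k c). Qed.

Definition sconst c : smoothfun := mksmooth (const_smooth c).

Lemma sconstE c x : sconst c x = c.
Proof. by rewrite /= /ext_base; case: ifP. Qed.

Lemma sconst_is_zmod_morphism : zmod_morphism sconst.
Proof. by move=> c e; apply/smoothfun_eq => x _; rewrite [RHS]/(sconst c x - sconst e x) !sconstE. Qed.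

Lemma sconst_is_monoid_morphism : monoid_morphism sconst.
Proof.
by split=> [|c e]; apply/smoothfun_eq => x _; rewrite ?[RHS]/(sconst c x * sconst e x) !sconstE.
Qed.

HB.instance Definition _ := GRing.isZmodMorphism.Build R smoothfun sconst sconst_is_zmod_morphism.
HB.instance Definition _ := GRing.isMonoidMorphism.Build R smoothfun sconst sconst_is_monoid_morphism.

Lemma sder_const a c : sder a (sconst c) = 0.
Proof.
apply/smoothfun_eq => x Ux; rewrite sderE //.
rewrite (@partial_eq_on _ _ U _ (cst c) _ _ (openP U)) //; last by move=> y _; exact: sconstE.
by rewrite /partial derive_cst.
Qed.

End SmoothRing.

Arguments openP {R n} o.
Arguments obaseP {R n} o.

(** * Tensor calculus over an abstract differential ring *)

Section DifferentialRing.
Variables (R : comNzRingType) (n : nat).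

(** The [d a] model commuting coordinate fields and [kap] the constants. In such a ring every
    expression can be differentiated again, which keeps smoothness proofs out of the tensor
    identities. *)
Record diff_ring (A : comNzRingType) (kap : {rmorphism R -> A}) (d : 'I_n -> A -> A) : Prop :=
  DiffRing {
  dr_add : forall a x y, d a (x + y) = d a x + d a y;
  dr_mul : forall a x y, d a (x * y) = d a x * y + x * d a y;
  dr_comm : forall a b x, d a (d b x) = d b (d a x);
  dr_const : forall a c, d a (kap c) = 0 }.

Variables (A : comNzRingType) (kap : {rmorphism R -> A}) (d : 'I_n -> A -> A).
Hypothesis dA : diff_ring kap d.

Lemma dr0 a : d a 0 = 0.
Proof. by have := dr_const dA a 0; rewrite rmorph0. Qed.

Lemma drN a x : d a (- x) = - d a x.
Proof.
by apply/eqP; rewrite -addr_eq0 -(dr_add dA) addNr dr0.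
Qed.

Lemma dr_sum a (I : Type) (r : seq I) P (F : I -> A) :
  d a (\sum_(i <- r | P i) F i) = \sum_(i <- r | P i) d a (F i).
Proof. by apply: (big_morph (d a)); [exact: dr_add dA a|exact: dr0]. Qed.

Definition dmx p q (a : 'I_n) (X : 'M[A]_(p, q)) : 'M[A]_(p, q) := map_mx (d a) X.

Lemma dmxD p q a (X Y : 'M[A]_(p, q)) : dmx a (X + Y) = dmx a X + dmx a Y.
Proof. by apply/matrixP => i j; rewrite !mxE (dr_add dA). Qed.

Lemma dmxN p q a (X : 'M[A]_(p, q)) : dmx a (- X) = - dmx a X.
Proof. by apply/matrixP => i j; rewrite !mxE drN. Qed.

Lemma dmx0 p q a : dmx a (0 : 'M[A]_(p, q)) = 0.
Proof. by apply/matrixP => i j; rewrite !mxE dr0. Qed.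

Lemma dmxM p q r a (X : 'M[A]_(p, q)) (Y : 'M[A]_(q, r)) :
  dmx a (X *m Y) = dmx a X *m Y + X *m dmx a Y.
Proof.
apply/matrixP => i j; rewrite !mxE dr_sum -big_split; apply: eq_bigr => k _ /=.
by rewrite !mxE (dr_mul dA).
Qed.

Lemma dmxC p q a b (X : 'M[A]_(p, q)) : dmx a (dmx b X) = dmx b (dmx a X).
Proof. by apply/matrixP => i j; rewrite !mxE (dr_comm dA). Qed.

Lemma dmx_const p q a (X : 'M[R]_(p, q)) : dmx a (map_mx kap X) = 0.
Proof. by apply/matrixP => i j; rewrite !mxE (dr_const dA). Qed.

Lemma dmx_row p q a i (X : 'M[A]_(p, q)) : dmx a (row i X) = row i (dmx a X).
Proof. by apply/matrixP => k j; rewrite !mxE. Qed.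

Lemma dmx_trmx p q a (X : 'M[A]_(p, q)) : dmx a X^T = (dmx a X)^T.
Proof. by apply/matrixP => k j; rewrite !mxE. Qed.

Lemma dmxZ p q a c (X : 'M[A]_(p, q)) : dmx a (c *: X) = d a c *: X + c *: dmx a X.
Proof. by apply/matrixP => k j; rewrite !mxE (dr_mul dA). Qed.

Lemma dmx_trace p a (X : 'M[A]_p) : d a (\tr X) = \tr (dmx a X).
Proof. by rewrite /mxtrace dr_sum; apply: eq_bigr => i _; rewrite mxE. Qed.

Lemma dmx_sum p q a (I : Type) (r : seq I) P (F : I -> 'M[A]_(p, q)) :
  dmx a (\sum_(i <- r | P i) F i) = \sum_(i <- r | P i) dmx a (F i).
Proof. by apply: (big_morph (dmx a)); [exact: dmxD|exact: dmx0]. Qed.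

End DifferentialRing.

Section Connection.
Variables (R : comNzRingType) (n : nat) (A : comNzRingType) (kap : {rmorphism R -> A})
  (d : 'I_n -> A -> A).
Hypothesis dA : diff_ring kap d.
Local Notation dmx := (dmx d).
(* Row b of [Y a] holds the components of the derivative of e_b along e_a. *)
Variable Y : 'I_n -> 'M[A]_n.
Hypothesis Ysym : forall a b, row a (Y b) = row b (Y a).

(** Vectors are rows of components and endomorphisms act on them from the right. In [nabe] the
    differentiation index is a mere label; [Dcurv] and [Dnab] also correct the form indices and are
    therefore tensors. *)
Definition nabv a (v : 'rV[A]_n) : 'rV[A]_n := dmx a v + v *m Y a.
Definition nabe a (X : 'M[A]_n) : 'M[A]_n := dmx a X + X *m Y a - Y a *m X.
Definition curv a b : 'M[A]_n := dmx a (Y b) - dmx b (Y a) + Y b *m Y a - Y a *m Y b.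
Definition Dcurv c a b : 'M[A]_n := nabe c (curv a b)
  - \sum_k Y c a k *: curv k b - \sum_k Y c b k *: curv a k.
Definition Dnab (T : 'I_n -> 'M[A]_n) a b : 'M[A]_n := nabe a (T b) - \sum_k Y a b k *: T k.

Lemma YsymE a b k : Y a b k = Y b a k.
Proof. by have /rowP/(_ k) := Ysym a b; rewrite !mxE. Qed.

Lemma curv_skew a b : curv b a = - curv a b.
Proof.
rewrite /curv; move: (dmx a (Y b)) (dmx b (Y a)) (Y b *m Y a) (Y a *m Y b) => p q r s.
by apply/matrixP => i j; rewrite !mxE; ring.
Qed.

Lemma nabv_nabv a b v : nabv a (nabv b v) - nabv b (nabv a v) = v *m curv a b.
Proof.
rewrite /nabv /curv !(dmxD dA) !(dmxM dA) (dmxC dA b a v) !mulmxDl !mulmxDr !mulmxN !mulmxA.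
(* Each product is abstracted to an atom: the identity becomes linear, and [ring] settles it entry
   by entry. *)
move: (dmx a (dmx b v)) (dmx a v *m Y b) (v *m dmx a (Y b)) (dmx b v *m Y a) (v *m Y b *m Y a)
  (v *m dmx b (Y a)) (v *m Y a *m Y b) => p q r s t u w.
by apply/matrixP => i j; rewrite !mxE; ring.
Qed.

Lemma nabe_nabe a b X : nabe a (nabe b X) - nabe b (nabe a X) = X *m curv a b - curv a b *m X.
Proof.
rewrite /nabe /curv !(dmxD dA) !(dmxN dA) !(dmxM dA) (dmxC dA b a X).
rewrite !(mulmxDl, mulmxDr, mulmxN, mulNmx, mulmxA).
move: (dmx a (dmx b X)) (dmx a X *m Y b) (X *m dmx a (Y b)) (dmx a (Y b) *m X) (Y b *m dmx a X)
 (dmx b X *m Y a) (X *m Y b *m Y a) (Y b *m X *m Y a) (Y a *m dmx b X) (Y a *m X *m Y b)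
 (Y a *m Y b *m X) (X *m dmx b (Y a)) (X *m Y a *m Y b) (dmx b (Y a) *m X) (Y b *m Y a *m X).
move=> p1 p2 p3 p4 p5 p6 p7 p8 p9 p10 p11 p12 p13 p14 p15.
by apply/matrixP => i j; rewrite !mxE; ring.
Qed.

(** Torsion-freeness exchanges the row index with the direction of Y, after which the derivatives
    and the quadratic terms cancel in pairs. *)
Lemma bianchi1 a b c : row c (curv a b) + row a (curv b c) + row b (curv c a) = 0.
Proof.
have rowE i (p q r s : 'M[A]_n) : row i (p - q + r - s) = row i p - row i q + row i r - row i s.
  by apply/rowP => j; rewrite !mxE.
rewrite /curv !rowE -!(dmx_row d) !row_mul.
rewrite (Ysym b a) (Ysym c a) (Ysym c b).
move: (dmx a (row b (Y c))) (dmx b (row a (Y c))) (dmx c (row a (Y b)))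
  (row a (Y b) *m Y c) (row a (Y c) *m Y b) (row b (Y c) *m Y a) => p q r s t u.
by apply/matrixP => i j; rewrite !mxE; ring.
Qed.

Lemma nabeD a X Z : nabe a (X + Z) = nabe a X + nabe a Z.
Proof.
rewrite /nabe (dmxD dA) mulmxDl mulmxDr.
move: (dmx a X) (dmx a Z) (X *m Y a) (Z *m Y a) (Y a *m X) (Y a *m Z) => p q r s t u.
by apply/matrixP => i j; rewrite !mxE; ring.
Qed.

Lemma nabeN a X : nabe a (- X) = - nabe a X.
Proof. by rewrite /nabe (dmxN dA) mulmxN mulNmx !opprD. Qed.

Lemma nabeM a X Z : nabe a (X *m Z) = nabe a X *m Z + X *m nabe a Z.
Proof.
rewrite /nabe (dmxM dA) !(mulmxDl, mulmxDr, mulmxN, mulNmx) !mulmxA.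
move: (dmx a X *m Z) (X *m dmx a Z) (X *m Z *m Y a) (Y a *m X *m Z) (X *m Y a *m Z) => p q r s t.
by apply/matrixP => i j; rewrite !mxE; ring.
Qed.

Lemma nabvM a v X : nabv a (v *m X) = nabv a v *m X + v *m nabe a X.
Proof.
rewrite /nabv /nabe (dmxM dA) !(mulmxDl, mulmxDr, mulmxN, mulNmx) !mulmxA.
move: (dmx a v *m X) (v *m dmx a X) (v *m X *m Y a) (v *m Y a *m X) => p q r s.
by apply/matrixP => i j; rewrite !mxE; ring.
Qed.

Lemma dr_trace a X : d a (\tr X) = \tr (nabe a X).
Proof.
by rewrite (dmx_trace dA) /nabe raddfB /= mxtraceD (mxtrace_mulC X) addrK.
Qed.

Lemma nabv_row a b X : nabv a (row b X) = row b (nabe a X) + \sum_k Y a b k *: row k X.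
Proof.
have -> : \sum_k Y a b k *: row k X = row b (Y a *m X).
  by apply/rowP => j; rewrite summxE !mxE; apply: eq_bigr => k _; rewrite !mxE.
by rewrite /nabv /nabe -row_mul dmx_row; apply/rowP => j; rewrite !mxE subrK.
Qed.

Lemma Dnab_skew T a b X : (forall c, T c = nabe c X) ->
  Dnab T a b - Dnab T b a = X *m curv a b - curv a b *m X.
Proof.
move=> TX; rewrite /Dnab -nabe_nabe !TX.
have -> : \sum_k Y b a k *: T k = \sum_k Y a b k *: T k.
  by apply: eq_bigr => k _; rewrite YsymE.
by rewrite opprB addrA subrK.
Qed.

Lemma Dcurv_skew c a b : Dcurv c b a = - Dcurv c a b.
Proof.
have E e f g : \sum_k Y e f k *: curv g k = - \sum_k Y e f k *: curv k g.
  by rewrite -sumrN; apply: eq_bigr => k _; rewrite curv_skew scalerN.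
by rewrite /Dcurv curv_skew nabeN (E c b a) (E c a b) !opprD !opprK addrAC.
Qed.

Lemma nabe_curv a b c : nabe a (curv b c) + nabe b (curv c a) + nabe c (curv a b) = 0.
Proof.
rewrite /nabe /curv !(dmxD dA) !(dmxN dA) !(dmxM dA).
rewrite (dmxC dA b a) (dmxC dA c a) (dmxC dA c b) !(mulmxDl, mulmxDr, mulmxN, mulNmx, mulmxA).
move: (dmx a (dmx b (Y c))) (dmx a (dmx c (Y b))) (dmx b (dmx c (Y a))).
move: (dmx a (Y b)) (dmx a (Y c)) (dmx b (Y a)) (dmx b (Y c)) (dmx c (Y a)) (dmx c (Y b)).
move: (Y a) (Y b) (Y c) => u v w p1 p2 p3 p4 p5 p6 q1 q2 q3.
move: (w *m v *m u) (v *m w *m u) (u *m w *m v) (u *m v *m w) (w *m u *m v) (v *m u *m w)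
 (p1 *m w) (w *m p1) (p2 *m v) (v *m p2) (p3 *m w) (w *m p3) (p4 *m u) (u *m p4) (p5 *m v)
 (v *m p5) (p6 *m u) (u *m p6) => r1 r2 r3 r4 r5 r6 r7 r8 r9 s1 s2 s3 s4 s5 s6 s7 s8 s9.
by apply/matrixP => i j; rewrite !mxE; ring.
Qed.

(** The corrections of the form indices cancel among the three terms, by the symmetry of Y and the
    skew symmetry of [curv]; what remains is [nabe_curv]. *)
Lemma bianchi2 a b c : Dcurv c a b + Dcurv a b c + Dcurv b c a = 0.
Proof.
have := nabe_curv a b c; pose s e f g := \sum_k Y e f k *: curv k g.
have E e f g : \sum_k Y e f k *: curv g k = - s e f g.
  by rewrite -sumrN; apply: eq_bigr => k _; rewrite curv_skew scalerN.
have sC e f g : s e f g = s f e g by apply: eq_bigr => k _; rewrite YsymE.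
rewrite /Dcurv !E -!/(s _ _ _) (sC c a) (sC c b) (sC b a).
move: (s _ _ _) (s _ _ _) (s _ _ _) (nabe a _) (nabe b _) (nabe c _) => p q r u v w.
move=> /matrixP H; apply/matrixP => i j; have := H i j; rewrite !mxE => <-; ring.
Qed.

End Connection.

(* The tensors of a gradient soliton with scalar curvature 1: the metric G, the
   Ricci endomorphism S and the gradient N of the potential; h stands for 1/2. *)
Record soliton_ring (R A : comNzRingType) n (kap : {rmorphism R -> A}) (d : 'I_n -> A -> A)
    (Y : 'I_n -> 'M[A]_n) (h : R) (G S : 'M[A]_n) (N : 'rV[A]_n) : Prop := SolitonRing {
  sr_diff : diff_ring kap d;
  sr_torsion : forall a b, row a (Y b) = row b (Y a);
  sr_half : h + h = 1;
  sr_metric : forall a, dmx d a G = Y a *m G + G *m (Y a)^T;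
  sr_Gsym : G^T = G;
  sr_Ssym : (S *m G)^T = S *m G;
  sr_ric : forall b c, \sum_a curv d Y a b c a = (S *m G) b c;
  sr_grad : forall a, nabv d Y a N = row a ((kap h)%:M - S);
  sr_trace : \tr S = 1 }.

Section SolitonRing.
Variables (R A : comNzRingType) (n : nat) (kap : {rmorphism R -> A}) (d : 'I_n -> A -> A)
  (Y : 'I_n -> 'M[A]_n) (h : R) (G S : 'M[A]_n) (N : 'rV[A]_n).
Hypothesis sr : soliton_ring kap d Y h G S N.
Local Notation dmx := (dmx d).
Local Notation nabv := (nabv d Y).
Local Notation nabe := (nabe d Y).
Local Notation curv := (curv d Y).
Local Notation Dcurv := (Dcurv d Y).
Let dA := sr_diff sr.
Let Ysym := sr_torsion sr.

Definition hess_endo : 'M[A]_n := (kap h)%:M - S.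
Definition Dric a : 'M[A]_n := nabe a S.
Local Notation T := Dric.
Local Notation H := (Dnab d Y Dric).

(** The covariant derivative of X read as a bilinear form. *)
Definition nabb a (X : 'M[A]_n) : 'M[A]_n := dmx a X - Y a *m X - X *m (Y a)^T.

Lemma nabb_mulG a X : nabb a (X *m G) = nabe a X *m G.
Proof.
rewrite /nabb /nabe (dmxM dA) (sr_metric sr) !(mulmxDl, mulmxDr, mulmxN, mulNmx) !mulmxA.
move: (dmx a X *m G) (X *m Y a *m G) (X *m G *m (Y a)^T) (Y a *m X *m G) => p q r s.
by apply/matrixP => i j; rewrite !mxE; ring.
Qed.

Lemma nabb_tr a X : (nabb a X)^T = nabb a X^T.
Proof.
rewrite /nabb !raddfB /= !trmx_mul trmxK (dmx_trmx d).
by rewrite -!addrA; congr (_ + _); rewrite addrC.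
Qed.

Lemma nabbN a X : nabb a (- X) = - nabb a X.
Proof. by rewrite /nabb (dmxN dA) mulmxN mulNmx !opprD. Qed.

(** G is parallel, so the commutator of covariant derivatives kills it; on G that commutator is
    minus the sum of [curv a b *m G] and its transpose. *)
Lemma curvG a b : (curv a b *m G)^T = - (curv a b *m G).
Proof.
have E c : nabb c G = 0 by rewrite /nabb (sr_metric sr) addrAC addrK subrr.
have nabb0 c : nabb c 0 = 0 by rewrite /nabb (dmx0 dA) mulmx0 mul0mx !subr0.
have : nabb a (nabb b G) - nabb b (nabb a G) = 0 by rewrite !E !nabb0 subrr.
have -> : nabb a (nabb b G) - nabb b (nabb a G) = - (curv a b *m G) - G *m (curv a b)^T.
  rewrite /nabb /curv !(dmxD dA) !(dmxN dA) !(dmxM dA) (dmxC dA b a) !(dmx_trmx d).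
  rewrite !(raddfB, raddfD) /= !trmx_mul !(mulmxDl, mulmxDr, mulmxN, mulNmx, mulmxA).
  move: (dmx a G) (dmx b G) (dmx a (Y b)) (dmx b (Y a)) => q r s t.
  move: (dmx a r) => p0.
  move: (s *m G) (t *m G) (Y b *m q) (Y a *m r) (q *m (Y b)^T) (r *m (Y a)^T) (G *m s^T)
   (G *m t^T) (Y a *m Y b *m G) (Y b *m Y a *m G) (Y a *m G *m (Y b)^T)
   (Y b *m G *m (Y a)^T) (G *m (Y a)^T *m (Y b)^T) (G *m (Y b)^T *m (Y a)^T).
  move=> p1 p2 p3 p4 p5 p6 p7 p8 p9 q1 q2 q3 q4 q5.
  by apply/matrixP => i j; rewrite !mxE; ring.
by move/eqP; rewrite subr_eq0 => /eqP ->; rewrite trmx_mul (sr_Gsym sr).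
Qed.

Lemma DcurvG c a b : (Dcurv c a b *m G)^T = - (Dcurv c a b *m G).
Proof.
have E : (nabe c (curv a b) *m G)^T = - (nabe c (curv a b) *m G).
  by rewrite -nabb_mulG nabb_tr curvG nabbN.
have skB (X Z : 'M[A]_n) : (X *m G)^T = - (X *m G) -> (Z *m G)^T = - (Z *m G) ->
    ((X - Z) *m G)^T = - ((X - Z) *m G).
  by move=> EX EZ; rewrite mulmxBl linearB /= EX EZ opprB opprK addrC.
have skS (I : finType) (c' : I -> A) (X : I -> 'M[A]_n) :
    (forall i, (X i *m G)^T = - (X i *m G)) ->
    ((\sum_i c' i *: X i) *m G)^T = - ((\sum_i c' i *: X i) *m G).
  move=> EX; rewrite mulmx_suml linear_sum /= -sumrN; apply: eq_bigr => i _.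
  by rewrite -scalemxAl linearZ /= EX scalerN.
by apply: (skB _ _ (skB _ _ E _)); apply: skS => k; exact: curvG.
Qed.

Lemma Dric_sym a : (T a *m G)^T = T a *m G.
Proof. by rewrite -nabb_mulG nabb_tr (sr_Ssym sr). Qed.

Lemma Dnab_sym a b : (H a b *m G)^T = H a b *m G.
Proof.
rewrite /Dnab mulmxBl raddfB /= -nabb_mulG nabb_tr Dric_sym; congr (_ - _).
rewrite mulmx_suml raddf_sum; apply: eq_bigr => k _ /=.
by rewrite -scalemxAl linearZ /= Dric_sym.
Qed.

(** The derivative of the first Bianchi identity; the correction terms are themselves sums of
    instances of that identity. *)
Lemma Dcurv_bianchi1 c e a b :
  row e (Dcurv c a b) + row a (Dcurv c b e) + row b (Dcurv c e a) = 0.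
Proof.
have E : nabv c (row e (curv a b) + row a (curv b e) + row b (curv e a)) = 0.
  by rewrite (bianchi1 d Ysym) /nabv (dmx0 dA) mul0mx addr0.
have nabvD v w : nabv c (v + w) = nabv c v + nabv c w.
  rewrite /nabv (dmxD dA) mulmxDl -!addrA; congr (_ + _).
  by rewrite addrCA; congr (_ + _); rewrite addrC.
rewrite !nabvD !nabv_row in E.
have B f g k : \sum_i Y c f i *: row i (curv g k) + \sum_i Y c f i *: row g (curv k i)
   + \sum_i Y c f i *: row k (curv i g) = 0.
  by rewrite -!big_split big1 // => i _; rewrite /= -!scalerDr (bianchi1 d Ysym) scaler0.
have D f g k : row f (Dcurv c g k) = row f (nabe c (curv g k))
   - \sum_i Y c g i *: row f (curv i k) - \sum_i Y c k i *: row f (curv g i).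
  apply/rowP => j; rewrite /Dcurv !mxE !summxE; congr (_ - _ - _);
  by apply: eq_bigr => i _; rewrite !mxE.
have := B e a b; have := B a b e; have := B b e a; rewrite !D; move: E.
move: (row e (nabe _ _)) (row a (nabe _ _)) (row b (nabe _ _)) => x y z.
move: (\sum_i _) (\sum_i _) (\sum_i _) (\sum_i _) (\sum_i _) (\sum_i _)
  (\sum_i _) (\sum_i _) (\sum_i _) => p1 p2 p3 p4 p5 p6 p7 p8 p9.
move=> /rowP E1 /rowP E2 /rowP E3 /rowP E4; apply/rowP => j.
move: (E1 j) (E2 j) (E3 j) (E4 j); rewrite !mxE => F1 F2 F3 F4.
rewrite -[RHS]F1 -[LHS]addr0 -[LHS]addr0 -[LHS]addr0 -{1}F2 -{1}F3 -F4; ring.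
Qed.

(** Contraction commutes with covariant differentiation: the corrections attached to the two
    contracted slots cancel each other. *)
Lemma Dcurv_ric c b e : \sum_a Dcurv c a b e a = (T c *m G) b e.
Proof.
rewrite -nabb_mulG /nabb.
have -> : \sum_a Dcurv c a b e a = \sum_a d c (curv a b e a)
   + (\sum_a (curv a b *m Y c) e a - \sum_a \sum_k Y c a k * curv k b e a)
   - \sum_a (Y c *m curv a b) e a - \sum_a \sum_k Y c b k * curv a k e a.
  rewrite -sumrB -big_split /= -!sumrB; apply: eq_bigr => a _.
  have Q x (Z : 'I_n -> 'M[A]_n) : (\sum_k Y c x k *: Z k) e a = \sum_k Y c x k * Z k e a.
    by rewrite summxE; apply: eq_bigr => k _; rewrite [LHS]mxE.
  rewrite -!Q /Dcurv /nabe; move: (curv a b) (\sum_k _) (\sum_k _) => X Z1 Z2.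
  rewrite !mxE.
  ring.
have -> : \sum_a (curv a b *m Y c) e a = \sum_a \sum_k Y c a k * curv k b e a.
  under eq_bigr do rewrite mxE.
  by rewrite exchange_big /=; apply: eq_bigr => k _; apply: eq_bigr => a _; rewrite mulrC.
rewrite subrr addr0 -(dr_sum dA) (sr_ric sr).
have mxB3 (X Z W : 'M[A]_n) i j : (X - Z - W) i j = X i j - Z i j - W i j by rewrite !mxE.
rewrite mxB3 addrAC; congr (_ - _ - _).
- by rewrite [RHS]mxE.
- rewrite [RHS]mxE exchange_big; apply: eq_bigr => k _ /=.
  by rewrite -mulr_sumr (sr_ric sr).
- rewrite [RHS]mxE (eq_bigr (fun a => \sum_k Y c e k * curv a b k a)); last by move=> a _; rewrite [LHS]mxE.
  rewrite exchange_big; apply: eq_bigr => k _ /=.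
  by rewrite -mulr_sumr (sr_ric sr) mulrC [(Y c)^T k e]mxE.
Qed.

Lemma nabe_const a c : nabe a (kap c)%:M = 0.
Proof.
rewrite /nabe (_ : (kap c)%:M = map_mx kap c%:M); last by rewrite map_scalar_mx.
by rewrite (dmx_const dA) map_scalar_mx /= mul_mx_scalar mul_scalar_mx add0r subrr.
Qed.

Lemma nabe_hess a : nabe a hess_endo = - T a.
Proof. by rewrite /hess_endo (nabeD dA) (nabeN dA) nabe_const sub0r. Qed.

(** The Ricci identity applied to N: its derivative is 1/2 - S and constants are parallel, so only
    derivatives of Ric survive. *)
Lemma curvN a b : N *m curv a b = row a (T b) - row b (T a).
Proof.
rewrite -(nabv_nabv dA) !(sr_grad sr) !nabv_row !nabe_hess.
have -> : \sum_k Y b a k *: row k hess_endo = \sum_k Y a b k *: row k hess_endo.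
  by apply: eq_bigr => k _; rewrite (YsymE Ysym).
move: (\sum_k _) => p; apply/rowP => j; rewrite !mxE; ring.
Qed.

(** The covariant derivative of [curvN]; the first term on the left comes from differentiating N. *)
Lemma DcurvN c a b : row c hess_endo *m curv a b + N *m Dcurv c a b = row a (H c b) - row b (H c a).
Proof.
have E : nabv c (N *m curv a b) = nabv c (row a (T b)) - nabv c (row b (T a)).
  rewrite curvN /nabv (dmxD dA) (dmxN dA) mulmxDl mulNmx.
  by rewrite opprD -!addrA; congr (_ + _); rewrite addrCA.
rewrite (nabvM dA) (sr_grad sr) !nabv_row in E.
have -> : N *m Dcurv c a b = N *m nabe c (curv a b)
   - \sum_k Y c a k *: (row k (T b) - row b (T k)) - \sum_k Y c b k *: (row a (T k) - row k (T a)).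
  rewrite /Dcurv !mulmxBr !mulmx_sumr; congr (_ - _ - _); apply: eq_bigr => k _;
  by rewrite -scalemxAr curvN.
have F f k e (X : 'I_n -> 'M[A]_n) : row e (Dnab d Y X f k) = row e (nabe f (X k)) - \sum_i Y f k i *: row e (X i).
  rewrite /Dnab linearB /= linear_sum; congr (_ - _); apply: eq_bigr => i _.
  by rewrite linearZ.
rewrite addrA addrA E !F.
have G2 f e (X Z : 'I_n -> 'rV[A]_n) : \sum_k Y f e k *: (X k - Z k) = \sum_k Y f e k *: X k - \sum_k Y f e k *: Z k.
  by rewrite -sumrB; apply: eq_bigr => k _; rewrite scalerBr.
rewrite (G2 c a (fun k => row k (T b)) (fun k => row b (T k))).
rewrite (G2 c b (fun k => row a (T k)) (fun k => row k (T a))).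
move: (row a (nabe _ _)) (row b (nabe _ _)) (\sum_k _) (\sum_k _) (\sum_k _) (\sum_k _) => p q r s t u.
by apply/rowP => j; rewrite !mxE; ring.
Qed.

Lemma trace_Dric a : \tr (T a) = 0.
Proof. by rewrite -(dr_trace dA) (sr_trace sr) -(rmorph1 kap) (dr_const dA). Qed.

Section SecondStage.
Hypothesis NS : N *m S = 0.
Hypothesis divS : forall b, \sum_a T a b a = 0.
Hypothesis trS2 : \tr (S *m S) = kap h.

(** [NS], [divS] and [trS2] are equations in the ring and not at a point, because they get
    differentiated in this section. They come from a first pass through the pointwise identities. *)
Lemma NDric a : N *m T a = - (row a hess_endo *m S).
Proof.
have : nabv a (N *m S) = 0 by rewrite NS /nabv (dmx0 dA) mul0mx addr0.
by rewrite (nabvM dA) (sr_grad sr) addrC => /eqP; rewrite addr_eq0 => /eqP.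
Qed.

Lemma div_Dnab c b : \sum_a H c a b a = 0.
Proof.
have -> : \sum_a H c a b a = \sum_a d c (T a b a)
   + (\sum_a (T a *m Y c) b a - \sum_a \sum_k Y c a k * T k b a) - \sum_a (Y c *m T a) b a.
  rewrite -sumrB -big_split /= -!sumrB; apply: eq_bigr => a _.
  have Q x (Z : 'I_n -> 'M[A]_n) : (\sum_k Y c x k *: Z k) b a = \sum_k Y c x k * Z k b a.
    by rewrite summxE; apply: eq_bigr => k _; rewrite [LHS]mxE.
  rewrite -Q /Dnab; move: (\sum_k _) => Z; rewrite /nabe; move: (T a) => X.
  rewrite !mxE.
  ring.
have -> : \sum_a (T a *m Y c) b a = \sum_a \sum_k Y c a k * T k b a.
  under eq_bigr do rewrite mxE.
  by rewrite exchange_big /=; apply: eq_bigr => k _; apply: eq_bigr => a _; rewrite mulrC.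
rewrite subrr addr0 -(dr_sum dA) divS (dr0 dA) sub0r.
rewrite (eq_bigr (fun a => \sum_k Y c b k * T a k a)); last by move=> a _; rewrite [LHS]mxE.
rewrite exchange_big big1 ?oppr0 // => k _ /=.
by rewrite -mulr_sumr divS mulr0.
Qed.

Lemma trSDric a : \tr (S *m T a) = 0.
Proof.
have : d a (\tr (S *m S)) = 0 by rewrite trS2 (dr_const dA).
rewrite (dr_trace dA Y) (nabeM dA) mxtraceD mxtrace_mulC => E.
(* The equation reads 2 x = 0; it is halved by multiplying with [kap h], since A is an arbitrary
   commutative ring. *)
have := congr1 ( *%R (kap h)) E; rewrite mulr0 -mulr2n mulrnAr mulr2n -mulrDl -rmorphD.
by rewrite (sr_half sr) rmorph1 mul1r.
Qed.

Lemma trDricDric a b : \tr (T a *m T b) + \tr (S *m H a b) = 0.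
Proof.
have : d a (\tr (S *m T b)) = 0 by rewrite trSDric (dr0 dA).
rewrite (dr_trace dA Y) (nabeM dA) mxtraceD => <-; congr (_ + _).
rewrite /Dnab mulmxBr linearB /= mulmx_sumr linear_sum big1 ?subr0 // => k _.
by rewrite -scalemxAr linearZ /= trSDric mulr0.
Qed.

End SecondStage.
End SolitonRing.

(** * Contractions at a point and the norm of the derivative of Ric *)

Section CurvatureContraction.
Variables (R : realFieldType) (n : nat).
Implicit Types (K : 'I_n -> 'I_n -> 'I_n -> 'I_n -> R).

Definition curvature_like K := [/\ forall a b i j, K b a i j = - K a b i j,
  forall a b i j, K a b j i = - K a b i j &
  forall a b c j, K a b c j + K b c a j + K c a b j = 0].

(** The octahedron argument: a linear combination of four Bianchi identities and of skew
    symmetries. *)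
Lemma curvature_like_pair K a b i j : curvature_like K -> K a b i j = K i j a b.
Proof.
move=> [s1 s2 B].
have := B a b i j; have := B b i j a; have := B i j a b; have := B j a b i.
have := s2 j a b i; have := s2 a b i j; have := s1 j b a i; have := s2 j b a i.
have := s2 i j a b; have := s1 i a j b; have := s2 i a j b; have := s2 b i a j.
lra.
Qed.

Variables (K : 'I_n -> 'I_n -> 'I_n -> 'I_n -> R) (DK : 'I_n -> 'I_n -> 'I_n -> 'I_n -> 'I_n -> R)
  (S : 'I_n -> 'I_n -> R) (T : 'I_n -> 'I_n -> 'I_n -> R) (N : 'I_n -> R).
Hypothesis Kc : curvature_like K.
Hypothesis DKc : forall c, curvature_like (DK c).
Hypothesis DKb : forall a b c i j, DK c a b i j + DK a b c i j + DK b c a i j = 0.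
Hypothesis Kric : forall b c, \sum_a K a b c a = S b c.
Hypothesis DKric : forall c b e, \sum_a DK c a b e a = T c b e.
Hypothesis Ssym : forall i j, S j i = S i j.
Hypothesis Tsym : forall c i j, T c j i = T c i j.
Hypothesis Ttr : forall c, \sum_i T c i i = 0.
Hypothesis KN : forall a b j, \sum_i N i * K a b i j = T b a j - T a b j.

(** K, DK, S and T are the components of Rm, DRm, Ric and DRic in an orthonormal frame. Two
    contractions of the second Bianchi identity relate the divergence of Ric to the derivative of
    the scalar curvature, which vanishes by [Ttr]. *)
Lemma contracted_bianchi c : \sum_a T a c a = 0.
Proof.
have [_ s2 _] := DKc c.
have E : \sum_a \sum_b (DK c a b b a + DK a b c b a + DK b c a b a) = 0.
  by rewrite big1 // => a _; rewrite big1 // => b _; exact: DKb.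
have E1 : \sum_a \sum_b DK c a b b a = 0.
  rewrite exchange_big -[RHS](Ttr c); apply: eq_bigr => b _; exact: DKric.
have E2 : \sum_a \sum_b DK a b c b a = - \sum_a T a c a.
  rewrite -sumrN; apply: eq_bigr => a _; rewrite -DKric -sumrN; apply: eq_bigr => b _.
  by have [_ -> _] := DKc a.
have E3 : \sum_a \sum_b DK b c a b a = - \sum_a T a c a.
  rewrite exchange_big -sumrN; apply: eq_bigr => b _; rewrite -DKric -sumrN; apply: eq_bigr => a _.
  by have [-> _ _] := DKc b.
have : \sum_a \sum_b (DK c a b b a + DK a b c b a + DK b c a b a) =
   \sum_a \sum_b DK c a b b a + \sum_a \sum_b DK a b c b a + \sum_a \sum_b DK b c a b a.
  by rewrite -!big_split; apply: eq_bigr => a _; rewrite -!big_split.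
rewrite E E1 E2 E3; lra.
Qed.

(** In the trace of [KN] the right side consists of the trace and the divergence of DRic, both zero,
    and the left side is Ric(N). *)
Lemma ric_grad0 b : \sum_i N i * S i b = 0.
Proof.
have : \sum_a \sum_i N i * K a b i a = 0.
  rewrite (eq_bigr _ (fun a _ => KN a b a)) sumrB Ttr contracted_bianchi subrr //.
rewrite exchange_big /= => E; rewrite -[RHS]E; apply: eq_bigr => i _.
by rewrite -mulr_sumr Kric Ssym.
Qed.

Variables (H : 'I_n -> 'I_n -> 'I_n -> 'I_n -> R).
Let B i j := 2^-1 * (i == j)%:R - S i j.
Hypothesis NT : forall a j, \sum_i N i * T a i j = - \sum_k B a k * S k j.
Hypothesis trS2 : \sum_i \sum_j S i j * S j i = 2^-1.
Hypothesis trST : forall a, \sum_i \sum_j S i j * T a j i = 0.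
Hypothesis DKN : forall c a b j,
  \sum_i B c i * K a b i j + \sum_i N i * DK c a b i j = H c b a j - H c a b j.
Hypothesis Hsym : forall a b i j, H a b j i = H a b i j.
Hypothesis Hcomm : forall a b i j,
  H a b i j - H b a i j = \sum_k S i k * K a b k j - \sum_k K a b i k * S k j.
Hypothesis Hdiv : forall c b, \sum_a H c a b a = 0.
Hypothesis Htt : forall a b, \sum_i \sum_j T a i j * T b j i + \sum_i \sum_j S i j * H a b j i = 0.

(** This is Rm(Ric, Ric), with the sign that makes it positive on round spheres. *)
Definition curv_quadratic := \sum_a \sum_b \sum_i \sum_j K a b i j * S a j * S b i.
Definition cube_trace := \sum_i \sum_j \sum_k S i j * S j k * S k i.

Lemma sum4_split (F1 F2 : 'I_n -> 'I_n -> 'I_n -> R) :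
  \sum_a \sum_b \sum_j (F1 a b j + F2 a b j) =
  \sum_a \sum_b \sum_j F1 a b j + \sum_a \sum_b \sum_j F2 a b j.
Proof.
rewrite -big_split; apply: eq_bigr => a _; rewrite -big_split; apply: eq_bigr => b _.
by rewrite -big_split.
Qed.

(** The derivative [DKN] of the formula for Rm(N) is traced over c = b and paired with Ric. The
    Laplacian of Ric pairs to - |DRic|^2 because |Ric|^2 is constant, commuting derivatives produces
    Rm(Ric, Ric), and the cubic traces on both sides cancel. *)
Lemma norm_Dric : \sum_a \sum_i \sum_j T a i j ^+ 2 = 2 * curv_quadratic - 2^-1.
Proof.
have [s1 s2 _] := Kc.
have Kric2 a j : \sum_b K a b b j = S a j.
  by rewrite -Kric; apply: eq_bigr => b _; rewrite s1 s2 opprK.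
have L1 : \sum_a \sum_b \sum_j (\sum_i B b i * K a b i j) * S a j = 2^-1 * 2^-1 - curv_quadratic.
  have -> : 2^-1 * 2^-1 = \sum_a \sum_b \sum_j \sum_i (2^-1 * (b == i)%:R * K a b i j) * S a j.
    rewrite -[X in _ * X = _]trS2 mulr_sumr; apply: eq_bigr => a _; rewrite mulr_sumr.
    rewrite [RHS](eq_bigr (fun b => \sum_j 2^-1 * K a b b j * S a j)); last first.
      move=> b _; apply: eq_bigr => j _; rewrite (bigD1 b) //= eqxx mulr1 big1 ?addr0 //.
      by move=> i ib; rewrite eq_sym (negbTE ib) mulr0 !mul0r.
    rewrite exchange_big; apply: eq_bigr => j _ /=.
    by rewrite -mulr_suml -mulr_sumr Kric2 -mulrA (Ssym j a).
  rewrite /curv_quadratic -sumrB; apply: eq_bigr => a _; rewrite -sumrB; apply: eq_bigr => b _.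
  rewrite [X in _ = _ - X]exchange_big -sumrB; apply: eq_bigr => j _.
  rewrite mulr_suml -sumrB; apply: eq_bigr => i _; rewrite /B; ring.
(* The second Bianchi identity makes the divergence of Rm a difference of derivatives of Ric. The
   one along N is orthogonal to Ric by [trST]; the other is evaluated by [NT]. *)
have L2 : \sum_a \sum_b \sum_j (\sum_i N i * DK b a b i j) * S a j = 2^-1 * 2^-1 - cube_trace.
  have C i j a : \sum_b DK b a b i j = T i j a - T j i a.
    rewrite (eq_bigr (fun b => DK i b j a b - DK j b i a b)); first by rewrite sumrB !DKric.
    move=> b _; rewrite (curvature_like_pair _ _ _ _ (DKc b)).
    have := DKb i j b a b; have [-> _ _] := DKc i; lra.
  have -> : \sum_a \sum_b \sum_j (\sum_i N i * DK b a b i j) * S a j =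
     \sum_a \sum_j \sum_i N i * (T i j a - T j i a) * S a j.
    apply: eq_bigr => a _; rewrite exchange_big; apply: eq_bigr => j _ /=.
    rewrite -mulr_suml exchange_big -mulr_suml; congr (_ * _); apply: eq_bigr => i _ /=.
    by rewrite -mulr_sumr C.
  have -> : \sum_a \sum_j \sum_i N i * (T i j a - T j i a) * S a j =
     \sum_i N i * (\sum_a \sum_j S a j * T i j a) - \sum_a \sum_j (\sum_i N i * T j i a) * S a j.
    have -> : \sum_i N i * (\sum_a \sum_j S a j * T i j a) =
        \sum_a \sum_j \sum_i N i * T i j a * S a j.
      transitivity (\sum_i \sum_a \sum_j N i * T i j a * S a j).
        apply: eq_bigr => i _; rewrite mulr_sumr; apply: eq_bigr => a _; rewrite mulr_sumr.
        by apply: eq_bigr => j _; ring.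
      by rewrite exchange_big; apply: eq_bigr => a _; rewrite exchange_big.
    rewrite -sumrB; apply: eq_bigr => a _; rewrite -sumrB; apply: eq_bigr => j _.
    by rewrite mulr_suml -sumrB; apply: eq_bigr => i _; ring.
  rewrite big1 ?sub0r; last by move=> i _; rewrite trST mulr0.
  have -> : \sum_a \sum_j (\sum_i N i * T j i a) * S a j =
     - (\sum_a \sum_j \sum_k 2^-1 * (j == k)%:R * S k a * S a j)
     + \sum_a \sum_j \sum_k S a j * S j k * S k a.
    rewrite -sumrN -big_split; apply: eq_bigr => a _; rewrite -sumrN -big_split.
    apply: eq_bigr => j _ /=; rewrite NT mulNr mulr_suml -!sumrN -big_split.
    by apply: eq_bigr => k _; rewrite /B /=; ring.
  rewrite opprD opprK; congr (_ - _).
  rewrite -[X in _ * X]trS2 mulr_sumr; apply: eq_bigr => a _; rewrite mulr_sumr.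
  apply: eq_bigr => j _; rewrite (bigD1 j) //= eqxx mulr1 big1 ?addr0; first by ring.
  by move=> k kj; rewrite eq_sym (negbTE kj) mulr0 !mul0r.
have R1 : \sum_a \sum_b \sum_j H b b a j * S a j = - \sum_a \sum_i \sum_j T a i j ^+ 2.
  rewrite exchange_big -sumrN; apply: eq_bigr => b _ /=.
  have := Htt b b; rewrite addrC => /eqP; rewrite addr_eq0 => /eqP E.
  rewrite (eq_bigr (fun i => \sum_j S i j * H b b j i)); last first.
    by move=> a _; apply: eq_bigr => j _; rewrite mulrC Hsym.
  rewrite E; congr (- _); apply: eq_bigr => i _; apply: eq_bigr => j _.
  by rewrite Tsym expr2.
(* Once the two derivatives are exchanged, the inner one is a divergence of Ric and drops out; only
   the curvature terms of the commutator are left. *)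
have R2 : \sum_a \sum_b \sum_j H b a b j * S a j = - curv_quadratic + cube_trace.
  have -> : \sum_a \sum_b \sum_j H b a b j * S a j =
    \sum_a \sum_b \sum_j (H a b b j * S a j +
       ((\sum_k S b k * K b a k j) - \sum_k K b a b k * S k j) * S a j).
    apply: eq_bigr => a _; apply: eq_bigr => b _; apply: eq_bigr => j _.
    by rewrite -Hcomm; ring.
  rewrite sum4_split.
  have -> : \sum_a \sum_b \sum_j H a b b j * S a j = 0.
    rewrite big1 // => a _; rewrite exchange_big big1 // => j _ /=.
    have E : \sum_b H a b b j = 0 by rewrite -[RHS](Hdiv a j); apply: eq_bigr.
    by rewrite -mulr_suml E mul0r.
  rewrite add0r.
  have -> : \sum_a \sum_b \sum_j ((\sum_k S b k * K b a k j) - \sum_k K b a b k * S k j) * S a j =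
    \sum_a \sum_b \sum_j ((\sum_k S b k * K b a k j) * S a j
       + (- \sum_k K b a b k * S k j) * S a j).
    by apply: eq_bigr => a _; apply: eq_bigr => b _; apply: eq_bigr => j _; rewrite mulrDl.
  rewrite sum4_split; congr (_ + _).
    rewrite /curv_quadratic -sumrN; apply: eq_bigr => a _; rewrite -sumrN; apply: eq_bigr => b _.
    rewrite exchange_big -sumrN; apply: eq_bigr => j _ /=; rewrite mulr_suml -sumrN.
    by apply: eq_bigr => k _; rewrite s1; ring.
  rewrite /cube_trace; apply: eq_bigr => a _.
  rewrite exchange_big; apply: eq_bigr => j _ /=.
  rewrite -mulr_suml sumrN exchange_big -sumrN /= mulr_suml; apply: eq_bigr => k _.
  rewrite -mulr_suml (eq_bigr (fun b => - K b a k b)); last by move=> b _; rewrite s2.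
  by rewrite sumrN Kric (Ssym k a) (Ssym j k); ring.
have : \sum_a \sum_b \sum_j ((\sum_i B b i * K a b i j + \sum_i N i * DK b a b i j) * S a j)
   = \sum_a \sum_b \sum_j ((H b b a j - H b a b j) * S a j).
  by apply: eq_bigr => a _; apply: eq_bigr => b _; apply: eq_bigr => j _; rewrite DKN.
have -> : \sum_a \sum_b \sum_j ((\sum_i B b i * K a b i j + \sum_i N i * DK b a b i j) * S a j)
   = \sum_a \sum_b \sum_j ((\sum_i B b i * K a b i j) * S a j + (\sum_i N i * DK b a b i j) * S a j).
  by apply: eq_bigr => a _; apply: eq_bigr => b _; apply: eq_bigr => j _; rewrite mulrDl.
have -> : \sum_a \sum_b \sum_j ((H b b a j - H b a b j) * S a j)
   = \sum_a \sum_b \sum_j (H b b a j * S a j + (-1) * (H b a b j * S a j)).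
  by apply: eq_bigr => a _; apply: eq_bigr => b _; apply: eq_bigr => j _; ring.
rewrite !sum4_split L1 L2 R1.
have -> : \sum_a \sum_b \sum_j (-1) * (H b a b j * S a j) = - \sum_a \sum_b \sum_j H b a b j * S a j.
  rewrite -sumrN; apply: eq_bigr => a _; rewrite -sumrN; apply: eq_bigr => b _.
  by rewrite -sumrN; apply: eq_bigr => j _; rewrite mulN1r.
rewrite R2; lra.
Qed.

End CurvatureContraction.

(** * Constant changes of frame *)

Section FrameChange.
Variables (R A : comNzRingType) (n : nat) (kap : {rmorphism R -> A}) (d : 'I_n -> A -> A)
  (Y : 'I_n -> 'M[A]_n) (h : R) (G S : 'M[A]_n) (N : 'rV[A]_n) (C Ci : 'M[R]_n).
Hypothesis sr : soliton_ring kap d Y h G S N.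
Hypotheses (CCi : C *m Ci = 1%:M) (CiC : Ci *m C = 1%:M).
Let dA := sr_diff sr.
Let KC := map_mx kap C.
Let KCi := map_mx kap Ci.

Let KCCi : KC *m KCi = 1%:M.
Proof. by rewrite -map_mxM CCi map_mx1. Qed.

Let KCiC : KCi *m KC = 1%:M.
Proof. by rewrite -map_mxM CiC map_mx1. Qed.

(** The change of frame C has constant entries, so the new fields still commute and the axioms of
    [soliton_ring] persist; a constant C suffices to make G the identity at one given point. *)
Definition fr_der a x := \sum_b kap (C a b) * d b x.
Definition fr_endo (X : 'M[A]_n) : 'M[A]_n := KC *m X *m KCi.
Definition fr_conn a : 'M[A]_n := \sum_b kap (C a b) *: fr_endo (Y b).
Definition fr_metric : 'M[A]_n := KC *m G *m KC^T.
Definition fr_vec : 'rV[A]_n := N *m KCi.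

Lemma fr_endoM X Z : fr_endo (X *m Z) = fr_endo X *m fr_endo Z.
Proof. by rewrite /fr_endo !mulmxA -(mulmxA _ KCi) KCiC mulmx1. Qed.

Lemma fr_endo_tr X : \tr (fr_endo X) = \tr X.
Proof. by rewrite /fr_endo mxtrace_mulC mulmxA KCiC mul1mx. Qed.

Lemma fr_dmx p q a (X : 'M[A]_(p, q)) : dmx fr_der a X = \sum_b kap (C a b) *: dmx d b X.
Proof.
by apply/matrixP => i j; rewrite !mxE summxE; apply: eq_bigr => b _; rewrite !mxE.
Qed.

Lemma fr_diff_ring : diff_ring kap fr_der.
Proof.
split=> [a x y|a x y|a b x|a c]; rewrite /fr_der.
- by rewrite -big_split; apply: eq_bigr => b _; rewrite (dr_add dA) mulrDr.
- rewrite mulr_suml mulr_sumr -big_split; apply: eq_bigr => b _ /=.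
  by rewrite (dr_mul dA) mulrDr mulrA; congr (_ + _); rewrite mulrCA.
- have E a' b' : \sum_e kap (C a' e) * d e (\sum_f kap (C b' f) * d f x) =
    \sum_e \sum_f kap (C a' e) * kap (C b' f) * d e (d f x).
    apply: eq_bigr => e _; rewrite (dr_sum dA) mulr_sumr; apply: eq_bigr => f _.
    by rewrite (dr_mul dA) (dr_const dA) mul0r add0r mulrA.
  rewrite !E exchange_big; apply: eq_bigr => e _; apply: eq_bigr => f _.
  by rewrite (dr_comm dA) [kap _ * kap _]mulrC.
- by rewrite big1 // => b _; rewrite (dr_const dA) mulr0.
Qed.

Lemma dmx_fr_endo a X : dmx d a (fr_endo X) = fr_endo (dmx d a X).
Proof.
by rewrite /fr_endo !(dmxM dA) !(dmx_const dA) mulmx0 addr0 mul0mx add0r.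
Qed.

Lemma fr_endoB X Z : fr_endo (X - Z) = fr_endo X - fr_endo Z.
Proof. by rewrite /fr_endo mulmxBr mulmxBl. Qed.

Lemma fr_endoD X Z : fr_endo (X + Z) = fr_endo X + fr_endo Z.
Proof. by rewrite /fr_endo mulmxDr mulmxDl. Qed.

Lemma fr_curv a b : curv fr_der fr_conn a b =
  \sum_e \sum_f (kap (C a e) * kap (C b f)) *: fr_endo (curv d Y e f).
Proof.
have D a' b' : dmx fr_der a' (fr_conn b') =
    \sum_e \sum_f (kap (C a' e) * kap (C b' f)) *: fr_endo (dmx d e (Y f)).
  rewrite fr_dmx; apply: eq_bigr => e _; rewrite (dmx_sum dA) scaler_sumr.
  by apply: eq_bigr => f _; rewrite (dmxZ dA) (dr_const dA) scale0r add0r dmx_fr_endo scalerA.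
have P a' b' : fr_conn a' *m fr_conn b' =
    \sum_e \sum_f (kap (C a' e) * kap (C b' f)) *: fr_endo (Y e *m Y f).
  rewrite mulmx_suml; apply: eq_bigr => e _; rewrite mulmx_sumr; apply: eq_bigr => f _.
  by rewrite -scalemxAl -scalemxAr scalerA fr_endoM.
have X (F : 'I_n -> 'I_n -> 'M[A]_n) : \sum_e \sum_f (kap (C b e) * kap (C a f)) *: F e f =
    \sum_e \sum_f (kap (C a e) * kap (C b f)) *: F f e.
  by rewrite exchange_big; apply: eq_bigr => e _; apply: eq_bigr => f _; rewrite [kap _ * _]mulrC.
rewrite /curv !D !P (X (fun e f => fr_endo (dmx d e (Y f)))) (X (fun e f => fr_endo (Y e *m Y f))).
rewrite -!sumrB -big_split -sumrB; apply: eq_bigr => e _ /=.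
rewrite -sumrB -big_split -sumrB; apply: eq_bigr => f _ /=.
by rewrite !fr_endoB fr_endoD fr_endoB !scalerBr scalerDr scalerBr.
Qed.

Lemma fr_contract (X : 'I_n -> 'M[A]_n) c :
  \sum_a \sum_e kap (C a e) * fr_endo (X e) c a = \sum_m kap (C c m) * \sum_e X e m e.
Proof.
transitivity (\sum_e (KC *m X e) c e).
  rewrite exchange_big; apply: eq_bigr => e _ /=.
  have -> : \sum_a kap (C a e) * fr_endo (X e) c a = (fr_endo (X e) *m KC) c e.
    by rewrite [RHS]mxE; apply: eq_bigr => a _; rewrite [KC _ _]mxE mulrC.
  by rewrite /fr_endo -mulmxA KCiC mulmx1.
rewrite (eq_bigr (fun e => \sum_m kap (C c m) * X e m e)); last first.
  by move=> e _; rewrite mxE; apply: eq_bigr => m _; rewrite [KC _ _]mxE.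
by rewrite exchange_big; apply: eq_bigr => m _; rewrite mulr_sumr.
Qed.

Lemma fr_nabe a X : nabe fr_der fr_conn a (fr_endo X) = \sum_b kap (C a b) *: fr_endo (nabe d Y b X).
Proof.
rewrite /nabe fr_dmx mulmx_suml mulmx_sumr -big_split -sumrB; apply: eq_bigr => b _ /=.
rewrite dmx_fr_endo -scalemxAl -scalemxAr -!fr_endoM -scalerDr -scalerBr.
by rewrite fr_endoB fr_endoD.
Qed.

Lemma fr_soliton_ring : soliton_ring kap fr_der fr_conn h fr_metric (fr_endo S) fr_vec.
Proof.
have rowsum a (F : 'I_n -> 'M[A]_n) b : row a (\sum_e kap (C b e) *: F e) =
    \sum_e kap (C b e) *: row a (F e).
  by apply/rowP => j; rewrite !mxE !summxE; apply: eq_bigr => e _; rewrite !mxE.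
have rowC p (X : 'M[A]_(n, p)) a : row a (KC *m X) = \sum_f kap (C a f) *: row f X.
  by apply/rowP => j; rewrite !mxE summxE; apply: eq_bigr => f _; rewrite !mxE.
split; first exact: fr_diff_ring.
- move=> a b; rewrite /fr_conn !rowsum /fr_endo.
  have E a' b' : \sum_e kap (C b' e) *: row a' (KC *m Y e *m KCi) =
     \sum_e \sum_f (kap (C b' e) * kap (C a' f)) *: (row f (Y e) *m KCi).
    apply: eq_bigr => e _; rewrite -mulmxA rowC scaler_sumr.
    by apply: eq_bigr => f _; rewrite scalerA row_mul.
  rewrite !E exchange_big; apply: eq_bigr => e _; apply: eq_bigr => f _.
  by rewrite (sr_torsion sr) [kap _ * _]mulrC.
- exact: sr_half sr.
- move=> a; rewrite fr_dmx /fr_metric /fr_conn mulmx_suml linear_sum mulmx_sumr -big_split.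
  apply: eq_bigr => b _ /=; rewrite !(dmxM dA) (dmx_trmx d) !(dmx_const dA) trmx0 mulmx0 addr0 mul0mx add0r.
  rewrite (sr_metric sr) linearZ /= -scalemxAl -scalemxAr -scalerDr; congr (_ *: _).
  rewrite /fr_endo !trmx_mul mulmxDr mulmxDl !mulmxA; congr (_ + _).
    by rewrite -(mulmxA _ KCi KC) KCiC mulmx1.
  by rewrite -(mulmxA _ KC^T) -trmx_mul KCiC trmx1 mulmx1.
- by rewrite /fr_metric !trmx_mul trmxK (sr_Gsym sr) mulmxA.
- rewrite /fr_metric /fr_endo !mulmxA -(mulmxA _ KCi KC) KCiC mulmx1.
  by rewrite -(mulmxA KC S G) trmx_mul trmxK trmx_mul (sr_Ssym sr) mulmxA.
- move=> b c.
  rewrite (eq_bigr (fun a => \sum_e kap (C a e) * fr_endo (\sum_f kap (C b f) *: curv d Y e f) c a)); last first.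
    move=> a _; rewrite fr_curv summxE; apply: eq_bigr => e _.
    rewrite summxE /fr_endo mulmx_sumr mulmx_suml summxE mulr_sumr; apply: eq_bigr => f _.
    by rewrite -scalemxAr -scalemxAl [LHS]mxE [X in _ = _ * X]mxE mulrA.
  rewrite fr_contract /fr_metric /fr_endo !mulmxA -(mulmxA _ KCi KC) KCiC mulmx1 -(mulmxA KC S).
  rewrite [RHS]mxE; apply: eq_bigr => m _; rewrite mulrC [KC^T _ _]mxE [KC _ _]mxE; congr (_ * _).
  rewrite [RHS]mxE (eq_bigr (fun e => \sum_f kap (C b f) * curv d Y e f m e)); last first.
    by move=> e _; rewrite summxE; apply: eq_bigr => f _; rewrite [LHS]mxE.
  rewrite exchange_big; apply: eq_bigr => f _ /=.
  by rewrite -mulr_sumr (sr_ric sr) [KC _ _]mxE.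
- move=> a; rewrite /nabv fr_dmx /fr_vec /fr_conn mulmx_sumr -big_split.
  have -> : (kap h)%:M - fr_endo S = KC *m ((kap h)%:M - S) *m KCi.
    by rewrite mulmxBr mulmxBl mul_mx_scalar -scalemxAl KCCi scalemx1.
  rewrite row_mul rowC mulmx_suml; apply: eq_bigr => b _ /=.
  rewrite -(sr_grad sr) /nabv (dmxM dA) (dmx_const dA) mulmx0 addr0 -scalemxAr -scalerDr -scalemxAl.
  by rewrite /fr_endo !mulmxA -(mulmxA _ KCi KC) KCiC mulmx1 mulmxDl.
- by rewrite fr_endo_tr (sr_trace sr).
Qed.

Lemma fr_div b : (forall c, \sum_a Dric d Y S a c a = 0) ->
  \sum_a Dric fr_der fr_conn (fr_endo S) a b a = 0.
Proof.
move=> divS.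
rewrite (eq_bigr (fun a => \sum_e kap (C a e) * fr_endo (nabe d Y e S) b a)); last first.
  by move=> a _; rewrite /Dric fr_nabe summxE; apply: eq_bigr => e _; rewrite [LHS]mxE.
by rewrite fr_contract big1 // => m _; rewrite divS mulr0.
Qed.

Lemma fr_NS : N *m S = 0 -> fr_vec *m fr_endo S = 0.
Proof. by move=> NS; rewrite /fr_vec /fr_endo !mulmxA -(mulmxA _ KCi KC) KCiC mulmx1 NS mul0mx. Qed.

End FrameChange.

(** * The pointwise inequality for the third symmetric function *)

Section KeyEstimate.
Variable R : realFieldType.

(** Lagrange's identity: the difference of the two sides is half the sum of the squares of x i y j -
    x j y i. *)
Lemma sum_cauchy_schwarz (I : finType) (x y : I -> R) :
  (\sum_i x i * y i) ^+ 2 <= (\sum_i x i ^+ 2) * (\sum_i y i ^+ 2).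
Proof.
have : 0 <= \sum_i \sum_j (x i * y j - x j * y i) ^+ 2.
  by apply: sumr_ge0 => i _; apply: sumr_ge0 => j _; exact: sqr_ge0.
have -> : \sum_i \sum_j (x i * y j - x j * y i) ^+ 2 =
   2 * ((\sum_i x i ^+ 2) * (\sum_i y i ^+ 2)) - 2 * (\sum_i x i * y i) ^+ 2.
  have -> : 2 * ((\sum_i x i ^+ 2) * (\sum_i y i ^+ 2)) =
      \sum_i \sum_j (x i ^+ 2 * y j ^+ 2 + x j ^+ 2 * y i ^+ 2).
    have -> : \sum_i \sum_j (x i ^+ 2 * y j ^+ 2 + x j ^+ 2 * y i ^+ 2) =
       \sum_i \sum_j x i ^+ 2 * y j ^+ 2 + \sum_i \sum_j x j ^+ 2 * y i ^+ 2.
      by rewrite -big_split; apply: eq_bigr => i _; rewrite -big_split.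
    rewrite [X in _ + X]exchange_big -big_distrlr /=; ring.
  rewrite expr2 big_distrlr mulr_sumr -sumrB; apply: eq_bigr => i _.
  by rewrite mulr_sumr -sumrB; apply: eq_bigr => j _ /=; ring.
lra.
Qed.

Lemma sum2_cauchy_schwarz (I : finType) (x y : I -> I -> R) :
  (\sum_i \sum_j x i j * y i j) ^+ 2 <=
  (\sum_i \sum_j x i j ^+ 2) * (\sum_i \sum_j y i j ^+ 2).
Proof.
rewrite !pair_bigA; exact: (sum_cauchy_schwarz (fun p => x p.1 p.2) (fun p => y p.1 p.2)).
Qed.

Definition tr2 n (S T : 'I_n -> 'I_n -> R) := \sum_i \sum_j S i j * T j i.
Definition tr3 n (S T X : 'I_n -> 'I_n -> R) := \sum_i \sum_j \sum_k S i j * T j k * X k i.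

(** In dimension 3 there is no Weyl tensor, so K is determined by its contraction Q. S and Q are
    kept apart: S will be Ric, and Q the contraction of Rm restricted to the complement of N. The
    proof reduces K to its six independent components. *)
Lemma curvature3_quadratic (K : 'I_3 -> 'I_3 -> 'I_3 -> 'I_3 -> R) (S Q : 'I_3 -> 'I_3 -> R) :
  curvature_like K -> (forall i j, S j i = S i j) -> (forall b i, \sum_a K a b i a = Q b i) ->
  curv_quadratic K S = 2 * tr2 Q S * (\sum_i S i i) - 2 * tr3 Q S S
    - 2^-1 * (\sum_i Q i i) * ((\sum_i S i i) ^+ 2 - tr2 S S).
Proof.
move=> Kc Ssym EQ; have [s1 s2 _] := Kc.
have z1 a i j : K a a i j = 0 by have := s1 a a i j; lra.
have z2 a b i : K a b i i = 0 by have := s2 a b i i; lra.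
rewrite /curv_quadratic /tr2 /tr3;
have -> : \sum_i Q i i = \sum_i \sum_a K a i i a by apply: eq_bigr.
have -> : \sum_i \sum_j Q i j * S j i = \sum_i \sum_j (\sum_a K a i j a) * S j i.
  by apply: eq_bigr => i _; apply: eq_bigr => j _; rewrite EQ.
have -> : \sum_i \sum_j \sum_k Q i j * S j k * S k i =
   \sum_i \sum_j \sum_k (\sum_a K a i j a) * S j k * S k i.
  by apply: eq_bigr => i _; apply: eq_bigr => j _; apply: eq_bigr => k _; rewrite EQ.
rewrite !big_ord_recl !big_ord0.
set o1 := lift ord0 ord0; set o2 := lift ord0 (lift ord0 ord0).
rewrite !z1 !z2 !(s1 ord0 o1) !(s1 ord0 o2) !(s1 o1 o2).
rewrite !(s2 _ _ ord0 o1) !(s2 _ _ ord0 o2) !(s2 _ _ o1 o2).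
rewrite (curvature_like_pair ord0 o2 ord0 o1 Kc) (curvature_like_pair o1 o2 ord0 o1 Kc).
rewrite (curvature_like_pair o1 o2 ord0 o2 Kc).
rewrite (Ssym ord0 o1) (Ssym ord0 o2) (Ssym o1 o2).
move: (K ord0 o1 ord0 o1) (K ord0 o1 ord0 o2) (K ord0 o1 o1 o2) (K ord0 o2 ord0 o2)
  (K ord0 o2 o1 o2) (K o1 o2 o1 o2) => k1 k2 k3 k4 k5 k6.
move: (S ord0 ord0) (S ord0 o1) (S ord0 o2) (S o1 o1) (S o1 o2) (S o2 o2) => a b c d e f.
by field.
Qed.

Section Three.
Variables (S T : 'I_3 -> 'I_3 -> R).
Hypotheses (Ssym : forall i j, S j i = S i j) (Tsym : forall i j, T j i = T i j).
Hypotheses (trS : \sum_i S i i = 1) (trS2 : tr2 S S = 2^-1).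
Hypotheses (trT : \sum_i T i i = 0) (trST : tr2 S T = 0).
(** By Newton's identities with tr S = 1 and tr S^2 = 1/2, this is the third elementary symmetric
    function of S, here its determinant. *)
Let u := (tr3 S S S - 4^-1) / 3.
Let D := tr3 S S T.
(** The component of S^2 orthogonal to the identity and to S; the traces 1, 1/2 and 1/4 + 3 u of the
    powers of S force these coefficients. Since T is orthogonal to the identity and to S as well, it
    pairs with c as with S^2. *)
Let c i j := \sum_k S i k * S k j - (2^-1 + 18 * u) * S i j + 6 * u * (i == j)%:R.

(** The trace of S times the characteristic equation of S, whose coefficients are written through
    power sums. *)
Lemma trace_fourth : \sum_i \sum_j (\sum_k S i k * S k j) ^+ 2 = 8^-1 + 4 * u.
Proof.
have -> : \sum_i \sum_j (\sum_k S i k * S k j) ^+ 2 =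
   (\sum_i S i i) * tr3 S S S - ((\sum_i S i i) ^+ 2 - tr2 S S) / 2 * tr2 S S
   + ((\sum_i S i i) ^+ 3 - 3 * (\sum_i S i i) * tr2 S S + 2 * tr3 S S S) / 6 * (\sum_i S i i).
  rewrite /tr2 /tr3 !big_ord_recl !big_ord0.
  set o1 := lift ord0 ord0; set o2 := lift ord0 (lift ord0 ord0).
  rewrite (Ssym ord0 o1) (Ssym ord0 o2) (Ssym o1 o2).
  move: (S ord0 ord0) (S ord0 o1) (S ord0 o2) (S o1 o1) (S o1 o2) (S o2 o2) => x1 x2 x3 x4 x5 x6.
  by field.
rewrite trS trS2 /u; by field.
Qed.

Lemma norm_cayley : \sum_i \sum_j c i j ^+ 2 = u - 54 * u ^+ 2.
Proof.
have -> : \sum_i \sum_j c i j ^+ 2 = \sum_i \sum_j (\sum_k S i k * S k j) ^+ 2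
   - 2 * (2^-1 + 18 * u) * tr3 S S S + ((2^-1 + 18 * u) ^+ 2 + 12 * u) * tr2 S S
   - 12 * u * (2^-1 + 18 * u) * (\sum_i S i i) + 108 * u ^+ 2.
  rewrite /c; move: u => u'; rewrite /tr2 /tr3 !big_ord_recl !big_ord0 /=.
  set o1 := lift ord0 ord0; set o2 := lift ord0 (lift ord0 ord0).
  rewrite (Ssym ord0 o1) (Ssym ord0 o2) (Ssym o1 o2).
  move: (S ord0 ord0) (S ord0 o1) (S ord0 o2) (S o1 o1) (S o1 o2) (S o2 o2) => x1 x2 x3 x4 x5 x6.
  by field.
rewrite trace_fourth trS trS2; have -> : tr3 S S S = 4^-1 + 3 * u by rewrite /u; field.
by field.
Qed.

Lemma cayley_pairing : \sum_i \sum_j c i j * T i j = D.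
Proof.
have -> : \sum_i \sum_j c i j * T i j = D - (2^-1 + 18 * u) * tr2 S T + 6 * u * \sum_i T i i.
  rewrite /c /D; move: u => u'; rewrite /tr2 /tr3 !big_ord_recl !big_ord0 /=.
  set o1 := lift ord0 ord0; set o2 := lift ord0 (lift ord0 ord0).
  rewrite (Ssym ord0 o1) (Ssym ord0 o2) (Ssym o1 o2) (Tsym ord0 o1) (Tsym ord0 o2) (Tsym o1 o2).
  ring.
rewrite trST trT; ring.
Qed.

Lemma hess_direction_bound : D ^+ 2 <= (u - 54 * u ^+ 2) * \sum_i \sum_j T i j ^+ 2.
Proof. by rewrite -cayley_pairing -norm_cayley; exact: sum2_cauchy_schwarz. Qed.

(** Both bounds express that the squared norm u (1 - 54 u) of [c] is nonnegative. *)
Lemma e3_bounds : 0 <= u /\ 54 * u <= 1.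
Proof.
have : 0 <= u - 54 * u ^+ 2.
  by rewrite -norm_cayley; apply: sumr_ge0 => i _; apply: sumr_ge0 => j _; exact: sqr_ge0.
move=> H; split; nra.
Qed.

(** For u = 0 the tensor [c] is S^2 - S / 2, and its norm is zero. *)
Lemma e3_zero_idem : u = 0 -> forall i j, \sum_k S i k * S k j = 2^-1 * S i j.
Proof.
move=> u0.
have : \sum_i \sum_j (\sum_k S i k * S k j - 2^-1 * S i j) ^+ 2 = 0.
  transitivity (\sum_i \sum_j c i j ^+ 2); last by rewrite norm_cayley u0; ring.
  by apply: eq_bigr => i _; apply: eq_bigr => j _; rewrite /c u0 !mulr0 mul0r !addr0.
move=> /psumr_eq0P H i j; apply/eqP; rewrite -subr_eq0 -sqrf_eq0; apply/eqP.
have H2 : \sum_j (\sum_k S i k * S k j - 2^-1 * S i j) ^+ 2 = 0.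
  by apply: H => // k _; apply: sumr_ge0 => l _; exact: sqr_ge0.
by move: H2 => /psumr_eq0P; apply => // l _; exact: sqr_ge0.
Qed.

(** Here s is |N|^2 and T the derivative of Ric along N. Q is Ric minus the curvature of the planes
    containing N, which the formula for Rm(N) expresses through T and S. The left side is Rm(Ric,
    Ric) as given by [curvature3_quadratic]. *)
Lemma level_quadratic (s : R) (Q : 'I_3 -> 'I_3 -> R) : s != 0 ->
  (forall i j, Q i j = S i j - (T i j + 2^-1 * S i j - \sum_k S i k * S k j) / s) ->
  2 * tr2 Q S * (\sum_i S i i) - 2 * tr3 Q S S
    - 2^-1 * (\sum_i Q i i) * ((\sum_i S i i) ^+ 2 - tr2 S S) = 4^-1 - 6 * u + (2 * D + u) / s.
Proof.
move=> s0 EQ.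
have Q1 : \sum_i Q i i = 1.
  have -> : \sum_i Q i i = (\sum_i S i i) - ((\sum_i T i i) + 2^-1 * (\sum_i S i i) - tr2 S S) / s.
    rewrite (eq_bigr _ (fun i _ => EQ i i)) /tr2 !big_ord_recl !big_ord0; ring.
  by rewrite trS trT trS2; field.
have Q2 : tr2 Q S = 2^-1 - (4^-1 - tr3 S S S) / s.
  have -> : tr2 Q S = tr2 S S - (tr2 S T + 2^-1 * tr2 S S - tr3 S S S) / s.
    rewrite /tr2 (eq_bigr (fun i => \sum_j (S i j - (T i j + 2^-1 * S i j - \sum_k S i k * S k j) / s) * S j i)).
      rewrite /tr3 !big_ord_recl !big_ord0.
      set o1 := lift ord0 ord0; set o2 := lift ord0 (lift ord0 ord0).
      rewrite (Ssym ord0 o1) (Ssym ord0 o2) (Ssym o1 o2) (Tsym ord0 o1) (Tsym ord0 o2) (Tsym o1 o2).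
      ring.
    by move=> i _; apply: eq_bigr => j _; rewrite EQ.
  by rewrite trST trS2; field.
have Q3 : tr3 Q S S = tr3 S S S - (D + 2^-1 * tr3 S S S - (8^-1 + 4 * u)) / s.
  rewrite -trace_fourth /D /tr3 (eq_bigr (fun i => \sum_j \sum_k
     (S i j - (T i j + 2^-1 * S i j - \sum_k S i k * S k j) / s) * S j k * S k i)).
    rewrite !big_ord_recl !big_ord0.
    set o1 := lift ord0 ord0; set o2 := lift ord0 (lift ord0 ord0).
    rewrite (Ssym ord0 o1) (Ssym ord0 o2) (Ssym o1 o2) (Tsym ord0 o1) (Tsym ord0 o2) (Tsym o1 o2).
    ring.
  by move=> i _; apply: eq_bigr => j _; apply: eq_bigr => k _; rewrite EQ.
have E : tr3 S S S = 4^-1 + 3 * u by rewrite /u; field.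
rewrite Q1 Q2 Q3 trS trS2 E; by field.
Qed.

End Three.

Section Four.
Variables (K : 'I_4 -> 'I_4 -> 'I_4 -> 'I_4 -> R) (S : 'I_4 -> 'I_4 -> R)
  (T : 'I_4 -> 'I_4 -> 'I_4 -> R) (nu : R).
Hypothesis nu0 : nu != 0.
Hypothesis Kc : curvature_like K.
Hypothesis Kric : forall b c, \sum_a K a b c a = S b c.
Hypothesis Ssym : forall i j, S j i = S i j.
Hypothesis Tsym : forall c i j, T c j i = T c i j.
Hypothesis Ttr : forall c, \sum_i T c i i = 0.
Hypothesis trS : \sum_i S i i = 1.
Hypothesis trS2 : tr2 S S = 2^-1.
Hypothesis trST : forall a, tr2 S (T a) = 0.
Hypothesis S0 : forall j, S ord0 j = 0.
Hypothesis KN : forall a b j, nu * K a b ord0 j = T b a j - T a b j.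
Hypothesis NT : forall a j, nu * T a ord0 j = - (2^-1 * S a j - \sum_k S a k * S k j).
Hypothesis normT : \sum_a \sum_i \sum_j T a i j ^+ 2 = 2 * curv_quadratic K S - 2^-1.

Let l (i : 'I_3) : 'I_4 := lift ord0 i.
Let S3 i j := S (l i) (l j).
Let T3 i j := nu * T ord0 (l i) (l j).

Lemma sum_lift0 (F : 'I_4 -> R) : F ord0 = 0 -> \sum_i F i = \sum_(i < 3) F (l i).
Proof. by move=> F0; rewrite big_ord_recl F0 add0r. Qed.

Let S0' j : S j ord0 = 0. Proof. by rewrite Ssym. Qed.

Let T00 j : T ord0 ord0 j = 0.
Proof.
apply: (mulfI nu0); rewrite NT S0 mulr0 sub0r opprK mulr0.
by rewrite big1 // => k _; rewrite S0 mul0r.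
Qed.

Let SS i j : \sum_k S i k * S k j = \sum_(k < 3) S i (l k) * S (l k) j.
Proof. by rewrite sum_lift0 // S0 mulr0. Qed.

Lemma tr3_lift (X : 'I_4 -> 'I_4 -> R) : tr3 S S X = tr3 S3 S3 (fun i j => X (l i) (l j)).
Proof.
rewrite /tr3 sum_lift0; last by rewrite big1 // => j _; rewrite big1 // => k _; rewrite S0 !mul0r.
apply: eq_bigr => i _; rewrite sum_lift0; last by rewrite big1 // => k _; rewrite S0 mulr0 mul0r.
by apply: eq_bigr => j _; rewrite sum_lift0 // S0' mulr0 mul0r.
Qed.

Lemma tr2_lift (X : 'I_4 -> 'I_4 -> R) : tr2 S X = tr2 S3 (fun i j => X (l i) (l j)).
Proof.
rewrite /tr2 sum_lift0; last by rewrite big1 // => j _; rewrite S0 mul0r.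
by apply: eq_bigr => i _; rewrite sum_lift0 // S0' mul0r.
Qed.

Lemma curv_quadratic_lift : curv_quadratic K S =
  curv_quadratic (fun a b i j => K (l a) (l b) (l i) (l j)) S3.
Proof.
rewrite /curv_quadratic sum_lift0; last first.
  by rewrite big1 // => b _; rewrite big1 // => i _; rewrite big1 // => j _; rewrite S0 mulr0 mul0r.
apply: eq_bigr => a _; rewrite sum_lift0; last first.
  by rewrite big1 // => i _; rewrite big1 // => j _; rewrite S0 mulr0.
apply: eq_bigr => b _; rewrite sum_lift0; last first.
  by rewrite big1 // => j _; rewrite S0' mulr0.
by apply: eq_bigr => i _; rewrite sum_lift0 // S0' mulr0 mul0r.
Qed.

Let u := (tr3 S S S - 4^-1) / 3.
Let D := tr3 S S (fun i j => nu * T ord0 i j).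

(** The first frame vector points along N = nu e_0, and everything is restricted to its complement.
    The factor 4 D + 2 u - 12 nu^2 u equals nu^2 |DRic|^2 and dominates the squared norm of the
    derivative of Ric along N, against which Cauchy-Schwarz is applied with a tensor of squared norm
    at most u. For u = 0 this gives D = 0, whence DRic = 0. *)
Lemma pointwise_key : [/\ 0 <= u, D ^+ 2 <= u * (4 * D + 2 * u - 12 * nu ^+ 2 * u) &
  u = 0 -> (forall a i j, T a i j = 0) /\ (forall i j, \sum_k S i k * S k j = 2^-1 * S i j)].
Proof.
have S3sym i j : S3 j i = S3 i j by exact: Ssym.
have T3sym i j : T3 j i = T3 i j by rewrite /T3 Tsym.
have trS3 : \sum_i S3 i i = 1 by rewrite -trS sum_lift0.
have trS23 : tr2 S3 S3 = 2^-1 by rewrite -trS2 tr2_lift.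
have trT3 : \sum_i T3 i i = 0.
  by rewrite /T3 -mulr_sumr -(sum_lift0 (F := fun i => T ord0 i i)) ?Ttr ?mulr0.
have trST3 : tr2 S3 T3 = 0.
  have := trST ord0; rewrite tr2_lift => E; rewrite -[RHS](mulr0 nu) -E /tr2 mulr_sumr.
  apply: eq_bigr => i _; rewrite mulr_sumr; apply: eq_bigr => j _; rewrite /T3; ring.
have u3 : u = (tr3 S3 S3 S3 - 4^-1) / 3 by rewrite /u tr3_lift.
have D3 : D = tr3 S3 S3 T3 by rewrite /D tr3_lift.
have nu20 : nu ^+ 2 != 0 by rewrite expf_neq0.
(* The term of the Ricci contraction in direction e_0 is computed by [KN] and then [NT], each of
   which costs a division by nu. *)
have Q3 b i : \sum_a K (l a) (l b) (l i) (l a) =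
    S3 b i - (T3 b i + 2^-1 * S3 b i - \sum_k S3 b k * S3 k i) / nu ^+ 2.
  have := Kric (l b) (l i); rewrite big_ord_recl => /eqP; rewrite addrC eq_sym -subr_eq => /eqP <-.
  congr (_ - _); have [s1 s2 _] := Kc.
  have -> : K ord0 (l b) (l i) ord0 = K (l b) ord0 ord0 (l i) by rewrite s1 s2 opprK.
  apply: (mulfI nu0); rewrite KN; apply: (mulfI nu0); rewrite mulrBr NT SS /T3 /S3.
  by field.
have Kc3 : curvature_like (fun a b i j => K (l a) (l b) (l i) (l j)).
  by have [s1 s2 B] := Kc; split => *; [exact: s1|exact: s2|exact: B].
have RQ : curv_quadratic K S = 4^-1 - 6 * u + (2 * D + u) / nu ^+ 2.
  rewrite curv_quadratic_lift (curvature3_quadratic Kc3 S3sym (fun b i => erefl)) u3 D3.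
  exact: (level_quadratic S3sym T3sym trS3 trS23 trT3 trST3 nu20 Q3).
have s0 : 0 < nu ^+ 2 by rewrite lt_neqAle eq_sym nu20 sqr_ge0.
have nT : nu ^+ 2 * (\sum_a \sum_i \sum_j T a i j ^+ 2) = 4 * D + 2 * u - 12 * nu ^+ 2 * u.
  by rewrite normT RQ; field.
have T3le : \sum_i \sum_j T3 i j ^+ 2 <= 4 * D + 2 * u - 12 * nu ^+ 2 * u.
  rewrite -nT; have -> : \sum_i \sum_j T3 i j ^+ 2 = nu ^+ 2 * \sum_(i < 3) \sum_(j < 3) T ord0 (l i) (l j) ^+ 2.
    rewrite mulr_sumr; apply: eq_bigr => i _; rewrite mulr_sumr; apply: eq_bigr => j _.
    by rewrite /T3 exprMn.
  rewrite ler_wpM2l ?sqr_ge0 //.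
  have P a i : 0 <= \sum_j T a i j ^+ 2 by apply: sumr_ge0 => j _; exact: sqr_ge0.
  apply: (@le_trans _ _ (\sum_i \sum_j T ord0 i j ^+ 2)).
    rewrite [leRHS]big_ord_recl -[leLHS]add0r lerD // ler_sum // => i _.
    by rewrite [leRHS]big_ord_recl lerDr sqr_ge0.
  by rewrite [leRHS]big_ord_recl lerDl; apply: sumr_ge0 => a _; apply: sumr_ge0.
have T3ge : 0 <= \sum_i \sum_j T3 i j ^+ 2.
  by apply: sumr_ge0 => i _; apply: sumr_ge0 => j _; exact: sqr_ge0.
have [u0 u1] := e3_bounds S3sym trS3 trS23; rewrite -u3 in u0 u1.
have DB := hess_direction_bound S3sym T3sym trS3 trS23 trT3 trST3; rewrite -u3 -D3 in DB.
have DD : D ^+ 2 <= u * (4 * D + 2 * u - 12 * nu ^+ 2 * u).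
  apply: (le_trans DB); apply: (@le_trans _ _ (u * \sum_i \sum_j T3 i j ^+ 2)).
    by rewrite ler_wpM2r // gerBl mulr_ge0 // sqr_ge0.
  by rewrite ler_wpM2l.
split=> // uz.
have D0 : D = 0.
  by apply/eqP; rewrite -sqrf_eq0 eq_le sqr_ge0 andbT; rewrite uz mul0r in DD.
split=> [a i j|i j].
  move: nT; rewrite D0 uz !mulr0 addr0 subr0 => /eqP; rewrite mulf_eq0 (negbTE nu20) /= => /eqP.
  move=> /psumr_eq0P H; apply/eqP; rewrite -sqrf_eq0; apply/eqP.
  have P b k : 0 <= \sum_j T b k j ^+ 2 by apply: sumr_ge0 => m _; exact: sqr_ge0.
  have H1 : \sum_i \sum_j T a i j ^+ 2 = 0 by apply: H => // b _; apply: sumr_ge0.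
  have H2 : \sum_j T a i j ^+ 2 = 0 by move: H1 => /psumr_eq0P; apply.
  by move: H2 => /psumr_eq0P; apply => // k _; exact: sqr_ge0.
rewrite uz in u3; have I := e3_zero_idem S3sym trS3 trS23 (esym u3).
have [i'|->] := unliftP ord0 i; last by rewrite S0 mulr0 big1 // => k _; rewrite S0 mul0r.
move=> ->; have [j'|->] := unliftP ord0 j; last by rewrite S0' mulr0 big1 // => k _; rewrite S0' mulr0.
by move=> ->; rewrite SS; exact: I.
Qed.

End Four.
End KeyEstimate.

(** * Orthonormal frames for a positive definite form *)

Section AdaptedFrame.
Variable R : rcfType.

Definition posdef n (G : 'M[R]_n) := forall v : 'rV[R]_n, v != 0 -> 0 < (v *m G *m v^T) 0 0.

Lemma posdef_normalize n (G : 'M[R]_n) (v : 'rV[R]_n) : posdef G -> v != 0 ->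
  let r := Num.sqrt ((v *m G *m v^T) 0 0) in
  r != 0 /\ (r^-1 *: v) *m G *m (r^-1 *: v)^T = 1%:M.
Proof.
move=> pG v0 r; have c0 := pG v v0; have r0 : r != 0 by rewrite gt_eqF // sqrtr_gt0.
split=> //; rewrite linearZ /= -!scalemxAl -scalemxAr scalerA.
apply/matrixP => i j; rewrite !ord1 [LHS]mxE [RHS]mxE eqxx mulr1n -invfM -expr2 sqr_sqrtr ?ltW //.
by rewrite mulVf // gt_eqF.
Qed.

Lemma gram_sym n p q (G : 'M[R]_n) (X : 'M[R]_(p, n)) (Z : 'M[R]_(q, n)) :
  G^T = G -> X *m G *m Z^T = (Z *m G *m X^T)^T.
Proof. by move=> Gs; rewrite !trmx_mul trmxK Gs mulmxA. Qed.

(** Gram-Schmidt by counting: as long as k < n, the k + 1 orthogonality conditions leave a nonzero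
    vector in dimension n + 1, and it only has to be normalized. *)
Lemma posdef_partial_frame n (G : 'M[R]_n.+1) (w : 'rV[R]_n.+1) k :
  G^T = G -> posdef G -> w *m G *m w^T = 1%:M -> (k <= n)%N ->
  exists C : 'M[R]_(k, n.+1), C *m G *m C^T = 1%:M /\ w *m G *m C^T = 0.
Proof.
move=> Gs pG w1; elim: k => [_|k IH kn].
  by exists 0; split; apply/matrixP => - [] //= i ?; case.
have [C [C1 C2]] := IH (ltnW kn).
pose B := G *m (col_mx w C)^T.
have : kermx B != 0.
  rewrite kermx_eq0 /row_free neq_ltn (leq_ltn_trans (rank_leq_col _)) //.
move=> /rowV0Pn[v /sub_kermxP vB v0].
have [r0 v1] := posdef_normalize pG v0; set r := Num.sqrt _ in r0 v1.
have [vw vC] : v *m G *m w^T = 0 /\ v *m G *m C^T = 0.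
  move: vB; rewrite /B tr_col_mx mulmxA mul_mx_row => E.
  by rewrite -row_mx0 in E; have [] := eq_row_mx E.
have sw : w *m G *m v^T = 0 by rewrite (gram_sym _ _ Gs) vw trmx0.
have sC : C *m G *m v^T = 0 by rewrite (gram_sym _ _ Gs) vC trmx0.
pose F : 'M[R]_(1 + k, n.+1) := col_mx (r^-1 *: v) C.
have FF : F *m G *m F^T = 1%:M.
  rewrite /F tr_col_mx mul_col_mx mul_col_row v1 C1 linearZ /= -!scalemxAl -scalemxAr vC sC.
  by rewrite !scaler0 -scalar_mx_block.
have wF : w *m G *m F^T = 0.
  by rewrite /F tr_col_mx mul_mx_row linearZ /= -scalemxAr sw C2 scaler0 row_mx0.
by exists F.
Qed.

Lemma posdef_frame n (G : 'M[R]_n.+1) (w : 'rV[R]_n.+1) :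
  G^T = G -> posdef G -> exists C Ci : 'M[R]_n.+1,
  [/\ C *m Ci = 1%:M, Ci *m C = 1%:M, C *m G *m C^T = 1%:M &
      w *m Ci = Num.sqrt ((w *m G *m w^T) 0 0) *: delta_mx 0 0].
Proof.
move=> Gs pG.
(* For w = 0 any nonzero vector can start the frame, and the last clause reads 0 = 0. *)
have [w' [w'0 wE]] : exists w', w' != 0 /\ (w == 0) || (w == w').
  have [->|w0] := eqVneq w 0; last by exists w; rewrite w0 eqxx orbT.
  exists (delta_mx 0 0); split=> //.
  by apply/eqP => /matrixP/(_ 0 0); rewrite !mxE !eqxx => /eqP; rewrite oner_eq0.
have [r0 w1] := posdef_normalize pG w'0; set r := Num.sqrt _ in r0 w1.
have [C [C1 C2]] := posdef_partial_frame Gs pG w1 (leqnn n).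
pose F : 'M[R]_(1 + n) := col_mx (r^-1 *: w') C.
have C3 : C *m G *m (r^-1 *: w')^T = 0 by rewrite (gram_sym _ _ Gs) C2 trmx0.
have FGF : F *m G *m F^T = 1%:M.
  by rewrite /F tr_col_mx mul_col_mx mul_col_row w1 C1 C2 C3 -scalar_mx_block.
have FFi : F *m (G *m F^T) = 1%:M by rewrite mulmxA.
exists F, (G *m F^T); split=> //; first exact: mulmx1C.
have [->|wn0] := eqVneq w 0; first by rewrite !mul0mx mxE sqrtr0 scale0r.
rewrite (negbTE wn0) /= in wE; move/eqP: wE => wE; rewrite wE -/r.
have -> : w' = r *: (delta_mx 0 0 *m F).
  rewrite -rowE (_ : row 0 F = r^-1 *: w') ?scalerA ?mulfV ?scale1r //.
  apply/rowP => j; rewrite mxE; transitivity (F (lshift n 0) j).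
    by congr (F _ j); exact: val_inj.
  exact: col_mxEu.
by rewrite -scalemxAl -mulmxA FFi mulmx1.
Qed.

End AdaptedFrame.

(* Unlike mxE, these do not unfold the entries of the operands. *)
Lemma mx_trE (A : Type) p q (X : 'M[A]_(p, q)) i j : X^T i j = X j i.
Proof. by rewrite mxE. Qed.
Lemma mx_rowE (A : Type) p q (X : 'M[A]_(p, q)) k i j : row k X i j = X k j.
Proof. by rewrite mxE. Qed.
Lemma mx_addE (A : nmodType) p q (X Z : 'M[A]_(p, q)) i j : (X + Z) i j = X i j + Z i j.
Proof. by rewrite mxE. Qed.
Lemma mx_oppE (A : zmodType) p q (X : 'M[A]_(p, q)) i j : (- X) i j = - X i j.
Proof. by rewrite mxE. Qed.
Lemma mx_0E (A : nmodType) p q i j : (0 : 'M[A]_(p, q)) i j = 0.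
Proof. by rewrite mxE. Qed.

(** * Evaluation of the ring identities in an orthonormal frame *)

Section OrthonormalEvaluation.
Variables (R : realFieldType) (A : comNzRingType) (n : nat) (kap : {rmorphism R -> A})
  (d : 'I_n -> A -> A) (Y : 'I_n -> 'M[A]_n) (h : R) (G S : 'M[A]_n) (N : 'rV[A]_n)
  (ev : {rmorphism A -> R}).
Hypothesis sr : soliton_ring kap d Y h G S N.
Hypothesis ev_kap : forall c, ev (kap c) = c.
Hypothesis evG : map_mx ev G = 1%:M.
Local Notation T := (Dric d Y S).
Local Notation H := (Dnab d Y (Dric d Y S)).

Let K a b i j := ev (curv d Y a b i j).
Let DK c a b i j := ev (Dcurv d Y c a b i j).
Let Se i j := ev (S i j).
Let Te a i j := ev (T a i j).
Let Ne i := ev (N 0 i).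
Let He a b i j := ev (H a b i j).

Lemma ev_mulG (X : 'M[A]_n) i j : ev ((X *m G) i j) = ev (X i j).
Proof.
rewrite mxE rmorph_sum (bigD1 j) //= rmorphM big1 => [|k kj].
  by have /matrixP/(_ j j) := evG; rewrite !mxE eqxx => ->; rewrite mulr1 addr0.
by have /matrixP/(_ k j) := evG; rewrite !mxE (negbTE kj) rmorphM => ->; rewrite mulr0.
Qed.

Lemma ev_mulmx p q r (X : 'M[A]_(p, q)) (Z : 'M[A]_(q, r)) i j :
  ev ((X *m Z) i j) = \sum_k ev (X i k) * ev (Z k j).
Proof. by rewrite mxE rmorph_sum; apply: eq_bigr => k _; rewrite rmorphM. Qed.

Lemma ev_skew (X : 'M[A]_n) : (X *m G)^T = - (X *m G) -> forall i j, ev (X j i) = - ev (X i j).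
Proof.
move=> E i j; have := congr1 (fun Z : 'M[A]_n => ev (Z i j)) E.
by rewrite /= mx_trE mx_oppE rmorphN !ev_mulG.
Qed.

Lemma ev_sym (X : 'M[A]_n) : (X *m G)^T = X *m G -> forall i j, ev (X j i) = ev (X i j).
Proof.
by move=> E i j; have := congr1 (fun Z : 'M[A]_n => ev (Z i j)) E; rewrite /= mx_trE !ev_mulG.
Qed.

Lemma ev_curvature_like : curvature_like K.
Proof.
split=> [a b i j|a b i j|a b c j].
- by rewrite /K curv_skew mx_oppE rmorphN.
- exact: ev_skew (curvG sr a b) _ _.
- have := congr1 (fun Z : 'rV[A]_n => ev (Z 0 j)) (bianchi1 d (sr_torsion sr) a b c).
  by rewrite /= !mx_addE !mx_rowE mx_0E !rmorphD rmorph0.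
Qed.

Lemma ev_Dcurvature_like c : curvature_like (DK c).
Proof.
split=> [a b i j|a b i j|a b e j].
- by rewrite /DK (Dcurv_skew (sr_diff sr)) mx_oppE rmorphN.
- exact: ev_skew (DcurvG sr c a b) _ _.
- have := congr1 (fun Z : 'rV[A]_n => ev (Z 0 j)) (Dcurv_bianchi1 sr c e a b).
  by rewrite /= !mx_addE !mx_rowE mx_0E !rmorphD rmorph0.
Qed.

Lemma ev_bianchi2 a b c i j : DK c a b i j + DK a b c i j + DK b c a i j = 0.
Proof.
have := congr1 (fun Z : 'M[A]_n => ev (Z i j)) (bianchi2 (sr_diff sr) (sr_torsion sr) a b c).
by rewrite /DK /= -!rmorphD -!mx_addE => ->; rewrite mx_0E rmorph0.
Qed.

Lemma ev_ric b c : \sum_a K a b c a = Se b c.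
Proof. by rewrite /Se -ev_mulG -(sr_ric sr) rmorph_sum. Qed.

Lemma ev_Dcurv_ric c b e : \sum_a DK c a b e a = Te c b e.
Proof. by rewrite /Te -ev_mulG -(Dcurv_ric sr) rmorph_sum. Qed.

Lemma ev_Ssym i j : Se j i = Se i j.
Proof. exact: ev_sym (sr_Ssym sr) _ _. Qed.

Lemma ev_Tsym c i j : Te c j i = Te c i j.
Proof. exact: ev_sym (Dric_sym sr c) _ _. Qed.

Lemma ev_Ttr c : \sum_i Te c i i = 0.
Proof. by have := congr1 ev (trace_Dric sr c); rewrite rmorph0 rmorph_sum. Qed.

Lemma ev_curvN a b j : \sum_i Ne i * K a b i j = Te b a j - Te a b j.
Proof.
have := congr1 (fun Z : 'rV[A]_n => ev (Z 0 j)) (curvN sr a b).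
by rewrite /= ev_mulmx => ->; rewrite mx_addE mx_oppE !mx_rowE rmorphB.
Qed.

Lemma ev_div0 c : \sum_a Te a c a = 0.
Proof.
exact: (contracted_bianchi ev_Dcurvature_like ev_bianchi2 ev_Dcurv_ric ev_Ttr).
Qed.

Lemma ev_NS0 : map_mx ev (N *m S) = 0.
Proof.
apply/rowP => j; rewrite [LHS]mxE ev_mulmx mxE.
exact: (ric_grad0 ev_Dcurvature_like ev_bianchi2 ev_ric ev_Dcurv_ric ev_Ssym ev_Ttr ev_curvN).
Qed.

Section SecondStage.
Hypothesis NS : N *m S = 0.
Hypothesis divS : forall b, \sum_a T a b a = 0.

Lemma half_inv : h = 2^-1.
Proof. by have := sr_half sr; lra. Qed.

(** The trace of [NDric]: the contraction of N with DRic vanishes because Ric is divergence free,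
    leaving tr ((1/2 - S) S) = 0. *)
Lemma trace_ric_sqr : \tr (S *m S) = kap h.
Proof.
have : \tr (hess_endo kap h S *m S) = 0.
  have E a : (hess_endo kap h S *m S) a a = - \sum_i N 0 i * T a i a.
    have := congr1 (fun Z : 'rV[A]_n => Z 0 a) (NDric sr NS a).
    rewrite /= -row_mul mx_oppE mx_rowE => /eqP; rewrite eq_sym eqr_oppLR => /eqP ->.
    by rewrite [in LHS]mxE.
  rewrite /mxtrace (eq_bigr _ (fun a _ => E a)) sumrN exchange_big big1 ?oppr0 // => i _ /=.
  by rewrite -mulr_sumr divS mulr0.
rewrite /hess_endo mulmxBl mul_scalar_mx linearB /= mxtraceZ (sr_trace sr) mulr1.
by move/eqP; rewrite subr_eq0 => /eqP ->.
Qed.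

Lemma ev_trS2 : tr2 Se Se = 2^-1.
Proof.
have := congr1 ev trace_ric_sqr; rewrite ev_kap half_inv => <-.
by rewrite rmorph_sum; apply: eq_bigr => i _; rewrite ev_mulmx.
Qed.

Lemma ev_hess i j : ev (hess_endo kap h S i j) = 2^-1 * (i == j)%:R - Se i j.
Proof.
by rewrite !mxE rmorphB rmorphMn ev_kap half_inv mulr_natr.
Qed.

Lemma ev_NT a j : \sum_i Ne i * Te a i j = - \sum_k (2^-1 * (a == k)%:R - Se a k) * Se k j.
Proof.
have := congr1 (fun Z : 'rV[A]_n => ev (Z 0 j)) (NDric sr NS a).
rewrite /= ev_mulmx => ->; rewrite mx_oppE rmorphN ev_mulmx; congr (- _).
by apply: eq_bigr => k _; rewrite mx_rowE ev_hess.
Qed.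

Lemma ev_tr_mul (X Z : 'M[A]_n) : ev (\tr (X *m Z)) = \sum_i \sum_j ev (X i j) * ev (Z j i).
Proof. by rewrite rmorph_sum; apply: eq_bigr => i _; rewrite ev_mulmx. Qed.

Lemma ev_trST a : tr2 Se (Te a) = 0.
Proof. by rewrite /tr2 -ev_tr_mul (trSDric sr trace_ric_sqr) rmorph0. Qed.

Lemma ev_norm_Dric : \sum_a \sum_i \sum_j Te a i j ^+ 2 = 2 * curv_quadratic K Se - 2^-1.
Proof.
apply: (@norm_Dric _ _ K DK Se Te Ne ev_curvature_like ev_Dcurvature_like ev_bianchi2
  ev_ric ev_Dcurv_ric ev_Ssym ev_Tsym He).
- exact: ev_NT.
- exact: ev_trS2.
- exact: ev_trST.
- move=> c a b j; have := congr1 (fun Z : 'rV[A]_n => ev (Z 0 j)) (DcurvN sr c a b).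
  rewrite /= !mx_addE mx_oppE !mx_rowE.
  rewrite rmorphB rmorphD !ev_mulmx => <-; congr (_ + _).
  by apply: eq_bigr => i _; rewrite mx_rowE ev_hess.
- by move=> a b i j; exact: ev_sym (Dnab_sym sr a b) _ _.
- move=> a b i j; have := congr1 (fun Z : 'M[A]_n => ev (Z i j)) (Dnab_skew (sr_diff sr) (sr_torsion sr) a b (fun c => erefl (Dric d Y S c))).
  have EB (X Z : 'M[A]_n) : ev ((X - Z) i j) = ev (X i j) - ev (Z i j).
    by rewrite mx_addE mx_oppE rmorphB.
  by rewrite /= (EB (H a b)) (EB (S *m _)) !ev_mulmx.
- by move=> c b; have := congr1 ev (div_Dnab sr divS c b); rewrite rmorph0 rmorph_sum.
- move=> a b; have := congr1 ev (trDricDric sr trace_ric_sqr a b).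
  by rewrite rmorphD rmorph0 !ev_tr_mul.
Qed.

End SecondStage.
End OrthonormalEvaluation.

Section PointwiseSoliton.
Variables (R : rcfType) (A : comNzRingType) (kap : {rmorphism R -> A})
  (d : 'I_4 -> A -> A) (Y : 'I_4 -> 'M[A]_4) (h : R) (G S : 'M[A]_4) (N : 'rV[A]_4)
  (ev : {rmorphism A -> R}).
Hypothesis sr : soliton_ring kap d Y h G S N.
Hypothesis ev_kap : forall c, ev (kap c) = c.
Hypothesis posG : posdef (map_mx ev G).
Local Notation T := (Dric d Y S).

Lemma ev_Gsym : (map_mx ev G)^T = map_mx ev G.
Proof. by rewrite map_trmx (sr_Gsym sr). Qed.

Lemma map_ev_kap p q (X : 'M[R]_(p, q)) : map_mx ev (map_mx kap X) = X.
Proof. by apply/matrixP => i j; rewrite !mxE ev_kap. Qed.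

Section Frame.
Variables (C Ci : 'M[R]_4).
Hypotheses (CCi : C *m Ci = 1%:M) (CiC : Ci *m C = 1%:M).
Hypothesis CGC : C *m map_mx ev G *m C^T = 1%:M.
Let sr' := fr_soliton_ring sr CCi CiC.
Let evG' : map_mx ev (fr_metric kap G C) = 1%:M.
Proof. by rewrite !map_mxM -map_trmx !map_ev_kap. Qed.

Lemma ev_fr_endo X : map_mx ev (fr_endo kap C Ci X) = C *m map_mx ev X *m Ci.
Proof. by rewrite !map_mxM !map_ev_kap. Qed.

Lemma fr_Dric a : Dric (fr_der kap d C) (fr_conn kap Y C Ci) (fr_endo kap C Ci S) a =
  \sum_b kap (C a b) *: fr_endo kap C Ci (T b).
Proof. exact: (fr_nabe sr CiC). Qed.

Lemma ev_fr_Dric a : map_mx ev (Dric (fr_der kap d C) (fr_conn kap Y C Ci) (fr_endo kap C Ci S) a) =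
  \sum_b C a b *: (C *m map_mx ev (T b) *m Ci).
Proof.
rewrite fr_Dric map_mx_sum; apply: eq_bigr => b _.
by rewrite map_mxZ ev_kap ev_fr_endo.
Qed.

Lemma stage1_frame : map_mx ev (N *m S) = 0 /\ forall b, ev (\sum_a T a b a) = 0.
Proof.
split.
  have := ev_NS0 sr' evG'; rewrite /fr_vec -mulmxA.
  rewrite (_ : map_mx kap Ci *m fr_endo kap C Ci S = S *m map_mx kap Ci); last first.
    by rewrite /fr_endo !mulmxA -map_mxM CiC map_mx1 mul1mx.
  rewrite mulmxA map_mxM map_ev_kap => E.
  by rewrite -[LHS]mulmx1 -CiC mulmxA E mul0mx.
pose x : 'cV[R]_4 := \col_m ev (\sum_a T a m a).
have Cx : C *m x = 0.
  apply/colP => b; rewrite mx_0E mxE -[RHS](ev_div0 sr' evG' b).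
  have E := fr_contract kap CiC T b.
  rewrite -(rmorph_sum ev); transitivity (ev (\sum_m kap (C b m) * \sum_e T e m e)); last first.
    rewrite -E; congr (ev _); apply: eq_bigr => a _; rewrite fr_Dric summxE.
    by apply: eq_bigr => e _; rewrite [RHS]mxE.
  by rewrite rmorph_sum; apply: eq_bigr => m _; rewrite rmorphM ev_kap mxE.
have x0 : x = 0 by rewrite -[x]mul1mx -CiC -mulmxA Cx mulmx0.
by move=> b; have /colP/(_ b) := x0; rewrite !mxE.
Qed.

End Frame.

Lemma soliton_stage1 : map_mx ev (N *m S) = 0 /\ forall b, ev (\sum_a T a b a) = 0.
Proof.
have [C [Ci [CCi CiC CGC _]]] := posdef_frame (map_mx ev N) ev_Gsym posG.
exact: stage1_frame CCi CiC CGC.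
Qed.

Lemma tr3E n (X Z W : 'M[R]_n) :
  tr3 (fun i j => X i j) (fun i j => Z i j) (fun i j => W i j) = \tr (X *m Z *m W).
Proof.
rewrite /tr3 /mxtrace; apply: eq_bigr => i _; rewrite mxE exchange_big; apply: eq_bigr => k _ /=.
by rewrite mxE mulr_suml.
Qed.

(** The quantities u and D are traces and s is a norm, so they can be computed in any frame. The
    frame is orthonormal with its first vector along N; s > 0 makes the coefficient nu of N
    nonzero. *)
Lemma soliton_stage2 : N *m S = 0 -> (forall b, \sum_a T a b a = 0) ->
  let Se := map_mx ev S in let Te a := map_mx ev (T a) in
  let s := (map_mx ev N *m map_mx ev G *m (map_mx ev N)^T) 0 0 in
  let u := (\tr (Se *m Se *m Se) - 4^-1) / 3 in
  let D := \tr (Se *m Se *m \sum_a (map_mx ev N) 0 a *: Te a) in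
  0 < s -> [/\ 0 <= u, D ^+ 2 <= u * (4 * D + 2 * u - 12 * s * u) &
    u = 0 -> (forall a, Te a = 0) /\ Se *m Se = 2^-1 *: Se].
Proof.
move=> NS divS Se Te s u D s0.
have [C [Ci [CCi CiC CGC]]] := posdef_frame (map_mx ev N) ev_Gsym posG.
rewrite -/s; set nu := Num.sqrt s => NCi.
have nu0 : nu != 0 by rewrite gt_eqF // sqrtr_gt0.
have nu2 : nu ^+ 2 = s by rewrite sqr_sqrtr // ltW.
pose d' := fr_der kap d C; pose Y' := fr_conn kap Y C Ci; pose S' := fr_endo kap C Ci S.
pose N' := fr_vec kap N Ci.
have sr' : soliton_ring kap d' Y' h (fr_metric kap G C) S' N' by exact: fr_soliton_ring.
have evG' : map_mx ev (fr_metric kap G C) = 1%:M by rewrite !map_mxM -map_trmx !map_ev_kap.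
have NS' : N' *m S' = 0 by exact: fr_NS.
have divS' b : \sum_a Dric d' Y' S' a b a = 0 by exact: (fr_div sr CiC b divS).
have evN' i : ev (N' 0 i) = nu * (i == 0)%:R.
  have := congr1 (fun Z : 'rV[R]_4 => Z 0 i) NCi; rewrite /= !mxE eqxx => <-.
  by rewrite rmorph_sum; apply: eq_bigr => k _; rewrite rmorphM !mxE ev_kap.
have sumN (F : 'I_4 -> R) : \sum_i ev (N' 0 i) * F i = nu * F 0.
  rewrite (bigD1 0) //= evN' eqxx mulr1 big1 ?addr0 // => i i0.
  by rewrite evN' (negbTE i0) mulr0 mul0r.
have evS' : map_mx ev S' = C *m Se *m Ci by exact: ev_fr_endo.
have evT' a : map_mx ev (Dric d' Y' S' a) = \sum_b C a b *: (C *m Te b *m Ci).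
  exact: ev_fr_Dric.
have trC X : \tr (C *m X *m Ci) = \tr X by rewrite mxtrace_mulC mulmxA CiC mul1mx.
have mulC X Z : (C *m X *m Ci) *m (C *m Z *m Ci) = C *m (X *m Z) *m Ci.
  by rewrite !mulmxA -(mulmxA _ Ci C) CiC mulmx1.
have fS i j : ev (S' i j) = (C *m Se *m Ci) i j by rewrite -evS' [RHS]mxE.
have nuT : C *m (\sum_a (map_mx ev N) 0 a *: Te a) *m Ci =
    nu *: map_mx ev (Dric d' Y' S' 0).
  rewrite evT' scaler_sumr mulmx_sumr mulmx_suml; apply: eq_bigr => b _.
  rewrite -scalemxAr -scalemxAl scalerA; congr (_ *: _).
  have := congr1 (fun Z : 'rV[R]_4 => (Z *m C) 0 b) NCi.
  by rewrite /= -mulmxA CiC mulmx1 -scalemxAl -rowE [X in _ = X -> _]mxE [X in _ = _ * X -> _]mxE.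
have key := @pointwise_key R (fun a b i j => ev (curv d' Y' a b i j)) (fun i j => ev (S' i j))
   (fun a i j => ev (Dric d' Y' S' a i j)) nu nu0 (ev_curvature_like sr' evG')
   (ev_ric sr' evG') (ev_Ssym sr' evG') (ev_Tsym sr' evG') (ev_Ttr _ sr').
have H1 : \sum_i ev (S' i i) = 1 by rewrite -rmorph_sum -[\sum_i _]/(\tr S') (sr_trace sr') rmorph1.
have H2 j : ev (S' ord0 j) = 0.
  apply: (mulfI nu0); rewrite mulr0 -(sumN (fun i => ev (S' i j))).
  by have := congr1 (fun Z : 'rV[A]_4 => ev (Z 0 j)) NS'; rewrite /= ev_mulmx mx_0E rmorph0.
have H3 a b j : nu * ev (curv d' Y' a b ord0 j) = ev (Dric d' Y' S' b a j) - ev (Dric d' Y' S' a b j).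
  by rewrite -(ev_curvN ev sr') sumN.
have H4 a j : nu * ev (Dric d' Y' S' a ord0 j) =
    - (2^-1 * ev (S' a j) - \sum_k ev (S' a k) * ev (S' k j)).
  rewrite -(sumN (fun i => ev (Dric d' Y' S' a i j))) (ev_NT sr' ev_kap NS'); congr (- _).
  rewrite (eq_bigr (fun k => 2^-1 * (a == k)%:R * ev (S' k j) - ev (S' a k) * ev (S' k j))).
    rewrite sumrB; congr (_ - _); rewrite (bigD1 a) //= eqxx mulr1 big1 ?addr0 // => k ka.
    by rewrite eq_sym (negbTE ka) mulr0 mul0r.
  by move=> k _; rewrite mulrBl.
have [K1 K2 K3] := key H1 (ev_trS2 sr' ev_kap NS' divS') (ev_trST ev sr' NS' divS') H2 H3 H4
  (ev_norm_Dric sr' ev_kap evG' NS' divS').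
have E3 : tr3 (fun i j => ev (S' i j)) (fun i j => ev (S' i j)) (fun i j => ev (S' i j)) =
    \tr (Se *m Se *m Se).
  have -> : (fun i j => ev (S' i j)) = (fun i j => (C *m Se *m Ci) i j).
    by apply/funext => i; apply/funext => j; exact: fS.
  by rewrite tr3E !mulC trC.
have ED : tr3 (fun i j => ev (S' i j)) (fun i j => ev (S' i j))
    (fun i j => nu * ev (Dric d' Y' S' ord0 i j)) = D.
  have -> : (fun i j => ev (S' i j)) = (fun i j => (C *m Se *m Ci) i j).
    by apply/funext => i; apply/funext => j; exact: fS.
  have -> : (fun i j => nu * ev (Dric d' Y' S' ord0 i j)) =
      (fun i j => (nu *: map_mx ev (Dric d' Y' S' 0)) i j).
    by apply/funext => i; apply/funext => j; rewrite [RHS]mxE [X in _ = _ * X]mxE.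
  by rewrite tr3E -nuT !mulC trC.
rewrite E3 -/u in K1; rewrite E3 ED nu2 -/u in K2; rewrite E3 -/u in K3.
split=> // uz; have [T0 SS] := K3 uz; split.
  (* DRic vanishes in the adapted frame; the inverse change of frame is then undone in the
     differentiation index and in both tensor slots. *)
  have Z a : \sum_b C a b *: (C *m Te b *m Ci) = 0.
    by rewrite -evT'; apply/matrixP => i j; rewrite [LHS]mxE T0 mx_0E.
  move=> e; have : \sum_a Ci e a *: (\sum_b C a b *: (C *m Te b *m Ci)) = 0.
    by rewrite big1 // => a _; rewrite Z scaler0.
  have -> : \sum_a Ci e a *: (\sum_b C a b *: (C *m Te b *m Ci)) = C *m Te e *m Ci.
    under eq_bigr do rewrite scaler_sumr.
    rewrite exchange_big /= (bigD1 e) //= [X in _ + X]big1 => [|b be].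
      rewrite addr0; under eq_bigr do rewrite scalerA.
      rewrite -scaler_suml; have /matrixP/(_ e e) := CiC; rewrite !mxE eqxx => ->.
      by rewrite scale1r.
    under eq_bigr do rewrite scalerA.
    rewrite -scaler_suml; have /matrixP/(_ e b) := CiC; rewrite !mxE eq_sym (negbTE be) => ->.
    by rewrite scale0r.
  move=> E; rewrite -[Te e]mul1mx -CiC -[Te e]mulmx1 -CiC.
  by rewrite !mulmxA -(mulmxA Ci) -(mulmxA Ci) E mulmx0 mul0mx.
have : C *m (Se *m Se) *m Ci = C *m (2^-1 *: Se) *m Ci.
  rewrite -mulC; apply/matrixP => i j; rewrite -scalemxAr -scalemxAl mxE [RHS]mxE -fS -SS.
  by apply: eq_bigr => k _; rewrite !fS.
move=> E; rewrite -[LHS]mul1mx -CiC -[LHS]mulmx1 -CiC -[RHS]mul1mx -CiC -[RHS]mulmx1 -CiC.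
have := congr1 (fun Z => Ci *m Z *m C) E; by rewrite !mulmxA.
Qed.

End PointwiseSoliton.

Arguments evs : simpl never.
Arguments sder : simpl never.

(** * From coordinate formulas to the abstract soliton ring *)

Section PotentialRing.
Variables (R A : comNzRingType) (n : nat) (kap : {rmorphism R -> A}) (d : 'I_n -> A -> A)
  (h : R) (G Gi : 'M[A]_n) (F : A).
Hypothesis dA : diff_ring kap d.
Hypothesis hh : h + h = 1.
Hypothesis Gsym : G^T = G.
Hypotheses (GGi : G *m Gi = 1%:M) (GiG : Gi *m G = 1%:M).

Definition levi_civita a : 'M[A]_n := \matrix_(b, k)
  (kap h * \sum_l Gi k l * (d a (G b l) + d b (G a l) - d l (G a b))).
Local Notation Y := levi_civita.
Definition ring_ricci : 'M[A]_n := \matrix_(b, c) \sum_a curv d Y a b c a.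
Definition ring_hessian : 'M[A]_n := \matrix_(a, b) (d a (d b F) - \sum_k Y a b k * d k F).
Definition ring_S : 'M[A]_n := ring_ricci *m Gi.
Definition ring_N : 'rV[A]_n := (\row_a d a F) *m Gi.

Lemma levi_civitaE a b k :
  Y a b k = kap h * \sum_l Gi k l * (d a (G b l) + d b (G a l) - d l (G a b)).
Proof. by rewrite mxE. Qed.

Lemma GsymE a b : G a b = G b a.
Proof. by rewrite -[in LHS]Gsym mxE. Qed.

Lemma levi_civita_sym a b : row a (Y b) = row b (Y a).
Proof.
apply/rowP => k; rewrite !mxE; congr (_ * _); apply: eq_bigr => l _.
by rewrite (GsymE b a) (addrC (d b _)).
Qed.

Lemma levi_civitaG a b m : (Y a *m G) b m = kap h * (d a (G b m) + d b (G a m) - d m (G a b)).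
Proof.
rewrite mxE (eq_bigr (fun k => \sum_l kap h * (Gi k l * G m k * (d a (G b l) + d b (G a l) - d l (G a b))))); last first.
  by move=> k _; rewrite mxE mulr_sumr mulr_suml; apply: eq_bigr => l _; rewrite (GsymE m k); ring.
rewrite exchange_big /= (eq_bigr (fun l => (m == l)%:R * (kap h * (d a (G b l) + d b (G a l) - d l (G a b))))); last first.
  move=> l _; have /matrixP/(_ m l) := GGi; rewrite !mxE => <-.
  by rewrite mulr_suml; apply: eq_bigr => k _; ring.
by rewrite (bigD1 m) //= eqxx mul1r big1 ?addr0 // => l lm; rewrite eq_sym (negbTE lm) mul0r.
Qed.

Lemma levi_civita_metric a : dmx d a G = Y a *m G + G *m (Y a)^T.
Proof.
have E : G *m (Y a)^T = (Y a *m G)^T by rewrite trmx_mul Gsym.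
apply/matrixP => b m; rewrite E mx_addE mx_trE !levi_civitaG mxE (GsymE m b).
rewrite -[LHS]mul1r -[X in X * _](rmorph1 kap) -hh rmorphD; ring.
Qed.

Hypothesis soliton : ring_ricci + ring_hessian = kap h *: G.
Hypothesis scal : \sum_a \sum_b Gi a b * ring_ricci a b = 1.

Lemma ring_hessian_sym : ring_hessian^T = ring_hessian.
Proof.
apply/matrixP => a b; rewrite !mxE (dr_comm dA); congr (_ - _); apply: eq_bigr => k _.
by have /rowP/(_ k) := levi_civita_sym a b; rewrite !mxE => ->.
Qed.

Lemma ring_ricci_eq : ring_ricci = kap h *: G - ring_hessian.
Proof. by rewrite -soliton addrK. Qed.

(** Symmetry of Ric is read off from the soliton equation, since the Hessian is symmetric by
    torsion-freeness. The axiom on the gradient is the same equation with one index raised. *)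
Lemma potential_soliton_ring : soliton_ring kap d Y h G ring_S ring_N.
Proof.
have SG : ring_S *m G = ring_ricci by rewrite -mulmxA GiG mulmx1.
have Rsym : ring_ricci^T = ring_ricci.
  by rewrite ring_ricci_eq linearB linearZ /= Gsym ring_hessian_sym.
split=> //; first exact: levi_civita_sym.
- exact: levi_civita_metric.
- by rewrite SG.
- by move=> b c; rewrite SG mxE.
- move=> a.
  have E : nabv d Y a ring_N *m G = row a ring_hessian.
    have NG : ring_N *m G = \row_b d b F by rewrite -mulmxA GiG mulmx1.
    have -> : nabv d Y a ring_N *m G = dmx d a (ring_N *m G) - (ring_N *m G) *m (Y a)^T.
      rewrite (dmxM dA) levi_civita_metric /nabv mulmxDl mulmxDr !mulmxA.
      by rewrite [X in _ = X - _]addrA addrK.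
    rewrite NG; apply/rowP => b; rewrite !mxE; congr (_ - _); apply: eq_bigr => k _.
    by rewrite !mxE mulrC.
  rewrite -[LHS]mulmx1 -GGi mulmxA E -row_mul; congr (row a _).
  rewrite (_ : ring_hessian = kap h *: G - ring_ricci); last by rewrite -soliton addrAC subrr add0r.
  by rewrite mulmxBl -scalemxAl GGi scalemx1.
- rewrite -scal /mxtrace; rewrite exchange_big; apply: eq_bigr => b _ /=.
  rewrite mxE; apply: eq_bigr => a _; rewrite mulrC -[in LHS]Rsym mx_trE; congr (_ * _).
Qed.

End PotentialRing.

Section SmoothMatrix.
Variables (R : realType) (n : nat).

Definition pdm p q (a : 'I_n) (X : 'rV[R]_n -> 'M[R]_(p, q)) x : 'M[R]_(p, q) :=
  \matrix_(i, j) partial a (fun y => X y i j) x.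

Definition smooth_mx p q (U : set 'rV[R]_n) (X : 'rV[R]_n -> 'M[R]_(p, q)) :=
  forall i j, smooth_on U (fun y => X y i j).

Variable U : open_set R n.
Local Notation A := (smoothfun U).

(** The passage between ring elements, which can be differentiated formally, and matrix functions in
    coordinates, of which only the values on U count. *)
Definition represents p q (X : 'M[A]_(p, q)) (Xf : 'rV[R]_n -> 'M[R]_(p, q)) :=
  forall y, oset U y -> map_mx (evs y) X = Xf y.

Lemma represents_smooth p q (X : 'M[A]_(p, q)) Xf : represents X Xf -> smooth_mx U Xf.
Proof.
move=> XX i j k; apply: (Ck_ext (openP U) _ (smoothfunP (X i j) k)) => y Uy.
by rewrite -(XX y Uy) mxE.
Qed.

Lemma represents_dmx p q (X : 'M[A]_(p, q)) Xf a : represents X Xf ->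
  represents (dmx (@sder R n U) a X) (pdm a Xf).
Proof.
move=> XX y Uy; apply/matrixP => i j; rewrite !mxE /evs sderE //.
by apply: (partial_eq_on _ (openP U) _ Uy) => z Uz; rewrite -(XX z Uz) mxE.
Qed.

Lemma represents_eq p q (X Z : 'M[A]_(p, q)) :
  (forall y, oset U y -> map_mx (evs y) X = map_mx (evs y) Z) -> X = Z.
Proof.
move=> E; apply/matrixP => i j; apply/smoothfun_eq => y Uy.
by have /matrixP/(_ i j) := E y Uy; rewrite !mxE.
Qed.

Definition mk_smooth_mx p q (X : 'rV[R]_n -> 'M[R]_(p, q)) (sX : smooth_mx U X) : 'M[A]_(p, q) :=
  \matrix_(i, j) mksmooth (sX i j).

Lemma represents_mk p q (X : 'rV[R]_n -> 'M[R]_(p, q)) (sX : smooth_mx U X) :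
  represents (mk_smooth_mx sX) X.
Proof. by move=> y Uy; apply/matrixP => i j; rewrite !mxE /evs mksmoothE. Qed.

Lemma smooth_diff_ring : diff_ring (@sconst R n U) (@sder R n U).
Proof.
split=> [a x y|a x y|a b x|a c];
  [exact: sderD|exact: sderM|exact: sderC|exact: sder_const].
Qed.

Lemma evs_sconst x c : evs x (sconst U c) = c.
Proof. exact: sconstE. Qed.

End SmoothMatrix.

Section ChartSoliton.
Variables (R : realType) (U : open_set R 4) (G : 'rV[R]_4 -> 'M[R]_4) (F : 'rV[R]_4 -> R).
Hypothesis sG : smooth_mx U G.
Hypothesis sF : smooth_on U F.
Hypothesis Gs : forall x, oset U x -> (G x)^T = G x.
Hypothesis Gpos : forall x, oset U x -> posdef (G x).
Hypothesis soliton_eq : forall x, oset U x -> ricci G x + hessian G F x = 2^-1 *: G x.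
Hypothesis scal1 : forall x, oset U x -> scalar_curvature G x = 1.
Local Notation A := (smoothfun U).
Local Notation rep := (@represents R 4 U _ _).
Local Notation d := (@sder R 4 U).

Definition conn_of a x : 'M[R]_4 := \matrix_(b, k) christoffel G k a b x.
Definition ric_endo x : 'M[R]_4 := ricci G x *m invmx (G x).
Definition grad_of x : 'rV[R]_4 := (\row_a partial a F x) *m invmx (G x).

Let Gm := mk_smooth_mx sG.
Let Fm : A := mksmooth sF.

Lemma posdef_unit n (X : 'M[R]_n) : posdef X -> X \in unitmx.
Proof.
move=> pX; rewrite -row_free_unit -kermx_eq0; apply/negPn/negP => /rowV0Pn[v /sub_kermxP vX v0].
by have := pX v v0; rewrite vX mul0mx mxE ltxx.
Qed.

Lemma detG_smooth : smooth_on U (fun x => (\det (G x))^-1).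
Proof.
move=> k; apply: (Ck_inv (openP U)) => [x Ux|].
  by have := posdef_unit (Gpos Ux); rewrite unitmxE unitfE.
apply: (Ck_ext (openP U) _ (smoothfunP (\det Gm) k)) => y Uy.
by rewrite -(represents_mk sG Uy) det_map_mx.
Qed.

(** The ring of smooth functions is not a field, so the inverse metric is built from the adjugate
    and the smooth function 1 / det G. *)
Let Gim : 'M[A]_4 := mksmooth detG_smooth *: \adj Gm.

Lemma Gm_inv : Gm *m Gim = 1%:M.
Proof.
rewrite /Gim -scalemxAr mul_mx_adj scale_scalar_mx (_ : _ * _ = 1) //.
apply/smoothfun_eq => x Ux; change ((mksmooth detG_smooth) x * (\det Gm) x = 1).
rewrite mksmoothE // -(represents_mk sG Ux) det_map_mx mulVf //.
have := posdef_unit (Gpos Ux); rewrite unitmxE unitfE -(represents_mk sG Ux) det_map_mx //.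
Qed.

Lemma Gm_inv' : Gim *m Gm = 1%:M.
Proof. by rewrite /Gim -scalemxAl mul_adj_mx -mul_mx_adj scalemxAr Gm_inv. Qed.

Lemma rep_G : rep Gm G. Proof. exact: represents_mk. Qed.

Lemma rep_Gi : rep Gim (fun x => invmx (G x)).
Proof.
move=> x Ux; have U1 := posdef_unit (Gpos Ux).
have := congr1 (map_mx (evs x)) Gm_inv; rewrite map_mxM map_mx1 (rep_G Ux) => E.
by rewrite -[LHS]mul1mx -(mulVmx U1) -mulmxA E mulmx1.
Qed.

Let Ym := levi_civita (@sconst R 4 U) d 2^-1 Gm Gim.

Lemma rep_Y a : rep (Ym a) (conn_of a).
Proof.
move=> x Ux; apply/matrixP => b k.
rewrite [LHS]mxE [RHS]mxE /Ym levi_civitaE rmorphM rmorph_sum; congr (_ * _); first exact: evs_sconst.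
apply: eq_bigr => l _; rewrite rmorphM rmorphB rmorphD /=.
have /matrixP/(_ k l) := rep_Gi Ux; rewrite mxE => ->.
have E c p q : evs x (d c (Gm p q)) = partial c (fun y => G y p q) x.
  by have /matrixP/(_ p q) := represents_dmx c rep_G Ux; rewrite !mxE.
by rewrite !E.
Qed.

Lemma rep_curv a b x c l : oset U x -> evs x (curv d Ym a b c l) = riemann G l c a b x.
Proof.
move=> Ux.
have E p q r s : evs x (d p (Ym q r s)) = partial p (christoffel G s q r) x.
  have /matrixP/(_ r s) := represents_dmx p (@rep_Y q) Ux; rewrite !mxE => ->.
  by congr (partial p _ x); apply/funext => y; rewrite mxE.
have E2 p q r : evs x (Ym p q r) = christoffel G r p q x.
  by have /matrixP/(_ q r) := rep_Y p Ux; rewrite !mxE.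
rewrite /curv; move: E E2; move: Ym => Y E E2.
rewrite !mx_addE !mx_oppE !mxE !rmorphB rmorphD rmorphB /= !E /riemann -addrA; congr (_ + _).
rewrite !rmorph_sum -sumrB; apply: eq_bigr => m _; rewrite !rmorphM /= !E2.
by rewrite mulrC [X in _ - X]mulrC.
Qed.

Lemma rep_ricci : rep (ring_ricci (@sconst R 4 U) d 2^-1 Gm Gim) (ricci G).
Proof.
move=> x Ux; apply/matrixP => b c; rewrite !mxE rmorph_sum; apply: eq_bigr => a _.
exact: rep_curv.
Qed.

Lemma evs_dF a x : oset U x -> evs x (d a Fm) = partial a F x.
Proof.
move=> Ux; rewrite /evs sderE //; apply: (partial_eq_on _ (openP U) _ Ux) => y Uy.
exact: mksmoothE.
Qed.

Lemma rep_hessian : rep (ring_hessian (@sconst R 4 U) d 2^-1 Gm Gim Fm) (hessian G F).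
Proof.
move=> x Ux; apply/matrixP => a b; rewrite [LHS]mxE [RHS]mxE [ring_hessian _ _ _ _ _ _ _ _]mxE rmorphB rmorph_sum; congr (_ - _).
  rewrite /= /evs sderE //; apply: (partial_eq_on _ (openP U) _ Ux) => y Uy.
  exact: evs_dF.
apply: eq_bigr => k _; rewrite rmorphM /= evs_dF //.
by have /matrixP/(_ b k) := rep_Y a Ux; rewrite !mxE => ->.
Qed.

Let Sm := ring_S (@sconst R 4 U) d 2^-1 Gm Gim.
Let Nm := ring_N d Gim Fm.

Lemma rep_S : rep Sm ric_endo.
Proof. by move=> x Ux; rewrite map_mxM (rep_ricci Ux) (rep_Gi Ux). Qed.

Lemma rep_N : rep Nm grad_of.
Proof.
move=> x Ux; rewrite map_mxM (rep_Gi Ux); congr (_ *m _).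
by apply/rowP => a; rewrite !mxE /= evs_dF.
Qed.

Lemma chart_soliton_ring : soliton_ring (@sconst R 4 U) d Ym 2^-1 Gm Sm Nm.
Proof.
have Gms : Gm^T = Gm.
  by apply: represents_eq => y Uy; rewrite -map_trmx (rep_G Uy) Gs.
apply: potential_soliton_ring.
- exact: smooth_diff_ring.
- by lra.
- exact: Gms.
- exact: Gm_inv.
- exact: Gm_inv'.
- apply: represents_eq => y Uy.
  rewrite map_mxD (rep_ricci Uy) (rep_hessian Uy) soliton_eq //.
  by rewrite map_mxZ /= evs_sconst (rep_G Uy).
- apply/smoothfun_eq => y Uy; change (evs y (\sum_a \sum_b Gim a b *
    ring_ricci (@sconst R 4 U) d 2^-1 Gm Gim a b) = 1).
  rewrite rmorph_sum -[RHS](scal1 Uy); apply: eq_bigr => a _; rewrite rmorph_sum.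
  apply: eq_bigr => b _; rewrite rmorphM /=.
  have /matrixP/(_ a b) := rep_Gi Uy; rewrite mxE => ->.
  by have /matrixP/(_ a b) := rep_ricci Uy; rewrite mxE => ->.
Qed.

Definition Dric_of a x : 'M[R]_4 :=
  pdm a ric_endo x + ric_endo x *m conn_of a x - conn_of a x *m ric_endo x.

Lemma rep_Dric a : rep (Dric d Ym Sm a) (Dric_of a).
Proof.
move=> x Ux; rewrite /Dric /nabe; have := represents_dmx a rep_S Ux.
have := rep_S Ux; have := rep_Y a Ux; move: Sm (Ym a) => X Z EZ EX ED.
by rewrite map_mxB map_mxD !map_mxM ED EX EZ.
Qed.

(** The first stage holds at every point of U, hence as an equality of ring elements, which the
    second stage is allowed to differentiate. *)
Lemma chart_NS_div : Nm *m Sm = 0 /\ forall b, \sum_a Dric d Ym Sm a b a = 0.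
Proof.
have P y : oset U y -> posdef (map_mx (evs y) Gm) by move=> Uy; rewrite (rep_G Uy); exact: Gpos.
have St y (Uy : oset U y) := soliton_stage1 chart_soliton_ring (@evs_sconst R 4 U y) (P y Uy).
split; first by apply: represents_eq => y Uy; rewrite map_mx0; have [] := St y Uy.
by move=> b; apply/smoothfun_eq => y Uy; have [_ /(_ b)] := St y Uy.
Qed.

Lemma chart_grad_ric x : oset U x -> grad_of x *m ric_endo x = 0.
Proof.
by move=> Ux; rewrite -(rep_N Ux) -(rep_S Ux) -map_mxM; have [-> _] := chart_NS_div; rewrite map_mx0.
Qed.

Definition grad_sqr x : R := (grad_of x *m G x *m (grad_of x)^T) 0 0.
(** The third elementary symmetric function of the Ricci eigenvalues, by Newton's identities for
    trace 1 and squared norm 1/2; [e3_der] is its derivative along the gradient of the potential. *)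
Definition e3_of x : R := (\tr (ric_endo x *m ric_endo x *m ric_endo x) - 4^-1) / 3.
Definition e3_der x : R :=
  \tr (ric_endo x *m ric_endo x *m \sum_a (grad_of x) 0 a *: Dric_of a x).

Lemma chart_key x : oset U x -> 0 < grad_sqr x ->
  [/\ 0 <= e3_of x,
      e3_der x ^+ 2 <= e3_of x * (4 * e3_der x + 2 * e3_of x - 12 * grad_sqr x * e3_of x) &
      e3_of x = 0 -> (forall a, Dric_of a x = 0) /\
        ric_endo x *m ric_endo x = 2^-1 *: ric_endo x].
Proof.
move=> Ux s0; have [NS dv] := chart_NS_div.
have P : posdef (map_mx (evs x) Gm) by rewrite (rep_G Ux); exact: Gpos.
have := soliton_stage2 chart_soliton_ring (@evs_sconst R 4 U x) P NS dv.
rewrite /= (rep_N Ux) (rep_G Ux) (rep_S Ux).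
have -> : \sum_a grad_of x 0 a *: map_mx (evs x) (Dric d Ym Sm a) = \sum_a grad_of x 0 a *: Dric_of a x.
  by apply: eq_bigr => a _; rewrite (rep_Dric a Ux).
move=> /(_ s0)[K1 K2 K3]; split=> // uz; have [K4 K5] := K3 uz; split=> // a.
by rewrite -(rep_Dric a Ux); exact: K4.
Qed.

Lemma chart_trace_sqr x : oset U x -> \tr (ric_endo x *m ric_endo x) = 2^-1.
Proof.
move=> Ux; have [NS dv] := chart_NS_div.
have := congr1 (evs x) (trace_ric_sqr chart_soliton_ring NS dv).
by rewrite evs_sconst => <-; rewrite -(rep_S Ux) -map_mxM trace_map_mx.
Qed.

Lemma chart_metric_der a x : oset U x ->
  pdm a G x = conn_of a x *m G x + G x *m (conn_of a x)^T.
Proof.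
move=> Ux; rewrite -(represents_dmx a rep_G Ux) (sr_metric chart_soliton_ring).
by rewrite map_mxD !map_mxM -map_trmx (rep_G Ux) (rep_Y a Ux).
Qed.

Lemma chart_grad_der a x : oset U x ->
  pdm a grad_of x = row a (2^-1%:M - ric_endo x) - grad_of x *m conn_of a x.
Proof.
move=> Ux; have := congr1 (map_mx (evs x)) (sr_grad chart_soliton_ring a).
rewrite /nabv map_mxD map_mxM (represents_dmx a rep_N Ux) (rep_N Ux) (rep_Y a Ux).
rewrite map_row map_mxB map_scalar_mx /= evs_sconst (rep_S Ux) => <-.
by rewrite addrK.
Qed.

Lemma chart_conn_sym a b x : oset U x -> row a (conn_of b x) = row b (conn_of a x).
Proof.
by move=> Ux; rewrite -(rep_Y b Ux) -(rep_Y a Ux) -!map_row (sr_torsion chart_soliton_ring).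
Qed.

Lemma chart_ric_sym x : oset U x -> (ric_endo x *m G x)^T = ric_endo x *m G x.
Proof.
move=> Ux; rewrite -(rep_S Ux) -(rep_G Ux) -map_mxM map_trmx (sr_Ssym chart_soliton_ring) //.
Qed.

Lemma smooth_G_inv : smooth_mx U (fun x => invmx (G x)).
Proof. exact: represents_smooth rep_Gi. Qed.
Lemma smooth_conn a : smooth_mx U (conn_of a).
Proof. exact: represents_smooth (@rep_Y a). Qed.
Lemma smooth_ric_endo : smooth_mx U ric_endo.
Proof. exact: represents_smooth rep_S. Qed.
Lemma smooth_grad : smooth_mx U grad_of.
Proof. exact: represents_smooth rep_N. Qed.

End ChartSoliton.

(** * Consequences in a single chart *)

Record soliton_chart (R : realType) (U : set 'rV[R]_4) (G : 'rV[R]_4 -> 'M[R]_4)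
    (F : 'rV[R]_4 -> R) : Prop := SolitonChart {
  sc_open : open U;
  sc_smooth_metric : smooth_mx U G;
  sc_smooth_pot : smooth_on U F;
  sc_sym : forall x, U x -> (G x)^T = G x;
  sc_pos : forall x, U x -> posdef (G x);
  sc_soliton : forall x, U x -> ricci G x + hessian G F x = 2^-1 *: G x;
  sc_scal : forall x, U x -> scalar_curvature G x = 1 }.

Section SolitonChartTheory.
Variables (R : realType) (U : set 'rV[R]_4) (G : 'rV[R]_4 -> 'M[R]_4) (F : 'rV[R]_4 -> R).
Hypothesis sc : soliton_chart U G F.

Let mkU x (Ux : U x) : open_set R 4 := OpenSet (sc_open sc) Ux.

Lemma sc_unit x : U x -> G x \in unitmx.
Proof. by move=> Ux; apply: posdef_unit; exact: sc_pos sc _ Ux. Qed.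

Lemma sc_grad_ric x : U x -> grad_of G F x *m ric_endo G x = 0.
Proof.
by move=> Ux; apply: (@chart_grad_ric R (mkU Ux)) => //; case: sc.
Qed.

Lemma sc_key x : U x -> 0 < grad_sqr G F x ->
  [/\ 0 <= e3_of G x,
      e3_der G F x ^+ 2 <= e3_of G x * (4 * e3_der G F x + 2 * e3_of G x - 12 * grad_sqr G F x * e3_of G x) &
      e3_of G x = 0 -> (forall a, Dric_of G a x = 0) /\
        ric_endo G x *m ric_endo G x = 2^-1 *: ric_endo G x].
Proof.
by move=> Ux s0; apply: (@chart_key R (mkU Ux)) => //; case: sc.
Qed.

Lemma sc_trace_sqr x : U x -> \tr (ric_endo G x *m ric_endo G x) = 2^-1.
Proof. by move=> Ux; apply: (@chart_trace_sqr R (mkU Ux) _ F) => //; case: sc. Qed.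

Lemma sc_metric_der a x : U x ->
  pdm a G x = conn_of G a x *m G x + G x *m (conn_of G a x)^T.
Proof. by move=> Ux; apply: (@chart_metric_der R (mkU Ux) _ F) => //; case: sc. Qed.

Lemma sc_grad_der a x : U x -> pdm a (grad_of G F) x =
  row a (2^-1%:M - ric_endo G x) - grad_of G F x *m conn_of G a x.
Proof. by move=> Ux; apply: (@chart_grad_der R (mkU Ux)) => //; case: sc. Qed.

Lemma sc_conn_sym a b x : U x -> row a (conn_of G b x) = row b (conn_of G a x).
Proof. by move=> Ux; apply: (@chart_conn_sym R (mkU Ux) _ F) => //; case: sc. Qed.

Lemma sc_ric_sym x : U x -> (ricci G x)^T = ricci G x.
Proof.
move=> Ux; have E : ric_endo G x *m G x = ricci G x.
  by rewrite /ric_endo -mulmxA mulVmx ?mulmx1 // sc_unit.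
by rewrite -E; apply: (@chart_ric_sym R (mkU Ux) _ F) => //; case: sc.
Qed.

(** An [open_set] carries a base point, so smoothness is first obtained in the presence of a point
    of U; on the empty set it is vacuous. *)
Lemma smooth_on_nonempty (K : 'rV[R]_4 -> R) : (forall x, U x -> smooth_on U K) -> smooth_on U K.
Proof.
move=> H; have [[x Ux]|E] := pselect (exists x, U x); first exact: (H x Ux).
have N x : ~ U x by move=> Ux; apply: E; exists x.
suff C k L : Ck_on k U L by move=> k.
elim: k L => [|k IH] L; split=> // x; first by move=> /N.
  by move=> /N.
by split=> [y /N|].
Qed.

Lemma sc_smooth_inv : smooth_mx U (fun x => invmx (G x)).
Proof.
move=> i j; apply: smooth_on_nonempty => x Ux.
by apply: (@smooth_G_inv R (mkU Ux)); case: sc.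
Qed.

Lemma sc_smooth_conn a : smooth_mx U (conn_of G a).
Proof.
move=> i j; apply: smooth_on_nonempty => x Ux.
by apply: (@smooth_conn R (mkU Ux)); case: sc.
Qed.

Lemma sc_smooth_ric_endo : smooth_mx U (ric_endo G).
Proof.
move=> i j; apply: smooth_on_nonempty => x Ux.
by apply: (@smooth_ric_endo R (mkU Ux)); case: sc.
Qed.

Lemma sc_smooth_grad : smooth_mx U (grad_of G F).
Proof.
move=> i j; apply: smooth_on_nonempty => x Ux.
by apply: (@smooth_grad R (mkU Ux)); case: sc.
Qed.

Lemma sc_ricE x : U x -> ricci G x = ric_endo G x *m G x.
Proof. by move=> Ux; rewrite /ric_endo -mulmxA mulVmx ?mulmx1 // sc_unit. Qed.

Lemma sc_trace x : U x -> \tr (ric_endo G x) = 1.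
Proof.
move=> Ux; rewrite -(sc_scal sc Ux) /scalar_curvature /mxtrace exchange_big.
apply: eq_bigr => b _ /=; rewrite mxE; apply: eq_bigr => a _; rewrite mulrC.
by rewrite -[in LHS](sc_ric_sym Ux) mx_trE.
Qed.

(* In an orthonormal frame this is Cauchy-Schwarz, as the entries of the Ricci
   tensor have sum of squares 1/2. *)
Lemma sc_ric_bound x (X : 'rV[R]_4) : U x ->
  (X *m ric_endo G x *m G x *m X^T) 0 0 <= (X *m G x *m X^T) 0 0.
Proof.
move=> Ux; have [C [Ci [CCi CiC CGC _]]] := posdef_frame 0 (sc_sym sc Ux) (sc_pos sc Ux).
pose w := X *m Ci; have XE : X = w *m C by rewrite /w -mulmxA CiC mulmx1.
pose B := C *m ric_endo G x *m Ci.
have GC : G x *m C^T = Ci by rewrite -[LHS]mul1mx -CiC -mulmxA (mulmxA C) CGC mulmx1.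
have E1 : X *m ric_endo G x *m G x *m X^T = w *m B *m w^T.
  by rewrite XE trmx_mul !mulmxA -(mulmxA _ (G x)) GC /B ?mulmxA.
have E2 : X *m G x *m X^T = w *m w^T.
  by rewrite XE trmx_mul !mulmxA -(mulmxA w) -(mulmxA w) CGC mulmx1.
have Bs : B^T = B.
  have -> : B = C *m ricci G x *m C^T by rewrite sc_ricE // /B -GC ?mulmxA.
  by rewrite !trmx_mul trmxK sc_ric_sym // mulmxA.
have trB : \tr (B *m B) = 2^-1.
  rewrite -(sc_trace_sqr Ux) /B !mulmxA -(mulmxA _ Ci C) CiC mulmx1.
  by rewrite mxtrace_mulC !mulmxA CiC mul1mx.
have nB : \sum_i \sum_j B i j ^+ 2 = 2^-1.
  rewrite -trB; apply: eq_bigr => i _; rewrite mxE; apply: eq_bigr => j _.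
  by rewrite -[X in _ = _ * X]mx_trE Bs expr2.
clearbody B w; rewrite E1 E2; set q := (w *m w^T) 0 0.
have qE : q = \sum_i w 0 i ^+ 2.
  by rewrite /q mxE; apply: eq_bigr => i _; rewrite mx_trE expr2.
have q0 : 0 <= q by rewrite qE; apply: sumr_ge0 => i _; exact: sqr_ge0.
have := sum2_cauchy_schwarz (fun i j => B i j) (fun i j => w 0 i * w 0 j).
have -> : \sum_i \sum_j B i j * (w 0 i * w 0 j) = (w *m B *m w^T) 0 0.
  rewrite [RHS]mxE exchange_big; apply: eq_bigr => j _ /=; rewrite [(w *m B) 0 j]mxE mulr_suml mx_trE.
  by apply: eq_bigr => i _; ring.
have -> : \sum_i \sum_j (w 0 i * w 0 j) ^+ 2 = q ^+ 2.
  rewrite qE expr2 big_distrlr; apply: eq_bigr => i _; apply: eq_bigr => j _.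
  by rewrite exprMn.
rewrite nB => H; nra.
Qed.

Definition conn_along x (v : 'rV[R]_4) : 'M[R]_4 := \sum_a v 0 a *: conn_of G a x.
Definition pdm_along p q (X : 'rV[R]_4 -> 'M[R]_(p, q)) x (v : 'rV[R]_4) : 'M[R]_(p, q) :=
  \sum_a v 0 a *: pdm a X x.

Lemma metric_along x v : U x -> pdm_along G x v = conn_along x v *m G x + G x *m (conn_along x v)^T.
Proof.
move=> Ux; rewrite /conn_along mulmx_suml linear_sum mulmx_sumr -big_split.
apply: eq_bigr => a _ /=; rewrite sc_metric_der // scalerDr -scalemxAl.
by rewrite linearZ /= -scalemxAr.
Qed.

Lemma grad_along x v : U x -> pdm_along (grad_of G F) x v =
  v *m (2^-1%:M - ric_endo G x) - grad_of G F x *m conn_along x v.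
Proof.
move=> Ux; rewrite /pdm_along; under eq_bigr do rewrite sc_grad_der //.
have -> : v *m (2^-1%:M - ric_endo G x) = \sum_a v 0 a *: row a (2^-1%:M - ric_endo G x).
  by rewrite -mulmx_sum_row.
rewrite /conn_along mulmx_sumr -sumrB; apply: eq_bigr => a _.
by rewrite scalerBr -scalemxAr.
Qed.

Lemma ric_along x v : pdm_along (ric_endo G) x v =
  \sum_a v 0 a *: Dric_of G a x - ric_endo G x *m conn_along x v + conn_along x v *m ric_endo G x.
Proof.
rewrite /conn_along mulmx_sumr mulmx_suml -sumrB -big_split; apply: eq_bigr => a _ /=.
rewrite /Dric_of -scalemxAr -scalemxAl -scalerBr -scalerDr; congr (_ *: _).
by rewrite [X in _ = X + _]addrAC addrK subrK.
Qed.

End SolitonChartTheory.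

(** * Matrix-valued curves *)

Section RealCurves.
Variable R : realType.

Definition curve_der p q (X : R -> 'M[R]_(p, q)) (t : R) (D : 'M[R]_(p, q)) :=
  forall i j, is_derive t 1 (fun s => X s i j) (D i j).

Lemma curve_derM p q r (X : R -> 'M[R]_(p, q)) (Z : R -> 'M[R]_(q, r)) t DX DZ :
  curve_der X t DX -> curve_der Z t DZ ->
  curve_der (fun s => X s *m Z s) t (DX *m Z t + X t *m DZ).
Proof.
move=> HX HZ i j.
have E : (fun s => (X s *m Z s) i j) = \sum_k ((fun s => X s i k) * (fun s => Z s k j)).
  by apply/funext => s; rewrite mxE fct_sumE.
have EE : (DX *m Z t + X t *m DZ) i j = \sum_k (X t i k *: DZ k j + Z t k j *: DX i k).
  rewrite mx_addE !mxE -big_split; apply: eq_bigr => k _ /=.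
  by rewrite /GRing.scale /= addrC (mulrC (DX i k)).
rewrite E EE; apply: is_derive_sum => k.
exact: is_deriveM.
Qed.

Lemma curve_derD p q (X Z : R -> 'M[R]_(p, q)) t DX DZ :
  curve_der X t DX -> curve_der Z t DZ -> curve_der (fun s => X s + Z s) t (DX + DZ).
Proof.
move=> HX HZ i j; rewrite mx_addE.
have -> : (fun s => (X s + Z s) i j) = (fun s => X s i j) + (fun s => Z s i j).
  by apply/funext => s; rewrite mx_addE.
exact: is_deriveD.
Qed.

Lemma curve_derN p q (X : R -> 'M[R]_(p, q)) t DX :
  curve_der X t DX -> curve_der (fun s => - X s) t (- DX).
Proof.
move=> HX i j; rewrite mx_oppE.
have -> : (fun s => (- X s) i j) = - (fun s => X s i j).
  by apply/funext => s; rewrite mx_oppE.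
exact: is_deriveN.
Qed.

Lemma curve_derZ p q (c : R -> R) (X : R -> 'M[R]_(p, q)) (t : R) Dc DX :
  is_derive t 1 c Dc -> curve_der X t DX ->
  curve_der (fun s => c s *: X s) t (Dc *: X t + c t *: DX).
Proof.
move=> Hc HX i j.
have -> : (fun s => (c s *: X s) i j) = c * (fun s => X s i j).
  by apply/funext => s; rewrite mxE.
have -> : (Dc *: X t + c t *: DX) i j = c t *: DX i j + X t i j *: Dc.
  by rewrite !mxE addrC [X in _ + X]mulrC.
exact: is_deriveM.
Qed.

Lemma curve_der_tr p q (X : R -> 'M[R]_(p, q)) t DX :
  curve_der X t DX -> curve_der (fun s => (X s)^T) t DX^T.
Proof.
move=> HX i j; rewrite mxE.
have -> : (fun s => (X s)^T i j) = (fun s => X s j i) by apply/funext => s; rewrite mxE.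
exact: HX.
Qed.

Lemma curve_der_const p q (X : 'M[R]_(p, q)) t : curve_der (fun=> X) t 0.
Proof. by move=> i j; rewrite mxE; exact: is_derive_cst. Qed.

Lemma curve_der_trace p (X : R -> 'M[R]_p) (t : R) DX : curve_der X t DX ->
  is_derive t 1 (fun s => \tr (X s)) (\tr DX).
Proof.
move=> HX; rewrite (_ : (fun s => \tr (X s)) = \sum_i (fun s => X s i i)).
  by apply: is_derive_sum => i.
by apply/funext => s; rewrite fct_sumE.
Qed.

Lemma curve_der_eq p q (X : R -> 'M[R]_(p, q)) t D D' : curve_der X t D -> D = D' -> curve_der X t D'.
Proof. by move=> H <-. Qed.

Lemma curve_der_near p q (X Z : R -> 'M[R]_(p, q)) t D :
  (\forall s \near t, X s = Z s) -> curve_der X t D -> curve_der Z t D.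
Proof.
move=> E H i j; apply: near_eq_is_derive (H i j).
by apply: filterS E => s ->.
Qed.

Lemma curve_der_pdm n p q (O : set 'rV[R]_n) (X : 'rV[R]_n -> 'M[R]_(p, q)) (x : R -> 'rV[R]_n) v t :
  open O -> smooth_mx O X -> O (x t) -> curve_der x t v ->
  curve_der (fun s => X (x s)) t (\sum_a v 0 a *: pdm a X (x t)).
Proof.
move=> oO sX Ox dx i j.
have [dF EF] := C1_diff oO (sX i j 1%N) Ox.
have H := @is_derive_comp R n R (fun y => X y i j) x t 1 dF EF (fun k => @ex_derive _ _ _ _ _ _ _ (dx 0 k)).
apply: is_derive_eq H _; rewrite summxE; apply: eq_bigr => k _; rewrite !mxE.
by rewrite (@derive_val _ _ _ _ _ _ _ (dx 0 k)).
Qed.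

End RealCurves.

(** * Charts and geodesics of the manifold *)

Section ManifoldCharts.
Variables (R : realType) (n : nat) (M : riemannian_data R n).
Hypothesis mM : is_manifold M.
Implicit Types (i j : chart_index M) (p : M).

Lemma chart_cover p : exists i, dom i p.
Proof. by have [_ H _ _ _] := mM. Qed.
Lemma dom_open i : open (dom i).
Proof. by have [_ _ /(_ i)[]] := mM. Qed.
Lemma cod_open i : open (cod i).
Proof. by have [_ _ /(_ i)[]] := mM. Qed.
Lemma chartK i p : dom i p -> param i (chart i p) = p.
Proof. by have [_ _ _ /(_ i)[H _ _] _] := mM; exact: H. Qed.
Lemma chart_continuous i p : dom i p -> {for p, continuous (chart i)}.
Proof. by have [_ _ _ /(_ i)[_ H _] _] := mM; exact: H. Qed.
Lemma param_continuous i x : cod i x -> {for x, continuous (param i)}.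
Proof. by have [_ _ _ /(_ i)[_ _ H] _] := mM; exact: H. Qed.
Lemma cod_chart i p : dom i p -> cod i (chart i p).
Proof. by move=> ip; exists p. Qed.
Lemma cod_param i x : cod i x -> dom i (param i x) /\ chart i (param i x) = x.
Proof. by move=> [p ip <-]; rewrite chartK. Qed.
Lemma manifold_hausdorff : hausdorff_space M.
Proof. by have [[H _] _ _ _ _] := mM. Qed.

Definition chart_image i (V : set M) : set 'rV[R]_n := chart i @` (dom i `&` V).

Lemma chart_imageP i V x : chart_image i V x <-> cod i x /\ V (param i x).
Proof.
split=> [[p [ip Vp] <-]|[[p ip <-]]]; first by rewrite chartK //; split=> //; exact: cod_chart.
by rewrite chartK // => Vp; exists p.
Qed.

Lemma chart_image_open i V : open V -> open (chart_image i V).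
Proof.
move=> oV; rewrite openE => x /chart_imageP[cx Vx]; rewrite /interior.
have N1 : nbhs x (cod i) by apply: open_nbhs_nbhs; split=> //; exact: cod_open.
have N2 : nbhs x (param i @^-1` V).
  exact: (param_continuous cx (open_nbhs_nbhs (conj oV Vx))).
by apply: filterS (filterI N1 N2) => y [cy Vy]; apply/chart_imageP.
Qed.

Definition transition i j := local_expr (@id M) i j.

Lemma transition_smooth i j k :
  smooth_on (chart_image i (dom j)) (fun x => transition i j x 0 k).
Proof. by have [_ _ _ _ [_ H]] := mM; exact: H. Qed.

Lemma transitionE i j p : dom i p -> transition i j (chart i p) = chart j p.
Proof. by move=> ip; rewrite /transition /local_expr /= chartK. Qed.

Lemma chart_image_chart i p (V : set M) : dom i p -> V p -> chart_image i V (chart i p).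
Proof. by move=> ip Vp; exists p. Qed.

Lemma dom_near i p : dom i p -> nbhs p (dom i).
Proof. by move=> ip; apply: open_nbhs_nbhs; split=> //; exact: dom_open. Qed.

Section Curve.
Variable c : R -> M.
Hypothesis cc : continuous c.

Lemma curve_near_open (V : set M) t : open V -> V (c t) -> \forall s \near t, V (c s).
Proof. by move=> oV Vt; exact: (@cc t V (open_nbhs_nbhs (conj oV Vt))). Qed.

Definition vel i t : 'rV[R]_n := \row_k derive1 (fun s => chart i (c s) 0 k) t.

Lemma curve_der_unique m1 m2 (X : R -> 'M[R]_(m1, m2)) t D D' :
  curve_der X t D -> curve_der X t D' -> D = D'.
Proof.
move=> H H'; apply/matrixP => a b.
by rewrite -(@derive_val _ _ _ _ _ _ _ (H a b)) -(@derive_val _ _ _ _ _ _ _ (H' a b)).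
Qed.

Lemma curve_der_vel i t D : curve_der (fun s => chart i (c s)) t D -> vel i t = D.
Proof.
move=> H; apply/rowP => k; rewrite mxE derive1E.
by rewrite (@derive_val _ _ _ _ _ _ _ (H 0 k)).
Qed.

Lemma vel_change i j t D : dom i (c t) -> dom j (c t) ->
  curve_der (fun s => chart i (c s)) t D ->
  curve_der (fun s => chart j (c s)) t (D *m jacobian_mx (transition i j) (chart i (c t))).
Proof.
move=> it jt dx.
have oO := @chart_image_open i _ (@dom_open j).
have Ot : chart_image i (dom j) (chart i (c t)) by exact: chart_image_chart.
have sm : smooth_mx (chart_image i (dom j)) (transition i j).
  by move=> a k; rewrite ord1; exact: transition_smooth.
have := curve_der_pdm oO sm Ot dx.
have -> : \sum_a D 0 a *: pdm a (transition i j) (chart i (c t)) =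
    D *m jacobian_mx (transition i j) (chart i (c t)).
  apply/rowP => k; rewrite summxE mxE; apply: eq_bigr => a _; rewrite !mxE.
  by congr (_ * _).
apply: curve_der_near.
have N := curve_near_open (@dom_open i) it.
by apply: filterS N => s ids; rewrite transitionE.
Qed.

End Curve.
End ManifoldCharts.

Arguments dom_open {R n M} mM i.
Arguments cod_open {R n M} mM i.
Arguments chart_image_open {R n M} mM i {V}.

Section Geodesics.
Variables (R : realType) (M : riemannian_data R 4).
Hypothesis mM : is_manifold M.
Variable c : R -> M.
Hypothesis gc : geodesic c.
Implicit Types (i j : chart_index M).

Lemma geodesic_continuous : continuous c.
Proof. by have [] := gc. Qed.

Lemma geodesic_vel i t : dom i (c t) -> curve_der (fun s => chart i (c s)) t (vel c i t).
Proof.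
move=> it a k; rewrite ord1 mxE derive1E; apply: derivableP.
by have [_ /(_ i t it k)[]] := gc.
Qed.

Lemma geodesic_acc i t : dom i (c t) ->
  curve_der (vel c i) t (- (vel c i t *m conn_along (metric i) (chart i (c t)) (vel c i t))).
Proof.
move=> it a k; rewrite ord1.
have [_ /(_ i t it k)[_ d2 E]] := gc.
have -> : (fun s => vel c i s 0 k) = derive1 (fun s => chart i (c s) 0 k).
  by apply/funext => s; rewrite mxE.
apply: DeriveDef => //; rewrite -derive1E; move/eqP: E; rewrite addr_eq0 => /eqP ->.
rewrite mx_oppE; congr (- _); rewrite mxE exchange_big; apply: eq_bigr => b _ /=.
rewrite /conn_along summxE mulr_sumr; apply: eq_bigr => e _; rewrite !mxE; ring.
Qed.

Lemma geodesic_along i t (O : set 'rV[R]_4) (F : 'rV[R]_4 -> R) : dom i (c t) ->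
  open O -> smooth_on O F -> O (chart i (c t)) ->
  is_derive t 1 (fun s => F (chart i (c s))) (\sum_k vel c i t 0 k * partial k F (chart i (c t))).
Proof.
move=> it oO sF Ot; have [dF EF] := C1_diff oO (sF 1%N) Ot.
have dx := geodesic_vel it.
have H := @is_derive_comp R 4 R F (fun s => chart i (c s)) t 1 dF EF (fun k => @ex_derive _ _ _ _ _ _ _ (dx 0 k)).
apply: is_derive_eq H _; apply: eq_bigr => k _.
by rewrite (@derive_val _ _ _ _ _ _ _ (dx 0 k)).
Qed.

Lemma geodesic_near_chart i t (O : set 'rV[R]_4) : dom i (c t) -> open O ->
  O (chart i (c t)) -> \forall s \near t, dom i (c s) /\ O (chart i (c s)).
Proof.
move=> it oO Ot; have cc := geodesic_continuous.
have N1 := curve_near_open cc (dom_open mM i) it.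
have N2 : \forall s \near t, O (chart i (c s)).
  have cct : {for t, continuous (chart i \o c)}.
    by apply: continuous_comp (cc t) (chart_continuous mM it).
  exact: (cct O (open_nbhs_nbhs (conj oO Ot))).
exact: filterI N1 N2.
Qed.

(** Differentiating dF(v) along the curve, the acceleration contributes exactly the Christoffel part
    of the Hessian. *)
Lemma geodesic_hessian i t (O : set 'rV[R]_4) (F : 'rV[R]_4 -> R) : dom i (c t) ->
  open O -> smooth_on O F -> O (chart i (c t)) ->
  is_derive t 1 (derive1 (fun s => F (chart i (c s))))
    ((vel c i t *m hessian (metric i) F (chart i (c t)) *m (vel c i t)^T) 0 0).
Proof.
move=> it oO sF Ot; set v := vel c i t; set x := chart i (c t).
have N := geodesic_near_chart it oO Ot.
apply: (@near_eq_is_derive _ _ _ (fun s => (vel c i s *m (\col_k partial k F (chart i (c s)))) 0 0)).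
  apply: filterS N => s [ids Os]; rewrite derive1E.
  rewrite (@derive_val _ _ _ _ _ _ _ (geodesic_along ids oO sF Os)) mxE.
  by apply: eq_bigr => k _; rewrite [(\col__ _) k 0]mxE.
have sC : smooth_mx O (fun y => \col_k partial k F y).
  move=> a b k; have [_ /(_ a)[_ CF]] := sF k.+1.
  by apply: (Ck_ext oO _ CF) => y _; rewrite mxE.
have H := curve_derM (geodesic_acc it) (curve_der_pdm oO sC Ot (geodesic_vel it)).
apply: is_derive_eq (H 0 0) _; rewrite -/v -/x; clear H N; clearbody v.
set w := \col_k partial k F x.
have L1 : (v *m conn_along (metric i) x v *m w) 0 0 =
    \sum_b \sum_a v 0 a * v 0 b * \sum_k christoffel (metric i) k a b x * partial k F x.
  rewrite -mulmxA mxE; apply: eq_bigr => b _.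
  rewrite /conn_along mulmx_suml summxE mulr_sumr; apply: eq_bigr => a _.
  rewrite -scalemxAl mxE mulrCA mulrA; congr (_ * _).
  by rewrite mxE; apply: eq_bigr => k _; rewrite !mxE.
have L2 : (v *m \sum_a v 0 a *: pdm a (fun y => \col_k partial k F y) x) 0 0 =
    \sum_b \sum_a v 0 a * v 0 b * partial a (partial b F) x.
  rewrite mxE; apply: eq_bigr => b _; rewrite summxE mulr_sumr; apply: eq_bigr => a _.
  rewrite !mxE mulrCA mulrA; congr (_ * _); congr (partial a _ x).
  by apply/funext => y; rewrite mxE.
rewrite mx_addE mulNmx mx_oppE L1 L2 addrC mxE -sumrB; apply: eq_bigr => b _.
rewrite mx_trE mxE mulr_suml -sumrB; apply: eq_bigr => a _.
rewrite mxE; ring.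
Qed.

Lemma geodesic_hessian_near i t (O : set 'rV[R]_4) (F : 'rV[R]_4 -> R) (g : R -> R) : dom i (c t) ->
  open O -> smooth_on O F -> O (chart i (c t)) ->
  (\forall s \near t, F (chart i (c s)) = g s) ->
  derive1 (derive1 g) t = (vel c i t *m hessian (metric i) F (chart i (c t)) *m (vel c i t)^T) 0 0.
Proof.
move=> it oO sF Ot E; have H := geodesic_hessian it oO sF Ot.
rewrite -(@derive_val _ _ _ _ _ _ _ H) [LHS]derive1E; apply: near_eq_derive.
have := nbhs_interior E; apply: filterS => s Es; rewrite !derive1E; apply: near_eq_derive.
by apply: filterS Es => u ->.
Qed.

End Geodesics.

Section Gronwall.
Variable R : realType.

Lemma gronwall (phi dphi : R -> R) (k b : R) : 0 <= b ->
  (forall t : R, 0 <= t <= b -> is_derive t 1 phi (dphi t)) ->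
  (forall t, 0 <= t <= b -> dphi t <= k * phi t) ->
  phi b <= expR (k * b) * phi 0.
Proof.
move=> b0 H Hle.
have E (t : R) : is_derive t 1 (fun s : R => expR (- k * s)) (- k * expR (- k * t)).
  have L : is_derive t 1 ( *%R (- k)) (- k).
    by apply: is_derive_eq (is_deriveZ (- k) (is_derive_id t 1)) _; rewrite /GRing.scale /= mulr1.
  have := is_derive1_comp (is_derive_expR (- k * t)) L; rewrite mulrC; exact.
have := @is_derive1_ge0_le R (fun t => - (expR (- k * t) * phi t))
  (fun t => - (expR (- k * t) * dphi t + phi t * (- k * expR (- k * t)))) 0 b b0.
rewrite !mulr0 expR0 mul1r lerN2 => K.
have {}K : expR (- k * b) * phi b <= phi 0.
  apply: K => t tb; last first.
    rewrite oppr_ge0 (_ : _ + _ = expR (- k * t) * (dphi t - k * phi t)); last by ring.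
    by rewrite pmulr_rle0 ?expR_gt0 // subr_le0 Hle.
  apply: (@is_deriveN _ _ _ (fun t => expR (- k * t) * phi t)).
  by apply: is_derive_eq (is_deriveM (E t) (H t tb)) _; rewrite /GRing.scale.
rewrite -(ler_pM2l (expR_gt0 (- k * b))) mulrA -expRD mulNr addNr expR0 mul1r.
by rewrite mulNr in K.
Qed.

End Gronwall.

(** * Transformation laws under a change of charts *)

Section ChartChange.
Variables (R : realType) (M : riemannian_data R 4).
Hypothesis rM : is_riemannian M.
Implicit Types (i j : chart_index M) (p : M) (psi : M -> R).
Let mM : is_manifold M. Proof. by have [] := rM. Qed.

Definition jac i j p : 'M[R]_4 := jacobian_mx (transition i j) (chart i p).

Lemma metric_posdef i x : cod i x -> posdef (metric i x).
Proof. by have [_ _ H _] := rM; move=> /(H i)[]. Qed.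

Lemma metric_sym i x : cod i x -> (metric i x)^T = metric i x.
Proof. by have [_ _ H _] := rM; move=> /(H i)[]. Qed.

Lemma metric_change i j p : dom i p -> dom j p ->
  metric i (chart i p) = jac i j p *m metric j (chart j p) *m (jac i j p)^T.
Proof.
move=> ip jp; have [_ _ _ H] := rM.
have := H i j (chart i p) (chart_image_chart ip (jp : dom j p)).
by rewrite /= -/(transition i j) transitionE.
Qed.

Lemma jac_unit i j p : dom i p -> dom j p -> jac i j p \in unitmx.
Proof.
move=> ip jp; have := posdef_unit (metric_posdef (cod_chart ip)).
by rewrite (metric_change ip jp) !unitmx_mul => /andP[/andP[]].
Qed.

Lemma smooth_change psi (V : set M) i j : open V ->
  smooth_on (chart_image j V) (psi \o param j) ->
  smooth_on (chart_image i (V `&` dom j)) (psi \o param i).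
Proof.
move=> oV sp k.
have oI : open (chart_image i (V `&` dom j)).
  by apply: (chart_image_open mM); apply: openI => //; exact: dom_open.
apply: (Ck_ext oI (F := (psi \o param j) \o transition i j)).
  by move=> y /chart_imageP[//|cy [Vy jy]]; rewrite /transition /local_expr /= chartK.
apply: (Ck_comp oI (chart_image_open mM j oV) (sp k)) => [l|x].
  have sub : chart_image i (V `&` dom j) `<=` chart_image i (dom j).
    by move=> y [q [iq [Vq jq]] <-]; exists q.
  exact: (Ck_sub sub (@transition_smooth _ _ _ mM i j l k)).
move=> [q [iq [Vq jq]] <-]; rewrite transitionE //; by exists q.
Qed.

Lemma partial_change psi (V : set M) i j p a : open V -> V p -> dom i p -> dom j p ->
  smooth_on (chart_image j V) (psi \o param j) ->
  partial a (psi \o param i) (chart i p) =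
  \sum_k jac i j p a k * partial k (psi \o param j) (chart j p).
Proof.
move=> oV Vp ip jp sp.
have oI : open (chart_image i (V `&` dom j)).
  by apply: (chart_image_open mM); apply: openI => //; exact: dom_open.
have Ip : chart_image i (V `&` dom j) (chart i p) by exists p.
have E y : chart_image i (V `&` dom j) y ->
    ((psi \o param j) \o transition i j) y = (psi \o param i) y.
  by move=> [q [iq [Vq jq]] <-]; rewrite /= transitionE // !chartK.
have sub : chart_image i (V `&` dom j) `<=` chart_image i (dom j).
  by move=> y [q [iq [Vq jq]] <-]; exists q.
have D := @partial_comp R 4 4 _ _ (psi \o param j) (transition i j) (chart i p) a oI
  (chart_image_open mM j oV) (sp 1%N)
  (fun k => Ck_sub sub (@transition_smooth _ _ _ mM i j k 1%N)) Ip.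
rewrite -(partial_eq_on a oI E Ip) /partial.
have Jp : chart_image j V (transition i j (chart i p)) by rewrite transitionE //; exists p.
have [_ ->] := D Jp.
by rewrite transitionE //; apply: eq_bigr => k _; rewrite !mxE.
Qed.

Lemma sym_quadratic_eq (A B : 'M[R]_4) : A^T = A -> B^T = B ->
  (forall v : 'rV[R]_4, (v *m A *m v^T) 0 0 = (v *m B *m v^T) 0 0) -> A = B.
Proof.
move=> As Bs H.
have E (X : 'M[R]_4) a b : ((delta_mx 0 a : 'rV_4) *m X *m (delta_mx 0 b)^T) 0 0 = X a b.
  rewrite -rowE mxE (bigD1 b) //= big1 => [|k kb].
    by rewrite !mxE !eqxx mulr1 addr0.
  by rewrite !mxE (negbTE kb) mulr0.
have D (X : 'M[R]_4) a b : X^T = X ->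
   ((delta_mx 0 a + delta_mx 0 b : 'rV_4) *m X *m (delta_mx 0 a + delta_mx 0 b)^T) 0 0
   = X a a + X b b + 2 * X a b.
  move=> Xs; rewrite linearD /= mulmxDl !mulmxDr mulmxDl !mx_addE !mulmxDl !mx_addE !E.
  rewrite (_ : X b a = X a b); last by rewrite -[in LHS]Xs mxE.
  ring.
apply/matrixP => a b; have := H (delta_mx 0 a + delta_mx 0 b); rewrite !D //.
have := H (delta_mx 0 a); have := H (delta_mx 0 b); rewrite !E => -> ->; lra.
Qed.

Lemma hessian_sym i (O : set 'rV[R]_4) (F : 'rV[R]_4 -> R) x : open O -> O x -> O `<=` cod i ->
  smooth_on O F -> (hessian (metric i) F x)^T = hessian (metric i) F x.
Proof.
move=> oO Ox Oc sF; apply/matrixP => a b; rewrite !mxE (partial_comm oO _ _ (sF 2%N) Ox).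
congr (_ - _); apply: eq_bigr => k _; congr (_ * _); rewrite /christoffel; congr (_ * _).
apply: eq_bigr => l _; congr (_ * _).
have -> : partial l (fun y => metric i y b a) x = partial l (fun y => metric i y a b) x.
  apply: (partial_eq_on _ oO _ Ox) => y Oy.
  by rewrite -[in LHS](metric_sym (Oc _ Oy)) mxE.
by rewrite (addrC (partial b _ x)).
Qed.

Hypothesis complete : geodesically_complete M.

Lemma geodesic_exists i p (v : 'rV[R]_4) : dom i p ->
  exists c : R -> M, [/\ geodesic c, c 0 = p & vel c i 0 = v].
Proof.
move=> ip; have [c [gc c0 cv]] := complete v ip.
by exists c; split=> //; apply/rowP => k; rewrite mxE cv.
Qed.

(* The second derivative of psi along geodesics does not involve charts. *)
Lemma hessian_change psi (V : set M) i j p : open V -> V p -> dom i p -> dom j p ->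
  smooth_on (chart_image i V) (psi \o param i) -> smooth_on (chart_image j V) (psi \o param j) ->
  hessian (metric i) (psi \o param i) (chart i p) =
  jac i j p *m hessian (metric j) (psi \o param j) (chart j p) *m (jac i j p)^T.
Proof.
move=> oV Vp ip jp si sj.
have oI k := chart_image_open mM k oV.
have Ip k : dom k p -> chart_image k V (chart k p) by move=> kp; exists p.
have Ic k : chart_image k V `<=` cod k by move=> y [q [kq _] <-]; exists q.
apply: sym_quadratic_eq.
- exact: hessian_sym (oI i) (Ip i ip) (Ic i) si.
- rewrite !trmx_mul trmxK (hessian_sym (oI j) (Ip j jp) (Ic j) sj).
  by rewrite mulmxA.
move=> v; have [c [gc c0 cv]] := geodesic_exists v ip.
have cc := geodesic_continuous gc.
have H k (kp : dom k p) (sk : smooth_on (chart_image k V) (psi \o param k)) :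
   derive1 (derive1 (psi \o c)) 0 =
   (vel c k 0 *m hessian (metric k) (psi \o param k) (chart k p) *m (vel c k 0)^T) 0 0.
  have kc : dom k (c 0) by rewrite c0.
  have Ik : chart_image k V (chart k (c 0)) by rewrite c0; exact: Ip.
  have := geodesic_hessian_near mM gc kc (oI k) sk Ik; rewrite c0; apply.
  have := curve_near_open cc (dom_open mM k) kc; apply: filterS => s ks.
  by rewrite /= chartK.
have E : vel c j 0 = v *m jac i j p.
  have ic : dom i (c 0) by rewrite c0.
  have jc : dom j (c 0) by rewrite c0.
  have := vel_change mM cc ic jc (geodesic_vel gc ic).
  by move=> /curve_der_vel; rewrite cv c0.
have := H i ip si; rewrite (H j jp sj) E cv => <-.
by rewrite trmx_mul !mulmxA.
Qed.

End ChartChange.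

Lemma congr_inv (R : fieldType) n (A B J : 'M[R]_n) : A \in unitmx -> B \in unitmx -> J \in unitmx ->
  A = J *m B *m J^T -> J^T *m invmx A *m J = invmx B.
Proof.
move=> Au Bu Ju E; set X := _ *m J.
have EX : J *m (B *m X) = J by rewrite /X !mulmxA -E mulmxV // mul1mx.
have BX : B *m X = 1%:M by rewrite -[LHS](mulKmx Ju) EX mulVmx.
by rewrite -[LHS](mulKmx Bu) BX mulmx1.
Qed.

(** The inequality reads (D - 2 u)^2 <= 6 u^2 - 12 s u^2. It gives D >= (2 - sqrt 6) u >= - u, and
    its right side is at most - 6 u^2 once s >= 1. *)
Lemma key_numeric (R : realFieldType) (u D s : R) : 0 <= u ->
  D ^+ 2 <= u * (4 * D + 2 * u - 12 * s * u) -> 0 <= s -> 0 <= D + u /\ (1 <= s -> u = 0).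
Proof.
move=> u0 H s0; have su : 0 <= s * (u * u) by rewrite !mulr_ge0.
have H1 : D ^+ 2 <= 4 * u * D + 2 * u ^+ 2 by nra.
split; first by rewrite leNgt; apply/negP => Du; nra.
move=> s1; have H2 : u * u <= s * (u * u) by rewrite ler_peMl // mulr_ge0.
have H3 : (D - 2 * u) ^+ 2 + 6 * (u * u) <= 0 by nra.
have H4 : 0 <= (D - 2 * u) ^+ 2 by exact: sqr_ge0.
have H5 : u ^+ 2 = 0 by apply/eqP; rewrite eq_le sqr_ge0 andbT expr2; lra.
by apply/eqP; rewrite -sqrf_eq0 H5.
Qed.

Lemma gronwall_zero (R : realType) (phi dphi : R -> R) (k b : R) : 0 <= b -> phi 0 = 0 ->
  (forall t : R, 0 <= t <= b -> is_derive t 1 phi (dphi t)) ->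
  (forall t : R, 0 <= t <= b -> dphi t <= k * phi t) -> phi b <= 0.
Proof. by move=> b0 p0 H1 H2; have := gronwall b0 H1 H2; rewrite p0 mulr0. Qed.

(** * The third symmetric function vanishes and Ric is parallel *)

Section SolitonManifold.
Variables (R : realType) (M : riemannian_data R 4) (f : M -> R).
Hypothesis sol : shrinking_gradient_ricci_soliton f.
Hypothesis scal : constant_scalar_curvature M 1.
Implicit Types (i j : chart_index M) (p : M).

Lemma sol_riemannian : is_riemannian M. Proof. by have [] := sol. Qed.
Let rM := sol_riemannian.
Lemma sol_manifold : is_manifold M. Proof. by have [] := rM. Qed.
Let mM := sol_manifold.
Lemma sol_complete : geodesically_complete M. Proof. by have [] := sol. Qed.
Let cM := sol_complete.

Local Notation G i := (metric i).
Local Notation F i := (f \o param i).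

Lemma sol_chart i : soliton_chart (cod i) (G i) (F i).
Proof.
have [_ _ _ sf se] := sol; have [_ sG Gp _] := rM; split=> //.
- exact: cod_open.
- by move=> x cx; have [] := Gp i x cx.
- by move=> x cx; have [] := Gp i x cx.
- by move=> x cx; exact: se.
- by move=> x cx; exact: scal.
Qed.

Lemma pot_smooth i : smooth_on (chart_image i setT) (F i).
Proof.
have [_ _ _ sf _] := sol; move=> k; apply: Ck_sub (sf i k).
by move=> x [p [ip _] <-]; exact: cod_chart.
Qed.

Lemma grad_change i j p : dom i p -> dom j p ->
  grad_of (G i) (F i) (chart i p) *m jac i j p = grad_of (G j) (F j) (chart j p).
Proof.
move=> ip jp; have Ju := jac_unit rM ip jp.
have Gu k (kp : dom k p) : G k (chart k p) \in unitmx := sc_unit (sol_chart k) (cod_chart kp).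
rewrite /grad_of.
have -> : \row_a partial a (F i) (chart i p) = (\row_a partial a (F j) (chart j p)) *m (jac i j p)^T.
  apply/rowP => a; rewrite !mxE (partial_change rM a openT I ip jp (pot_smooth j)).
  by apply: eq_bigr => k _; rewrite !mxE mulrC.
by rewrite -!mulmxA (mulmxA (jac i j p)^T) (congr_inv (Gu i ip) (Gu j jp) Ju (metric_change rM ip jp)).
Qed.

Lemma sol_unit i p : dom i p -> G i (chart i p) \in unitmx.
Proof. by move=> ip; exact: (sc_unit (sol_chart i) (cod_chart ip)). Qed.

(** The soliton equation expresses Ric through the metric and a Hessian, whose transformation laws
    are known; the curvature itself is never transformed. *)
Lemma ric_change i j p : dom i p -> dom j p ->
  ricci (G i) (chart i p) = jac i j p *m ricci (G j) (chart j p) *m (jac i j p)^T.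
Proof.
move=> ip jp.
have E k (kp : dom k p) : ricci (G k) (chart k p) =
    2^-1 *: G k (chart k p) - hessian (G k) (F k) (chart k p).
  by rewrite -(sc_soliton (sol_chart k) (cod_chart kp)) addrK.
rewrite !E // (hessian_change rM cM openT I ip jp (pot_smooth i) (pot_smooth j)).
by rewrite (metric_change rM ip jp) mulmxBr mulmxBl -scalemxAr -scalemxAl.
Qed.

Lemma ric_endo_change i j p : dom i p -> dom j p ->
  ric_endo (G i) (chart i p) *m jac i j p = jac i j p *m ric_endo (G j) (chart j p).
Proof.
move=> ip jp; rewrite /ric_endo (ric_change ip jp) -!mulmxA; congr (_ *m (_ *m _)).
by rewrite mulmxA (congr_inv (sol_unit ip) (sol_unit jp) (jac_unit rM ip jp) (metric_change rM ip jp)).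
Qed.

Lemma e3_change i j p : dom i p -> dom j p ->
  e3_of (G i) (chart i p) = e3_of (G j) (chart j p).
Proof.
move=> ip jp; have Ju := jac_unit rM ip jp; have E := ric_endo_change ip jp.
rewrite /e3_of; congr ((_ - _) / _).
set S := ric_endo (G i) _ in E *; set S' := ric_endo (G j) _ in E *; set J := jac i j p in Ju E.
have ES : S = J *m S' *m invmx J by rewrite -E mulmxK.
rewrite ES !mulmxA -(mulmxA _ (invmx J) J) mulVmx // mulmx1.
rewrite -(mulmxA _ (invmx J) J) mulVmx // mulmx1.
by rewrite mxtrace_mulC !mulmxA mulVmx // mul1mx.
Qed.

Lemma grad_sqr_change i j p : dom i p -> dom j p ->
  grad_sqr (G i) (F i) (chart i p) = grad_sqr (G j) (F j) (chart j p).
Proof.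
move=> ip jp; rewrite /grad_sqr (metric_change rM ip jp) -(grad_change ip jp).
by move: (grad_of _ _ _) => N; rewrite trmx_mul !mulmxA.
Qed.

Definition chart_at p : chart_index M := projT1 (cid (chart_cover mM p)).
Lemma chart_atP p : dom (chart_at p) p.
Proof. exact: projT2 (cid (chart_cover mM p)). Qed.

Section AlongGeodesic.
Variable c : R -> M.
Hypothesis gc : geodesic c.
Let cc := geodesic_continuous gc.
Local Notation x i t := (chart i (c t)).
Local Notation v i t := (vel c i t).
Local Notation S i t := (ric_endo (G i) (x i t)).
Local Notation N i t := (grad_of (G i) (F i) (x i t)).

(** For q independent of the chart, this turns its local expressions into one function of time,
    although the chosen chart may jump with t. *)
Definition glue (q : chart_index M -> R -> R) t := q (chart_at (c t)) t.

Lemma glue_derive q i (t D : R) :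
  (forall i j t, dom i (c t) -> dom j (c t) -> q i t = q j t) ->
  dom i (c t) -> is_derive t 1 (q i) D -> is_derive t 1 (glue q) D.
Proof.
move=> qE it; apply: near_eq_is_derive.
have := curve_near_open cc (dom_open mM i) it; apply: filterS => s ids.
by rewrite /glue (qE _ _ _ ids (chart_atP (c s))).
Qed.

Lemma glueE q i t : (forall i j t, dom i (c t) -> dom j (c t) -> q i t = q j t) ->
  dom i (c t) -> glue q t = q i t.
Proof. by move=> qE it; apply: qE => //; exact: chart_atP. Qed.

Section InChart.
Variables (i : chart_index M) (t : R).
Hypothesis it : dom i (c t).
Let ct := cod_chart it.
Let Ga := conn_along (G i) (x i t) (v i t).

Lemma metric_curve : curve_der (fun s => G i (x i s)) t (Ga *m G i (x i t) + G i (x i t) *m Ga^T).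
Proof.
rewrite -(metric_along (sol_chart i) _ ct).
exact: (curve_der_pdm (cod_open mM i) (sc_smooth_metric (sol_chart i)) ct (geodesic_vel gc it)).
Qed.

Lemma grad_curve : curve_der (fun s => N i s) t (v i t *m (2^-1%:M - S i t) - N i t *m Ga).
Proof.
rewrite -(grad_along (sol_chart i) _ ct).
exact: (curve_der_pdm (cod_open mM i) (sc_smooth_grad (sol_chart i)) ct (geodesic_vel gc it)).
Qed.

Lemma ric_curve : curve_der (fun s => S i s) t
  (\sum_a v i t 0 a *: Dric_of (G i) a (x i t) - S i t *m Ga + Ga *m S i t).
Proof.
rewrite -ric_along.
exact: (curve_der_pdm (cod_open mM i) (sc_smooth_ric_endo (sol_chart i)) ct (geodesic_vel gc it)).
Qed.

(** [DX] is the covariant derivative of X along the curve; the connection terms cancel against the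
    derivative of the metric. *)
Lemma sqr_curve (X : R -> 'rV[R]_4) (DX : 'rV[R]_4) : curve_der X t (DX - X t *m Ga) ->
  is_derive t 1 (fun s => (X s *m G i (x i s) *m (X s)^T) 0 0)
    (2 * (DX *m G i (x i t) *m (X t)^T) 0 0).
Proof.
move=> HX; have H := curve_derM (curve_derM HX metric_curve) (curve_der_tr HX).
apply: is_derive_eq (H 0 0) _.
set g := G i _; set y := X t.
have gs : g^T = g by exact: (sc_sym (sol_chart i) ct).
have E : y *m g *m DX^T = (DX *m g *m y^T)^T by rewrite !trmx_mul trmxK gs mulmxA.
have E2 : y *m g *m (y *m Ga)^T = y *m (g *m Ga^T) *m y^T.
  by rewrite trmx_mul !mulmxA.
have -> : ((DX - y *m Ga) *m g + y *m (Ga *m g + g *m Ga^T)) *m y^T + y *m g *m (DX - y *m Ga)^T =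
    DX *m g *m y^T + (DX *m g *m y^T)^T.
  rewrite linearB /= mulmxBr E2 E mulmxBl mulmxDr !mulmxDl mulNmx !mulmxA.
  move: (DX *m g *m y^T) (y *m Ga *m g *m y^T) (y *m g *m Ga^T *m y^T) => p q r.
  by apply/matrixP => a b; rewrite !mxE; ring.
by rewrite mx_addE mx_trE; ring.
Qed.

Lemma e3_curve : is_derive t 1 (fun s => e3_of (G i) (x i s))
  (\tr (S i t *m S i t *m \sum_a v i t 0 a *: Dric_of (G i) a (x i t))).
Proof.
have H := curve_der_trace (curve_derM (curve_derM ric_curve ric_curve) ric_curve).
have -> : (fun s => e3_of (G i) (x i s)) =
    (fun s => 3^-1 * (\tr (S i s *m S i s *m S i s) - 4^-1)).
  by apply/funext => s; rewrite /e3_of mulrC.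
have HB := is_deriveZ (3^-1 : R) (is_deriveB H (is_derive_cst (4^-1 : R) t 1)).
apply: is_derive_eq HB _; rewrite subr0.
set s := S i t; set T := \sum_a _; set g := Ga.
have -> : ((T - s *m g + g *m s) *m s + s *m (T - s *m g + g *m s)) *m s + s *m s *m (T - s *m g + g *m s)
  = T *m s *m s + s *m T *m s + s *m s *m T + (g *m (s *m s *m s) - (s *m s *m s) *m g).
  rewrite !(mulmxDl, mulmxDr, mulmxN, mulNmx) !mulmxA.
  move: (T *m s *m s) (s *m T *m s) (s *m s *m T) (s *m g *m s *m s) (g *m s *m s *m s)
    (s *m s *m g *m s) (s *m s *m s *m g) => p1 p2 p3 p4 p5 p6 p7.
  by apply/matrixP => a b; rewrite !mxE; ring.
rewrite mxtraceD linearB /= (mxtrace_mulC g) subrr addr0 !mxtraceD.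
clearbody s T; have -> : \tr (T *m s *m s) = \tr (s *m s *m T) by rewrite -mulmxA mxtrace_mulC.
have -> : \tr (s *m T *m s) = \tr (s *m s *m T) by rewrite mxtrace_mulC mulmxA.
by rewrite /GRing.scale /=; field.
Qed.

End InChart.

Variable t0 : R.
Hypothesis t00 : 0 < t0.
Hypothesis init : forall i, dom i (c 0) -> N i 0 = (t0 / 2) *: v i 0.
Hypothesis init_s : forall i, dom i (c 0) -> grad_sqr (G i) (F i) (x i 0) = t0 ^+ 2 / 4.

Let tau t := t + t0.
Let X i t : 'rV[R]_4 := N i t - (tau t / 2) *: v i t.
Let phi i t := (X i t *m G i (x i t) *m (X i t)^T) 0 0.
Let dphi i t := 4 / tau t * (X i t *m S i t *m G i (x i t) *m (X i t)^T) 0 0.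

Let tau_gt0 t : 0 <= t -> 0 < tau t. Proof. by move=> t1; rewrite /tau ltr_wpDl. Qed.

Let NS i t : dom i (c t) -> N i t *m S i t = 0.
Proof. by move=> it; exact: (sc_grad_ric (sol_chart i) (cod_chart it)). Qed.

Lemma phi_derive i t : dom i (c t) -> 0 <= t -> is_derive t 1 (phi i) (dphi i t).
Proof.
move=> it t1; have tp := tau_gt0 t1.
have dtau : is_derive t 1 (fun s => tau s / 2) 2^-1.
  have H := is_deriveZ (2^-1 : R) (is_deriveD (is_derive_id t 1) (is_derive_cst t0 t 1)).
  have -> : (fun s => tau s / 2) = 2^-1 *: (id + cst t0).
    by apply/funext => s; rewrite /tau mulrC.
  by apply: is_derive_eq H _; rewrite addr0 /GRing.scale /= mulr1.
have HX : curve_der (X i) t (- (v i t *m S i t) - X i t *m conn_along (G i) (x i t) (v i t)).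
  have H := curve_derD (grad_curve it) (curve_derN (curve_derZ dtau (geodesic_acc gc it))).
  apply: curve_der_eq H _; rewrite /X mulmxBr mulmxBl mul_mx_scalar -scalemxAl scalerN.
  move: (_ *: v i t) (v i t *m S i t) (N i t *m _) (_ *: (_ *m _)) => p q r s.
  by apply/matrixP => a b; rewrite !mxE; ring.
apply: is_derive_eq (sqr_curve it HX) _; rewrite /dphi.
have vE : v i t = (2 / tau t) *: (N i t - X i t).
  by rewrite /X opprB addrC subrK scalerA mulrA divfK ?divff ?scale1r ?gt_eqF.
rewrite {1}vE -scalemxAl mulmxBl NS // sub0r scalerN opprK -!scalemxAl mxE mulrA; congr (_ * _).
by field; rewrite gt_eqF.
Qed.

Lemma phi_change i j t : dom i (c t) -> dom j (c t) -> phi i t = phi j t.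
Proof.
move=> it jt; have V : v j t = v i t *m jac i j (c t).
  exact: (curve_der_vel (vel_change mM cc it jt (geodesic_vel gc it))).
have XE : X j t = X i t *m jac i j (c t).
  by rewrite /X mulmxBl (grad_change it jt) -scalemxAl V.
by rewrite /phi XE (metric_change rM it jt) trmx_mul !mulmxA.
Qed.

Lemma phi_ge0 i t : dom i (c t) -> 0 <= phi i t.
Proof.
move=> it; rewrite /phi; have [->|X0] := eqVneq (X i t) 0; first by rewrite !mul0mx mxE.
exact: (ltW (sc_pos (sol_chart i) (cod_chart it) X0)).
Qed.

(** X = N - (tau / 2) v measures the failure of c to be a gradient line. As N is in the kernel of
    Ric, its covariant derivative is (2 / tau) S X, so |X|^2 satisfies a linear differential
    inequality with initial value 0, by the bound of Ric by the metric. *)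
Lemma radial_velocity i t : dom i (c t) -> 0 <= t -> N i t = (tau t / 2) *: v i t.
Proof.
move=> it t1.
have p0 : glue phi 0 = 0.
  have X0 : X (chart_at (c 0)) 0 = 0.
    rewrite /X (init (chart_atP (c 0))); have -> : tau 0 = t0 by exact: add0r.
    by rewrite subrr.
  by rewrite /glue /phi X0 !mul0mx mxE.
have : glue phi t <= 0.
  apply: (@gronwall_zero R (glue phi) (glue dphi) (4 / t0) t t1 p0) => s /andP[s0 _].
- apply: glue_derive (chart_atP (c s)) _; first exact: phi_change.
  by apply: phi_derive => //; exact: chart_atP.
- rewrite /glue /dphi; set k := chart_at (c s).
  have kc : dom k (c s) := chart_atP (c s).
  apply: (@le_trans _ _ (4 / tau s * phi k s)).
    rewrite ler_pM2l ?divr_gt0 ?tau_gt0 //.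
    exact: (sc_ric_bound (sol_chart k) _ (cod_chart kc)).
  rewrite ler_wpM2r ?phi_ge0 // ler_pM2l // lef_pV2 ?posrE ?tau_gt0 //.
  by rewrite /tau lerDr.
rewrite (glueE phi_change it) => pt.
have : phi i t = 0 by apply/eqP; rewrite eq_le pt phi_ge0.
have [/eqP|X0] := eqVneq (X i t) 0; first by rewrite subr_eq0 => /eqP.
by have := sc_pos (sol_chart i) (cod_chart it) X0; rewrite -/(phi i t) => /[swap] ->; rewrite ltxx.
Qed.

Let s_ i t := grad_sqr (G i) (F i) (x i t).

Lemma s_change i j t : dom i (c t) -> dom j (c t) -> s_ i t = s_ j t.
Proof. exact: grad_sqr_change. Qed.

Lemma s_derive i t : dom i (c t) -> 0 <= t -> is_derive t 1 (s_ i) (2 / tau t * s_ i t).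
Proof.
move=> it t1; have tp := tau_gt0 t1; apply: is_derive_eq (sqr_curve it (grad_curve it)) _.
have vE : v i t = (2 / tau t) *: N i t.
  by rewrite radial_velocity // scalerA mulrA divfK ?divff ?scale1r ?gt_eqF.
rewrite {1}vE mulmxBr -!scalemxAl NS // scaler0 subr0 mul_mx_scalar !scalerA -!scalemxAl mxE /s_ /grad_sqr.
by rewrite mulrA; congr (_ * _); field; rewrite gt_eqF.
Qed.

(** Both sides solve s' = (2 / tau) s with the same initial value; Gronwall is applied to the square
    of their difference. *)
Lemma radial_sqr i t : dom i (c t) -> 0 <= t -> s_ i t = tau t ^+ 2 / 4.
Proof.
move=> it t1; pose w j t := (4 * s_ j t - tau t ^+ 2) ^+ 2.
have wE j k s : dom j (c s) -> dom k (c s) -> w j s = w k s by move=> js ks; rewrite /w (s_change js ks).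
have dtau (s : R) : is_derive s 1 tau 1.
  by apply: is_derive_eq (is_deriveD (is_derive_id s 1) (is_derive_cst t0 s 1)) _; rewrite addr0.
have dw j s : dom j (c s) -> 0 <= s -> is_derive s 1 (w j) (4 / tau s * w j s).
  move=> js s0; have tp := tau_gt0 s0.
  have H := is_deriveB (is_deriveZ (4 : R) (s_derive js s0)) (is_deriveX 2 (dtau s)).
  apply: is_derive_eq (is_deriveX 2 H) _.
  have -> : (4 \*: s_ j - tau ^+ 2) s = 4 * s_ j s - tau s ^+ 2 by [].
  rewrite /w; move: (s_ j s) (tau s) tp => a b b0.
  by rewrite /GRing.scale /= !expr1; field; rewrite gt_eqF.
have p0 : glue w 0 = 0.
  rewrite /glue /w /s_ (init_s (chart_atP (c 0))); have -> : tau 0 = t0 by exact: add0r.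
  by field.
have H1 (s : R) : 0 <= s <= t -> is_derive s 1 (glue w) (4 / tau s * glue w s).
  move=> /andP[s0 _]; by apply: (glue_derive wE (chart_atP (c s))); exact: (dw _ _ (chart_atP (c s)) s0).
have H2 (s : R) : 0 <= s <= t -> 4 / tau s * glue w s <= 4 / t0 * glue w s.
  move=> /andP[s0 _]; apply: ler_wpM2r; first by rewrite /glue /w; exact: sqr_ge0.
  by rewrite ler_pM2l // lef_pV2 ?posrE ?tau_gt0 // lerDr.
have := gronwall_zero t1 p0 H1 H2.
rewrite (glueE wE it) => wt.
have : w i t = 0 by apply/eqP; rewrite eq_le wt sqr_ge0.
by move/eqP; rewrite sqrf_eq0 subr_eq0 => /eqP <-; field.
Qed.

(** Along c the function u = e3 has derivative (2 / tau) D, so tau^2 u has derivative 2 tau (D + u)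
    >= 0. At tau = 2 the gradient has norm 1 and u = 0; being nonnegative, u then vanishes at the
    start too. *)
Lemma e3_zero_along i : dom i (c 0) -> e3_of (G i) (x i 0) = 0.
Proof.
move=> i0; pose e j t := e3_of (G j) (x j t).
have eE j k t : dom j (c t) -> dom k (c t) -> e j t = e k t by exact: e3_change.
have key j t : dom j (c t) -> 0 <= t -> [/\ 0 <= e j t,
    0 <= e3_der (G j) (F j) (x j t) + e j t & 1 <= tau t ^+ 2 / 4 -> e j t = 0].
  move=> jt t1; have sE := radial_sqr jt t1.
  have s0 : 0 < tau t ^+ 2 / 4 by rewrite divr_gt0 // exprn_gt0 ?tau_gt0.
  have [] := sc_key (sol_chart j) (cod_chart jt); rewrite -/(s_ j t) sE // => K1 K2 _.
  by have [H1 H2] := key_numeric K1 K2 (ltW s0); split.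
have de j t : dom j (c t) -> 0 <= t ->
    is_derive t 1 (e j) (2 / tau t * e3_der (G j) (F j) (x j t)).
  move=> jt t1; apply: is_derive_eq (e3_curve jt) _.
  have vE : v j t = (2 / tau t) *: N j t.
    by rewrite radial_velocity // scalerA mulrA divfK ?divff ?scale1r ?gt_eqF ?tau_gt0.
  rewrite /e3_der -mxtraceZ scalemxAr; congr (\tr (_ *m _)); rewrite scaler_sumr.
  by apply: eq_bigr => a _; rewrite {1}vE mxE scalerA.
have [t02|t02] := leP 2 t0.
  have [_ _] := key i 0 i0 (lexx 0); apply; have -> : tau 0 = t0 by exact: add0r.
  by rewrite ler_pdivlMr // mul1r (_ : 4 = 2 ^+ 2) ?lerXn2r ?nnegrE //; lra.
pose b := 2 - t0; have b0 : 0 <= b by rewrite /b; lra.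
pose w j t := tau t ^+ 2 * e j t.
have wE j k t : dom j (c t) -> dom k (c t) -> w j t = w k t by move=> jt kt; rewrite /w (eE _ _ _ jt kt).
have dtau (s : R) : is_derive s 1 tau 1.
  by apply: is_derive_eq (is_deriveD (is_derive_id s 1) (is_derive_cst t0 s 1)) _; rewrite addr0.
have := @is_derive1_ge0_le R (glue w) (glue (fun j t => 2 * tau t * (e3_der (G j) (F j) (x j t) + e j t))) 0 b b0.
move=> Hg; have {Hg} : glue w 0 <= glue w b.
  refine (Hg _ _) => s /andP[s0 _].
- apply: glue_derive (chart_atP (c s)) _; first exact: wE.
  have tp := tau_gt0 s0.
  apply: is_derive_eq (is_deriveM (is_deriveX 2 (dtau s)) (de _ _ (chart_atP (c s)) s0)) _.
  have -> : (tau ^+ 2) s = tau s ^+ 2 by [].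
  rewrite /glue; move: (e _ s) (tau s) tp (e3_der _ _ _) => p q q0 d.
  by rewrite /GRing.scale /= expr1; field; rewrite gt_eqF.
- rewrite /glue mulr_ge0 //; first by rewrite mulr_ge0 // ltW // tau_gt0.
  by have [_ ] := key _ _ (chart_atP (c s)) s0.
rewrite (glueE wE i0) (glueE wE (chart_atP (c b))) {2}/w.
have [_ _ ->] := key _ _ (chart_atP (c b)) b0; last by rewrite /tau /b subrK; lra.
have t0E : tau 0 = t0 by exact: add0r.
rewrite mulr0 /w t0E => H.
have [e0 _ _] := key i 0 i0 (lexx 0).
apply/eqP; rewrite eq_le e0 andbT.
by rewrite -(pmulr_rle0 _ (exprn_gt0 2 t00)).
Qed.

End AlongGeodesic.

Lemma e3_zero i p : dom i p -> 0 < grad_sqr (G i) (F i) (chart i p) ->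
  e3_of (G i) (chart i p) = 0.
Proof.
move=> ip; set s := grad_sqr _ _ _ => s0.
pose r := Num.sqrt s; have r0 : 0 < r by rewrite sqrtr_gt0.
have [c [gc c0 cv]] := geodesic_exists cM (r^-1 *: grad_of (G i) (F i) (chart i p)) ip.
have ic : dom i (c 0) by rewrite c0.
(* With the unit initial velocity N / r, the value t0 = 2 r gives N = (t0 / 2) v and |N|^2 = t0^2 /
   4 at time 0. *)
have t00 : 0 < 2 * r by rewrite mulr_gt0.
have := @e3_zero_along c gc (2 * r) t00 _ _ i ic; rewrite c0; apply=> j jc.
  have -> : vel c j 0 = vel c i 0 *m jac i j p.
    have jc0 : dom j (c 0) by rewrite c0.
    have := curve_der_vel (vel_change mM (geodesic_continuous gc) ic jc0 (geodesic_vel gc ic)).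
    by rewrite /jac c0.
  rewrite cv -scalemxAl (grad_change ip jc) scalerA.
  by rewrite (_ : _ * _ = 1) ?scale1r //; field; rewrite gt_eqF.
by rewrite -(grad_sqr_change ip jc) -/s exprMn sqr_sqrtr ?ltW //; field.
Qed.

(* The gradient cannot vanish on an open set, since then the Hessian of the potential would. *)
Lemma grad_dense i x (P : 'rV[R]_4 -> Prop) : cod i x ->
  (forall y, cod i y -> 0 < grad_sqr (G i) (F i) y -> P y) ->
  forall e, 0 < e -> exists y, [/\ `|y - x| < e, cod i y & P y].
Proof.
move=> cx HP e e0; apply: contrapT => nE.
have [r r0 Hr] := open_rV_ball (cod_open mM i) cx.
pose O := [set y | `|y - x| < Num.min e r].
have oO : open O by exact: rV_ball_open.
have Ox : O x by rewrite /O /= subrr normr0 lt_min e0.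
have Oc y : O y -> cod i y by rewrite /O /= lt_min => /andP[_ yr]; exact: Hr.
have N0 y : O y -> grad_of (G i) (F i) y = 0.
  move=> Oy; have cy := Oc y Oy; apply/eqP/negPn/negP => N1; apply: nE; exists y; split=> //.
    by move: Oy; rewrite /O /= lt_min => /andP[].
  by apply: HP => //; exact: (sc_pos (sol_chart i) cy N1).
have H a : row a (2^-1%:M - ric_endo (G i) x) = 0.
  have := sc_grad_der (sol_chart i) a cx; rewrite N0 // mul0mx subr0 => <-.
  apply/rowP => k; rewrite !mxE (@partial_eq_on _ _ O _ (cst 0) _ _ oO) //.
    by rewrite /partial derive_cst.
  by move=> y Oy; rewrite N0 // mxE.
have E : 2^-1%:M - ric_endo (G i) x = 0.
  by apply/row_matrixP => a; rewrite H row0.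
(* The trace of 1/2 - S is 2 - 1, not 0. *)
have := congr1 (@mxtrace _ _) E; rewrite linearB /= mxtrace_scalar (sc_trace (sol_chart i) cx).
by rewrite mxtrace0 => /eqP; rewrite -mulr_natr; apply/negP; rewrite subr_eq0; apply/eqP; lra.
Qed.

Lemma zero_of_dense i x (g : 'rV[R]_4 -> R) : cod i x -> {for x, continuous g} ->
  (forall y, cod i y -> 0 < grad_sqr (G i) (F i) y -> g y = 0) -> g x = 0.
Proof.
move=> cx cg H; apply/eqP; rewrite -normr_le0; apply/ler_addgt0Pr => e e0; rewrite add0r.
have /cvgrPdist_le/(_ e e0)/nbhs_rV_ball[d d0 Hd] := cg.
have [y [yx _ gy]] := grad_dense cx H d0.
by have := Hd y yx; rewrite gy subr0.
Qed.

Lemma noncritical_ricci i x : cod i x -> 0 < grad_sqr (G i) (F i) x ->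
  (forall a, Dric_of (G i) a x = 0) /\
  ric_endo (G i) x *m ric_endo (G i) x = 2^-1 *: ric_endo (G i) x.
Proof.
move=> cx s0; have [_ _] := sc_key (sol_chart i) cx s0; apply.
by have [ix Ex] := cod_param mM cx; have := e3_zero ix; rewrite Ex; exact.
Qed.

Lemma parallel_ricci i x a : cod i x -> Dric_of (G i) a x = 0.
Proof.
move=> cx.
apply/matrixP => k l; rewrite mx_0E.
apply: (@zero_of_dense i x (fun y => Dric_of (G i) a y k l) cx) => [|y cy s0]; last first.
  by have [-> _] := noncritical_ricci cy s0; rewrite mxE.
have sS := sc_smooth_ric_endo (sol_chart i); have sC := sc_smooth_conn (sol_chart i) a.
have -> : (fun y => Dric_of (G i) a y k l) =
    partial a (fun y => ric_endo (G i) y k l)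
    + \sum_m ((fun y => ric_endo (G i) y k m) * (fun y => conn_of (G i) a y m l))
    - \sum_m ((fun y => conn_of (G i) a y k m) * (fun y => ric_endo (G i) y m l)).
  apply/funext => y; rewrite /Dric_of !mxE !fctE; congr (_ + _ - _).
    by rewrite fct_sumE; apply: eq_bigr => m _.
  by rewrite fct_sumE; apply: eq_bigr => m _.
have C0 (K : 'rV[R]_4 -> R) : smooth_on (cod i) K -> {for x, continuous K}.
  by move=> sK; have [cK _] := sK 0%N; exact: cK.
apply: continuousB; [apply: continuousD|].
- by have [_ /(_ a)[_ [cK _]]] := sS k l 1%N; exact: cK.
- by elim/big_ind: _ => [|u w|m _]; [exact: cst_continuous|exact: continuousD|
    apply: continuousM; apply: C0].
- by elim/big_ind: _ => [|u w|m _]; [exact: cst_continuous|exact: continuousD|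
    apply: continuousM; apply: C0].
Qed.

Lemma ricci_idempotent i x : cod i x ->
  ric_endo (G i) x *m ric_endo (G i) x = 2^-1 *: ric_endo (G i) x.
Proof.
move=> cx.
have sS := sc_smooth_ric_endo (sol_chart i).
apply/matrixP => k l; rewrite [RHS]mxE; apply/eqP; rewrite -subr_eq0; apply/eqP.
apply: (@zero_of_dense i x (fun y => (ric_endo (G i) y *m ric_endo (G i) y) k l
   - 2^-1 * ric_endo (G i) y k l) cx) => [|y cy s0]; last first.
  by have [_ ->] := noncritical_ricci cy s0; rewrite [X in X - _]mxE subrr.
have -> : (fun y => (ric_endo (G i) y *m ric_endo (G i) y) k l - 2^-1 * ric_endo (G i) y k l) =
   \sum_m ((fun y => ric_endo (G i) y k m) * (fun y => ric_endo (G i) y m l))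
   - (cst 2^-1) * (fun y => ric_endo (G i) y k l).
  apply/funext => y; rewrite [X in X - _]mxE !fctE; congr (_ - _).
  by rewrite fct_sumE; apply: eq_bigr => m _.
have C0 (K : 'rV[R]_4 -> R) : smooth_on (cod i) K -> {for x, continuous K}.
  by move=> sK; have [cK _] := sK 0%N; exact: cK.
apply: continuousB.
- by elim/big_ind: _ => [|u w|m _]; [exact: cst_continuous|exact: continuousD|
    apply: continuousM; apply: C0].
- by apply: continuousM; [exact: cst_continuous|apply: C0].
Qed.

End SolitonManifold.

(** * Linear ordinary differential equations *)

Section LinearODE.
Variable R : realType.

Lemma primitive (g : R -> R) (b : R) : continuous g ->
  exists P : R -> R, P 0 = 0 /\ forall t : R, - b < t < b -> is_derive t 1 P (g t).
Proof.
move=> cg; pose F x := (\int[@lebesgue_measure R]_(t in [set` `[- b, x]]) g t)%R.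
have [b0|b0] := ltP 0 b; last first.
  exists (cst 0); split=> // t /andP[t1 t2]; exfalso.
  by have := lt_trans t1 t2; apply/negP; rewrite -leNgt; lra.
have FD (t : R) : - b < t < b -> is_derive t 1 F (g t).
  move=> /andP[t1 t2].
  have gi : (@lebesgue_measure R).-integrable `[- b, b] (EFin \o g).
    apply: continuous_compact_integrable; first exact: segment_compact.
    by apply: continuous_subspaceT => x; exact: cg.
  have [dF EF] := continuous_FTC1_closed t2 gi t1 (cg t).
  by apply: DeriveDef => //; rewrite -derive1E.
exists (fun t => F t - F 0); split=> [|t tb]; first exact: subrr.
by apply: is_derive_eq (is_deriveB (FD t tb) (is_derive_cst (F 0) t 1)) _; rewrite subr0.
Qed.

(** The retraction of the line onto [-1, 2]. It makes coefficients and iterates global and bounded,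
    while leaving a neighbourhood of [0, 1] untouched. *)
Definition clamp (t : R) : R := (`|t + 1| - `|t - 2| + 1) / 2.

Lemma clamp_id t : -1 <= t <= 2 -> clamp t = t.
Proof.
move=> /andP[t1 t2]; rewrite /clamp ger0_norm ?ler0_norm; [by field|lra|lra].
Qed.

Lemma clamp_bound t : -1 <= clamp t <= 2.
Proof.
rewrite /clamp; have [t1|t1] := leP 0 (t + 1); have [t2|t2] := leP 0 (t - 2).
all: rewrite ?(ger0_norm t1) ?(ltr0_norm t1) ?(ger0_norm t2) ?(ltr0_norm t2).
all: by apply/andP; split; lra.
Qed.

Lemma clamp_continuous : continuous clamp.
Proof.
have nc (a : R) : continuous (fun t : R => `|t + a|).
  move=> t; apply: (@continuous_comp _ _ _ (fun t : R => t + a) Num.norm); last exact: norm_continuous.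
  by apply: (@continuousD _ _ _ id (cst a)); [exact: cvg_id|exact: cst_continuous].
have -> : clamp = ((fun t : R => `|t + 1|) - (fun t : R => `|t - 2|) + cst 1) * cst 2^-1 by [].
move=> t; apply: continuousM; last exact: cst_continuous.
by apply: continuousD; [apply: continuousB; exact: nc|exact: cst_continuous].
Qed.

(** The intervals with centre s k and radius 2 D / 2^k are nested; the limit is the supremum of
    their left ends, hence lies in all of them. *)
Lemma geometric_limit (s : nat -> R) D : (forall k, `|s k.+1 - s k| <= D / 2 ^+ k) ->
  exists l, forall k, `|l - s k| <= 2 * D / 2 ^+ k.
Proof.
move=> H; pose e k : R := 2 * D / 2 ^+ k.
have eS k : e k = 2 * (D / 2 ^+ k) by rewrite /e mulrA.
have eS2 k : e k.+1 = D / 2 ^+ k by rewrite /e exprS; field; rewrite expf_neq0.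
have d0 k : 0 <= D / 2 ^+ k by exact: le_trans (normr_ge0 _) (H k).
have lo k j : s k - e k <= s (k + j)%N - e (k + j)%N.
  elim: j => [|j IH]; rewrite ?addn0 // addnS; apply: (le_trans IH).
  by have := H (k + j)%N; rewrite ler_norml => /andP[h1 h2]; rewrite (eS2 (k + j)%N) (eS (k + j)%N); lra.
have hi k j : s (k + j)%N + e (k + j)%N <= s k + e k.
  elim: j => [|j IH]; rewrite ?addn0 // addnS; apply: le_trans IH.
  by have := H (k + j)%N; rewrite ler_norml => /andP[h1 h2]; rewrite (eS2 (k + j)%N) (eS (k + j)%N); lra.
have e0 k : 0 <= e k by rewrite eS mulr_ge0.
have lh k j : s k - e k <= s j + e j.
  have h1 := lo k j; have h2 := hi j k; rewrite addnC in h2.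
  by apply: (le_trans h1); apply: le_trans h2; have := e0 (k + j)%N; lra.
pose E := [set x | exists k, x = s k - e k].
have Eb j : ubound E (s j + e j) by move=> x [k ->]; exact: lh.
have E0 : E !=set0 by exists (s 0%N - e 0%N); exists 0%N.
exists (sup E) => k; rewrite ler_norml; apply/andP; split.
  have : s k - e k <= sup E by apply: ub_le_sup; [exists (s 0%N + e 0%N); exact: Eb|exists k].
  by rewrite /e; lra.
by have : sup E <= s k + e k := ge_sup E0 (@Eb k); rewrite /e; lra.
Qed.

Lemma geometric_small (D e : R) : 0 < e -> exists k, D / 2 ^+ k <= e.
Proof.
move=> e0; have [k /ltW Hk] : exists k : nat, `|D| / e < k%:R.
  by exists (Num.bound (`|D| / e)); have := archi_boundP (divr_ge0 (normr_ge0 D) (ltW e0)).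
exists k; rewrite ler_pdivrMr ?exprn_gt0 //.
rewrite ler_pdivrMr // in Hk; apply: (le_trans (ler_norm D)); apply: (le_trans Hk).
by rewrite mulrC; apply: ler_wpM2l; [exact: ltW|rewrite -natrX ler_nat ltnW // ltn_expl].
Qed.

Lemma eq_of_geometric (x y D : R) : (forall k, `|x - y| <= D / 2 ^+ k) -> x = y.
Proof.
move=> H; apply/eqP; rewrite -subr_eq0 -normr_le0; apply/ler_addgt0Pr => e e0; rewrite add0r.
by have [k Hk] := geometric_small D e0; exact: le_trans (H k) Hk.
Qed.

Section Picard.
Variables (m : nat) (A : R -> 'M[R]_m) (K : R) (u0 : 'rV[R]_m).
Hypothesis cA : forall i j, continuous (fun t => A t i j).
Hypothesis bA : forall t i j, `|A t i j| <= K.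
Hypothesis mK : m%:R * K <= 4^-1.

Let cont (V : R -> 'rV[R]_m) := forall j, continuous (fun t => V t 0 j).

Lemma rate_continuous V j : cont V -> continuous (fun t => (V t *m A t) 0 j).
Proof.
move=> cV; have -> : (fun t => (V t *m A t) 0 j) =
    \sum_i ((fun t => V t 0 i) * (fun t => A t i j)).
  by apply/funext => t; rewrite mxE fct_sumE; apply: eq_bigr.
move=> t; elim/big_ind: _ => [|f g|i _]; [exact: cst_continuous|exact: continuousD|].
by apply: continuousM; [exact: cV|exact: cA].
Qed.

Lemma rate_bound (V : R -> 'rV[R]_m) t j (c : R) : (forall i, `|V t 0 i| <= c) -> `|(V t *m A t) 0 j| <= c / 4.
Proof.
move=> HV; have c0 : 0 <= c by exact: le_trans (normr_ge0 _) (HV j).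
rewrite mxE; apply: le_trans (ler_norm_sum _ _ _) _.
apply: (@le_trans _ _ (\sum_(i < m) c * K)).
  by apply: ler_sum => i _; rewrite normrM ler_pM.
rewrite sumr_const card_ord -mulr_natl; have := ler_wpM2l c0 mK; lra.
Qed.

(** Picard iteration. By [mK] the rate is at most a quarter of the bound on the solution, and
    integrating it from 0 inside [-1, 2] costs at most a factor 2: the iteration contracts by 1/2 in
    the sup norm. *)
Lemma linear_ode : exists u : R -> 'rV[R]_m, [/\ u 0 = u0,
  forall t : R, -1 < t < 2 -> curve_der u t (u t *m A t) &
  forall t j, `|u t 0 j| <= 3 * `|u0|].
Proof.
(* Stated for all g, with a condition only on continuous ones, so that choice yields one total
   primitive operator. *)
have exP (g : R -> R) : exists P : R -> R, continuous g ->
    P 0 = 0 /\ forall t : R, - 3 < t < 3 -> is_derive t 1 P (g t).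
  have [cg|ncg] := pselect (continuous g); last by exists id.
  by have [P HP] := primitive 3 cg; exists P.
have [P HP] := choice exP.
have cl3 t : - 3 < clamp t < 3 by have /andP[h1 h2] := clamp_bound t; apply/andP; split; lra.
have Pc g : continuous g -> continuous (fun t => P g (clamp t)).
  move=> cg t; apply: (@continuous_comp _ _ _ clamp (P g)); first exact: clamp_continuous.
  have [_ /(_ _ (cl3 t))[d _]] := HP g cg.
  by apply: differentiable_continuous; apply/derivable1_diffP.
have Pd g h t (c : R) : continuous g -> continuous h -> (forall s, `|g s - h s| <= c) ->
    `|P g (clamp t) - P h (clamp t)| <= 2 * c.
  move=> cg ch Hc; have [g0 dg] := HP g cg; have [h0 dh] := HP h ch.
  have [|s _] := @mvt0 R (fun t => P g t - P h t) (fun t => g t - h t) (clamp t).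
    move=> s; rewrite ler_norml => /andP[s1 s2].
    have s3 : - 3 < s < 3.
      have /andP[h1 h2] := clamp_bound t.
      have h3 : `|clamp t| <= 2 by rewrite ler_norml; apply/andP; split; lra.
      by apply/andP; split; lra.
    by apply: is_deriveB; [exact: dg|exact: dh].
  rewrite g0 h0 subrr subr0 => ->; rewrite normrM mulrC ler_pM //.
  by have /andP[h1 h2] := clamp_bound t; rewrite ler_norml; apply/andP; split; lra.
pose T (V : R -> 'rV[R]_m) t : 'rV[R]_m := u0 + \row_j P (fun s => (V s *m A s) 0 j) (clamp t).
have TE V t j : T V t 0 j = u0 0 j + P (fun s => (V s *m A s) 0 j) (clamp t).
  by rewrite /T !mxE.
have Tc V : cont V -> cont (T V).
  move=> cV j; have -> : (fun t => T V t 0 j) =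
      cst (u0 0 j) + (fun t => P (fun s => (V s *m A s) 0 j) (clamp t)).
    by apply/funext => t; rewrite TE.
  move=> t; apply: continuousD; first exact: cst_continuous.
  by apply: Pc; exact: rate_continuous.
have Td V W t j (c : R) : cont V -> cont W -> (forall s i, `|V s 0 i - W s 0 i| <= c) ->
    `|T V t 0 j - T W t 0 j| <= c / 2.
  move=> cV cW H; rewrite !TE (_ : _ - _ = P (fun s => (V s *m A s) 0 j) (clamp t)
    - P (fun s => (W s *m A s) 0 j) (clamp t)); last by ring.
  apply: (le_trans (Pd _ _ _ (c / 4) _ _ _)); try exact: rate_continuous; last lra.
  move=> s; have := @rate_bound (fun s => V s - W s) s j c; rewrite mulmxBl mx_addE mx_oppE.
  by apply=> i; rewrite mx_addE mx_oppE.
pose U k := iter k T (fun=> u0).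
have Uc k : cont (U k).
  by elim: k => [j t|k IH]; [exact: cst_continuous|exact: Tc].
pose D := `|u0| : R.
have step k t j : `|U k.+1 t 0 j - U k t 0 j| <= D / 2 ^+ k.
  elim: k t j => [|k IH] t j.
    rewrite /U /= TE addrC addKr divr1.
    have c0 : continuous (cst 0 : R -> R) by exact: cst_continuous.
    have cu : continuous (fun s => (u0 *m A s) 0 j) by exact: (@rate_continuous (fun=> u0) j (Uc 0%N)).
    have [cst0 dcst0] := HP _ c0.
    have Pz : P (cst 0) (clamp t) = 0.
      have [|s _] := @mvt0 R (P (cst 0)) (cst 0) (clamp t); last by rewrite cst0 subr0 mul0r.
      move=> s; rewrite ler_norml => /andP[s1 s2]; apply: dcst0.
      have /andP[h1 h2] := clamp_bound t.
      have h3 : `|clamp t| <= 2 by rewrite ler_norml; apply/andP; split; lra.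
      by apply/andP; split; lra.
    rewrite -[X in `|X|]subr0 -Pz; apply: (le_trans (Pd _ _ _ (D / 4) cu c0 _)).
      move=> s; rewrite subr0; apply: (@rate_bound (fun=> u0)) => i; exact: coord_le_norm.
    by have : 0 <= D := normr_ge0 u0; lra.
  by have := Td _ _ t j _ (Uc k.+1) (Uc k) IH; rewrite exprS invfM mulrCA mulrA [_ / 2]mulrC !mulrA.
have exl tj : exists l, forall k, `|l - U k tj.1 0 tj.2| <= 2 * D / 2 ^+ k.
  by apply: geometric_limit => k; exact: step.
have [l Hl] := choice exl.
pose u t : 'rV[R]_m := \row_j l (t, j).
have uU k t j : `|u t 0 j - U k t 0 j| <= 2 * D / 2 ^+ k by rewrite mxE; exact: (Hl (t, j)).
have cu : cont u.
  move=> j t; apply/cvgrPdist_le => e e0.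
  have [k Hk] := geometric_small (2 * D) (divr_gt0 e0 (ltr0Sn _ 2)).
  have /cvgrPdist_le/(_ _ (divr_gt0 e0 (ltr0Sn _ 2))) := Uc k j t.
  apply: filterS => s Hs; have h1 := le_trans (uU k t j) Hk; have h2 := le_trans (uU k s j) Hk.
  rewrite (_ : _ - _ = (u t 0 j - U k t 0 j) + (U k t 0 j - U k s 0 j) - (u s 0 j - U k s 0 j)); last by ring.
  apply: le_trans (ler_normB _ _) _; have := ler_normD (u t 0 j - U k t 0 j) (U k t 0 j - U k s 0 j); lra.
have fix_u t j : u t 0 j = T u t 0 j.
  apply: (@eq_of_geometric _ _ (2 * D)) => k.
  have h1 := uU k.+1 t j; have h2 := Td _ _ t j _ cu (Uc k) (uU k).
  rewrite (_ : _ - _ = (u t 0 j - U k.+1 t 0 j) - (T u t 0 j - U k.+1 t 0 j)); last by ring.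
  apply: le_trans (ler_normB _ _) _.
  have E : 2 * D / 2 ^+ k.+1 = 2 * D / 2 ^+ k / 2 by rewrite exprS invfM; ring.
  by move: h1 h2; rewrite E /U /=; lra.
exists u; split.
- apply/rowP => j; rewrite fix_u TE clamp_id; last by apply/andP; split; lra.
  by have [-> _] := HP _ (rate_continuous cu (j := j)); rewrite addr0.
- move=> t tb i j; rewrite ord1; have [_ dP] := HP _ (rate_continuous cu (j := j)).
  have t3 : - 3 < t < 3 by move/andP: tb => [h1 h2]; apply/andP; split; lra.
  apply: (@near_eq_is_derive _ _ _ (fun t => u0 0 j + P (fun s => (u s *m A s) 0 j) t)).
    have oI : open [set s : R | -1 < s < 2].
      have -> : [set s : R | -1 < s < 2] = `]-1, 2[%classic by apply/seteqP; split=> s /=; rewrite in_itv.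
      exact: interval_open.
    apply: filterS (open_nbhs_nbhs (conj oI tb)) => s /andP[s1 s2].
    by rewrite fix_u TE clamp_id // !ltW.
  by apply: is_derive_eq (is_deriveD (is_derive_cst (u0 0 j) t 1) (dP t t3)) _; rewrite add0r.
(* The factor 3 is 2 + 1: the limit is within 2 |u0| of the first iterate, which is the constant
   u0. *)
move=> t j; have := uU 0%N t j; rewrite divr1 => h; have h2 := coord_le_norm u0 j.
have := ler_normD (u t 0 j - U 0%N t 0 j) (u0 0 j); rewrite /U /= subrK.
by move: h; rewrite /U /= /D; lra.
Qed.

End Picard.
End LinearODE.

(** * The Frobenius theorem for flat linear systems *)

Section FrobeniusTools.
Variable R : realType.

Lemma quadratic_is_derive (g : R -> R) (d C r : R) : 0 < r ->
  (forall s, `|s| < r -> `|g s - g 0 - s * d| <= C * s ^+ 2) -> is_derive (0 : R) 1 g d.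
Proof.
move=> r0 H; have C0 : 0 <= C.
  have r2 : 0 < r / 2 by rewrite divr_gt0.
  have := H (r / 2); rewrite gtr0_norm // ltr_pdivrMr // ltr_pMr // ltr1n => /(_ isT) h.
  by have := le_trans (normr_ge0 _) h; rewrite pmulr_lge0 // exprn_gt0.
have cv : h^-1 *: ((g \o shift 0) (h *: 1) - g 0) @[h --> (0 : R)^'] --> d.
  apply/cvgrPdist_le => e e0.
  have p0 : 0 < Num.min r (e / (C + 1)) by rewrite lt_min r0 divr_gt0 // ltr_wpDl.
  have := @dnbhs0_lt R R _ p0; apply: filter_app.
  have := nbhs_dnbhs_neq (0 : R); apply: filterS => h h0; rewrite lt_min => /andP[h1 h2].
  rewrite /= addr0 [_%:A]mulr1.
  have -> : d - h^-1 *: (g h - g 0) = - (h^-1 * (g h - g 0 - h * d)).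
    by rewrite /GRing.scale /=; field.
  rewrite normrN normrM normfV ler_pdivrMl ?normr_gt0 //; apply: le_trans (H h h1) _.
  rewrite -(real_normK (num_real h)) expr2 mulrCA ler_wpM2l //.
  rewrite ltr_pdivlMr in h2; last by rewrite ltr_wpDl.
  have : 0 <= `|h| by []; nra.
by split; [apply/cvg_ex; exists d|exact: cvg_lim cv].
Qed.

Lemma taylor2 (g dg ddg : R -> R) (C r : R) :
  (forall s : R, `|s| < r -> is_derive s 1 g (dg s)) ->
  (forall s : R, `|s| < r -> is_derive s 1 dg (ddg s)) ->
  (forall s, `|s| < r -> `|ddg s| <= C) ->
  forall s, `|s| < r -> `|g s - g 0 - s * dg 0| <= C * s ^+ 2.
Proof.
move=> H1 H2 H3 s sr; have [|c cs E] := @mvt0 R g dg s.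
  by move=> t ts; apply: H1; exact: le_lt_trans ts sr.
have [|c' cs' E'] := @mvt0 R dg ddg c.
  by move=> t tc; apply: H2; apply: le_lt_trans (le_trans tc cs) sr.
rewrite E; have -> : dg c * s - s * dg 0 = ddg c' * c * s by rewrite -E'; ring.
rewrite !normrM -[s ^+ 2]real_normK ?num_real // expr2 mulrA ler_wpM2r //.
by apply: ler_pM => //; apply: H3; apply: le_lt_trans (le_trans cs' cs) sr.
Qed.

(** Gronwall for |D|^2 + m c^2: the added constant absorbs the source term, so that the resulting
    bound is linear in c. *)
Lemma gronwall_vec m (D rho : R -> 'rV[R]_m) (A : R -> 'M[R]_m) (K c : R) : 0 <= c -> 0 <= K ->
  D 0 = 0 -> (forall t : R, 0 <= t <= 1 -> curve_der D t (D t *m A t + rho t)) ->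
  (forall t i j, 0 <= t <= 1 -> `|A t i j| <= K) ->
  (forall t j, 0 <= t <= 1 -> `|rho t 0 j| <= c) ->
  forall j, `|D 1 0 j| <= (expR (2 * m%:R * K + 1) * m%:R + 1) * c.
Proof.
move=> c0 K0 D0 dD bA br j; pose k := 2 * m%:R * K + 1.
pose N t := \sum_j D t 0 j ^+ 2; pose phi t := N t + m%:R * c ^+ 2.
have N0 t : 0 <= N t by apply: sumr_ge0 => i _; exact: sqr_ge0.
have k1 : 1 <= k by rewrite /k lerDr !mulr_ge0.
have H := @gronwall R phi (fun t => \sum_j 2 * D t 0 j * (D t *m A t + rho t) 0 j) k 1 ler01.
have {H} : phi 1 <= expR (k * 1) * phi 0.
  apply: H => t tb.
    have -> : phi = (\sum_j (fun t => D t 0 j) ^+ 2) + cst (m%:R * c ^+ 2).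
      apply/funext => s; transitivity ((\sum_j (fun t => D t 0 j) ^+ 2) s + m%:R * c ^+ 2) => //.
      by rewrite fct_sumE.
    rewrite -[X in is_derive _ _ _ X]addr0; apply: is_deriveD.
    apply: is_derive_sum => i; apply: is_derive_eq (is_deriveX 2 (dD t tb 0 i)) _.
    by rewrite /GRing.scale /= expr1.
  apply: (@le_trans _ _ (\sum_i (\sum_l K * (D t 0 l ^+ 2 + D t 0 i ^+ 2) + (D t 0 i ^+ 2 + c ^+ 2)))).
    apply: ler_sum => i _; rewrite mx_addE mulrDr; apply: lerD.
      rewrite [X in _ * X]mxE mulr_sumr; apply: ler_sum => l _.
      apply: le_trans (ler_norm _) _; rewrite !normrM (ger0_norm (ler0n _ 2)).
      have h1 := bA t l i tb; have h2 := normr_ge0 (D t 0 i); have h3 := normr_ge0 (D t 0 l).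
      rewrite -(real_normK (num_real (D t 0 l))) -(real_normK (num_real (D t 0 i))).
      apply: (@le_trans _ _ (2 * `|D t 0 i| * (`|D t 0 l| * K))).
        by rewrite ler_wpM2l ?mulr_ge0 // ler_wpM2l.
      have := mulr_ge0 K0 (sqr_ge0 (`|D t 0 i| - `|D t 0 l|)); nra.
    have h1 := br t i tb; have : rho t 0 i ^+ 2 <= c ^+ 2.
      by rewrite -(real_normK (num_real (rho t 0 i))) lerXn2r ?nnegrE.
    have := sqr_ge0 (D t 0 i - rho t 0 i); nra.
  rewrite big_split /=; under eq_bigr do rewrite -mulr_sumr big_split /= sumr_const card_ord -[_ *+ m]mulr_natl.
  rewrite -mulr_sumr !big_split /= sumr_const card_ord -mulr_sumr sumr_const card_ord -/(N t).
  rewrite -[_ *+ m]mulr_natl -[_ *+ m]mulr_natl /phi.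
  have : 0 <= (k - 1) * (m%:R * c ^+ 2) by rewrite mulr_ge0 ?subr_ge0 ?mulr_ge0 ?sqr_ge0.
  by rewrite /k; lra.
have -> : phi 0 = m%:R * c ^+ 2.
  by rewrite /phi /N big1 ?add0r // => i _; rewrite D0 mxE expr0n.
rewrite mulr1 => H; have e1 : 1 <= expR k by apply: le_trans (expR_ge1Dx k); lra.
have Dj : D 1 0 j ^+ 2 <= expR k * (m%:R * c ^+ 2).
  apply: le_trans H; rewrite /phi /N (bigD1 j) //= -addrA lerDl addr_ge0 //.
    by apply: sumr_ge0 => i _; exact: sqr_ge0.
  by rewrite mulr_ge0 ?sqr_ge0.
have em : 0 <= expR k * m%:R by rewrite mulr_ge0 ?expR_ge0.
rewrite -(@ler_pXn2r _ 2) ?nnegrE ?mulr_ge0 ?addr_ge0 //.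
rewrite real_normK ?num_real //; apply: (le_trans Dj); rewrite exprMn mulrA ler_wpM2r ?sqr_ge0 //.
by rewrite -/k; nra.
Qed.

Lemma line_derive n (U : set 'rV[R]_n) (F : 'rV[R]_n -> R) p w (s : R) : open U -> Ck_on 1 U F ->
  U (p + s *: w) -> is_derive s 1 (fun s => F (p + s *: w)) (\sum_k w 0 k * partial k F (p + s *: w)).
Proof.
move=> oU CF Us; have [dF EF] := C1_diff oU CF Us.
have dH k : is_derive s 1 (fun u : R => (p + u *: w) 0 k) (w 0 k).
  have -> : (fun u : R => (p + u *: w) 0 k) = cst (p 0 k) + ( *:%R^~ (w 0 k) : R -> R).
    by apply/funext => u; rewrite !mxE.
  rewrite -[X in is_derive _ _ _ X]add0r; apply: is_deriveD.
  have := is_deriveZ (w 0 k) (is_derive_id s (1 : R)).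
  have -> : w 0 k \*: id = ( *:%R^~ (w 0 k) : R -> R) by apply/funext => u; rewrite /= /GRing.scale /= mulrC.
  by rewrite /GRing.scale /= mulr1.
have H := @is_derive_comp R n R F (fun u => p + u *: w) s 1 dF EF (fun k => @ex_derive _ _ _ _ _ _ _ (dH k)).
apply: is_derive_eq H _; apply: eq_bigr => k _.
by rewrite (@derive_val _ _ _ _ _ _ _ (dH k)).
Qed.

Lemma smooth_bound n (U : set 'rV[R]_n) (F : 'rV[R]_n -> R) x : open U -> smooth_on U F -> U x ->
  \forall y \near x, `|F y| <= `|F x| + 1.
Proof.
move=> oU sF Ux; have /cvgrPdist_le/(_ 1 ltr01) := Ck_continuous (sF 0%N) Ux.
apply: filterS => y; rewrite distrC => h; have := ler_normD (F y - F x) (F x).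
by rewrite subrK; lra.
Qed.

End FrobeniusTools.

Lemma derive_along_line (R : realType) n (F : 'rV[R]_n -> R) x v (d : R) :
  is_derive (0 : R) 1 (fun s : R => F (x + s *: v)) d -> is_derive x v F d.
Proof.
have E : (fun h : R => h^-1 *: (((fun s : R => F (x + s *: v)) \o shift 0) (h *: 1) - F (x + 0 *: v)))
  = (fun h => h^-1 *: ((F \o shift x) (h *: v) - F x)).
  by apply/funext => h /=; rewrite addr0 [_%:A]mulr1 scale0r addr0 [x + _]addrC.
by move=> [d1 d2]; split; [move: d1|move: d2]; rewrite /derivable /derive E.
Qed.

Lemma smooth_family_bound (R : realType) n (U : set 'rV[R]_n) x (T : finType) (F : T -> 'rV[R]_n -> R) :
  open U -> U x -> (forall i, smooth_on U (F i)) ->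
  exists2 K, 0 <= K & \forall y \near x, forall i, `|F i y| <= K.
Proof.
move=> oU Ux sF; exists (\sum_i (`|F i x| + 1)).
  by apply: sumr_ge0 => i _; rewrite addr_ge0.
refine (@filter_forall _ _ (fun i y => `|F i y| <= \sum_i (`|F i x| + 1)) (nbhs x) _ _) => i.
apply: filterS (smooth_bound oU (sF i) Ux) => y Hy; apply: (le_trans Hy).
by rewrite (bigD1 i) //= lerDl; apply: sumr_ge0 => j _; rewrite addr_ge0.
Qed.

Lemma sum_le_bound (R : realType) n (x : 'I_n -> R) c :
  (forall i, `|x i| <= c) -> `|\sum_i x i| <= n%:R * c.
Proof.
move=> H; apply: le_trans (ler_norm_sum _ _ _) _; apply: le_trans (ler_sum _ (fun i _ => H i)) _.
by rewrite sumr_const card_ord mulr_natl.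
Qed.

Lemma mulmx_bound (R : realType) p q r (X : 'M[R]_(p, q)) (Z : 'M[R]_(q, r)) c d :
  (forall i j, `|X i j| <= c) -> (forall i j, `|Z i j| <= d) ->
  forall i j, `|(X *m Z) i j| <= q%:R * (c * d).
Proof.
move=> HX HZ i j; rewrite mxE; apply: sum_le_bound => k; rewrite normrM; exact: ler_pM.
Qed.

Lemma continuous_at_dist (R : realType) (V W : normedModType R) (g : V -> W) x :
  (forall e, 0 < e -> exists2 d, 0 < d & forall y, `|y - x| < d -> `|g x - g y| <= e) ->
  {for x, continuous g}.
Proof.
move=> H; apply/cvgrPdist_le => e e0; have [d d0 Hd] := H e e0.
apply/nbhs_ballP; exists d => // y; rewrite -ball_normE /= distrC; exact: Hd.
Qed.

Section Frobenius.
Variables (R : realType) (n m : nat) (U : set 'rV[R]_n) (x0 : 'rV[R]_n) (Th : 'I_n -> 'rV[R]_n -> 'M[R]_m).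
Hypotheses (oU : open U) (Ux0 : U x0) (sTh : forall a, smooth_mx U (Th a)).
Hypothesis flat : forall a b x, U x ->
  pdm a (Th b) x + Th a x *m Th b x = pdm b (Th a) x + Th b x *m Th a x.

(** The connection contracted with a direction h; [dM] and [ddM] are its first and second
    derivatives along k. *)
Let Mx (h : 'rV[R]_n) y : 'M[R]_m := \sum_a h 0 a *: Th a y.
Let dM (h k : 'rV[R]_n) y : 'M[R]_m := \sum_a \sum_l (h 0 a * k 0 l) *: pdm l (Th a) y.
Let ddM (h k : 'rV[R]_n) y : 'M[R]_m :=
  \matrix_(i, j) \sum_a \sum_l \sum_c (h 0 a * k 0 l * k 0 c) * partial c (partial l (fun y => Th a y i j)) y.

Lemma connection_bounds : exists r K : R, [/\ 0 < r, 0 <= K, forall y, `|y - x0| < r -> U y &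
  forall y, `|y - x0| < r -> forall a i j, [/\ `|Th a y i j| <= K, forall l, `|pdm l (Th a) y i j| <= K &
    forall l c, `|partial c (partial l (fun y => Th a y i j)) y| <= K]].
Proof.
have s1 a i j l : smooth_on U (partial l (fun y => Th a y i j)).
  by move=> k; have [_ /(_ l)[]] := sTh a i j k.+1.
have s2 a i j l c : smooth_on U (partial c (partial l (fun y => Th a y i j))).
  by move=> k; have [_ /(_ c)[]] := s1 a i j l k.+1.
have [K0 K00 N0] := @smooth_family_bound R n U x0 ('I_n * ('I_m * 'I_m))%type
  (fun t y => Th t.1 y t.2.1 t.2.2) oU Ux0 (fun t => sTh t.1 t.2.1 t.2.2).
have [K1 K10 N1] := @smooth_family_bound R n U x0 ('I_n * ('I_m * ('I_m * 'I_n)))%type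
  (fun t y => partial t.2.2.2 (fun y => Th t.1 y t.2.1 t.2.2.1) y) oU Ux0 (fun t => s1 _ _ _ _).
have [K2 K20 N2] := @smooth_family_bound R n U x0 ('I_n * ('I_m * ('I_m * ('I_n * 'I_n))))%type
  (fun t y => partial t.2.2.2.2 (partial t.2.2.2.1 (fun y => Th t.1 y t.2.1 t.2.2.1)) y) oU Ux0
  (fun t => s2 _ _ _ _ _).
have NU : nbhs x0 U := open_nbhs_nbhs (conj oU Ux0).
have [r r0 Hr] := nbhs_rV_ball (filterI NU (filterI N0 (filterI N1 N2))).
exists r, (K0 + K1 + K2); split=> // [|y yr|y yr a i j]; first by rewrite !addr_ge0.
  by have [] := Hr y yr.
have [_ [h0 [h1 h2]]] := Hr y yr; split=> [|l|l c].
- by apply: (le_trans (h0 (a, (i, j)))); lra.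
- by rewrite mxE; apply: (le_trans (h1 (a, (i, (j, l))))); lra.
by apply: (le_trans (h2 (a, (i, (j, (l, c)))))); lra.
Qed.

Section Solution.
Variables (r K rho : R) (u0 : 'rV[R]_m).
Hypotheses (r0 : 0 < r) (K0 : 0 <= K) (rU : forall y, `|y - x0| < r -> U y).
Hypothesis bK : forall y, `|y - x0| < r -> forall a i j, [/\ `|Th a y i j| <= K,
  forall l, `|pdm l (Th a) y i j| <= K &
  forall l c, `|partial c (partial l (fun y => Th a y i j)) y| <= K].
Hypotheses (rho0 : 0 < rho) (rhor : 2 * rho <= r) (rho1 : 2 * rho <= 1)
  (rhoK : m%:R * (n%:R * (rho * K)) <= 4^-1).

Lemma in_big (t : R) (v : 'rV[R]_n) : `|t| <= 2 -> `|v| < rho -> `|x0 + t *: v - x0| < r.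
Proof.
move=> t2 vr; rewrite addrC addrA addNr add0r normrZ; apply: lt_le_trans rhor.
by have := normr_ge0 v; have := normr_ge0 t; nra.
Qed.

Lemma Mx_bound (h : 'rV[R]_n) y (c : R) i j : `|y - x0| < r -> (forall a, `|h 0 a| <= c) -> `|Mx h y i j| <= n%:R * (c * K).
Proof.
move=> yr hc; rewrite summxE; apply: sum_le_bound => a; rewrite mxE normrM.
by apply: ler_pM => //; have [] := bK yr a i j.
Qed.

Lemma dM_bound (h k : 'rV[R]_n) y i j : `|y - x0| < r -> (forall a, `|h 0 a| <= 1) -> (forall a, `|k 0 a| <= 1) ->
  `|dM h k y i j| <= n%:R * (n%:R * K).
Proof.
move=> yr h1 k1; rewrite summxE; apply: sum_le_bound => a; rewrite summxE; apply: sum_le_bound => l.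
rewrite [X in `|X|]mxE normrM -[leRHS]mul1r; apply: ler_pM => //; last by have [_ -> _] := bK yr a i j.
by rewrite normrM -[leRHS]mul1r; apply: ler_pM.
Qed.

Lemma ddM_bound (h k : 'rV[R]_n) y i j : `|y - x0| < r -> (forall a, `|h 0 a| <= 1) -> (forall a, `|k 0 a| <= 1) ->
  `|ddM h k y i j| <= n%:R * (n%:R * (n%:R * K)).
Proof.
move=> yr h1 k1; rewrite mxE.
apply: sum_le_bound => a; apply: sum_le_bound => l; apply: sum_le_bound => c.
rewrite normrM -[leRHS]mul1r; apply: ler_pM => //; last by have [_ _ ->] := bK yr a i j.
rewrite !normrM -[leRHS]mul1r; apply: ler_pM => //.
by rewrite -[leRHS]mul1r; apply: ler_pM.
Qed.

Lemma Mx_line (h p w : 'rV[R]_n) (s : R) i j : U (p + s *: w) ->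
  is_derive s 1 (fun s => Mx h (p + s *: w) i j) (dM h w (p + s *: w) i j).
Proof.
move=> Us; have -> : (fun s => Mx h (p + s *: w) i j) =
    \sum_a (h 0 a \*: (fun s : R => Th a (p + s *: w) i j)).
  by apply/funext => t; rewrite /Mx summxE fct_sumE; apply: eq_bigr => a _; rewrite mxE.
rewrite /dM summxE; apply: is_derive_sum => a.
have H := line_derive oU (sTh a i j 1%N) Us.
apply: is_derive_eq (is_deriveZ (h 0 a) H) _; rewrite scaler_sumr summxE.
by apply: eq_bigr => l _; rewrite [RHS]mxE mxE /GRing.scale /= mulrA.
Qed.

Lemma dM_line (h p w : 'rV[R]_n) (s : R) i j : U (p + s *: w) ->
  is_derive s 1 (fun s => dM h w (p + s *: w) i j) (ddM h w (p + s *: w) i j).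
Proof.
move=> Us; have -> : (fun s => dM h w (p + s *: w) i j) =
    \sum_a \sum_l ((h 0 a * w 0 l) \*: (fun s : R => partial l (fun y => Th a y i j) (p + s *: w))).
  apply/funext => t; rewrite /dM summxE fct_sumE; apply: eq_bigr => a _.
  by rewrite summxE fct_sumE; apply: eq_bigr => l _; rewrite !mxE.
rewrite /ddM mxE; apply: is_derive_sum => a; apply: is_derive_sum => l.
have s1 : Ck_on 1 U (partial l (fun y => Th a y i j)) by have [_ /(_ l)[]] := sTh a i j 2%N.
have H := line_derive oU s1 Us.
apply: is_derive_eq (is_deriveZ (h 0 a * w 0 l) H) _; rewrite scaler_sumr.
by apply: eq_bigr => c _; rewrite /GRing.scale /= mulrA.
Qed.

(** The equation is integrated along the segment from x0 to x; the candidate solution at x is the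
    value at time 1. By [rhoK] the coefficients along the ray are small enough for [linear_ode]. *)
Lemma ray_solution : exists u : 'rV[R]_n -> R -> 'rV[R]_m, forall x, `|x - x0| < rho ->
  [/\ u x 0 = u0, forall t : R, 0 <= t <= 1 ->
        curve_der (u x) t (u x t *m Mx (x - x0) (x0 + t *: (x - x0)))
    & forall t j, `|u x t 0 j| <= 3 * `|u0|].
Proof.
suff /choice[u Hu] : forall x, exists u : R -> 'rV[R]_m, `|x - x0| < rho ->
  [/\ u 0 = u0, forall t : R, 0 <= t <= 1 ->
        curve_der u t (u t *m Mx (x - x0) (x0 + t *: (x - x0)))
    & forall t j, `|u t 0 j| <= 3 * `|u0|] by exists u.
move=> x; have [xr|xr] := ltP `|x - x0| rho; last by exists (fun=> 0).
set v := x - x0 in xr *.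
pose A (t : R) := Mx v (x0 + clamp t *: v).
have cb (t : R) : `|clamp t| <= 2 by have /andP[h1 h2] := clamp_bound t; rewrite ler_norml; apply/andP; split; lra.
have cA i j : continuous (fun t => A t i j).
  move=> t; apply: (@continuous_comp _ _ _ (@clamp R) (fun s : R => Mx v (x0 + s *: v) i j)).
    exact: clamp_continuous.
  apply: differentiable_continuous; apply/derivable1_diffP.
  have Ut := rU (in_big (cb t) xr).
  by have [] := @Mx_line v x0 v (clamp t) i j Ut.
have bA t i j : `|A t i j| <= n%:R * (rho * K).
  apply: Mx_bound; first exact: in_big.
  by move=> a; apply: le_trans (coord_le_norm _ _) (ltW xr).
have [u [h1 h2 h3]] := linear_ode u0 cA bA rhoK.
exists u => _; split=> // t /andP[t0 t1].
have t12 : -1 < t < 2 by apply/andP; split; lra.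
by have := h2 t t12; rewrite /A clamp_id //; apply/andP; split; lra.
Qed.

Variable u : 'rV[R]_n -> R -> 'rV[R]_m.
Hypothesis Hu : forall x, `|x - x0| < rho -> [/\ u x 0 = u0, forall t : R, 0 <= t <= 1 ->
        curve_der (u x) t (u x t *m Mx (x - x0) (x0 + t *: (x - x0)))
    & forall t j, `|u x t 0 j| <= 3 * `|u0|].

Lemma flat_commutation (v h : 'rV[R]_n) y : U y ->
  dM v h y + Mx h y *m Mx v y = dM h v y + Mx v y *m Mx h y.
Proof.
move=> Uy.
have E (g k : 'rV[R]_n) : dM g k y + Mx k y *m Mx g y =
    \sum_a \sum_l (g 0 a * k 0 l) *: (pdm l (Th a) y + Th l y *m Th a y).
  rewrite /dM /Mx mulmx_suml exchange_big -big_split [RHS]exchange_big; apply: eq_bigr => l _ /=.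
  rewrite mulmx_sumr -big_split; apply: eq_bigr => a _ /=.
  by rewrite -scalemxAl -scalemxAr scalerA scalerDr [k 0 l * _]mulrC.
rewrite !E exchange_big; apply: eq_bigr => l _; apply: eq_bigr => a _.
by rewrite flat // mulrC.
Qed.

(** By flatness, u B with B t = t [Mx h] is the variation field of the rays when their endpoint
    moves along h. The error D of this first-order prediction starts at 0 and solves the ray
    equation with a source of order s^2, so Gronwall bounds it; at time 1 the field is u [Mx h]. *)
Lemma ray_variation (x h : 'rV[R]_n) : `|x - x0| < rho -> `|h| <= 1 -> exists C, forall (s : R) j,
  `|s| < rho - `|x - x0| ->
  `|u (x + s *: h) 1 0 j - u x 1 0 j - s * (u x 1 *m Mx h x) 0 j| <= C * s ^+ 2.
Proof.
move=> xr h1; set v := x - x0 in xr *.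
have vs (s : R) : `|s| < rho - `|v| -> `|v + s *: h| < rho.
  move=> sr; apply: le_lt_trans (ler_normD _ _) _; rewrite normrZ.
  by have := normr_ge0 s; nra.
have hc a : `|h 0 a| <= 1 := le_trans (coord_le_norm h a) h1.
have rho2 : rho <= 1 by have := rho0; have := rho1; lra.
have v1 : `|v| <= 1 := ltW (lt_le_trans xr rho2).
have vc a : `|v 0 a| <= 1 := le_trans (coord_le_norm v a) v1.
have s1 (s : R) : `|s| < rho - `|v| -> `|s| <= 1.
  by move=> sr; have := normr_ge0 v; have := rho2; lra.
pose p (t : R) := x0 + t *: v; pose w (t : R) := t *: h.
have wc t : 0 <= t <= 1 -> forall a, `|w t 0 a| <= 1.
  move=> /andP[t0 t1] a; rewrite mxE normrM -[leRHS]mul1r ler_pM // ger0_norm //.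
have psw (s t : R) : p t + s *: w t = x0 + t *: (v + s *: h).
  by apply/rowP => k; rewrite !mxE; ring.
have inb (s t : R) : `|s| < rho - `|v| -> 0 <= t <= 1 -> `|p t + s *: w t - x0| < r.
  move=> sr /andP[t0 t1]; rewrite psw; apply: in_big; last exact: vs.
  by rewrite ger0_norm //; lra.
(* The coefficient at time t of the ray towards x + s h; [A1] and [A2] are its first two derivatives
   in s. *)
pose A (s t : R) : 'M[R]_m := Mx (v + s *: h) (p t + s *: w t).
pose A1 (s t : R) i j := dM v (w t) (p t + s *: w t) i j
  + (Mx h (p t + s *: w t) i j + s * dM h (w t) (p t + s *: w t) i j).
pose A2 (s t : R) i j := ddM v (w t) (p t + s *: w t) i j
  + (dM h (w t) (p t + s *: w t) i j + (dM h (w t) (p t + s *: w t) i j + s * ddM h (w t) (p t + s *: w t) i j)).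
have MxD (g k : 'rV[R]_n) (s : R) y : Mx (g + s *: k) y = Mx g y + s *: Mx k y.
  rewrite /Mx scaler_sumr -big_split; apply: eq_bigr => a _ /=.
  by rewrite !mxE scalerDl scalerA.
have dA (t : R) i j (s : R) : 0 <= t <= 1 -> `|s| < rho - `|v| -> is_derive s 1 (fun s => A s t i j) (A1 s t i j).
  move=> tb sr; have Us := rU (inb s t sr tb).
  have -> : (fun s => A s t i j) = (fun s => Mx v (p t + s *: w t) i j) + id * (fun s => Mx h (p t + s *: w t) i j).
    by apply/funext => z; rewrite /A MxD !mxE.
  have H := is_deriveD (Mx_line v i j Us) (is_deriveM (is_derive_id s (1 : R)) (Mx_line h i j Us)).
  by apply: is_derive_eq H _; rewrite /A1 /GRing.scale /= mulr1; ring.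
have dA1 (t : R) i j (s : R) : 0 <= t <= 1 -> `|s| < rho - `|v| ->
    is_derive s 1 (fun s => A1 s t i j) (A2 s t i j).
  move=> tb sr; have Us := rU (inb s t sr tb).
  have H := is_deriveD (dM_line v i j Us) (is_deriveD (Mx_line h i j Us)
    (is_deriveM (is_derive_id s (1 : R)) (dM_line h i j Us))).
  by apply: is_derive_eq H _; rewrite /A2 /GRing.scale /= mulr1; ring.
pose N := n%:R : R; have N0 : 0 <= N by rewrite ler0n.
pose C1 := N * (N * K) + (N * (1 * K) + N * (N * K)).
pose C2 := N * (N * (N * K)) + (N * (N * K) + (N * (N * K) + N * (N * (N * K)))).
have bA1 (t : R) i j (s : R) : 0 <= t <= 1 -> `|s| < rho - `|v| -> `|A1 s t i j| <= C1.
  move=> tb sr; have yr := inb s t sr tb; have tw := wc t tb.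
  apply: le_trans (ler_normD _ _) _; apply: lerD; first exact: dM_bound.
  apply: le_trans (ler_normD _ _) _; apply: lerD; first exact: Mx_bound.
  by rewrite normrM -[leRHS]mul1r ler_pM ?s1 ?dM_bound.
have bA2 (t : R) i j (s : R) : 0 <= t <= 1 -> `|s| < rho - `|v| -> `|A2 s t i j| <= C2.
  move=> tb sr; have yr := inb s t sr tb; have tw := wc t tb.
  apply: le_trans (ler_normD _ _) _; apply: lerD; first exact: ddM_bound.
  apply: le_trans (ler_normD _ _) _; apply: lerD; first exact: dM_bound.
  apply: le_trans (ler_normD _ _) _; apply: lerD; first exact: dM_bound.
  by rewrite normrM -[leRHS]mul1r ler_pM ?s1 ?ddM_bound.
pose B (t : R) : 'M[R]_m := t *: Mx h (p t).
pose dB (t : R) : 'M[R]_m := Mx h (p t) + t *: dM h v (p t).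
have pin (t : R) : 0 <= t <= 1 -> `|p t - x0| < r.
  by move=> /andP[t0 t1]; apply: in_big => //; rewrite ger0_norm //; lra.
have dBt (t : R) : 0 <= t <= 1 -> curve_der B t (dB t).
  move=> tb i j; have -> : (fun s => B s i j) = id * (fun s => Mx h (x0 + s *: v) i j).
    by apply/funext => s; rewrite /B mxE.
  have H := is_deriveM (is_derive_id t (1 : R)) (Mx_line h i j (rU (pin t tb))).
  by apply: is_derive_eq H _; rewrite /dB !mxE /GRing.scale /= mulr1 addrC.
(* Flatness enters here: the derivative of the coefficient in s is that of B in t plus the
   commutator of A and B. *)
have key (t : R) : 0 <= t <= 1 -> (\matrix_(i, j) A1 0 t i j) + B t *m A 0 t = A 0 t *m B t + dB t.
  move=> tb; have Up := rU (pin t tb); have F := flat_commutation v h Up.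
  have -> : (\matrix_(i, j) A1 0 t i j) = t *: dM v h (p t) + Mx h (p t).
    apply/matrixP => i j; rewrite mxE /A1 scale0r addr0 mul0r addr0 mx_addE; congr (_ + _).
    rewrite [RHS]mxE /dM !summxE mulr_sumr; apply: eq_bigr => a _.
    rewrite !summxE mulr_sumr; apply: eq_bigr => l _; rewrite !mxE; ring.
  have -> : A 0 t = Mx v (p t) by rewrite /A !scale0r !addr0.
  rewrite /B /dB -scalemxAl -scalemxAr.
  rewrite addrAC -scalerDr F scalerDr -!addrA addrCA; congr (_ + _).
  by rewrite addrC.
have [ux0 dux bux] := Hu xr.
pose Bu := 3 * `|u0|; have Bu0 : 0 <= Bu by rewrite mulr_ge0.
pose mm := m%:R : R; have mm0 : 0 <= mm by rewrite ler0n.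
pose C3 := mm * (Bu * (C2 + mm * (N * (1 * K) * C1))).
have C10 : 0 <= C1 by rewrite !addr_ge0 ?mulr_ge0.
have C20 : 0 <= C2 by rewrite !addr_ge0 ?mulr_ge0.
exists ((expR (2 * m%:R * (N * (1 * K)) + 1) * m%:R + 1) * C3) => s j1 sr.
have yr : `|x + s *: h - x0| < rho by rewrite addrAC; exact: vs.
have [uy0 duy _] := Hu yr.
have yE : x + s *: h - x0 = v + s *: h by rewrite addrAC.
pose D t := u (x + s *: h) t - u x t - s *: (u x t *m B t).
pose Q t := A s t - A 0 t - s *: (\matrix_(i, j) A1 0 t i j).
pose rh t := u x t *m (Q t + s *: (B t *m (A s t - A 0 t))).
have sv0 : `|0 : R| < rho - `|v| by rewrite normr0 subr_gt0.
have AE (t : R) i j : 0 <= t <= 1 -> `|(A s t - A 0 t) i j| <= C1 * `|s|.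
  move=> tb; have [|z zs] := @mvt0 R (fun s => A s t i j) (fun s => A1 s t i j) s.
    by move=> z zs; apply: dA => //; exact: le_lt_trans zs sr.
  rewrite mx_addE mx_oppE => ->; rewrite normrM ler_wpM2r //; apply: bA1 => //.
  exact: le_lt_trans zs sr.
have QE (t : R) i j : 0 <= t <= 1 -> `|Q t i j| <= C2 * s ^+ 2.
  move=> tb; have H := @taylor2 R (fun s => A s t i j) (fun s => A1 s t i j) (fun s => A2 s t i j)
    C2 (rho - `|v|) (fun s => @dA t i j s tb) (fun s => @dA1 t i j s tb) (fun s => @bA2 t i j s tb) s sr.
  by rewrite /Q !mxE.
have H := @gronwall_vec R m D rh (A s) (N * (1 * K)) (C3 * s ^+ 2).
have {H} : forall j, `|D 1 0 j| <= (expR (2 * m%:R * (N * (1 * K)) + 1) * m%:R + 1) * (C3 * s ^+ 2).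
  apply: H.
  - by apply: mulr_ge0 (sqr_ge0 _); rewrite /C3 !mulr_ge0 // addr_ge0 ?mulr_ge0.
  - by rewrite !mulr_ge0.
  - by rewrite /D uy0 ux0 subrr /B scale0r mulmx0 scaler0 subr0.
  - move=> t tb; have H1 := duy t tb; rewrite yE -psw in H1.
    have H2 := dux t tb; have H3 := curve_derM H2 (dBt t tb).
    have H4 := curve_derZ (is_derive_cst s t (1 : R)) H3.
    have H5 := curve_derD (curve_derD H1 (curve_derN H2)) (curve_derN H4).
    apply: curve_der_eq H5 _; rewrite scale0r add0r -/(A s t).
    have -> : Mx v (x0 + t *: v) = A 0 t by rewrite /A !scale0r !addr0.
    have E : A 0 t *m B t + dB t = (\matrix_(i, j) A1 0 t i j) + B t *m A 0 t by rewrite key.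
    rewrite -mulmxA -mulmxDr E /D /rh /Q.
    move: (\matrix_(i, j) A1 0 t i j) (A s t) (A 0 t) (B t) (u x t) (u (x + s *: h) t) => M1 As A0 Bt ut uy.
    have -> : cst s t = s by [].
    have -> : ut *m (As - A0 - s *: M1 + s *: (Bt *m (As - A0))) =
      ut *m As - ut *m A0 - s *: (ut *m M1) + s *: (ut *m Bt *m As - ut *m Bt *m A0).
      by rewrite mulmxDr !mulmxBr -!scalemxAr mulmxBr !mulmxA.
    rewrite !mulmxBl mulmxDr -scalemxAl !mulmxA.
    move: (uy *m As) (ut *m As) (ut *m A0) (ut *m M1) (ut *m Bt *m As) (ut *m Bt *m A0) => z1 z2 z3 z4 z5 z6.
    by apply/matrixP => a b; rewrite !mxE; ring.
  - move=> t i j0 tb; apply: Mx_bound; first exact: inb.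
    move=> a; apply: (le_trans (coord_le_norm _ _)); apply: (le_trans (ltW (vs s sr))); lra.
  move=> t j0 tb; rewrite /C3 -mulrA.
  have bQ i l : `|(Q t + s *: (B t *m (A s t - A 0 t))) i l| <= (C2 + mm * (N * (1 * K) * C1)) * s ^+ 2.
    rewrite mx_addE; apply: le_trans (ler_normD _ _) _; rewrite mulrDl; apply: lerD; first exact: QE.
    rewrite mxE normrM.
    have bB i' l' : `|B t i' l'| <= N * (1 * K).
      rewrite /B mxE normrM -[leRHS]mul1r; apply: ler_pM => //.
        by move/andP: tb => [t0 t1]; rewrite ger0_norm.
      by apply: Mx_bound => //; exact: pin.
    have := mulmx_bound bB (fun i' l' => AE t i' l' tb) i l.
    move=> /(ler_wpM2l (normr_ge0 s)); rewrite -(real_normK (num_real s)) => H.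
    by apply: (le_trans H); rewrite -/mm; lra.
  have bu' i l : `|u x t i l| <= Bu by rewrite ord1; exact: bux.
  by have := mulmx_bound bu' bQ 0 j0; rewrite -/mm !mulrA.
move=> /(_ j1); rewrite mulrA; apply: le_trans; rewrite /D /B /p !scale1r.
have -> : x0 + v = x by rewrite /v addrC subrK.
by move: (u x 1 *m Mx h x) (u x 1) (u _ 1) => y1 y2 y3; rewrite !mxE.
Qed.

(** Smoothness bootstraps from the equation: the partial derivatives are u times smooth
    coefficients, hence as regular as u. *)
Lemma frobenius_row : [/\ u x0 1 = u0, forall j, smooth_on [set x | `|x - x0| < rho] (fun x => u x 1 0 j) &
  forall x a j, `|x - x0| < rho -> partial a (fun x => u x 1 0 j) x = (u x 1 *m Th a x) 0 j].
Proof.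
have der x (h : 'rV[R]_n) j : `|x - x0| < rho -> `|h| <= 1 -> is_derive x h (fun x => u x 1 0 j) ((u x 1 *m Mx h x) 0 j).
  move=> xr h1; have [C HC] := ray_variation xr h1; apply: derive_along_line.
  apply: (@quadratic_is_derive _ _ _ C (rho - `|x - x0|)) => [|s sr]; first by rewrite subr_gt0.
  by rewrite scale0r addr0; exact: HC.
have MxE a x : Mx (delta_mx 0 a) x = Th a x.
  rewrite /Mx (bigD1 a) //= mxE !eqxx scale1r big1 ?addr0 // => b ba.
  by rewrite mxE eqxx (negbTE ba) scale0r.
have dera x a j : `|x - x0| < rho -> is_derive x (delta_mx 0 a) (fun x => u x 1 0 j) ((u x 1 *m Th a x) 0 j).
  by move=> xr; rewrite -MxE; apply: der => //; exact: norm_delta_mx_le.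
have oB : open [set x | `|x - x0| < rho] by exact: rV_ball_open.
have cont (x : 'rV[R]_n) j : `|x - x0| < rho -> {for x, continuous (fun x : 'rV[R]_n => u x 1 0 j)}.
  move=> xr; apply: continuous_at_dist => e e0.
  pose L := m%:R * (3 * `|u0| * (n%:R * K)) + 1 : R.
  have L0 : 0 < L by rewrite ltr_wpDl // !mulr_ge0.
  exists (Num.min (rho - `|x - x0|) (e / L)).
    by rewrite lt_min subr_gt0 xr divr_gt0.
  move=> y; rewrite lt_min => /andP[y1 y2]; set h := y - x.
  have inb (s : R) : `|s| <= 1 -> `|x + s *: h - x0| < rho.
    move=> s1; rewrite addrAC; apply: le_lt_trans (ler_normD _ _) _; rewrite normrZ.
    by have := normr_ge0 h; nra.
  have h1 : `|h| <= 1.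
    apply: le_trans (ltW y1) _; have := normr_ge0 (x - x0); have := rho0; have := rho1; lra.
  have H := @mvt0 R (fun s => u (x + s *: h) 1 0 j) (fun s => (u (x + s *: h) 1 *m Mx h (x + s *: h)) 0 j) 1.
  have [|c c1 E] := H.
    move=> s; rewrite normr1 => s1.
    have := @der (x + s *: h) h j (inb s s1) h1.
    have E : (fun s0 : R => u (x + s0 *: h) 1 0 j) = (fun x => u x 1 0 j) \o (fun s => x + s *: h) by [].
    have E2 : (fun g : R => g^-1 *: (((fun s0 : R => u (x + s0 *: h) 1 0 j) \o shift s) (g *: 1) - u (x + s *: h) 1 0 j))
      = (fun g : R => g^-1 *: (((fun x => u x 1 0 j) \o shift (x + s *: h)) (g *: h) - u (x + s *: h) 1 0 j)).
      by apply/funext => g /=; rewrite [_%:A]mulr1 scalerDl addrCA.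
    by move=> [d1 d2]; split; rewrite /derivable /derive E2.
  rewrite scale1r scale0r addr0 mulr1 addrCA subrr addr0 in E.
  rewrite normr1 in c1; have inc := inb c c1.
  rewrite distrC E; have [_ _ bu] := Hu inc.
  have inr : `|x + c *: h - x0| < r by apply: lt_le_trans inc _; have := rho0; have := rhor; lra.
  have bu' i l : `|u (x + c *: h) 1 i l| <= 3 * `|u0| by rewrite ord1; exact: bu.
  have H1 := mulmx_bound bu' (fun i l => @Mx_bound h _ `|h| i l inr (coord_le_norm h)) 0 j.
  have yh : `|h| * L <= e by rewrite -ler_pdivlMr // ltW.
  apply: le_trans yh; apply: le_trans H1 _.
  have -> : m%:R * (3 * `|u0| * (n%:R * (`|h| * K))) = `|h| * (m%:R * (3 * `|u0| * (n%:R * K))) by ring.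
  by apply: ler_wpM2l => //; rewrite /L lerDl.
have [u10 du0 _] : [/\ u x0 0 = u0, forall t : R, 0 <= t <= 1 ->
    curve_der (u x0) t (u x0 t *m Mx (x0 - x0) (x0 + t *: (x0 - x0))) &
    forall t j, `|u x0 t 0 j| <= 3 * `|u0|] by apply: Hu; rewrite subrr normr0.
split=> [|j k|x a j xr]; last by have [_ E] := dera x a j xr.
  apply/rowP => j; rewrite -u10; apply: (@is_derive1_const_on R (fun t => u x0 t 0 j) 0 1 ler01) => t tb.
  have M0 y : Mx (x0 - x0) y = 0.
    by rewrite subrr /Mx big1 // => a _; rewrite mxE scale0r.
  by have := du0 t tb 0 j; rewrite M0 mulmx0 mx_0E.
elim: k j => [|k IH] j; first by split=> // x xr; exact: cont.
split=> [x xr|a]; first exact: cont.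
split=> [x xr|]; first by have [] := dera x a j xr.
apply: (@Ck_ext _ _ _ oB _ (\sum_i ((fun x => u x 1 0 i) * (fun x => Th a x i j)))).
  by move=> x xr; have [_ E] := dera x a j xr; rewrite /partial E mxE fct_sumE.
elim/big_ind: _ => [|F1 F2|i _]; [exact: Ck_cst|exact: CkD|].
apply: CkM => //; apply: Ck_sub (sTh a i j k) => x xr; apply: rU.
by apply: lt_le_trans xr _; have := rho0; have := rhor; lra.
Qed.

End Solution.

Lemma frobenius : exists2 rho, 0 < rho & (forall y, `|y - x0| < rho -> U y) /\
  forall p (W0 : 'M[R]_(p, m)), exists W : 'rV[R]_n -> 'M[R]_(p, m), [/\ W x0 = W0,
    smooth_mx [set x | `|x - x0| < rho] W &
    forall x a, `|x - x0| < rho -> pdm a W x = W x *m Th a x].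
Proof.
have [r [K [r0 K0 rU bK]]] := connection_bounds.
pose k := m%:R * (n%:R * K); have k0 : 0 <= k by rewrite !mulr_ge0.
(* r / 2 keeps the rays inside the ball of bounds up to parameter 2, 1/2 makes their directions
   shorter than 1, and the last bound is the smallness required by [linear_ode]. *)
pose rho := Num.min (r / 2) (Num.min (1 / 2) (4^-1 / (k + 1))).
have rho0 : 0 < rho by rewrite !lt_min !divr_gt0 // ltr_wpDl.
have rhor : 2 * rho <= r.
  have : rho <= r / 2 by rewrite /rho ge_min lexx.
  by lra.
have rho1 : 2 * rho <= 1.
  have : rho <= 1 / 2 by rewrite /rho !ge_min lexx orbT.
  by lra.
have rhoK : m%:R * (n%:R * (rho * K)) <= 4^-1.
  have : rho <= 4^-1 / (k + 1) by rewrite /rho !ge_min lexx !orbT.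
  rewrite ler_pdivlMr; last by rewrite ltr_wpDl.
  have -> : m%:R * (n%:R * (rho * K)) = rho * k by rewrite /k; ring.
  by have := rho0; nra.
exists rho => //; split=> [y yr|p W0].
  by apply: rU; apply: lt_le_trans yr _; have := rho0; lra.
have rows i : exists u : 'rV[R]_n -> 'rV[R]_m, [/\ u x0 = row i W0,
    forall j, smooth_on [set x | `|x - x0| < rho] (fun x => u x 0 j) &
    forall x a j, `|x - x0| < rho -> partial a (fun x => u x 0 j) x = (u x *m Th a x) 0 j].
  have [u Hu] := ray_solution (row i W0) rU bK rhor rhoK.
  by exists (fun x => u x 1); apply: (@frobenius_row r K rho (row i W0)).
have [u Hu] := choice rows; exists (fun x => \matrix_(i, j) u i x 0 j); split.
- by apply/matrixP => i j; rewrite mxE; have [-> _ _] := Hu i; rewrite mxE.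
- move=> i j k'; have [_ s _] := Hu i.
  have -> : (fun y => (\matrix_(i, j) u i y 0 j) i j) = (fun y => u i y 0 j) by apply/funext => y; rewrite mxE.
  exact: s.
move=> x a xr; apply/matrixP => i j; have [_ _ d] := Hu i; rewrite mxE.
have -> : (fun y => (\matrix_(i, j) u i y 0 j) i j) = (fun y => u i y 0 j) by apply/funext => y; rewrite mxE.
by rewrite d // !mxE; apply: eq_bigr => l _; rewrite mxE.
Qed.

End Frobenius.

(** * The curvature tensor when Ric is parallel *)

Lemma sym_idem_trace (R : realFieldType) n (P : 'M[R]_n) : P^T = P -> P *m P = P ->
  \tr P = \sum_i \sum_j P i j ^+ 2.
Proof.
move=> Ps Pi; rewrite -{1}Pi; apply: eq_bigr => i _; rewrite mxE; apply: eq_bigr => j _.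
by rewrite -[X in _ * X]mx_trE Ps expr2.
Qed.

(** By induction on the dimension: a nonzero projector fixes the vectors of its row space, and a
    unit one is split off as the first row of an orthogonal matrix. *)
Lemma proj_frame (R : rcfType) n k (P : 'M[R]_n) : P^T = P -> P *m P = P -> \tr P = k%:R ->
  exists O : 'M[R]_n, O *m O^T = 1%:M /\ O *m P *m O^T = pid_mx k.
Proof.
elim: n k P => [|n IH] k P Ps Pi trP.
  by exists 1%:M; split; apply/matrixP => -[].
have [P0|] := eqVneq P 0.
  exists 1%:M; split; first by rewrite trmx1 mulmx1.
  move: trP; rewrite P0 mxtrace0 => /esym/eqP; rewrite pnatr_eq0 => /eqP ->.
  by rewrite mulmx0 mul0mx pid_mx_0.
case/rowV0Pn => w /submxP[D wE] w0.
have wP : w *m P = w by rewrite wE -mulmxA Pi.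
have p1 : posdef (1%:M : 'M[R]_n.+1).
  move=> v v0; rewrite mulmx1; have [i vi] : exists i, v 0 i != 0.
    by apply/existsP; apply: contra_neqT v0 => /existsPn H; apply/rowP => i; rewrite mxE; apply/eqP/negPn/H.
  rewrite mxE (bigD1 i) //= mx_trE -expr2 ltr_pwDl ?lt_neqAle ?sqr_ge0 ?andbT 1?eq_sym ?sqrf_eq0 //.
  by apply: sumr_ge0 => j _; rewrite mx_trE -expr2 sqr_ge0.
have [r0] := posdef_normalize p1 w0; set v := _ *: w; rewrite mulmx1 => vv.
have vP : v *m P = v by rewrite /v -scalemxAl wP.
have [C [Ci [CCi CiC]]] := posdef_frame v (trmx1 _ _) p1.
rewrite !mulmx1 vv mxE eqxx sqrtr1 scale1r => CC vCi.
have CiE : Ci = C^T by rewrite -[Ci]mulmx1 -CC mulmxA CiC mul1mx.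
pose Q : 'M[R]_(1 + n) := C *m P *m C^T.
have v0C : v = row 0 C by rewrite rowE -vCi -mulmxA CiC mulmx1.
have Q0 : row 0 Q = delta_mx 0 0.
  by rewrite /Q !row_mul -v0C vP -CiE vCi.
have Qs : Q^T = Q by rewrite /Q !trmx_mul trmxK Ps mulmxA.
have CtC : C^T *m C = 1%:M by rewrite -CiE.
have Qi : Q *m Q = Q by rewrite /Q !mulmxA -(mulmxA _ C^T C) CtC mulmx1 -(mulmxA C P P) Pi.
have QD : C *m P *m C^T = Q by [].
clearbody Q; pose Q' := drsubmx Q.
have QE : Q = block_mx 1%:M 0 0 Q'.
  rewrite -[LHS]submxK; have e j : Q 0 j = (j == 0)%:R.
    by have /rowP/(_ j) := Q0; rewrite !mxE eqxx.
  congr block_mx; apply/matrixP => i j; rewrite !mxE ?ord1.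
  - have -> : lshift n (0 : 'I_1) = 0 by exact/val_inj.
    by rewrite e.
  - have -> : lshift n (0 : 'I_1) = 0 by exact/val_inj.
    by rewrite e.
  have -> : lshift n (0 : 'I_1) = 0 by exact/val_inj.
  by rewrite -mx_trE Qs e.
have Q's : Q'^T = Q' by rewrite /Q' trmx_drsub Qs.
clearbody Q'.
have Q'i : Q' *m Q' = Q'.
  have := Qi; rewrite QE mulmx_block => /eq_block_mx[_ _ _].
  by rewrite mul0mx add0r.
have trQ : k%:R = 1 + \tr Q'.
  rewrite -trP -[in LHS](mulmx1 P) -CtC mulmxA mxtrace_mulC mulmxA QD.
  transitivity (\tr (Q : 'M[R]_(1 + n))) => //.
  by rewrite QE mxtrace_block mxtrace1.
have trQ0 : 0 <= \tr Q'.
  rewrite sym_idem_trace //; apply: sumr_ge0 => i _; apply: sumr_ge0 => j _; exact: sqr_ge0.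
case: k trP trQ => [|k] trP trQ.
  by exfalso; move: trQ trQ0; rewrite (_ : 0%:R = 0) //; lra.
have [B1 [HOO HOQ]] : exists O : 'M[R]_n, O *m O^T = 1%:M /\ O *m Q' *m O^T = pid_mx k.
  by apply: IH => //; move: trQ; rewrite -natr1; lra.
pose B : 'M[R]_(1 + n) := block_mx 1%:M 0 0 B1.
have BT : B^T = block_mx 1%:M 0 0 B1^T by rewrite /B tr_block_mx trmx1 !trmx0.
have BB : B *m B^T = 1%:M.
  rewrite BT /B mulmx_block !mul0mx !mulmx0 !addr0 add0r mulmx1 HOO.
  by rewrite -scalar_mx_block.
have BQB : B *m Q *m B^T = pid_mx k.+1.
  rewrite QE BT /B !mulmx_block !mul0mx !mulmx0 !addr0 !add0r ?mulmx1 ?mul0mx ?mulmx0 ?addr0 ?add0r HOQ.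
  apply/matrixP => i j; rewrite mxE [RHS]mxE.
  case: splitP => i' iE; rewrite mxE; case: splitP => j' jE; by rewrite !mxE iE jE ?ord1.
exists (B *m C); rewrite trmx_mul !mulmxA -(mulmxA B C C^T) CC mulmx1; split; first exact: BB.
by rewrite -(mulmxA (B *m C)) -(mulmxA B) (mulmxA C) QD.
Qed.

Lemma ord4_ind (P : 'I_4 -> Prop) : P 0 -> P 1 -> P 2 -> P 3 -> forall i, P i.
Proof.
move=> p0 p1 p2 p3 [[|[|[|[|//]]]] i4].
- by rewrite (_ : Ordinal i4 = 0) //; exact/val_inj.
- by rewrite (_ : Ordinal i4 = 1) //; exact/val_inj.
- by rewrite (_ : Ordinal i4 = 2) //; exact/val_inj.
by rewrite (_ : Ordinal i4 = 3) //; exact/val_inj.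
Qed.

Lemma sum_ord4 (V : nmodType) (F : 'I_4 -> V) : \sum_i F i = F 0 + F 1 + F 2 + F 3.
Proof.
rewrite !big_ord_recl big_ord0 addr0 !addrA.
by congr (F _ + F _ + F _ + F _); exact/val_inj.
Qed.

(** Each curvature endomorphism preserves the splitting 2 + 2, so by pair symmetry and the first
    Bianchi identity only planes inside one summand carry curvature. Each summand is a single plane,
    whose curvature, 1/2 or 0, is read from the Ricci contraction. *)
Lemma split_curvature (R : realFieldType) (K : 'I_4 -> 'I_4 -> 'I_4 -> 'I_4 -> R) :
  let s (i j : 'I_4) : R := 2^-1 * ((i == j) && (i < 2)%N)%:R in
  curvature_like K -> (forall a b i j : 'I_4, (i < 2)%N != (j < 2)%N -> K a b i j = 0) ->
  (forall b c, \sum_a K a b c a = s b c) ->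
  forall a b i j, K a b i j = 2 * (s i b * s a j - s i a * s b j).
Proof.
move=> s Kc Z2 ric; have [s1 s2 B] := Kc.
have Z1 (a b i j : 'I_4) : (a < 2)%N != (b < 2)%N -> K a b i j = 0.
  by move=> ab; rewrite (curvature_like_pair _ _ _ _ Kc) Z2.
have Z3 (a b i j : 'I_4) : (a < 2)%N != (i < 2)%N -> K a b i j = 0.
  move=> ai; have [ab|ab] := eqVneq (a < 2)%N (b < 2)%N; last exact: Z1.
  have := B a b i j; rewrite (Z1 b i) ?(Z1 i a) ?addr0 //; first by rewrite eq_sym.
  by rewrite -ab.
have d1 a i j : K a a i j = 0 by have := s1 a a i j; lra.
have d2 a b i : K a b i i = 0 by have := s2 a b i i; lra.
have k1 : K 1 0 0 1 = 2^-1.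
  by have := ric 0 0; rewrite sum_ord4 d1 (Z1 2 0) // (Z1 3 0) // /s /= mulr1 add0r !addr0.
have k2 : K 3 2 2 3 = 0.
  by have := ric 2 2; rewrite sum_ord4 d1 (Z1 0 2) // (Z1 1 2) // /s /= mulr0 !add0r.
have k3 : K 0 1 0 1 = - 2^-1 by rewrite s1 k1.
have k4 : K 2 3 2 3 = 0 by rewrite s1 k2 oppr0.
apply: ord4_ind; apply: ord4_ind; apply: ord4_ind; apply: ord4_ind; rewrite /s /=.
all: rewrite ?mulr0 ?mul0r ?subrr ?subr0 ?sub0r ?oppr0 ?mulr0 ?mulr1.
all: first [by rewrite d1 | by rewrite d2 | by rewrite Z1 | by rewrite Z2 | by rewrite Z3 |
  rewrite ?k1 ?k2 ?k3 ?k4; try by field].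
all: first [by rewrite s2 ?k1 ?k2 ?k3 ?k4; field | by rewrite s1 s2 ?k1 ?k2 ?k3 ?k4; field].
Qed.

Section CurvatureFormula.
Variables (R : rcfType) (A : comNzRingType) (kap : {rmorphism R -> A})
  (d : 'I_4 -> A -> A) (Y : 'I_4 -> 'M[A]_4) (h : R) (G S : 'M[A]_4) (N : 'rV[A]_4)
  (ev : {rmorphism A -> R}).
Hypothesis sr : soliton_ring kap d Y h G S N.
Hypothesis ev_kap : forall c, ev (kap c) = c.
Hypothesis posG : posdef (map_mx ev G).
Hypothesis par : forall a, Dric d Y S a = 0.
Let Ge := map_mx ev G.
Let Se := map_mx ev S.
Hypothesis idem : Se *m Se = 2^-1 *: Se.
Local Notation e_ a := (delta_mx 0 a : 'rV[R]_4).

Lemma adapted_frame : exists C Ci : 'M[R]_4,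
  [/\ C *m Ci = 1%:M, Ci *m C = 1%:M, C *m Ge *m C^T = 1%:M & C *m Se *m Ci = 2^-1 *: pid_mx 2].
Proof.
have [C [Ci [CCi CiC CGC _]]] := posdef_frame 0 (ev_Gsym ev sr) posG.
have GC : Ge *m C^T = Ci by rewrite -[LHS]mul1mx -CiC -mulmxA (mulmxA C) CGC mulmx1.
have sSG : (Se *m Ge)^T = Se *m Ge by rewrite -map_mxM map_trmx (sr_Ssym sr).
pose P := 2 *: (C *m Se *m Ci).
have Ps : P^T = P.
  rewrite /P linearZ /= -GC mulmxA -(mulmxA C Se) trmx_mul trmxK trmx_mul sSG.
  by rewrite !mulmxA.
have Pi : P *m P = P.
  rewrite /P -scalemxAl -scalemxAr !mulmxA -(mulmxA _ Ci C) CiC mulmx1 -(mulmxA C Se Se) idem.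
  by rewrite -scalemxAr -scalemxAl !scalerA; congr (_ *: _); field.
have trP : \tr P = 2%:R.
  rewrite /P mxtraceZ mxtrace_mulC mulmxA CiC mul1mx /Se trace_map_mx (sr_trace sr).
  by rewrite rmorph1 mulr1.
have [B [OO OP]] := proj_frame Ps Pi trP.
have OtO : B^T *m B = 1%:M by exact: mulmx1C.
exists (B *m C), (Ci *m B^T); split.
- by rewrite mulmxA -(mulmxA B) CCi mulmx1.
- by rewrite mulmxA -(mulmxA Ci) OtO mulmx1.
- by rewrite trmx_mul !mulmxA -(mulmxA B C Ge) -(mulmxA B (C *m Ge)) CGC mulmx1.
by rewrite -OP /P -scalemxAr -scalemxAl scalerA !mulmxA (_ : _ * _ = 1) ?scale1r //; field.
Qed.

(** In an adapted frame this is [split_curvature]. Both sides are bilinear in the directions a and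
    b, which carries the formula back to the original coordinates. *)
Lemma curvature_formula a b : map_mx ev (curv d Y a b) =
  2 *: (Se *m Ge *m ((e_ b)^T *m e_ a - (e_ a)^T *m e_ b) *m Se).
Proof.
have [C [Ci [CCi CiC CGC CSC]]] := adapted_frame.
have GC : Ge *m C^T = Ci by rewrite -[LHS]mul1mx -CiC -mulmxA (mulmxA C) CGC mulmx1.
pose d' := fr_der kap d C; pose Y' := fr_conn kap Y C Ci; pose S' := fr_endo kap C Ci S.
pose N' := fr_vec kap N Ci.
have sr' : soliton_ring kap d' Y' h (fr_metric kap G C) S' N' by exact: fr_soliton_ring.
have evG' : map_mx ev (fr_metric kap G C) = 1%:M by rewrite !map_mxM -map_trmx !(map_ev_kap ev_kap).
have evS' : map_mx ev S' = 2^-1 *: pid_mx 2 by rewrite -CSC; exact: ev_fr_endo.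
have par' c : Dric d' Y' S' c = 0.
  rewrite (fr_Dric sr CiC) big1 // => e _.
  by rewrite par /fr_endo mulmx0 mul0mx scaler0.
have sE i j : ev (S' i j) = 2^-1 * ((i == j) && (i < 2)%N)%:R.
  by have /matrixP/(_ i j) := evS'; rewrite [X in X = _ -> _]mxE => ->; rewrite !mxE.
pose K a b i j := ev (curv d' Y' a b i j).
(* The Ricci identity applied to the parallel endomorphism S; commuting with S means preserving its
   eigenspaces, the splitting 2 + 2. *)
have comm c e : S' *m curv d' Y' c e = curv d' Y' c e *m S'.
  apply/eqP; rewrite -subr_eq0 -(nabe_nabe (sr_diff sr')) -!/(Dric _ _ _ _) !par'.
  by rewrite /Dric /nabe !(dmx0 (sr_diff sr')) !mul0mx !mulmx0 !subr0 addr0 subrr.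
have KE : forall a b i j, K a b i j = 2 * (ev (S' i b) * ev (S' a j) - ev (S' i a) * ev (S' b j)).
  move=> a' b' i j; rewrite !sE; apply: (split_curvature (ev_curvature_like sr' evG')).
    move=> c e p q pq; move: (comm c e); move: (curv d' Y' c e) => Z HZ.
    have := congr1 (fun Z : 'M[A]_4 => ev (Z p q)) HZ.
    rewrite /= [in LHS]mxE [in RHS]mxE !rmorph_sum (bigD1 p) //= big1 ?addr0; last first.
      by move=> k kp; rewrite rmorphM sE eq_sym (negbTE kp) mulr0 mul0r.
    rewrite (bigD1 q) //= big1 ?addr0; last first.
      by move=> k kp; rewrite rmorphM [ev (S' _ _)]sE (negbTE kp) !mulr0.
    rewrite !rmorphM !sE !eqxx /=; move: pq (ev (Z p q)) => + z; case: (p < 2)%N; case: (q < 2)%N => //= _; lra.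
  by move=> c e; rewrite (ev_ric sr' evG') sE.
have frK a' b' : map_mx ev (curv d' Y' a' b') =
    \sum_e \sum_f (C a' e * C b' f) *: (C *m map_mx ev (curv d Y e f) *m Ci).
  rewrite (fr_curv sr CiC) map_mx_sum; apply: eq_bigr => e _; rewrite map_mx_sum.
  by apply: eq_bigr => f _; rewrite map_mxZ rmorphM !ev_kap (ev_fr_endo ev_kap).
pose T a b := 2 *: (Se *m Ge *m ((e_ b)^T *m e_ a - (e_ a)^T *m e_ b) *m Se).
have rowC a' : e_ a' *m C = \sum_e C a' e *: e_ e by rewrite -rowE [LHS]row_sum_delta; apply: eq_bigr => e _; rewrite mxE.
have TE a' b' : \sum_e \sum_f (C a' e * C b' f) *: (C *m T e f *m Ci) =
    2 *: (map_mx ev S' *m ((e_ b')^T *m e_ a' - (e_ a')^T *m e_ b') *m map_mx ev S').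
  have sw (u v : 'rV[R]_4) : C *m (Se *m Ge *m ((v *m C)^T *m (u *m C)) *m Se) *m Ci =
      map_mx ev S' *m (v^T *m u) *m map_mx ev S'.
    by rewrite evS' -CSC trmx_mul !mulmxA -(mulmxA (C *m Se) Ge) GC.
  transitivity (2 *: (C *m (Se *m Ge *m ((e_ b' *m C)^T *m (e_ a' *m C)) *m Se) *m Ci
     - C *m (Se *m Ge *m ((e_ a' *m C)^T *m (e_ b' *m C)) *m Se) *m Ci)); last first.
    by rewrite !sw mulmxBr mulmxBl.
  rewrite !rowC -mulmxBl -mulmxBr -mulmxBl -mulmxBr.
  have E (p q : 'I_4 -> R) : (\sum_e q e *: e_ e)^T *m (\sum_e p e *: e_ e) =
      \sum_e \sum_f (p e * q f) *: ((e_ f)^T *m e_ e).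
    rewrite mulmx_sumr; apply: eq_bigr => e _; rewrite linear_sum /= mulmx_suml; apply: eq_bigr => f _.
    by rewrite -scalemxAr [(q f *: _)^T]linearZ /= -scalemxAl scalerA.
  rewrite !E [X in _ - X]exchange_big -sumrB mulmx_sumr mulmx_suml mulmx_sumr mulmx_suml scaler_sumr.
  apply: eq_bigr => e _ /=; rewrite -sumrB mulmx_sumr mulmx_suml mulmx_sumr mulmx_suml scaler_sumr.
  apply: eq_bigr => f _; rewrite /T [C b' f * C a' e]mulrC -scalerBr.
  move: (C a' e * C b' f) (_ - _) => k X.
  have -> : Se *m Ge *m (k *: X) *m Se = k *: (Se *m Ge *m X *m Se) by rewrite -scalemxAr -scalemxAl.
  have L (z : R) (W : 'M[R]_4) : C *m (z *: W) *m Ci = z *: (C *m W *m Ci) by rewrite -scalemxAr -scalemxAl.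
  by rewrite !L !scalerA mulrC.
have EZ (Z : 'M[A]_4) (u v i j : 'I_4) :
    (map_mx ev Z *m ((e_ v)^T *m e_ u) *m map_mx ev Z) i j = ev (Z i v) * ev (Z u j).
  by rewrite mulmxA -mulmxA trmx_delta -colE -rowE mxE big_ord1 !mxE.
pose D e f := C *m (map_mx ev (curv d Y e f) - T e f) *m Ci.
have D0 a' b' : \sum_e \sum_f (C a' e * C b' f) *: D e f = 0.
  transitivity (map_mx ev (curv d' Y' a' b') -
     2 *: (map_mx ev S' *m ((e_ b')^T *m e_ a' - (e_ a')^T *m e_ b') *m map_mx ev S')).
    rewrite frK -TE -sumrB; apply: eq_bigr => e _; rewrite -sumrB; apply: eq_bigr => f _.
    by rewrite /D mulmxBr mulmxBl scalerBr.
  apply/matrixP => i j; rewrite [LHS]mxE [X in X + _]mxE -/(K a' b' i j) KE mx_0E mx_oppE.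
  apply/eqP; rewrite subr_eq0; apply/eqP; rewrite [RHS]mxE; congr (_ * _).
  by rewrite mulmxBr mulmxBl mx_addE mx_oppE !EZ.
have DE : D a b = C *m (map_mx ev (curv d Y a b) - T a b) *m Ci by [].
clearbody D; have Dz p q : D p q = 0.
  have H : \sum_a' \sum_b' (Ci p a' * Ci q b') *: (\sum_e \sum_f (C a' e * C b' f) *: D e f) = 0.
    by rewrite big1 // => a' _; rewrite big1 // => b' _; rewrite D0 scaler0.
  have CiCE x y : \sum_k Ci x k * C k y = (x == y)%:R.
    by have /matrixP/(_ x y) := CiC; rewrite !mxE.
  transitivity (\sum_e \sum_f ((p == e)%:R * (q == f)%:R) *: D e f).
    rewrite (bigD1 p) //= [X in _ + X]big1 ?addr0; last first.
      by move=> e ep; rewrite big1 // => f _; rewrite eq_sym (negbTE ep) mul0r scale0r.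
    rewrite (bigD1 q) //= big1 ?addr0 ?eqxx ?mulr1 ?scale1r // => f fq.
    by rewrite [q == f]eq_sym (negbTE fq) mulr0 scale0r.
  rewrite -[RHS]H; symmetry.
  under eq_bigr do under eq_bigr do rewrite scaler_sumr.
  under eq_bigr do rewrite exchange_big.
  rewrite exchange_big; apply: eq_bigr => e _ /=.
  under eq_bigr do under eq_bigr do rewrite scaler_sumr.
  under eq_bigr do rewrite exchange_big.
  rewrite exchange_big; apply: eq_bigr => f _ /=.
  rewrite -!CiCE big_distrlr scaler_suml; apply: eq_bigr => a' _ /=.
  by rewrite scaler_suml; apply: eq_bigr => b' _; rewrite scalerA; congr (_ *: _); ring.
have : Ci *m D a b *m C = 0 by rewrite Dz mulmx0 mul0mx.
rewrite DE !mulmxA CiC mul1mx -mulmxA CiC mulmx1 => /eqP; rewrite subr_eq0 => /eqP ->.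
by [].
Qed.

End CurvatureFormula.

(** * The flat linear system *)

Section SmoothMatrixCalculus.
Variables (R : realType) (U : set 'rV[R]_4).
Hypothesis oU : open U.

Lemma smooth_mx_nonempty p q (X : 'rV[R]_4 -> 'M[R]_(p, q)) :
  (forall x, U x -> smooth_mx U X) -> smooth_mx U X.
Proof. by move=> H i j; apply: smooth_on_nonempty => x Ux; exact: H Ux i j. Qed.

Let V x (Ux : U x) : open_set R 4 := OpenSet oU Ux.

Let repM p q r (X : 'rV[R]_4 -> 'M[R]_(p, q)) (Z : 'rV[R]_4 -> 'M[R]_(q, r)) x (Ux : U x)
  (sX : smooth_mx (V Ux) X) (sZ : smooth_mx (V Ux) Z) :
  represents (mk_smooth_mx sX *m mk_smooth_mx sZ) (fun y => X y *m Z y).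
Proof. by move=> y Uy; rewrite map_mxM (represents_mk sX Uy) (represents_mk sZ Uy). Qed.

Lemma smooth_mxM p q r (X : 'rV[R]_4 -> 'M[R]_(p, q)) (Z : 'rV[R]_4 -> 'M[R]_(q, r)) :
  smooth_mx U X -> smooth_mx U Z -> smooth_mx U (fun y => X y *m Z y).
Proof.
move=> sX sZ; apply: smooth_mx_nonempty => x Ux.
exact: (represents_smooth (@repM _ _ _ X Z x Ux sX sZ)).
Qed.

Lemma pdmM p q r (X : 'rV[R]_4 -> 'M[R]_(p, q)) (Z : 'rV[R]_4 -> 'M[R]_(q, r)) a x : U x ->
  smooth_mx U X -> smooth_mx U Z ->
  pdm a (fun y => X y *m Z y) x = pdm a X x *m Z x + X x *m pdm a Z x.
Proof.
move=> Ux sX sZ; rewrite -(represents_dmx a (@repM _ _ _ X Z x Ux sX sZ) Ux).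
rewrite (dmxM (smooth_diff_ring (V Ux))) map_mxD !map_mxM.
rewrite (represents_dmx a (represents_mk (U := V Ux) sX) Ux) (represents_dmx a (represents_mk (U := V Ux) sZ) Ux).
by rewrite (represents_mk (U := V Ux) sX Ux) (represents_mk (U := V Ux) sZ Ux).
Qed.

Lemma smooth_mxD p q (X Z : 'rV[R]_4 -> 'M[R]_(p, q)) :
  smooth_mx U X -> smooth_mx U Z -> smooth_mx U (fun y => X y + Z y).
Proof.
move=> sX sZ i j k; have -> : (fun y => (X y + Z y) i j) = (fun y => X y i j) + (fun y => Z y i j).
  by apply/funext => y; rewrite mxE.
exact: (CkD oU (sX i j k) (sZ i j k)).
Qed.

Lemma pdmD p q (X Z : 'rV[R]_4 -> 'M[R]_(p, q)) a x : U x ->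
  smooth_mx U X -> smooth_mx U Z -> pdm a (fun y => X y + Z y) x = pdm a X x + pdm a Z x.
Proof.
move=> Ux sX sZ; apply/matrixP => i j; rewrite !mxE /partial.
have -> : (fun y => (X y + Z y) i j) = (fun y => X y i j) + (fun y => Z y i j).
  by apply/funext => y; rewrite mxE.
have [_ /(_ a)[dX _]] := sX i j 1%N; have [_ /(_ a)[dZ _]] := sZ i j 1%N.
by rewrite deriveD //; [exact: dX|exact: dZ].
Qed.

Lemma smooth_mx_cst p q (B : 'M[R]_(p, q)) : smooth_mx U (fun=> B).
Proof. by move=> i j k; exact: Ck_cst. Qed.

Lemma pdm_cst p q (B : 'M[R]_(p, q)) (a : 'I_4) (x : 'rV[R]_4) : pdm a (fun=> B) x = 0.
Proof. by apply/matrixP => i j; rewrite !mxE /partial derive_cst. Qed.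

Lemma smooth_mx_tr p q (X : 'rV[R]_4 -> 'M[R]_(p, q)) : smooth_mx U X -> smooth_mx U (fun y => (X y)^T).
Proof.
move=> sX i j; have -> : (fun y => (X y)^T i j) = (fun y => X y j i) by apply/funext => y; rewrite mxE.
exact: sX.
Qed.

Lemma pdm_tr p q (X : 'rV[R]_4 -> 'M[R]_(p, q)) (a : 'I_4) (x : 'rV[R]_4) : pdm a (fun y => (X y)^T) x = (pdm a X x)^T.
Proof.
apply/matrixP => i j; rewrite !mxE; congr (partial a _ x).
by apply/funext => y; rewrite mxE.
Qed.

Lemma smooth_mxZ p q c (X : 'rV[R]_4 -> 'M[R]_(p, q)) : smooth_mx U X -> smooth_mx U (fun y => c *: X y).
Proof.
move=> sX; have := smooth_mxM (smooth_mx_cst c%:M) sX.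
by under eq_fun do rewrite mul_scalar_mx.
Qed.

Lemma pdmZ p q c (X : 'rV[R]_4 -> 'M[R]_(p, q)) a x : U x -> smooth_mx U X ->
  pdm a (fun y => c *: X y) x = c *: pdm a X x.
Proof.
move=> Ux sX; have := pdmM a Ux (smooth_mx_cst c%:M) sX.
under [X in pdm a X x]eq_fun do rewrite mul_scalar_mx.
by rewrite pdm_cst mul0mx add0r mul_scalar_mx.
Qed.

End SmoothMatrixCalculus.

Lemma const_on_ball (R : realType) n p q (X : 'rV[R]_n -> 'M[R]_(p, q)) x0 (r : R) :
  smooth_mx [set x | `|x - x0| < r] X -> (forall x a, `|x - x0| < r -> pdm a X x = 0) ->
  forall x, `|x - x0| < r -> X x = X x0.
Proof.
move=> sX dX x xr; apply/matrixP => i j.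
have H := @is_derive1_const_on R (fun t => X (x0 + t *: (x - x0)) i j) 0 1 ler01.
rewrite scale1r scale0r addr0 addrCA subrr addr0 in H; apply: H => t /andP[t0 t1].
have inb : `|x0 + t *: (x - x0) - x0| < r.
  rewrite addrAC subrr add0r normrZ ger0_norm //; apply: le_lt_trans xr.
  by rewrite ler_piMl.
have oB : open [set x | `|x - x0| < r] by exact: rV_ball_open.
apply: is_derive_eq (line_derive oB (sX i j 1%N) inb) _; rewrite big1 // => k _.
by have /matrixP/(_ i j) := dX _ k inb; rewrite !mxE => ->; rewrite mulr0.
Qed.

Lemma block_add_mul (R : pzRingType) (p1 a1 b1 : 'M[R]_4) (p2 a2 b2 : 'cV[R]_4) (p3 a3 b3 : 'rV[R]_4) :
  block_mx p1 p2 p3 (0 : 'M[R]_1) + block_mx a1 a2 a3 (0 : 'M[R]_1) *m block_mx b1 b2 b3 (0 : 'M[R]_1) =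
  block_mx (p1 + (a1 *m b1 + a2 *m b3)) (p2 + a1 *m b2) (p3 + a3 *m b1) (a3 *m b2).
Proof. by rewrite mulmx_block add_block_mx !mulmx0 !mul0mx !addr0 add0r. Qed.

(** Integrability block by block: the first block is the curvature formula, the two off-diagonal
    ones torsion-freeness, the last the symmetry of [s *m r]. *)
Lemma flat_algebra (R : fieldType) (ga gb s r pa pb : 'M[R]_4) (ea eb : 'rV[R]_4) :
  pa - pb + gb *m ga - ga *m gb = 2 *: (r *m (eb^T *m ea - ea^T *m eb) *m s) ->
  r^T = r -> r *m s^T = s *m r -> ea *m gb = eb *m ga ->
  block_mx (pa^T + (ga^T *m gb^T + 2 *: (s^T *m ea^T) *m - (eb *m r)))
    (2 *: ((ga *m s - s *m ga)^T *m eb^T) + ga^T *m (2 *: (s^T *m eb^T)))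
    (- (eb *m (ga *m r + r *m ga^T)) + - (ea *m r) *m gb^T)
    (- (ea *m r) *m (2 *: (s^T *m eb^T))) =
  block_mx (pb^T + (gb^T *m ga^T + 2 *: (s^T *m eb^T) *m - (ea *m r)))
    (2 *: ((gb *m s - s *m gb)^T *m ea^T) + gb^T *m (2 *: (s^T *m ea^T)))
    (- (ea *m (gb *m r + r *m gb^T)) + - (eb *m r) *m ga^T)
    (- (eb *m r) *m (2 *: (s^T *m ea^T))).
Proof.
move=> cu rs srs tor.
have tort : gb^T *m ea^T = ga^T *m eb^T by rewrite -!trmx_mul tor.
congr block_mx.
- have H : pa - pb + gb *m ga - ga *m gb = 2 *: (r *m eb^T *m ea *m s) - 2 *: (r *m ea^T *m eb *m s).
    by rewrite cu mulmxBr mulmxBl !mulmxA scalerBr.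
  have X1 : (r *m eb^T *m ea *m s)^T = s^T *m ea^T *m (eb *m r) by rewrite !trmx_mul rs trmxK !mulmxA.
  have X2 : (r *m ea^T *m eb *m s)^T = s^T *m eb^T *m (ea *m r) by rewrite !trmx_mul rs trmxK !mulmxA.
  rewrite -(trmx_mul gb ga) -(trmx_mul ga gb) !mulmxN -!scalemxAl -X1 -X2.
  move: (r *m eb^T *m ea *m s) (r *m ea^T *m eb *m s) (gb *m ga) (ga *m gb) H => q1 q2 q3 q4 H.
  apply/matrixP => i j; have /matrixP/(_ j i) := H; rewrite !mxE => H1.
  move: H1; move: (pa j i) (pb j i) (q1 j i) (q2 j i) (q3 j i) (q4 j i) => z1 z2 z3 z4 z5 z6 H1.
  have -> : z1 = 2 * z3 - 2 * z4 + z2 - z5 + z6 by rewrite -H1; ring.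
  by ring.
- rewrite -!scalemxAr -!scalerDr; congr (_ *: _).
  have Y g e : (g *m s - s *m g)^T *m e^T + g^T *m (s^T *m e^T) = s^T *m (g^T *m e^T) :> 'cV[R]_4.
    by rewrite linearB /= !trmx_mul mulmxBl -!mulmxA subrK.
  by rewrite !Y tort.
- rewrite !mulNmx -!opprD !mulmxDr !mulmxA; congr (- _).
  by rewrite tor -(addrA (eb *m ga *m r)) [X in _ + X]addrC addrA.
rewrite !mulNmx -!scalemxAr; congr (- (_ *: _)).
have E u v : u *m r *m (s^T *m v^T) = u *m (s *m r) *m v^T :> 'M[R]_1.
  by rewrite !mulmxA -(mulmxA u) srs !mulmxA.
have sr : (s *m r)^T = s *m r by rewrite trmx_mul rs srs.
rewrite !E; move: (s *m r) sr => q qs.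
rewrite [LHS]mx11_scalar [RHS]mx11_scalar; congr (_%:M).
by rewrite -[RHS]mx_trE !trmx_mul trmxK qs !mulmxA.
Qed.

Section FlatSystem.
Variables (R : realType) (U : set 'rV[R]_4) (G : 'rV[R]_4 -> 'M[R]_4) (F : 'rV[R]_4 -> R).
Hypothesis sc : soliton_chart U G F.
Hypothesis par : forall a x, U x -> Dric_of G a x = 0.
Hypothesis idem : forall x, U x -> ric_endo G x *m ric_endo G x = 2^-1 *: ric_endo G x.
Let oU := sc_open sc.
Local Notation S := (ric_endo G).
Local Notation Ga := (conn_of G).
Local Notation e_ a := (delta_mx 0 a : 'rV[R]_4).
Definition ricg x : 'M[R]_4 := S x *m G x.
Let sS := sc_smooth_ric_endo sc.
Let sG := sc_smooth_metric sc.
Let sGa := sc_smooth_conn sc.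

Lemma ricg_sym x : U x -> (ricg x)^T = ricg x.
Proof. by move=> Ux; rewrite /ricg -(sc_ricE sc Ux) (sc_ric_sym sc Ux). Qed.

Lemma ricg_tr x : U x -> G x *m (S x)^T = ricg x.
Proof. by move=> Ux; rewrite -(ricg_sym Ux) [RHS]trmx_mul (sc_sym sc Ux). Qed.

Lemma ric_endo_der a x : U x -> pdm a S x = Ga a x *m S x - S x *m Ga a x.
Proof.
move=> Ux; have := par a Ux; rewrite /Dric_of => /eqP; rewrite subr_eq0 => /eqP <-.
by rewrite addrK.
Qed.

Lemma ricg_der a x : U x -> pdm a ricg x = Ga a x *m ricg x + ricg x *m (Ga a x)^T.
Proof.
move=> Ux; rewrite (pdmM oU a Ux sS sG) (ric_endo_der a Ux) (sc_metric_der sc a Ux) /ricg.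
by rewrite mulmxBl mulmxDr !mulmxA addrA subrK.
Qed.

Lemma inv_metric_der a x : U x ->
  pdm a (fun x => invmx (G x)) x = - ((Ga a x)^T *m invmx (G x)) - invmx (G x) *m Ga a x.
Proof.
move=> Ux; have Gu := sc_unit sc Ux.
have H := pdmM oU a Ux sG (sc_smooth_inv sc).
have E : pdm a (fun y => G y *m invmx (G y)) x = 0.
  rewrite -(pdm_cst 1%:M a x); apply/matrixP => i j; rewrite !mxE.
  by apply: (partial_eq_on _ oU _ Ux) => y Uy; rewrite mulmxV ?mxE //; exact: (sc_unit sc Uy).
rewrite E (sc_metric_der sc a Ux) mulmxDl -mulmxA mulmxV // mulmx1 in H.
have : invmx (G x) *m (Ga a x + G x *m (Ga a x)^T *m invmx (G x) + G x *m pdm a (fun y => invmx (G y)) x) = 0.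
  by rewrite -H mulmx0.
rewrite !mulmxDr !mulmxA mulVmx // !mul1mx => /eqP; rewrite addrC addr_eq0 => /eqP ->.
by rewrite opprD addrC.
Qed.

Lemma sc_curvature a b x : U x ->
  pdm a (Ga b) x - pdm b (Ga a) x + Ga b x *m Ga a x - Ga a x *m Ga b x =
  2 *: (ricg x *m ((e_ b)^T *m e_ a - (e_ a)^T *m e_ b) *m S x).
Proof.
move=> Ux; pose V := OpenSet oU Ux : open_set R 4.
have [_ smG sF Gs Gp se s1] := sc.
have sr := @chart_soliton_ring R V G F smG sF Gs Gp se s1.
have RY := @rep_Y R V G smG Gp; have RS := @rep_S R V G smG Gp; have RG := @rep_G R V G smG.
have RD := @rep_Dric R V G smG Gp.
move: sr RY RS RG RD; move: (levi_civita _ _ _ _ _) => Y; move: (ring_S _ _ _ _ _) => Sm.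
move: (ring_N _ _ _) => Nm; move: (mk_smooth_mx _) => Gm sr RY RS RG RD.
have C := @curvature_formula R (smoothfun V) (sconst V) (sder (U := V)) _ _ _ _ _ (evs x : {rmorphism _ -> R}) sr (@evs_sconst R 4 V x).
have p0 c : Dric (sder (U := V)) Y Sm c = 0.
  by apply: represents_eq => y Uy; rewrite (RD c y Uy) (par c Uy) map_mx0.
rewrite (RG x Ux) (RS x Ux) in C; have {p0}C := C (sc_pos sc Ux) p0 (idem Ux) a b.
rewrite /ricg -C /curv map_mxB map_mxD map_mxB !map_mxM.
by rewrite (represents_dmx a (RY b) Ux) (represents_dmx b (RY a) Ux) (RY a x Ux) (RY b x Ux).
Qed.

(** The system for A and y, transposed to the form dW = W Theta required by [frobenius], with W the
    row block of A^T and y^T. *)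
Let Theta a x : 'M[R]_(4 + 1) :=
  block_mx (Ga a x)^T (2 *: ((S x)^T *m (e_ a)^T)) (- (e_ a *m ricg x)) 0.

Lemma pdm_block a x (A : 'rV[R]_4 -> 'M[R]_4) (B : 'rV[R]_4 -> 'cV[R]_4) (C : 'rV[R]_4 -> 'rV[R]_4)
    (D : 'rV[R]_4 -> 'M[R]_1) :
  pdm a (fun y => block_mx (A y) (B y) (C y) (D y)) x =
  block_mx (pdm a A x) (pdm a B x) (pdm a C x) (pdm a D x).
Proof.
rewrite -[LHS]submxK; congr block_mx; apply/matrixP => i j; rewrite !mxE.
- by congr (partial a _ x); apply/funext => y; rewrite block_mxEul.
- by congr (partial a _ x); apply/funext => y; rewrite block_mxEur.
- by congr (partial a _ x); apply/funext => y; rewrite block_mxEdl.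
by congr (partial a _ x); apply/funext => y; rewrite block_mxEdr.
Qed.

Let sR : smooth_mx U ricg. Proof. exact: smooth_mxM. Qed.
Let cM p q (B : 'M[R]_(p, q)) : smooth_mx U (fun=> B). Proof. exact: smooth_mx_cst. Qed.
Let s12 a : smooth_mx U (fun x => 2 *: ((S x)^T *m (e_ a)^T)).
Proof. by apply: smooth_mxZ => //; apply: smooth_mxM => //; exact: smooth_mx_tr. Qed.
Let s21 a : smooth_mx U (fun x => (- e_ a) *m ricg x).
Proof. exact: smooth_mxM. Qed.

Lemma flat_smooth a : smooth_mx U (Theta a).
Proof.
move=> i j.
have E : (fun y => Theta a y i j) = (fun y => match fintype.split i, fintype.split j with
   | inl i', inl j' => (Ga a y)^T i' j'
   | inl i', inr j' => (2 *: ((S y)^T *m (e_ a)^T)) i' j'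
   | inr i', inl j' => ((- e_ a) *m ricg y) i' j'
   | inr i', inr j' => 0 end).
  apply/funext => y; rewrite /Theta [LHS]mxE; case: (fintype.split i) => i'; rewrite [LHS]mxE; case: (fintype.split j) => j' //.
    by rewrite mulNmx.
  by rewrite mxE.
rewrite E; case: (fintype.split i) => i'; case: (fintype.split j) => j'.
- exact: smooth_mx_tr.
- exact: s12.
- exact: s21.
by move=> k; exact: (Ck_cst oU).
Qed.

Lemma flat_der a b x : U x -> pdm a (Theta b) x =
  block_mx (pdm a (Ga b) x)^T (2 *: ((pdm a S x)^T *m (e_ b)^T)) (- (e_ b *m pdm a ricg x)) 0.
Proof.
move=> Ux; rewrite /Theta pdm_block; congr block_mx.
- exact: pdm_tr.
- rewrite (pdmZ oU) //; last by apply: smooth_mxM => //; exact: smooth_mx_tr.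
  rewrite (@pdmM R U oU _ _ _ (fun y => (S y)^T) (fun=> (e_ b)^T)) //; last exact: smooth_mx_tr.
  by rewrite pdm_tr pdm_cst mulmx0 addr0.
- have -> : (fun y => - (e_ b *m ricg y)) = (fun y => (- e_ b) *m ricg y).
    by apply/funext => y; rewrite mulNmx.
  by rewrite (@pdmM R U oU _ _ _ (fun=> - e_ b) ricg) // pdm_cst mul0mx add0r mulNmx.
exact: pdm_cst.
Qed.

Lemma flat_integrable a b x : U x ->
  pdm a (Theta b) x + Theta a x *m Theta b x = pdm b (Theta a) x + Theta b x *m Theta a x.
Proof.
move=> Ux.
have K c e : pdm c (Theta e) x + Theta c x *m Theta e x = block_mx
    ((pdm c (Ga e) x)^T + ((Ga c x)^T *m (Ga e x)^T + 2 *: ((S x)^T *m (e_ c)^T) *m - (e_ e *m ricg x)))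
    (2 *: ((Ga c x *m S x - S x *m Ga c x)^T *m (e_ e)^T) + (Ga c x)^T *m (2 *: ((S x)^T *m (e_ e)^T)))
    (- (e_ e *m (Ga c x *m ricg x + ricg x *m (Ga c x)^T)) + - (e_ c *m ricg x) *m (Ga e x)^T)
    (- (e_ c *m ricg x) *m (2 *: ((S x)^T *m (e_ e)^T))).
  by rewrite (flat_der c e Ux) (ric_endo_der c Ux) (ricg_der c Ux); exact: block_add_mul.
have RS : ricg x *m (S x)^T = S x *m ricg x.
  by rewrite {1}/ricg -mulmxA (ricg_tr Ux).
have tor : e_ a *m Ga b x = e_ b *m Ga a x by rewrite -!rowE (sc_conn_sym sc _ _ Ux).
have A := flat_algebra (sc_curvature a b Ux) (ricg_sym Ux) RS tor.
exact: (etrans (K a b) (etrans A (esym (K b a)))).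
Qed.

Lemma flat_solution x0 (A0 : 'M[R]_(4, 5)) (y0 : 'rV[R]_5) : U x0 -> exists2 rho, 0 < rho &
  (forall x, `|x - x0| < rho -> U x) /\ exists (A : 'rV[R]_4 -> 'M[R]_(4, 5)) (y : 'rV[R]_4 -> 'rV[R]_5),
  [/\ A x0 = A0, y x0 = y0, smooth_mx [set x | `|x - x0| < rho] A, smooth_mx [set x | `|x - x0| < rho] y &
  forall x a, `|x - x0| < rho -> pdm a A x = Ga a x *m A x - ricg x *m (e_ a)^T *m y x /\
    pdm a y x = 2 *: (e_ a *m S x *m A x)].
Proof.
move=> Ux0; have [rho rho0 [rU H]] := frobenius oU Ux0 flat_smooth flat_integrable.
exists rho => //; split=> //.
have [W [W0 sW dW]] := H 5%N (row_mx A0^T y0^T).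
exists (fun x => (lsubmx (W x))^T), (fun x => (rsubmx (W x))^T); split.
- by rewrite W0 row_mxKl trmxK.
- by rewrite W0 row_mxKr trmxK.
- move=> i j; have -> : (fun x => (lsubmx (W x))^T i j) = (fun x => W x j (lshift 1 i)).
    by apply/funext => x; rewrite !mxE.
  exact: sW.
- move=> i j; have -> : (fun x => (rsubmx (W x))^T i j) = (fun x => W x j (rshift 4 i)).
    by apply/funext => x; rewrite !mxE.
  exact: sW.
move=> x a xr; rewrite !pdm_tr.
have E1 : pdm a (fun x => lsubmx (W x)) x = lsubmx (pdm a W x).
  apply/matrixP => i j; rewrite !mxE; congr (partial a _ x).
  by apply/funext => z; rewrite mxE.
have E2 : pdm a (fun x => rsubmx (W x)) x = rsubmx (pdm a W x).
  apply/matrixP => i j; rewrite !mxE; congr (partial a _ x).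
  by apply/funext => z; rewrite mxE.
rewrite E1 E2 dW // -[in X in _ /\ X](hsubmxK (W x)) -[in X in X /\ _](hsubmxK (W x)).
rewrite /Theta !mul_row_block !(row_mxKl, row_mxKr) !mulmx0 !addr0; have rs := ricg_sym (rU _ xr).
move: (lsubmx _) (rsubmx _) (Ga a x) (ricg x) (S x) (e_ a) rs => w1 w2 g r s e rs; split.
  by rewrite mulmxN linearB /= !trmx_mul !trmxK rs.
by rewrite -scalemxAr linearZ /= !trmx_mul !trmxK ?mulmxA.
Qed.

(* The pairing of two solutions of the flat system by a parallel form P. *)
Lemma flat_pairing x0 (rho : R) (P : 'rV[R]_4 -> 'M[R]_4) (A A' : 'rV[R]_4 -> 'M[R]_(4, 5))
    (y y' : 'rV[R]_4 -> 'rV[R]_5) :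
  (forall x, `|x - x0| < rho -> U x) -> smooth_mx U P ->
  (forall x a, U x -> pdm a P x = - ((Ga a x)^T *m P x) - P x *m Ga a x) ->
  (forall x, U x -> ricg x *m P x = S x /\ P x *m ricg x = (S x)^T) ->
  smooth_mx [set x | `|x - x0| < rho] A -> smooth_mx [set x | `|x - x0| < rho] A' ->
  smooth_mx [set x | `|x - x0| < rho] y -> smooth_mx [set x | `|x - x0| < rho] y' ->
  (forall x a, `|x - x0| < rho -> pdm a A x = Ga a x *m A x - ricg x *m (e_ a)^T *m y x /\
    pdm a y x = 2 *: (e_ a *m S x *m A x)) ->
  (forall x a, `|x - x0| < rho -> pdm a A' x = Ga a x *m A' x - ricg x *m (e_ a)^T *m y' x /\
    pdm a y' x = 2 *: (e_ a *m S x *m A' x)) ->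
  forall x, `|x - x0| < rho -> (A x)^T *m P x *m A' x + 2^-1 *: ((y x)^T *m y' x) =
    (A x0)^T *m P x0 *m A' x0 + 2^-1 *: ((y x0)^T *m y' x0).
Proof.
move=> rU sP dP RP sA sA' sy sy' dA dA'.
have oB : open [set x | `|x - x0| < rho] by exact: rV_ball_open.
have sP' : smooth_mx [set x | `|x - x0| < rho] P by move=> i j k; apply: Ck_sub (sP i j k) => x; exact: rU.
have t1 := smooth_mx_tr sA; have t2 := smooth_mx_tr sy.
have m1 := smooth_mxM oB t1 sP'; have m2 := smooth_mxM oB m1 sA'.
have m3 := smooth_mxM oB t2 sy'; have m4 := smooth_mxZ oB 2^-1 m3.
apply: (@const_on_ball R 4 5 5 (fun x => (A x)^T *m P x *m A' x + 2^-1 *: ((y x)^T *m y' x)) x0 rho).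
  exact: (smooth_mxD oB m2 m4).
move=> x a xr; have Ux := rU x xr.
rewrite (pdmD a xr m2 m4) (pdmZ oB 2^-1 a xr m3) (pdmM oB a xr m1 sA') (pdmM oB a xr t1 sP') (pdmM oB a xr t2 sy').
rewrite !pdm_tr (dP x a Ux); have [-> ->] := dA x a xr; have [-> ->] := dA' x a xr.
have [R1 R2] := RP x Ux; have Rs := ricg_sym Ux.
move: (A x) (A' x) (y x) (y' x) (P x) (ricg x) (S x) (Ga a x) R1 R2 Rs => a1 a2 y1 y2 p r s g R1 R2 Rs.
rewrite linearB linearZ /= !trmx_mul trmxK Rs.
rewrite !(mulmxBl, mulmxBr, mulmxDl, mulmxDr, mulmxN, mulNmx) !mulmxA.
rewrite -(mulmxA (y1^T *m e_ a) r p) R1 -(mulmxA a1^T p r) R2 -!scalemxAl -!scalemxAr scalerDr !scalerA !mulmxA.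
have -> : 2^-1 * 2 = 1 :> R by field.
rewrite !scale1r.
move: (a1^T *m g^T *m p *m a2) (y1^T *m e_ a *m s *m a2) (a1^T *m p *m g *m a2) (a1^T *m s^T *m (e_ a)^T *m y2).
by move=> z1 z2 z3 z4; apply/matrixP => i j; rewrite !mxE; ring.
Qed.

End FlatSystem.

(** * Developing charts *)

Definition Psph (R : pzRingType) : 'M[R]_5 := \matrix_(i, j) ((i == j) && (2 <= i)%N)%:R.
Arguments Psph {R}.

Lemma mul_Psph (R : pzRingType) n (X : 'M[R]_(n, 5)) i k : (X *m Psph) i k = X i k * (2 <= k)%N%:R.
Proof.
rewrite mxE (bigD1 k) //= mxE eqxx /= big1 ?addr0 // => j jk.
by rewrite mxE (negbTE jk) mulr0.
Qed.

Lemma tr_Psph (R : pzRingType) : (Psph : 'M[R]_5)^T = Psph.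
Proof.
apply/matrixP => i j; rewrite !mxE; have [->|ij] := eqVneq j i; first by [].
by [].
Qed.

Lemma Psph_idem (R : pzRingType) : (Psph : 'M[R]_5) *m Psph = Psph.
Proof. by apply/matrixP => i j; rewrite mul_Psph !mxE; case: eqP => [->|]; case: (2 <= _)%N; rewrite ?mulr1 ?mulr0 ?mul0r. Qed.

(* A local isometry psi into R^2 x S^2(sqrt 2) inside R^5, normalized by the
   gradient of the potential; Psph projects onto the R^3 that contains the sphere. *)
Record dev_chart (R : realType) (U : set 'rV[R]_4) (G : 'rV[R]_4 -> 'M[R]_4) (F : 'rV[R]_4 -> R)
    (psi : 'rV[R]_4 -> 'rV[R]_5) : Prop := DevChart {
  dc_smooth : forall k, smooth_on U (fun x => psi x 0 k);
  dc_gram : forall x, U x -> jacobian_mx psi x *m (jacobian_mx psi x)^T = G x;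
  dc_perp : forall x, U x -> jacobian_mx psi x *m (psi x *m Psph)^T = 0;
  dc_norm : forall x, U x -> (psi x *m Psph) *m (psi x *m Psph)^T = 2%:M;
  dc_ric : forall x, U x -> 2 *: (ric_endo G x *m jacobian_mx psi x) = jacobian_mx psi x *m Psph;
  dc_pos : forall x, U x -> psi x = 2 *: (grad_of G F x *m jacobian_mx psi x) + psi x *m Psph;
  dc_hess : forall x k, U x ->
    hessian G (fun x => psi x 0 k) x = - ((psi x *m Psph) 0 k) *: ricci G x }.

(** The hypothesis says that the square matrix with rows A and y has the left inverse formed by A^T
    G^-1 and y^T / 2. A left inverse is a right inverse, and the blocks of that product are the
    three conclusions. *)
Lemma dual_frame (R : fieldType) (G A0 : 'M[R]_4) (A : 'M[R]_(4, 5)) (y : 'rV[R]_5) : 2 != 0 :> R -> G \in unitmx ->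
  A^T *m invmx G *m A + 2^-1 *: (y^T *m y) = 1%:M ->
  [/\ A *m A^T = G, A *m y^T = 0 & y *m y^T = 2%:M].
Proof.
move=> n2 Gu H; pose W : 'M[R]_(4 + 1, 5) := col_mx A y.
pose V : 'M[R]_(5, 4 + 1) := row_mx (A^T *m invmx G) (2^-1 *: y^T).
have VW : V *m W = 1%:M by rewrite /V /W mul_row_col -scalemxAl.
have WV : W *m V = 1%:M by exact: (@mulmx1C R 5 V W VW).
move: WV; rewrite /W /V mul_col_row -[1%:M]/(1%:M : 'M[R]_(4 + 1)) scalar_mx_block.
move=> /eq_block_mx[E1 E2 _ E4]; split.
- by rewrite -[LHS](mulmxKV Gu) -(mulmxA A) E1 mul1mx.
- by have := congr1 ( *:%R 2) E2; rewrite -scalemxAr scalerA mulfV // scale1r scaler0.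
by have := congr1 ( *:%R 2) E4; rewrite -scalemxAr scalerA mulfV // scale1r scale_scalar_mx mulr1.
Qed.

Lemma perp_tr (R : fieldType) (A : 'M[R]_(4, 5)) (y : 'rV[R]_5) : A *m y^T = 0 -> y *m A^T = 0.
Proof. by move=> h; rewrite -[LHS]trmxK trmx_mul trmxK h trmx0. Qed.

Lemma frame_project (R : fieldType) (G Q : 'M[R]_4) (A A' : 'M[R]_(4, 5)) (y y' : 'rV[R]_5) : 2 != 0 :> R ->
  A *m A^T = G -> A *m y^T = 0 -> y *m y^T = 2%:M ->
  A *m (A^T *m Q *m A' + 2^-1 *: (y^T *m y')) = G *m Q *m A' /\
  y *m (A^T *m Q *m A' + 2^-1 *: (y^T *m y')) = y'.
Proof.
move=> n2 h1 h2 h3; have h2' := perp_tr h2.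
rewrite !mulmxDr -!scalemxAr !mulmxA h1 h2 h2' h3 !mul0mx scaler0 addr0 add0r; split=> //.
by rewrite mul_scalar_mx scalerA mulVf // scale1r.
Qed.

Lemma frame_mul (R : fieldType) (Gi : 'M[R]_4) (A A' : 'M[R]_(4, 5)) (y y' : 'rV[R]_5) (g : 'M[R]_5) :
  A' *m g = A -> y' *m g = y ->
  (A^T *m Gi *m A' + 2^-1 *: (y^T *m y')) *m g = A^T *m Gi *m A + 2^-1 *: (y^T *m y).
Proof. by move=> h1 h2; rewrite mulmxDl -scalemxAl -!mulmxA h1 h2. Qed.

Lemma position_derivative (R : numFieldType) (e N : 'rV[R]_4) (S Ga r : 'M[R]_4) (A : 'M[R]_(4, 5)) (y : 'rV[R]_5) :
  N *m r = 0 ->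
  2 *: ((e *m (2^-1%:M - S) - N *m Ga) *m A + N *m (Ga *m A - r *m e^T *m y)) + 2 *: (e *m S *m A) = e *m A.
Proof.
move=> h; have -> : N *m (Ga *m A - r *m e^T *m y) = N *m Ga *m A.
  by rewrite mulmxBr !mulmxA h !mul0mx subr0.
rewrite mulmxBl mulmxBr mulmxBl mul_mx_scalar -scalemxAl.
move: (e *m A) (e *m S *m A) (N *m Ga *m A) => z1 z2 z3.
by apply/matrixP => i j; rewrite !mxE; field.
Qed.

Lemma projected_norm (R : fieldType) (G Q : 'M[R]_4) (A : 'M[R]_(4, 5)) (P : 'M[R]_5) (v : 'rV[R]_4) :
  P^T = P -> P *m P = P -> A *m P = 2 *: (Q *m A) -> A *m A^T = G ->
  (v *m A *m P) *m (v *m A *m P)^T = 2 *: (v *m (Q *m G) *m v^T).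
Proof.
move=> Pt PP AP AA; have E : A *m P *m (A *m P)^T = 2 *: (Q *m G).
  by rewrite trmx_mul Pt mulmxA -(mulmxA A) PP AP -scalemxAl -mulmxA AA.
have -> : v *m A *m P = v *m (A *m P) by rewrite mulmxA.
move: (A *m P) E => X E.
have -> : v *m X *m (v *m X)^T = v *m (X *m X^T) *m v^T by rewrite trmx_mul !mulmxA.
by rewrite E -scalemxAr -scalemxAl.
Qed.

Lemma frame_commute (R : fieldType) (Gi Q : 'M[R]_4) (A A' : 'M[R]_(4, 5)) (y y' : 'rV[R]_5) (P : 'M[R]_5) :
  P^T = P -> y *m P = y -> y' *m P = y' -> A *m P = 2 *: (Q *m A) -> A' *m P = 2 *: (Q *m A') ->
  Q^T *m Gi = Gi *m Q ->
  (A^T *m Gi *m A' + 2^-1 *: (y^T *m y')) *m P = P *m (A^T *m Gi *m A' + 2^-1 *: (y^T *m y')).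
Proof.
move=> Pt h1 h2 h3 h4 h5.
have E1 : P *m A^T = 2 *: (A^T *m Q^T) by rewrite -{1}Pt -trmx_mul h3 linearZ /= trmx_mul.
have E2 : P *m y^T = y^T by rewrite -{1}Pt -trmx_mul h1.
rewrite mulmxDl mulmxDr -scalemxAl -scalemxAr -(mulmxA _ y') h2 !(mulmxA P) E1 E2.
rewrite -(mulmxA _ A') h4 -scalemxAr -!scalemxAl; congr (_ *: _ + _).
by rewrite -(mulmxA _ Q^T) h5 !mulmxA.
Qed.

Lemma frame_complete (R : fieldType) (G : 'M[R]_4) (A : 'M[R]_(4, 5)) (y : 'rV[R]_5) : 2 != 0 :> R ->
  G \in unitmx -> A *m A^T = G -> A *m y^T = 0 -> y *m y^T = 2%:M ->
  A^T *m invmx G *m A + 2^-1 *: (y^T *m y) = 1%:M.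
Proof.
move=> n2 Gu h1 h2 h3.
pose W : 'M[R]_(4 + 1, 5) := col_mx A y.
pose V : 'M[R]_(5, 4 + 1) := row_mx (A^T *m invmx G) (2^-1 *: y^T).
have WV : W *m V = 1%:M.
  rewrite /W /V mul_col_row -!scalemxAr !mulmxA h1 h2 h3 (perp_tr h2).
  by rewrite mulmxV // mul0mx scaler0 scale_scalar_mx mulVf // -scalar_mx_block.
have : V *m W = 1%:M by exact: (@mulmx1C R 5 W V WV).
by rewrite /V /W mul_row_col -scalemxAl.
Qed.

Section DevChart.
Variables (R : realType) (U : set 'rV[R]_4) (G : 'rV[R]_4 -> 'M[R]_4) (F : 'rV[R]_4 -> R).
Hypothesis sc : soliton_chart U G F.
Hypothesis par : forall a x, U x -> Dric_of G a x = 0.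
Hypothesis idem : forall x, U x -> ric_endo G x *m ric_endo G x = 2^-1 *: ric_endo G x.
Let oU := sc_open sc.
Local Notation S := (ric_endo G).
Local Notation N := (grad_of G F).
Local Notation Ga := (conn_of G).
Local Notation rg := (ricg G).
Local Notation e_ a := (delta_mx 0 a : 'rV[R]_4).

Let inv_ric x : U x -> (S x)^T *m invmx (G x) = invmx (G x) *m S x.
Proof.
move=> Ux; have Gu := sc_unit sc Ux; have E := ricg_tr sc Ux.
rewrite -[LHS](mulKmx Gu) (mulmxA (G x)) E /ricg -(mulmxA (S x)) mulmxV // mulmx1.
by [].
Qed.

Lemma parallel_inv_metric : smooth_mx U (fun x => invmx (G x)) /\
  forall x, U x -> rg x *m invmx (G x) = S x /\ invmx (G x) *m rg x = (S x)^T.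
Proof.
split=> [|x Ux]; first exact: sc_smooth_inv sc.
have Gu := sc_unit sc Ux; split; first by rewrite /ricg mulmxK.
by rewrite -(ricg_tr sc Ux) mulKmx.
Qed.

(** A second parallel form: 2 S is the projector onto the curved directions, so this is the inverse
    metric restricted to them. Pairing with it yields [Psph] where the full inverse metric yields
    the identity. *)
Lemma parallel_inv_ric : [/\ smooth_mx U (fun x => 2 *: ((S x)^T *m invmx (G x))),
  forall x a, U x -> pdm a (fun x => 2 *: ((S x)^T *m invmx (G x))) x =
    - ((Ga a x)^T *m (2 *: ((S x)^T *m invmx (G x)))) - 2 *: ((S x)^T *m invmx (G x)) *m Ga a x &
  forall x, U x -> rg x *m (2 *: ((S x)^T *m invmx (G x))) = S x /\
    2 *: ((S x)^T *m invmx (G x)) *m rg x = (S x)^T].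
Proof.
have sT := smooth_mx_tr (sc_smooth_ric_endo sc).
have sP := smooth_mxM oU sT (sc_smooth_inv sc); split.
- exact: smooth_mxZ.
- move=> x a Ux; rewrite (pdmZ oU 2 a Ux sP) (pdmM oU a Ux sT (sc_smooth_inv sc)) pdm_tr.
  rewrite (ric_endo_der par a Ux) (inv_metric_der sc a Ux).
  move: (Ga a x) (S x) (invmx (G x)) => g s p.
  rewrite linearB /= !trmx_mul mulmxBl mulmxBr !mulmxN !mulmxA -!scalemxAr -!scalemxAl !mulmxA.
  move: (s^T *m g^T *m p) (g^T *m s^T *m p) (s^T *m p *m g) => z1 z2 z3.
  by apply/matrixP => i j; rewrite !mxE; ring.
move=> x Ux; have Gu := sc_unit sc Ux; have h2 : 2 * 2^-1 = 1 :> R by field.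
split.
  rewrite inv_ric // -scalemxAr /ricg mulmxA mulmxK // idem // scalerA h2 scale1r //.
rewrite -scalemxAl -(ricg_tr sc Ux) -mulmxA mulKmx //.
by rewrite -trmx_mul idem // linearZ /= scalerA h2 scale1r.
Qed.

Lemma sc_adapted_frame x : U x -> exists C Ci : 'M[R]_4,
  [/\ C *m Ci = 1%:M, Ci *m C = 1%:M, C *m G x *m C^T = 1%:M & C *m S x *m Ci = 2^-1 *: pid_mx 2].
Proof.
move=> Ux; pose V := OpenSet oU Ux : open_set R 4.
have [_ smG sF Gs Gp se s1] := sc.
have sr := @chart_soliton_ring R V G F smG sF Gs Gp se s1.
have RS := @rep_S R V G smG Gp; have RG := @rep_G R V G smG.
move: sr RS RG; move: (levi_civita _ _ _ _ _) => Y; move: (ring_S _ _ _ _ _) => Sm.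
move: (ring_N _ _ _) => Nm; move: (mk_smooth_mx _) => Gm sr RS RG.
have C := @adapted_frame R (smoothfun V) (sconst V) (sder (U := V)) _ _ _ _ _ (evs x : {rmorphism _ -> R}) sr.
by rewrite (RG x Ux) (RS x Ux) in C; exact: (C (sc_pos sc Ux) (idem Ux)).
Qed.

(** The adapted frame lists the two curved directions first; B sends them to coordinates 2 and 3 of
    R^5 and the flat ones to 0 and 1, leaving coordinate 4 to the pole y. *)
Let B : 'M[R]_(4, 5) := \matrix_(i, k) ((k : nat) == ((i + 2) %% 4)%N)%:R.
Let e4 : 'rV[R]_5 := delta_mx 0 ord_max.

Let BtB : B^T *m B + e4^T *m e4 = 1%:M.
Proof.
apply/matrixP => i j; rewrite /e4 trmx_delta mul_delta_mx !mxE !big_ord_recl big_ord0 !mxE.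
case: i => [[|[|[|[|[|//]]]]] ?]; case: j => [[|[|[|[|[|//]]]]] ?]; rewrite /=.
all: by rewrite ?(mulr0, mul0r, mulr1, mul1r, addr0, add0r).
Qed.

Let BpB : B^T *m pid_mx 2 *m B + e4^T *m e4 = Psph.
Proof.
apply/matrixP => i j; rewrite /e4 trmx_delta mul_delta_mx !mxE !big_ord_recl big_ord0 !mxE.
rewrite !big_ord_recl !big_ord0 !mxE.
case: i => [[|[|[|[|[|//]]]]] ?]; case: j => [[|[|[|[|[|//]]]]] ?]; rewrite /=.
all: by rewrite ?(mulr0, mul0r, mulr1, mul1r, addr0, add0r).
Qed.

(** The initial values make the two pairings equal to the identity and to [Psph] at x0; both are
    constant, and [dual_frame] turns them into the algebraic clauses of [dev_chart] on the whole
    ball. *)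
Lemma chart_dev_exists x0 (sg : R) : U x0 -> sg ^+ 2 = 2 -> exists2 rho, 0 < rho &
  (forall x, `|x - x0| < rho -> U x) /\ exists psi, dev_chart [set x | `|x - x0| < rho] G F psi /\
    psi x0 *m Psph = sg *: delta_mx 0 ord_max.
Proof.
move=> Ux0 sg2; have [C [Ci [CCi CiC CGC CSC]]] := sc_adapted_frame Ux0.
have n2 : 2 != 0 :> R by rewrite pnatr_eq0.
pose A0 := Ci *m B; pose y0 : 'rV[R]_5 := sg *: e4.
have Gi : invmx (G x0) = C^T *m C.
  have Gu := sc_unit sc Ux0; apply: (can_inj (mulKmx Gu)); rewrite mulmxV // mulmxA.
  have -> : G x0 *m C^T = Ci by rewrite -[LHS]mul1mx -CiC -mulmxA (mulmxA C) CGC mulmx1.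
  by rewrite CiC.
have yy : 2^-1 *: (y0^T *m y0) = e4^T *m e4.
  have -> : y0^T = sg *: e4^T by rewrite /y0 linearZ.
  rewrite /y0; move: (e4^T) => u; rewrite -scalemxAl -scalemxAr !scalerA -mulrA -expr2 sg2 mulVf // scale1r //.
have K1 : A0^T *m invmx (G x0) *m A0 + 2^-1 *: (y0^T *m y0) = 1%:M.
  rewrite yy /A0 Gi trmx_mul !mulmxA -(mulmxA _ Ci^T) -trmx_mul CCi trmx1 mulmx1.
  by rewrite -(mulmxA _ C) CCi mulmx1 BtB.
have K2 : A0^T *m (2 *: ((S x0)^T *m invmx (G x0))) *m A0 + 2^-1 *: (y0^T *m y0) = Psph.
  rewrite yy -BpB; congr (_ + _); rewrite /A0 Gi trmx_mul -scalemxAr -scalemxAl !mulmxA.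
  have E : Ci^T *m (S x0)^T *m C^T = 2^-1 *: pid_mx 2.
    by rewrite -!trmx_mul mulmxA CSC linearZ /= tr_pid_mx.
  have E' : B^T *m Ci^T *m (S x0)^T *m C^T = B^T *m (2^-1 *: pid_mx 2) by rewrite -E !mulmxA.
  rewrite -(mulmxA _ C Ci) CCi mulmx1 E'.
  by rewrite -scalemxAr -scalemxAl scalerA mulfV // scale1r.
have [rho rho0 [rU [A [y [A00 y00 sA sy dA]]]]] := flat_solution sc par idem A0 y0 Ux0.
exists rho => //; split=> //.
have oB : open [set x | `|x - x0| < rho] by exact: rV_ball_open.
have [p1 p2] := parallel_inv_metric; have [q1 q2 q3] := parallel_inv_ric.
have I1 x (xr : `|x - x0| < rho) : A x *m (A x)^T = G x /\ A x *m (y x)^T = 0 /\ y x *m (y x)^T = 2%:M.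
  have := flat_pairing sc rU p1 (fun x a Ux => inv_metric_der sc a Ux) p2 sA sA sy sy dA dA xr.
  rewrite A00 y00 K1 => H.
  by have [h1 h2 h3] := dual_frame 0 n2 (sc_unit sc (rU _ xr)) H.
have I2 x (xr : `|x - x0| < rho) : 2 *: (S x *m A x) = A x *m Psph /\ y x *m Psph = y x.
  have := flat_pairing sc rU q1 q2 q3 sA sA sy sy dA dA xr; rewrite A00 y00 K2 => H.
  have [h1 [h2 h3]] := I1 x xr; have Ux := rU _ xr.
  have [e1 e2] := frame_project (2 *: ((S x)^T *m invmx (G x))) (A x) (y x) n2 h1 h2 h3.
  rewrite H in e1 e2; split=> //; rewrite e1 -scalemxAr -scalemxAl; congr (_ *: _).
  by rewrite mulmxA (ricg_tr sc Ux) /ricg mulmxK // (sc_unit sc Ux).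
pose psi x := 2 *: (N x *m A x) + y x.
have sN : smooth_mx [set x | `|x - x0| < rho] N.
  by move=> i j k; apply: Ck_sub (sc_smooth_grad sc i j k) => x; exact: rU.
have sNA := smooth_mxM oB sN sA; have sNA2 := smooth_mxZ oB 2 sNA.
have spsi : smooth_mx [set x | `|x - x0| < rho] psi by exact: smooth_mxD.
have dpsi x a : `|x - x0| < rho -> pdm a psi x = row a (A x).
  move=> xr; have Ux := rU _ xr.
  rewrite (pdmD a xr sNA2 sy) (pdmZ oB 2 a xr sNA) (pdmM oB a xr sN sA).
  have [-> ->] := dA x a xr; rewrite (sc_grad_der sc a Ux) !rowE.
  by apply: position_derivative; rewrite /ricg mulmxA (sc_grad_ric sc Ux) mul0mx.
have jac x : `|x - x0| < rho -> jacobian_mx psi x = A x.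
  move=> xr; apply/matrixP => a k; rewrite [LHS]mxE.
  by have /rowP/(_ k) := dpsi x a xr; rewrite !mxE.
have psiP x : `|x - x0| < rho -> psi x *m Psph = y x.
  move=> xr; have [E1 E2] := I2 x xr; rewrite /psi mulmxDl E2 -scalemxAl -mulmxA -E1.
  by rewrite -scalemxAr mulmxA (sc_grad_ric sc (rU _ xr)) mul0mx !scaler0 add0r.
exists psi; split; last by rewrite psiP ?subrr ?normr0 // y00.
split=> [k|x xr|x xr|x xr|x xr|x xr|x k xr]; rewrite ?psiP ?jac //.
- by have [] := I1 x xr.
- by have [_ []] := I1 x xr.
- by have [_ []] := I1 x xr.
- by have [] := I2 x xr.
apply/matrixP => a b; rewrite (sc_ricE sc (rU _ xr)) -/(rg x) [LHS]mxE.
rewrite (@partial_eq_on _ _ [set x | `|x - x0| < rho] _ (fun x => A x b k) a x oB) //; last first.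
  move=> z zr; have /matrixP/(_ b k) := jac z zr; rewrite [LHS]mxE => <-.
  by [].
have [dAx _] := dA x a xr; have /matrixP/(_ b k) := dAx; rewrite [LHS]mxE => ->.
have E : (Ga a x *m A x) b k = \sum_l christoffel G l a b x * partial l (fun x => psi x 0 k) x.
  rewrite mxE; apply: eq_bigr => l _; rewrite [Ga a x b l]mxE; congr (_ * _).
  by have /matrixP/(_ l k) := jac x xr; rewrite [LHS]mxE.
rewrite mx_addE mx_oppE E addrAC subrr add0r.
rewrite [RHS]mxE mulNr; congr (- _); rewrite [LHS]mxE big_ord1 mulrC; congr (_ * _).
by rewrite trmx_delta -colE [LHS]mxE -[RHS]mx_trE (ricg_sym sc (rU _ xr)).
Qed.

(** The differentials and spherical parts of psi and psi' solve the same flat system, so their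
    mutual pairing is a constant matrix g. The clause [dc_pos] recovers the whole map from them,
    which excludes translations. *)
Lemma chart_dev_transition x0 (rho : R) psi psi' : 0 < rho -> (forall x, `|x - x0| < rho -> U x) ->
  dev_chart [set x | `|x - x0| < rho] G F psi -> dev_chart [set x | `|x - x0| < rho] G F psi' ->
  exists g : 'M[R]_5, [/\ g *m g^T = 1%:M, g *m Psph = Psph *m g &
    forall x, `|x - x0| < rho -> psi' x = psi x *m g].
Proof.
move=> rho0 rU dv dv'; have n2 : 2 != 0 :> R by rewrite pnatr_eq0.
have oB : open [set x | `|x - x0| < rho] by exact: rV_ball_open.
pose A (p : 'rV[R]_4 -> 'rV[R]_5) x := jacobian_mx p x; pose y (p : 'rV[R]_4 -> 'rV[R]_5) x := p x *m Psph.
have sys p : dev_chart [set x | `|x - x0| < rho] G F p ->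
  [/\ smooth_mx [set x | `|x - x0| < rho] (A p), smooth_mx [set x | `|x - x0| < rho] (y p) &
   forall x a, `|x - x0| < rho -> pdm a (A p) x = Ga a x *m A p x - rg x *m (e_ a)^T *m y p x /\
    pdm a (y p) x = 2 *: (e_ a *m S x *m A p x)].
  move=> d; have sp : smooth_mx [set x | `|x - x0| < rho] p by move=> i j; rewrite ord1; exact: dc_smooth d j.
  have sA : smooth_mx [set x | `|x - x0| < rho] (A p).
    move=> b k n; have -> : (fun x => A p x b k) = partial b (fun x => p x 0 k).
      by apply/funext => x; rewrite /A mxE.
    by have [_ /(_ b)[]] := dc_smooth d k n.+1.
  have cP := smooth_mx_cst oB (Psph : 'M[R]_5).
  split=> //; first exact: smooth_mxM.
  move=> x a xr; split; last first.
    rewrite /y (pdmM oB a xr sp cP) pdm_cst mulmx0 addr0.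
    have -> : pdm a p x = e_ a *m A p x.
      by rewrite -rowE; apply/rowP => k; rewrite !mxE.
    by rewrite -mulmxA -(dc_ric d xr) -scalemxAr mulmxA.
  apply/matrixP => b k; have /matrixP/(_ a b) := dc_hess d k xr; rewrite [LHS]mxE (sc_ricE sc (rU _ xr)) -/(rg x).
  move=> /eqP; rewrite subr_eq => /eqP H.
  transitivity (partial a (partial b (fun x => p x 0 k)) x).
    rewrite [LHS]mxE; congr (partial a _ x); apply/funext => z; by rewrite /A mxE.
  rewrite H mx_addE mx_oppE [RHS]addrC; congr (_ + _); last first.
    by rewrite [RHS]mxE; apply: eq_bigr => l _; rewrite [Ga a x b l]mxE /A [jacobian_mx _ _ _ _]mxE.
  rewrite [LHS]mxE mulNr; congr (- _); rewrite [RHS]mxE big_ord1 mulrC; congr (_ * _).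
  by rewrite trmx_delta -colE [RHS]mxE -[LHS]mx_trE (ricg_sym sc (rU _ xr)).
have [sA sy dA] := sys _ dv; have [sA' sy' dA'] := sys _ dv'.
have [p1 p2] := parallel_inv_metric.
have pair q q' x : dev_chart [set x | `|x - x0| < rho] G F q -> dev_chart [set x | `|x - x0| < rho] G F q' ->
   `|x - x0| < rho -> (A q x)^T *m invmx (G x) *m A q' x + 2^-1 *: ((y q x)^T *m y q' x) =
   (A q x0)^T *m invmx (G x0) *m A q' x0 + 2^-1 *: ((y q x0)^T *m y q' x0).
  move=> d d' xr; have [a1 a2 a3] := sys _ d; have [b1 b2 b3] := sys _ d'.
  exact: (flat_pairing sc rU p1 (fun x a Ux => inv_metric_der sc a Ux) p2 a1 b1 a2 b2 a3 b3 xr).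
pose gm q q' := (A q x0)^T *m invmx (G x0) *m A q' x0 + 2^-1 *: ((y q x0)^T *m y q' x0).
have tr q q' x : dev_chart [set x | `|x - x0| < rho] G F q -> dev_chart [set x | `|x - x0| < rho] G F q' ->
   `|x - x0| < rho -> A q x *m gm q q' = A q' x /\ y q x *m gm q q' = y q' x.
  move=> d d' xr;   have [e1 e2] := frame_project (invmx (G x)) (A q' x) (y q' x) n2 (dc_gram d xr) (dc_perp d xr) (dc_norm d xr).
  rewrite /gm -(pair q q' x) //; split; last exact: e2.
  by rewrite [LHS]e1 mulmxV ?mul1mx // (sc_unit sc (rU _ xr)).
have xx : `|x0 - x0| < rho by rewrite subrr normr0.
exists (gm psi psi'); split.
- have gt : (gm psi psi')^T = gm psi' psi.
    rewrite /gm linearD linearZ /= !trmx_mul !trmxK trmx_inv (sc_sym sc (rU _ xx)) !mulmxA //.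
  have [t1 t2] := tr _ _ _ dv' dv xx.
  rewrite gt /gm (frame_mul _ t1 t2).
  exact: (frame_complete n2 (sc_unit sc (rU _ xx)) (dc_gram dv xx) (dc_perp dv xx) (dc_norm dv xx)).
- have y1 q : y q x0 *m Psph = y q x0 by rewrite /y -mulmxA Psph_idem.
  apply: (frame_commute (tr_Psph R) (y1 psi) (y1 psi')); last exact: inv_ric (rU _ xx).
  - exact: esym (dc_ric dv xx).
  - exact: esym (dc_ric dv' xx).
move=> x xr; have [t1 t2] := tr _ _ _ dv dv' xr.
rewrite (dc_pos dv' xr) [in RHS](dc_pos dv xr) mulmxDl -scalemxAl -mulmxA [jacobian_mx psi x *m _]t1.
by rewrite [psi x *m Psph *m _]t2.
Qed.

End DevChart.

(** * Immersions and smoothness of continuous lifts *)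

Section Immersion.
Variables (R : realType) (n m : nat).

Lemma Ck_sum p k (V : set 'rV[R]_p) (T : finType) (F : T -> 'rV[R]_p -> R) : open V ->
  (forall i, Ck_on k V (F i)) -> Ck_on k V (fun x => \sum_i F i x).
Proof.
move=> oV sF; have -> : (fun x => \sum_i F i x) = \sum_i F i by apply/funext => x; rewrite fct_sumE.
by elim/big_ind: _ => [|F1 F2 s1 s2|i _]; [exact: Ck_cst|exact: CkD|exact: sF].
Qed.

Lemma taylor_row p q (U : set 'rV[R]_p) (psi : 'rV[R]_p -> 'rV[R]_q) x0 : open U -> U x0 ->
  (forall k, smooth_on U (fun x => psi x 0 k)) ->
  exists rho C : R, [/\ 0 < rho, 0 <= C, forall y, `|y - x0| < rho -> U y &
    forall y z, `|y - x0| < rho -> `|z - x0| < rho -> forall k,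
      `|psi z 0 k - psi y 0 k - ((z - y) *m jacobian_mx psi y) 0 k| <= C * `|z - y| ^+ 2].
Proof.
move=> oU Ux0 sp; have [e1 e10 H1] := open_rV_ball oU Ux0.
pose D2 (i : 'I_p * 'I_p * 'I_q) := partial i.1.1 (partial i.1.2 (fun x => psi x 0 i.2)).
have sD i : smooth_on U (D2 i).
  by move=> k; have [_ /(_ i.1.2)[_ [_ /(_ i.1.1)[]]]] := sp i.2 k.+2.
have [K K0 nK] := smooth_family_bound oU Ux0 sD.
have [e2 e20 H2] := nbhs_rV_ball nK.
pose e := Num.min e1 e2; have e0 : 0 < e by rewrite lt_min e10 e20.
exists (e / 8), (p%:R * (p%:R * K)); split.
- by rewrite divr_gt0.
- by rewrite !mulr_ge0.
- by move=> y ye; apply: H1; apply: (lt_le_trans ye); rewrite (@le_trans _ _ e) ?ge_min ?lexx // ler_pdivrMr // ler_peMr ?(ltW e0) // ler1n.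
move=> y z ye ze k; set w := z - y.
have we : `|w| < e / 4.
  rewrite /w; have -> : z - y = (z - x0) - (y - x0) by rewrite opprB addrA subrK.
  by apply: (le_lt_trans (ler_normB _ _)); move: ye ze; lra.
have inb (s : R) : `|s| < 2 -> `|y + s *: w - x0| < e.
  move=> s2; rewrite addrAC; apply: (le_lt_trans (ler_normD _ _)); rewrite normrZ.
  have : `|s| * `|w| <= 2 * `|w| by rewrite ler_wpM2r // ltW.
  by move: ye we; lra.
have inU s : `|s| < 2 -> U (y + s *: w).
  by move=> s2; apply: H1; apply: (lt_le_trans (inb s s2)); rewrite ge_min lexx.
pose g s := psi (y + s *: w) 0 k.
pose dg s := \sum_a w 0 a * partial a (fun x => psi x 0 k) (y + s *: w).
pose ddg s := \sum_a w 0 a * \sum_l w 0 l * partial l (partial a (fun x => psi x 0 k)) (y + s *: w).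
have d1 (s : R) : `|s| < 2 -> is_derive s 1 g (dg s).
  by move=> s2; exact: line_derive oU (sp k 1%N) (inU s s2).
have d2 (s : R) : `|s| < 2 -> is_derive s 1 dg (ddg s).
  move=> s2; have -> : dg = \sum_a (w 0 a \*: (fun s : R => partial a (fun x => psi x 0 k) (y + s *: w))).
    by apply/funext => t; rewrite /dg fct_sumE; apply: eq_bigr.
  apply: is_derive_sum => a; have s1 : Ck_on 1 U (partial a (fun x => psi x 0 k)) by have [_ /(_ a)[]] := sp k 2%N.
  have H := line_derive oU s1 (inU s s2).
  exact: (is_deriveZ (w 0 a) H).
have b2 s : `|s| < 2 -> `|ddg s| <= p%:R * (p%:R * K) * `|w| ^+ 2.
  move=> s2; have E : p%:R * (p%:R * K) * `|w| ^+ 2 = p%:R * (`|w| * (p%:R * (`|w| * K))) by ring.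
  rewrite E; apply: sum_le_bound => a; rewrite normrM ler_pM ?coord_le_norm //.
  apply: sum_le_bound => l; rewrite normrM ler_pM ?coord_le_norm //.
  by apply: (H2 _ _ (l, a, k)); apply: (lt_le_trans (inb s s2)); rewrite ge_min lexx orbT.
have l12 : `|1 : R| < 2 by rewrite normr1 ltr1n.
have := taylor2 d1 d2 b2 l12; rewrite expr1n mulr1 mul1r /g /dg scale1r scale0r addr0.
have -> : y + w = z by rewrite /w addrC subrK.
set S1 := \sum_a _; have -> // : S1 = (w *m jacobian_mx psi y) 0 k.
by rewrite /S1 mxE; apply: eq_bigr => a _; rewrite [jacobian_mx _ _ _ _]mxE.
Qed.

Variables (U : set 'rV[R]_n) (psi : 'rV[R]_n -> 'rV[R]_m) (B : 'rV[R]_n -> 'M[R]_(m, n)).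
Hypothesis oU : open U.
Hypothesis sp : forall k, smooth_on U (fun x => psi x 0 k).
Hypothesis sB : smooth_mx U B.
Hypothesis JB : forall x, U x -> jacobian_mx psi x *m B x = 1%:M.

Lemma inverse_bound x0 : U x0 -> exists rho K : R, [/\ 0 < rho, 0 <= K &
  forall y, `|y - x0| < rho -> forall i j, `|B y i j| <= K].
Proof.
move=> Ux0; have [K K0 nK] := smooth_family_bound oU Ux0 (fun i : 'I_m * 'I_n => sB i.1 i.2).
have [e e0 H] := nbhs_rV_ball nK; exists e, K; split=> // y ye i j; exact: (H y ye (i, j)).
Qed.

(** Taylor's formula and the right inverse B of the Jacobian bound |z - y| by a multiple of |psi z -
    psi y| + C |z - y|^2, and the quadratic term is absorbed on a small ball. This gives injectivity
    with control of the inverse. *)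
Lemma immersion_lipschitz x0 : U x0 -> exists rho C : R, [/\ 0 < rho, 0 <= C,
  forall y, `|y - x0| < rho -> U y &
  forall y z, `|y - x0| < rho -> `|z - x0| < rho -> `|z - y| <= C * `|psi z - psi y|].
Proof.
move=> Ux0; have [r1 [C [r10 C0 H1 H2]]] := taylor_row oU Ux0 sp.
have [r2 [K [r20 K0 H3]]] := inverse_bound Ux0.
(* On a ball of radius 1 / (4 q), of diameter 1 / (2 q), the absorbed term is at most half of |z -
   y|. *)
pose q := m%:R * K * C + 1; have q0 : 0 < q by rewrite ltr_wpDl // !mulr_ge0.
pose rho := Num.min (Num.min r1 r2) (4^-1 / q).
have rho0 : 0 < rho by rewrite !lt_min r10 r20 divr_gt0 // invr_gt0.
have [i1 i2 i3] : [/\ rho <= r1, rho <= r2 & rho <= 4^-1 / q] by rewrite /rho !ge_min !lexx !orbT.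
exists rho, (2 * (m%:R * K)); split=> //.
- by rewrite !mulr_ge0.
- by move=> y yr; apply: H1; exact: lt_le_trans yr i1.
move=> y z yr zr; have y1 := lt_le_trans yr i1; have z1 := lt_le_trans zr i1.
have dzy : `|z - y| <= 2 * rho.
  have -> : z - y = (z - x0) - (y - x0) by rewrite opprB addrA subrK.
  by apply: (le_trans (ler_normB _ _)); move: yr zr; lra.
have E : `|z - y| <= m%:R * ((`|psi z - psi y| + C * `|z - y| ^+ 2) * K).
  have Ezy : z - y = ((z - y) *m jacobian_mx psi y) *m B y by rewrite -mulmxA JB ?mulmx1 //; exact: H1.
  apply: norm_rV_le => [|i]; first by rewrite !mulr_ge0 // addr_ge0 // mulr_ge0 // exprn_ge0.
  rewrite {1}Ezy; apply: mulmx_bound => [a j|j k]; last by apply: H3; exact: lt_le_trans yr i2.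
  rewrite (ord1 a); have := H2 y z y1 z1 j; have := coord_le_norm (psi z - psi y) j.
  rewrite mx_addE mx_oppE; move: (((z - y) *m jacobian_mx psi y) 0 j) => u; move: (psi z 0 j - psi y 0 j) => d h1 h2.
  have := ler_normB d (d - u); have -> : d - (d - u) = u by ring.
  by move=> h3; apply: (le_trans h3); exact: lerD.
have N0 : 0 <= `|z - y| by [].
have h : m%:R * K * C * `|z - y| <= 2^-1.
  have h1 : m%:R * K * C * `|z - y| <= q * (2 * (4^-1 / q)).
    by apply: ler_pM => //; rewrite ?mulr_ge0 // /q ?lerDl //; apply: (le_trans dzy); rewrite ler_pM2l.
  apply: (le_trans h1); have -> : q * (2 * (4^-1 / q)) = 2^-1 by field; rewrite lt0r_neq0.
  by [].
have : m%:R * K * C * `|z - y| * `|z - y| <= 2^-1 * `|z - y| by rewrite ler_wpM2r.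
move: E; rewrite expr2; move: (`|z - y|) (`|psi z - psi y|) => u v.
have -> : m%:R * ((v + C * (u * u)) * K) = m%:R * K * v + m%:R * K * C * u * u by ring.
have -> : 2 * (m%:R * K) * v = 2 * (m%:R * K * v) by ring.
by move: (m%:R * K * v) (m%:R * K * C * u * u) => a w; lra.
Qed.

Section Lift.
Variables (p : nat) (V : set 'rV[R]_p) (iota : 'rV[R]_p -> 'rV[R]_m) (K : 'rV[R]_p -> 'rV[R]_n).
Hypothesis oV : open V.
Hypothesis KU : forall x, V x -> U (K x).
Hypothesis cK : forall x, V x -> {for x, continuous K}.
Hypothesis sI : forall k, smooth_on V (fun x => iota x 0 k).
Hypothesis pK : forall x, V x -> psi (K x) = iota x.

(** Continuity of K places K y in the ball where psi is Lipschitz invertible, so K is Lipschitz at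
    x; comparing the Taylor expansions of psi and iota then leaves a quadratic error. *)
Lemma lift_derive x a i : V x ->
  is_derive x (delta_mx 0 a) (fun y => K y 0 i) ((jacobian_mx iota x *m B (K x)) a i).
Proof.
move=> Vx; have Ux := KU Vx; apply: derive_along_line.
have [r1 [C1 [r10 C10 T1 T2]]] := taylor_row oV Vx sI.
have [r2 [C2 [r20 C20 S1 S2]]] := taylor_row oU Ux sp.
have [r3 [L [r30 L0 _ L2]]] := immersion_lipschitz Ux.
have [r4 [Kb [r40 Kb0 B2]]] := inverse_bound Ux.
have cKx : \forall y \near x, `|K y - K x| < Num.min r2 r3.
  have oB : open [set z : 'rV[R]_n | `|z - K x| < Num.min r2 r3] by exact: rV_ball_open.
  apply: (cK Vx (open_nbhs_nbhs (conj oB _))); rewrite /= subrr normr0 lt_min r20 r30 //.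
have [d d0 Hd] := nbhs_rV_ball cKx.
pose Jb := \sum_k `|jacobian_mx iota x a k|.
have Jb0 : 0 <= Jb by apply: sumr_ge0.
have JbP k : `|jacobian_mx iota x a k| <= Jb by rewrite /Jb (bigD1 k) //= lerDl; apply: sumr_ge0.
pose Q := C1 + C2 * (L * (Jb + C1)) ^+ 2.
pose r := Num.min (Num.min r1 d) 1.
have r0 : 0 < r by rewrite !lt_min r10 d0 ltr01.
have [i1 i2 i3] : [/\ r <= r1, r <= d & r <= 1] by rewrite /r !ge_min !lexx !orbT.
apply: (@quadratic_is_derive R _ _ (m%:R * (Q * Kb)) r r0) => s sr.
set y := x + s *: delta_mx 0 a; rewrite scale0r addr0.
have yx : `|y - x| <= `|s|.
  by rewrite /y addrAC subrr add0r normrZ ler_piMr // norm_delta_mx_le.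
have yr1 : `|y - x| < r1 by apply: (le_lt_trans yx); exact: lt_le_trans sr i1.
have yd : `|y - x| < d by apply: (le_lt_trans yx); exact: lt_le_trans sr i2.
have Vy := T1 y yr1.
have s1 : `|s| <= 1 by apply: ltW; exact: lt_le_trans sr i3.
have xr1 : `|x - x| < r1 by rewrite subrr normr0.
have yJ : (y - x) *m jacobian_mx iota x = s *: row a (jacobian_mx iota x).
  by rewrite /y addrAC subrr add0r -scalemxAl -rowE.
have e1 k : `|iota y 0 k - iota x 0 k - s * jacobian_mx iota x a k| <= C1 * s ^+ 2.
  have := T2 x y xr1 yr1 k; rewrite yJ [(_ *: row _ _) 0 k]mxE [row _ _ 0 k]mxE => h.
  apply: (le_trans h); rewrite ler_wpM2l // -[s ^+ 2](real_normK (num_real s)).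
  by rewrite lerXn2r ?nnegrE.
have ss : s ^+ 2 <= `|s|.
  by rewrite -(real_normK (num_real s)) expr2 ler_piMl.
have e2 : `|iota y - iota x| <= (Jb + C1) * `|s|.
  apply: norm_rV_le => [|k]; first by rewrite mulr_ge0 // addr_ge0.
  rewrite mx_addE mx_oppE; have := e1 k; move: (iota y 0 k - iota x 0 k) => u h.
  have -> : u = (u - s * jacobian_mx iota x a k) + s * jacobian_mx iota x a k by rewrite subrK.
  apply: (le_trans (ler_normD _ _)); rewrite mulrDl addrC lerD //.
    by rewrite normrM mulrC ler_wpM2r.
  by apply: (le_trans h); rewrite ler_wpM2l.
have := Hd y yd; rewrite lt_min => /andP[Ky2 Ky3].
have xx (e : R) : 0 < e -> `|K x - K x| < e by rewrite subrr normr0.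
have e3 : `|K y - K x| <= L * ((Jb + C1) * `|s|).
  by apply: (le_trans (L2 _ _ (xx _ r30) Ky3)); rewrite !pK // ler_wpM2l.
have e4 k : `|iota y 0 k - iota x 0 k - ((K y - K x) *m jacobian_mx psi (K x)) 0 k| <=
    C2 * (L * (Jb + C1)) ^+ 2 * s ^+ 2.
  have := S2 _ _ (xx _ r20) Ky2 k; rewrite !pK // => h; apply: (le_trans h).
  rewrite -mulrA ler_wpM2l // -[s ^+ 2](real_normK (num_real s)) -exprMn -mulrA.
  by rewrite lerXn2r ?nnegrE // ?mulr_ge0 // addr_ge0.
have -> : K y 0 i - K x 0 i - s * (jacobian_mx iota x *m B (K x)) a i =
  (((K y - K x) *m jacobian_mx psi (K x) - s *: row a (jacobian_mx iota x)) *m B (K x)) 0 i.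
  rewrite mulmxBl -mulmxA (JB Ux) mulmx1 -scalemxAl -row_mul !mx_addE !mx_oppE; congr (_ - _).
  by rewrite [RHS]mxE [row _ _ 0 i]mxE.
have -> : m%:R * (Q * Kb) * s ^+ 2 = m%:R * ((Q * s ^+ 2) * Kb) by ring.
apply: mulmx_bound => [b k|k b]; last exact: (B2 _ (xx _ r40)).
rewrite (ord1 b) mx_addE mx_oppE [(_ *: row _ _) 0 k]mxE [row _ _ 0 k]mxE /Q mulrDl.
have := e1 k; have := e4 k; move: (((K y - K x) *m jacobian_mx psi (K x)) 0 k) => z; move: (s * _) (iota y 0 k - iota x 0 k) => u v h1 h2.
have -> : z - u = (v - u) - (v - z) by ring.
by apply: (le_trans (ler_normB _ _)); exact: lerD.
Qed.

(** The derivative found in [lift_derive] involves K only through B (K x), so regularity climbs one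
    order at a time. *)
Lemma lift_smooth i : smooth_on V (fun x => K x 0 i).
Proof.
move=> k; elim: k i => [|k IHk] i.
  split=> // x Vx; have cc : {for K x, continuous (fun z : 'rV[R]_n => z 0 i)} by exact: coord_continuous.
  exact: (@continuous_comp _ _ _ K (fun z : 'rV[R]_n => z 0 i) x (cK Vx) cc).
split=> [x Vx|a]; first exact: (Ck_continuous (IHk i) Vx).
split=> [x Vx|]; first by have [] := lift_derive a i Vx.
have E y : V y -> (fun y => \sum_j partial a (fun x => iota x 0 j) y * B (K y) j i) y = partial a (fun x => K x 0 i) y.
  move=> Vy; rewrite /partial (@derive_val _ _ _ _ _ _ _ (lift_derive a i Vy)) mxE; apply: eq_bigr => j _.
  by rewrite [jacobian_mx _ _ _ _]mxE.
apply: (Ck_ext oV E); apply: Ck_sum => // j; apply: CkM => //.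
  by have [_ /(_ a)[]] := sI j k.+1.
exact: (Ck_comp oV oU (sB j i k) IHk KU).
Qed.

Lemma lift_jacobian x : V x -> jacobian_mx K x *m jacobian_mx psi (K x) = jacobian_mx iota x.
Proof.
move=> Vx; apply/matrixP => a k; rewrite mxE [RHS]mxE.
have H := partial_comp a oV oU (sp k 1%N) (fun l => lift_smooth l 1%N) Vx (KU Vx).
have -> : partial a (fun y => iota y 0 k) x = partial a ((fun y => psi y 0 k) \o K) x.
  by apply: (partial_eq_on _ oV _ Vx) => y Vy; rewrite /= pK.
rewrite /partial (@derive_val _ _ _ _ _ _ _ H); apply: eq_bigr => l _; by rewrite !mxE.
Qed.

End Lift.
End Immersion.

Lemma dev_chart_sub (R : realType) (U V : set 'rV[R]_4) G F phi : V `<=` U ->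
  dev_chart U G F phi -> dev_chart V G F phi.
Proof.
move=> VU d; split=> [k|x /VU|x /VU|x /VU|x /VU|x /VU|x k /VU].
- by move=> j; apply: Ck_sub (dc_smooth d k j).
- exact: (@dc_gram _ _ _ _ _ d x).
- exact: (@dc_perp _ _ _ _ _ d x).
- exact: (@dc_norm _ _ _ _ _ d x).
- exact: (@dc_ric _ _ _ _ _ d x).
- exact: (@dc_pos _ _ _ _ _ d x).
- exact: (@dc_hess _ _ _ _ _ d x k).
Qed.

Lemma hessian_eq_on (R : realType) n (G : 'rV[R]_n -> 'M[R]_n) (U : set 'rV[R]_n) (F F' : 'rV[R]_n -> R) x :
  open U -> (forall y, U y -> F y = F' y) -> U x -> hessian G F x = hessian G F' x.
Proof.
move=> oU E Ux.
have E1 b y : U y -> partial b F y = partial b F' y by move=> Uy; exact: (@partial_eq_on _ _ U F F' b y oU E Uy).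
have E2 a b := @partial_eq_on _ _ U (partial b F) (partial b F') a x oU (E1 b) Ux.
apply/matrixP => a b; rewrite [LHS]mxE [RHS]mxE E2; congr (_ + - _).
by apply: eq_bigr => l _; rewrite (E1 l x Ux).
Qed.

Section ChangeOfFrame.
Variables (R : fieldType).
Implicit Types (J S Q : 'M[R]_4) (A : 'M[R]_(4, 5)).

Lemma change_gram J Q Q' A : Q = J *m Q' *m J^T -> A *m A^T = Q' -> J *m A *m (J *m A)^T = Q.
Proof. by move=> -> <-; rewrite trmx_mul !mulmxA. Qed.

Lemma change_ric J S S' A (P : 'M[R]_5) : S *m J = J *m S' -> 2 *: (S' *m A) = A *m P ->
  2 *: (S *m (J *m A)) = J *m A *m P.
Proof. by move=> h1 h2; rewrite mulmxA h1 -[RHS]mulmxA -h2 -scalemxAr mulmxA. Qed.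

Lemma change_pos J A (N N' : 'rV[R]_4) (y z : 'rV[R]_5) : N *m J = N' -> y = 2 *: (N' *m A) + z ->
  y = 2 *: (N *m (J *m A)) + z.
Proof. by move=> <- {1}->; rewrite mulmxA. Qed.

Lemma change_hess J Q Q' (c : R) : Q' = J *m Q *m J^T -> J *m (c *: Q) *m J^T = c *: Q'.
Proof. by move=> ->; rewrite -scalemxAr -scalemxAl. Qed.

Lemma frame_component Q A (y v : 'rV[R]_5) : A^T *m Q *m A + 2^-1 *: (y^T *m y) = 1%:M ->
  v *m y^T = 0 -> v = v *m (A^T *m Q) *m A.
Proof.
by move=> K vy; rewrite -[LHS]mulmx1 -K mulmxDr -scalemxAr (mulmxA v y^T) vy mul0mx scaler0 addr0 !mulmxA.
Qed.

End ChangeOfFrame.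

(** * Developing maps on the manifold *)

Section Patches.
Variables (R : realType) (M : riemannian_data R 4) (f : M -> R).
Hypothesis sol : shrinking_gradient_ricci_soliton f.
Hypothesis scal : constant_scalar_curvature M 1.
Let rM := sol_riemannian sol.
Let mM := sol_manifold sol.
Local Notation F i := (f \o param i).
Local Notation ball x r := [set y : 'rV[R]_4 | `|y - x| < r].

Definition patch_dom (i : chart_index M) (x0 : 'rV[R]_4) (r : R) : set M :=
  [set q | dom i q /\ `|chart i q - x0| < r].

Record patch (i : chart_index M) (x0 : 'rV[R]_4) (r C : R) (phi : 'rV[R]_4 -> 'rV[R]_5) : Prop := Patch {
  patch_pos : 0 < r;
  patch_C : 0 <= C;
  patch_sub : forall x, `|x - x0| < r -> cod i x;
  patch_dev : dev_chart (ball x0 r) (metric i) (F i) phi;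
  patch_lip : forall y z, `|y - x0| < r -> `|z - x0| < r -> `|z - y| <= C * `|phi z - phi y| }.

(** This hides charts and balls: from outside, a good pair is an open set with an injective
    developing map on it. *)
Definition good (O : set M) (psi : M -> 'rV[R]_5) := exists i x0 r C phi,
  [/\ patch i x0 r C phi, O = patch_dom i x0 r & psi = phi \o chart i].

(** Membership in the model R^2 x S^2(sqrt 2) inside R^5; the first two coordinates are free. *)
Definition onE (e : 'rV[R]_5) := (e *m Psph) *m (e *m Psph)^T = 2%:M.

Lemma patch_dom_open i x0 r : open (patch_dom i x0 r).
Proof.
rewrite openE => q [iq qr]; have oB : open (ball x0 r) by exact: rV_ball_open.
have N1 := chart_continuous mM iq (open_nbhs_nbhs (conj oB qr)).
exact: filterI (dom_near mM iq) N1.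
Qed.

Lemma good_open O psi : good O psi -> open O.
Proof. by move=> [i [x0 [r [C [phi [P -> _]]]]]]; exact: patch_dom_open. Qed.

Lemma good_inj O psi q q' : good O psi -> O q -> O q' -> psi q = psi q' -> q = q'.
Proof.
move=> [i [x0 [r [C [phi [P -> ->]]]]]] [iq qr] [iq' qr'] /= E.
have := patch_lip P qr qr'; rewrite E subrr normr0 mulr0 normr_le0 subr_eq0 => /eqP E'.
by rewrite -(chartK mM iq) -E' (chartK mM iq').
Qed.

Lemma good_onE O psi q : good O psi -> O q -> onE (psi q).
Proof. by move=> [i [x0 [r [C [phi [P -> ->]]]]]] [iq qr]; exact: (dc_norm (patch_dev P) qr). Qed.

Lemma good_near O psi p V : good O psi -> O p -> nbhs p V ->
  exists2 e, 0 < e & forall q, O q -> `|psi q - psi p| < e -> V q.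
Proof.
move=> [i [x0 [r [C [phi [P -> ->]]]]]] [ip pr] NV.
have N1 : nbhs (chart i p) (param i @^-1` V).
  by apply: (param_continuous mM (cod_chart ip)); rewrite (chartK mM ip).
have [e e0 He] := nbhs_rV_ball N1.
have C1 : 0 < C + 1 by rewrite ltr_wpDl // (patch_C P).
exists (e / (C + 1)); first by rewrite divr_gt0.
move=> q [iq qr] /= h; have := He (chart i q); rewrite /= (chartK mM iq); apply.
apply: (le_lt_trans (patch_lip P pr qr)).
apply: (@le_lt_trans _ _ ((C + 1) * `|phi (chart i q) - phi (chart i p)|)).
  by rewrite ler_wpM2r // lerDl.
by rewrite mulrC -ltr_pdivlMr.
Qed.

Lemma good_continuous O psi p : good O psi -> O p -> {for p, continuous psi}.
Proof.
move=> [i [x0 [r [C [phi [P -> ->]]]]]] [ip pr].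
apply: continuous_comp (chart_continuous mM ip) _; apply: rV_continuous => k.
by have [] := dc_smooth (patch_dev P) k 0%N => H _; exact: H.
Qed.

(* Keeps a curve whose image under psi is known from leaving O. *)
Lemma good_barrier O psi p : good O psi -> O p -> exists e B, [/\ 0 < e, closed B, B `<=` O &
  forall q, O q -> `|psi q - psi p| <= e -> B q].
Proof.
move=> [i [x0 [r [C [phi [P -> ->]]]]]] [ip pr].
pose d := (r - `|chart i p - x0|) / 2; have d0 : 0 < d by rewrite divr_gt0 // subr_gt0.
have C1 : 0 < C + 1 by rewrite ltr_wpDl // (patch_C P).
pose K := [set x : 'rV[R]_4 | `|x - chart i p| <= d].
have KB x : K x -> `|x - x0| < r.
  move=> Kx; have -> : x - x0 = (x - chart i p) + (chart i p - x0) by rewrite addrA subrK.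
  by apply: (le_lt_trans (ler_normD _ _)); move: Kx pr; rewrite /K /= /d; lra.
have cK : compact K.
  apply: bounded_closed_compact.
    exists (`|chart i p| + d); split; first by rewrite num_real.
    move=> z hz x Kx; apply: ltW; apply: (le_lt_trans _ hz).
    by rewrite -[x](subrK (chart i p)) addrC; apply: (le_trans (ler_normD _ _)); rewrite lerD2l.
  have -> : K = closed_ball (chart i p) d.
    rewrite closed_ballE //; apply/funext => x; apply/propext; rewrite /K /closed_ball_ /=.
    by rewrite distrC.
  exact: closed_ball_closed.
exists (d / (C + 1)), (param i @` K); split.
- by rewrite divr_gt0.
- apply: compact_closed; first exact: manifold_hausdorff.
  apply: continuous_compact => //; apply: continuous_in_subspaceT => x /set_mem Kx.
  exact: (param_continuous mM (patch_sub P (KB _ Kx))).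
- move=> _ [x Kx <-]; have [ix E] := cod_param mM (patch_sub P (KB _ Kx)).
  by split=> //; rewrite E; exact: KB.
move=> q [iq qr] h; exists (chart i q); last exact: chartK.
rewrite /K /=; apply: (le_trans (patch_lip P pr qr)).
apply: (@le_trans _ _ ((C + 1) * `|phi (chart i q) - phi (chart i p)|)).
  by rewrite ler_wpM2r // lerDl.
by rewrite mulrC -ler_pdivlMr.
Qed.

Lemma dev_patch i x0 r phi : 0 < r -> (forall x, `|x - x0| < r -> cod i x) ->
  dev_chart (ball x0 r) (metric i) (F i) phi -> exists rho C, patch i x0 rho C phi.
Proof.
move=> r0 rc d; have sc := sol_chart sol scal i.
have oB : open (ball x0 r) by exact: rV_ball_open.
have sJ : smooth_mx (ball x0 r) (fun x => (jacobian_mx phi x)^T *m invmx (metric i x)).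
  apply: smooth_mxM => //; last by move=> a b k; apply: Ck_sub (sc_smooth_inv sc a b k).
  apply: smooth_mx_tr => a k j; have -> : (fun x => jacobian_mx phi x a k) = partial a (fun x => phi x 0 k).
    by apply/funext => x; rewrite mxE.
  by have [_ /(_ a)[]] := dc_smooth d k j.+1.
have JB x : ball x0 r x -> jacobian_mx phi x *m ((jacobian_mx phi x)^T *m invmx (metric i x)) = 1%:M.
  by move=> xr; rewrite mulmxA (dc_gram d xr) mulmxV // (sc_unit sc (rc _ xr)).
have x0r : ball x0 r x0 by rewrite /= subrr normr0.
have [rho [C [rho0 C0 H1 H2]]] := immersion_lipschitz oB (dc_smooth d) sJ JB x0r.
exists rho, C; split=> //; first by move=> x /H1; exact: rc.
exact: dev_chart_sub H1 d.
Qed.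

Lemma good_exists p (sg : R) : sg ^+ 2 = 2 -> exists O psi,
  [/\ good O psi, O p & psi p *m Psph = sg *: delta_mx 0 ord_max].
Proof.
move=> sg2; pose i := chart_at sol p; have ip : dom i p := chart_atP sol p.
have sc := sol_chart sol scal i; have cp := cod_chart ip.
have par a x : cod i x -> Dric_of (metric i) a x = 0 := parallel_ricci sol scal a.
have idem x : cod i x -> ric_endo (metric i) x *m ric_endo (metric i) x = 2^-1 *: ric_endo (metric i) x.
  by exact: (ricci_idempotent sol scal).
have [rho rho0 [rc [phi [d E]]]] := chart_dev_exists sc par idem cp sg2.
have [r [C P]] := dev_patch rho0 rc d.
exists (patch_dom i (chart i p) r), (phi \o chart i); split=> //.
  by exists i, (chart i p), r, C, phi.
by split=> //; rewrite subrr normr0 (patch_pos P).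
Qed.

(** Every clause of [dev_chart] is tensorial, so it can be checked in the other chart through the
    transformation laws. *)
Lemma dev_change i j x0 r phi p : dom i p -> patch_dom j x0 r p -> (forall x, `|x - x0| < r -> cod j x) ->
  dev_chart (ball x0 r) (metric j) (F j) phi ->
  exists2 rho, 0 < rho & (forall x, `|x - chart i p| < rho -> chart_image i (patch_dom j x0 r) x) /\
    dev_chart (ball (chart i p) rho) (metric i) (F i) (phi \o chart j \o param i).
Proof.
move=> ip Op rc d; pose O := patch_dom j x0 r.
have oO : open O by exact: patch_dom_open.
have oI : open (chart_image i O) by exact: chart_image_open.
have oB : open (ball x0 r) by exact: rV_ball_open.
have Ip : chart_image i O (chart i p) by exists p.
have [rho rho0 Hr] := open_rV_ball oI Ip; exists rho => //; split=> //.
apply: (dev_chart_sub (U := chart_image i O)) => //.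
have bj : chart_image j O `<=` ball x0 r.
  by move=> x /(chart_imageP mM)[cx [jx xr]]; have [_ E] := cod_param mM cx; rewrite E in xr.
have bj' q : O q -> ball x0 r (chart j q) by move=> [].
pose Psi k (q : M) := phi (chart j q) 0 k.
have sj k : smooth_on (chart_image j O) (Psi k \o param j).
  move=> n; apply: (Ck_ext (chart_image_open mM j oO)); last exact: Ck_sub bj (dc_smooth d k n).
  by move=> y /(chart_imageP mM)[cy _]; rewrite /Psi /=; have [_ ->] := cod_param mM cy.
have Oj : O `&` dom j = O by apply/funext => q; apply/propext; split=> [[]//|[jq qr]].
have si k : smooth_on (chart_image i O) (Psi k \o param i).
  by have := smooth_change rM i oO (sj k); rewrite Oj.
have J q : O q -> dom i q -> jacobian_mx (phi \o chart j \o param i) (chart i q) = jac i j q *m jacobian_mx phi (chart j q).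
  move=> Oq iq; have jq : dom j q by have [] := Oq.
  apply/matrixP => a k; rewrite [LHS]mxE [RHS]mxE; have := partial_change rM a oO Oq iq jq (sj k).
  rewrite /Psi => E; apply: (etrans E); apply: eq_bigr => l _; congr (_ * _).
  rewrite [RHS]mxE; apply: (partial_eq_on _ (chart_image_open mM j oO)); last by exists q.
  by move=> y /(chart_imageP mM)[cy _] /=; have [_ ->] := cod_param mM cy.
have par q : O q -> dom i q -> (phi \o chart j \o param i) (chart i q) = phi (chart j q).
  by move=> Oq iq; rewrite /= (chartK mM iq).
have im x : chart_image i O x -> exists q, [/\ O q, dom i q, dom j q & x = chart i q].
  by move=> [q [iq Oq] <-]; exists q; split=> //; case: Oq.
split=> [k|x|x|x|x|x|x k].
- exact: si.
- move=> /im[q [Oq iq jq ->]]; rewrite J //.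
  exact: (change_gram (metric_change rM iq jq) (dc_gram d (bj' _ Oq))).
- move=> /im[q [Oq iq jq ->]]; rewrite J // par // -mulmxA; have := dc_perp d (bj' _ Oq) => ->.
  by rewrite mulmx0.
- by move=> /im[q [Oq iq jq ->]]; rewrite par //; exact: (dc_norm d (bj' _ Oq)).
- move=> /im[q [Oq iq jq ->]]; rewrite J //.
  exact: (change_ric (ric_endo_change sol scal iq jq) (dc_ric d (bj' _ Oq))).
- move=> /im[q [Oq iq jq ->]]; rewrite J // par //.
  exact: (change_pos (grad_change sol scal iq jq) (dc_pos d (bj' _ Oq))).
move=> /im[q [Oq iq jq ->]]; rewrite par //.
have := hessian_change rM (sol_complete sol) oO Oq iq jq (si k) (sj k) => E.
apply: (etrans E); have -> : hessian (metric j) (Psi k \o param j) (chart j q) =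
    hessian (metric j) (fun x => phi x 0 k) (chart j q).
  have oJ := chart_image_open mM j oO; have Jq : chart_image j O (chart j q) by exists q.
  have Ej y : chart_image j O y -> (Psi k \o param j) y = phi y 0 k.
    by move=> /(chart_imageP mM)[cy _]; rewrite /Psi /=; have [_ ->] := cod_param mM cy.
  exact: (hessian_eq_on _ oJ Ej Jq).
by rewrite (dc_hess d k (bj' _ Oq)); exact: change_hess (ric_change sol scal iq jq).
Qed.

Lemma good_transition O O' psi psi' p : good O psi -> good O' psi' -> O p -> O' p ->
  exists g : 'M[R]_5, [/\ g *m g^T = 1%:M, g *m Psph = Psph *m g & \forall q \near p, psi' q = psi q *m g].
Proof.
move=> [i [x0 [r [C [phi [P -> ->]]]]]] [j [x0' [r' [C' [phi' [P' -> ->]]]]]] [ip pr] Op'.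
have [rho rho0 [H1 d']] := dev_change ip Op' (patch_sub P') (patch_dev P').
pose s := Num.min rho (r - `|chart i p - x0|).
have s0 : 0 < s by rewrite lt_min rho0 subr_gt0.
have b1 : ball (chart i p) s `<=` ball x0 r.
  move=> x /=; rewrite lt_min => /andP[_ h].
  have -> : x - x0 = (x - chart i p) + (chart i p - x0) by rewrite addrA subrK.
  by apply: (le_lt_trans (ler_normD _ _)); move: h; lra.
have b2 : ball (chart i p) s `<=` ball (chart i p) rho by move=> x /=; rewrite lt_min => /andP[].
have sc := sol_chart sol scal i.
have [g [g1 g2 g3]] := chart_dev_transition sc s0 (fun x xs => patch_sub P (b1 x xs))
  (dev_chart_sub b1 (patch_dev P)) (dev_chart_sub b2 d').
exists g; split=> //; have oB : open (ball (chart i p) s) by exact: rV_ball_open.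
have sp : ball (chart i p) s (chart i p) by rewrite /= subrr normr0.
have N1 := chart_continuous mM ip (open_nbhs_nbhs (conj oB sp)).
apply: filterS2 (dom_near mM ip) N1 => q iq qs.
by have := g3 _ qs; rewrite /= (chartK mM iq).
Qed.

Lemma jacobian_mulmx (U : set 'rV[R]_4) (phi : 'rV[R]_4 -> 'rV[R]_5) (g : 'M[R]_5) x : open U -> U x ->
  (forall k, smooth_on U (fun x => phi x 0 k)) ->
  jacobian_mx (fun x => phi x *m g) x = jacobian_mx phi x *m g.
Proof.
move=> oU Ux sp; apply/matrixP => a k.
have sm : smooth_mx U phi by move=> i j; rewrite ord1; exact: sp.
have := pdmM oU a Ux sm (smooth_mx_cst oU g); rewrite pdm_cst mulmx0 addr0 => /matrixP/(_ 0 k).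
rewrite [LHS]mxE => E; rewrite [LHS]mxE; apply: (etrans E); rewrite [LHS]mxE [RHS]mxE.
by apply: eq_bigr => j _; rewrite !mxE.
Qed.

Lemma good_rot O psi (g : 'M[R]_5) : good O psi -> g *m g^T = 1%:M -> g *m Psph = Psph *m g ->
  good O (fun q => psi q *m g).
Proof.
move=> [i [x0 [r [C [phi [P -> ->]]]]]] g1 g2; have d := patch_dev P.
have oB : open (ball x0 r) by exact: rV_ball_open.
have J x xr := @jacobian_mulmx _ phi g x oB xr (dc_smooth d).
have pg x : phi x *m g *m Psph = phi x *m Psph *m g by rewrite -!mulmxA g2.
have gg n q (X : 'M[R]_(n, 5)) (Y : 'M[R]_(q, 5)) : X *m g *m (Y *m g)^T = X *m Y^T.
  by rewrite trmx_mul mulmxA -(mulmxA X) g1 mulmx1.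
have d' : dev_chart (ball x0 r) (metric i) (F i) (fun x => phi x *m g).
  split=> [k|x xr|x xr|x xr|x xr|x xr|x k xr].
  - have sm : smooth_mx (ball x0 r) phi by move=> a j; rewrite ord1; exact: (dc_smooth d).
    exact: (smooth_mxM oB sm (smooth_mx_cst oB g) 0 k).
  - by rewrite (J _ xr) gg (dc_gram d xr).
  - by rewrite (J _ xr) pg gg (dc_perp d xr).
  - by rewrite pg gg (dc_norm d xr).
  - by rewrite (J _ xr) mulmxA scalemxAl (dc_ric d xr) -!mulmxA g2.
  - by rewrite (J _ xr) pg {1}(dc_pos d xr) mulmxDl -scalemxAl -!mulmxA.
  have sm : smooth_mx (ball x0 r) phi by move=> a j; rewrite ord1; exact: (dc_smooth d).
  apply/matrixP => a b.
  have sA : smooth_mx (ball x0 r) (jacobian_mx phi).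
    move=> a' k' j; have -> : (fun x => jacobian_mx phi x a' k') = partial a' (fun x => phi x 0 k').
      by apply/funext => z; rewrite mxE.
    by have [_ /(_ a')[]] := dc_smooth d k' j.+1.
  have E1 l z : ball x0 r z -> partial l (fun x => (phi x *m g) 0 k) z = \sum_j partial l (fun x => phi x 0 j) z * g j k.
    move=> zr; have /matrixP/(_ l k) := J z zr; rewrite [LHS]mxE [RHS]mxE => ->.
    by apply: eq_bigr => j _; rewrite [jacobian_mx _ _ _ _]mxE.
  have E2 : partial a (partial b (fun x => (phi x *m g) 0 k)) x = \sum_j partial a (partial b (fun x => phi x 0 j)) x * g j k.
    rewrite (partial_eq_on a oB (E1 b) xr).
    have := pdmM oB a xr sA (smooth_mx_cst oB g); rewrite pdm_cst mulmx0 addr0 => /matrixP/(_ b k).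
    rewrite [LHS]mxE [RHS]mxE => E.
    have -> : (fun x => \sum_j partial b (fun x => phi x 0 j) x * g j k) = (fun y => (jacobian_mx phi y *m g) b k).
      by apply/funext => y; rewrite mxE; apply: eq_bigr => j _; rewrite [jacobian_mx _ _ _ _]mxE.
    apply: (etrans E); apply: eq_bigr => j _; congr (_ * _); rewrite [LHS]mxE; congr (partial a _ x).
    by apply/funext => y; rewrite mxE.
  rewrite [LHS]mxE E2 pg.
  under [X in _ - X]eq_bigr => l _ do rewrite (E1 l _ xr) mulr_sumr.
  rewrite exchange_big /= -sumrB [RHS]mxE [(phi x *m Psph *m g) 0 k]mxE -sumrN mulr_suml.
  apply: eq_bigr => j _; have /matrixP/(_ a b) := dc_hess d j xr; rewrite [LHS]mxE [RHS]mxE => H.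
  transitivity ((partial a (partial b (fun x => phi x 0 j)) x -
    \sum_l christoffel (metric i) l a b x * partial l (fun x => phi x 0 j) x) * g j k).
    by rewrite mulrBl mulr_suml; congr (_ - _); apply: eq_bigr => l _; rewrite mulrA.
  by rewrite H; ring.
pose Gb := \sum_j \sum_k `|g j k|; have Gb0 : 0 <= Gb by apply: sumr_ge0 => j _; rewrite sumr_ge0.
have GbP j k : `|g j k| <= Gb.
  rewrite /Gb (bigD1 j) //= (bigD1 k) //= -addrA lerDl addr_ge0 ?sumr_ge0 // => j' _; rewrite sumr_ge0 //.
exists i, x0, r, (C * (5%:R * Gb)), (fun x => phi x *m g); split=> //; split=> //.
- exact: patch_pos P.
- by rewrite !mulr_ge0 ?(patch_C P).
- exact: patch_sub P.
move=> y z yr zr; apply: (le_trans (patch_lip P yr zr)); rewrite -mulrA ler_wpM2l ?(patch_C P) //.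
have -> : phi z - phi y = (phi z *m g - phi y *m g) *m g^T by rewrite -mulmxBl -mulmxA g1 mulmx1.
move: (phi z *m g - phi y *m g) => u; apply: norm_rV_le => [|k]; first by rewrite !mulr_ge0.
have -> : 5%:R * Gb * `|u| = 5%:R * (`|u| * Gb) by ring.
by apply: mulmx_bound => [a j|j l]; rewrite ?(ord1 a) ?coord_le_norm // mxE.
Qed.

(** h fixes psi near p, hence the rows of its differential and its spherical part, which together
    span R^5. *)
Lemma good_rigid O psi p (h : 'M[R]_5) : good O psi -> O p -> h *m Psph = Psph *m h ->
  (\forall q \near p, psi q *m h = psi q) -> h = 1%:M.
Proof.
move=> [i [x0 [r [C [phi [P -> ->]]]]]] [ip pr] hP N; have d := patch_dev P.
have N1 : nbhs (chart i p) (param i @^-1` [set q | phi (chart i q) *m h = phi (chart i q)]).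
  by apply: (param_continuous mM (cod_chart ip)); rewrite (chartK mM ip).
have [e e0 He] := nbhs_rV_ball N1.
pose s := Num.min e (r - `|chart i p - x0|).
have s0 : 0 < s by rewrite lt_min e0 subr_gt0.
have b1 : ball (chart i p) s `<=` ball x0 r.
  move=> x /=; rewrite lt_min => /andP[_ h'].
  have -> : x - x0 = (x - chart i p) + (chart i p - x0) by rewrite addrA subrK.
  by apply: (le_lt_trans (ler_normD _ _)); move: h'; lra.
have oB : open (ball (chart i p) s) by exact: rV_ball_open.
have E y : ball (chart i p) s y -> phi y *m h = phi y.
  move=> ys; have /= := He y; rewrite (cod_param mM (patch_sub P (b1 _ ys))).2; apply.
  by move: ys; rewrite /= lt_min => /andP[].
have sp : ball (chart i p) s (chart i p) by rewrite /= subrr normr0.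
have sm k : smooth_on (ball (chart i p) s) (fun x => phi x 0 k).
  by move=> n; apply: Ck_sub (dc_smooth d k n).
have J : jacobian_mx phi (chart i p) *m h = jacobian_mx phi (chart i p).
  rewrite -(jacobian_mulmx h oB sp sm); apply/matrixP => a k; rewrite [LHS]mxE [RHS]mxE.
  by apply: (partial_eq_on _ oB _ sp) => y ys; rewrite E.
have Y : phi (chart i p) *m Psph *m h = phi (chart i p) *m Psph by rewrite -mulmxA -hP mulmxA E.
have n2 : 2 != 0 :> R by rewrite pnatr_eq0.
have K := frame_complete n2 (sol_unit sol scal ip) (dc_gram d pr) (dc_perp d pr) (dc_norm d pr).
by have := frame_mul (invmx (metric i (chart i p))) J Y; rewrite K mul1mx.
Qed.

(** A vector orthogonal to the spherical position is tangent to the model, hence in the image of the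
    differential of psi; completeness supplies the geodesic. *)
Lemma good_velocity O psi p (v : 'rV[R]_5) : good O psi -> O p -> v *m (psi p *m Psph)^T = 0 ->
  exists c : R -> M, [/\ geodesic c, c 0 = p &
    forall k, is_derive (0 : R) 1 (fun s => psi (c s) 0 k) (v 0 k)].
Proof.
move=> [i [x0 [r [C [phi [P -> ->]]]]]] [ip pr] /= vp; have d := patch_dev P.
pose A := jacobian_mx phi (chart i p); pose w := v *m (A^T *m invmx (metric i (chart i p))).
have [c [gc c0 cv]] := geodesic_exists (sol_complete sol) w ip.
exists c; split=> // k; have ic : dom i (c 0) by rewrite c0.
have oB : open (ball x0 r) by exact: rV_ball_open.
have Bc : ball x0 r (chart i (c 0)) by rewrite c0.
have := geodesic_along gc ic oB (dc_smooth d k) Bc; rewrite cv c0 => H.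
apply: is_derive_eq H _.
have n2 : 2 != 0 :> R by rewrite pnatr_eq0.
have K := frame_complete n2 (sol_unit sol scal ip) (dc_gram d pr) (dc_perp d pr) (dc_norm d pr).
have -> : v = w *m A by exact: (frame_component K vp).
by rewrite [RHS]mxE; apply: eq_bigr => a _; rewrite [A a k]mxE.
Qed.

(** By [dc_hess] a geodesic develops to a solution of the geodesic equation of the model; the factor
    1/2 is the inverse square of the radius sqrt 2. *)
Lemma good_geodesic O psi (c : R -> M) t : good O psi -> geodesic c -> O (c t) ->
  let X' s : 'rV[R]_5 := \row_k derive1 (fun s => psi (c s) 0 k) s in
  X' t *m (psi (c t) *m Psph)^T = 0 /\ forall k, is_derive t 1 (fun s => psi (c s) 0 k) (X' t 0 k) /\
   is_derive t 1 (fun s => X' s 0 k)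
     (- ((X' t *m Psph) *m (X' t *m Psph)^T) 0 0 / 2 * (psi (c t) *m Psph) 0 k).
Proof.
move=> [i [x0 [r [C [phi [P -> ->]]]]]] gc [ic cr] X'; have d := patch_dev P.
have oB : open (ball x0 r) by exact: rV_ball_open.
have D1 l := geodesic_along gc ic oB (dc_smooth d l) cr.
have X'E l : X' t 0 l = \sum_a vel c i t 0 a * partial a (fun x => phi x 0 l) (chart i (c t)).
  by rewrite mxE derive1E; exact: (@derive_val _ _ _ _ _ _ _ (D1 l)).
have EX : X' t = vel c i t *m jacobian_mx phi (chart i (c t)).
  by apply/rowP => l; rewrite X'E [RHS]mxE; apply: eq_bigr => a _; rewrite [jacobian_mx _ _ _ _]mxE.
split=> [|k]; first by rewrite EX -mulmxA [X in _ *m X](dc_perp d cr) mulmx0.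
split; first by rewrite X'E; exact: D1.
have D2 := geodesic_hessian mM gc ic oB (dc_smooth d k) cr.
have -> : (fun s => X' s 0 k) = derive1 (fun s => phi (chart i (c s)) 0 k) by apply/funext => s; rewrite mxE.
apply: is_derive_eq D2 _; rewrite (dc_hess d k cr).
have sc := sol_chart sol scal i.
have E := projected_norm (vel c i t) (tr_Psph R) (Psph_idem R) (esym (dc_ric d cr)) (dc_gram d cr).
rewrite EX E -(sc_ricE sc (cod_chart ic)) -scalemxAr -scalemxAl.
move: (vel c i t *m ricci _ _ *m _) => z; rewrite [LHS]mxE [(2 *: z) 0 0]mxE /=.
by field.
Qed.

End Patches.

(** Connectedness of a segment. The hypothesis is also required where P fails, which makes the
    failure set open and dispenses with limit arguments. *)
Lemma locally_constant (R : realType) (P : R -> Prop) (a b : R) :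
  (forall t, a <= t <= b -> exists2 eta, 0 < eta & forall s s', a <= s <= b -> a <= s' <= b ->
    `|s - t| < eta -> `|s' - t| < eta -> P s -> P s') ->
  forall s s', a <= s <= b -> a <= s' <= b -> P s -> P s'.
Proof.
move=> H s s' sab s'ab Ps.
pose N (Q : R -> Prop) := [set x : R | exists t eta, `|x - t| < eta /\ forall y, a <= y <= b -> `|y - t| < eta -> Q y].
have oN Q : open (N Q).
  rewrite openE => x [t [eta [xt Hx]]]; apply/nbhs_ballP.
  exists (eta - `|x - t|); first by rewrite /= subr_gt0.
  move=> y; rewrite -ball_normE /= => h; exists t, eta; split=> //.
  have -> : y - t = (x - t) - (x - y) by ring.
  by apply: (le_lt_trans (ler_normB _ _)); move: h; lra.
have E : `[a, b]%classic `&` [set x | P x] = `[a, b]%classic.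
  apply: (@segment_connected R a b).
  - by exists s; split=> //; rewrite /= in_itv.
  - exists (N P) => //; apply/funext => x; apply/propext; split=> [[xab Px]|[xab [t [eta [xt Hx]]]]].
      split=> //; move: xab; rewrite /= in_itv /= => xab; have [eta eta0 He] := H x xab; exists x, eta.
      by rewrite subrr normr0; split=> // y yab yx; apply: (He x y) => //; rewrite subrr normr0.
    by split=> //; apply: Hx => //; move: xab; rewrite /= in_itv.
  exists (~` N (fun x => ~ P x)); first by rewrite closedC; exact: oN.
  apply/funext => x; apply/propext; split=> [[xab Px]|[xab nx]]; split=> //.
    by move=> [t [eta [xt Hx]]]; apply: (Hx x) => //; move: xab; rewrite /= in_itv.
  apply: contrapT => nPx; apply: nx; move: xab; rewrite /= in_itv /= => xab; have [eta eta0 He] := H x xab.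
  exists x, eta; rewrite subrr normr0; split=> // y yab yx Py; apply: nPx.
  by apply: (He y x) => //; rewrite subrr normr0.
have : (`[a, b]%classic `&` [set x | P x]) s' by rewrite E /= in_itv.
by case.
Qed.

Lemma constant_on_ball (R : realType) (g : R -> R) (t eta : R) :
  (forall u, `|u - t| < eta -> is_derive u 1 g 0) ->
  forall u u', `|u - t| < eta -> `|u' - t| < eta -> g u = g u'.
Proof.
move=> H u u'; wlog uu : u u' / u <= u' => [W h1 h2|h1 h2].
  by case/orP: (le_total u u') => h; [exact: W|apply/esym; exact: W].
apply/esym; apply: is_derive1_const_on uu _ => s /andP[us su]; apply: H.
by move: h1 h2; rewrite !ltr_norml => /andP[? ?] /andP[? ?]; lra.
Qed.

(** The energy D'^2 + k D^2 is constant, so D' vanishes; D is then constant, also when k = 0. *)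
Lemma oscillator_unique (R : realType) (k t eta : R) (D D' : R -> R) s : 0 <= k ->
  (forall u, `|u - t| < eta -> is_derive u 1 D (D' u) /\ is_derive u 1 D' (- k * D u)) ->
  `|s - t| < eta -> D s = 0 -> D' s = 0 -> forall u, `|u - t| < eta -> D u = 0 /\ D' u = 0.
Proof.
move=> k0 H st Ds D's.
pose E u := D' u * D' u + k * (D u * D u).
have dE u : `|u - t| < eta -> is_derive u 1 E 0.
  move=> ut; have [h1 h2] := H u ut.
  have := is_deriveD (is_deriveM h2 h2) (is_deriveZ k (is_deriveM h1 h1)).
  by move/is_derive_eq; apply; rewrite /GRing.scale /=; ring.
have D'0 u : `|u - t| < eta -> D' u = 0.
  move=> ut; have := constant_on_ball dE ut st; rewrite /E Ds D's !mulr0 addr0 => e.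
  have := mulr_ge0 k0 (sqr_ge0 (D u)); have := sqr_ge0 (D' u); rewrite !expr2 => h1 h2.
  by apply/eqP; rewrite -sqrf_eq0 expr2 eq_le h1 andbT; move: e h1 h2; lra.
move=> u ut; split; last exact: D'0.
have dD v : `|v - t| < eta -> is_derive v 1 D 0 by move=> vt; rewrite -(D'0 v vt); have [] := H v vt.
by rewrite -Ds; exact: (constant_on_ball dD).
Qed.

Lemma sqrt2_gt0 (R : realType) : 0 < Num.sqrt (2 : R).
Proof. by rewrite sqrtr_gt0. Qed.

Lemma sqrt2_sqr (R : realType) : Num.sqrt (2 : R) ^+ 2 = 2.
Proof. by rewrite sqr_sqrtr. Qed.

(** * Explicit geodesics and logarithm of the model *)

Section ModelGeodesic.
Variables (R : realType) (e0 : 'rV[R]_5) (sg : R).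
Hypothesis sg2 : sg ^+ 2 = 1.
Local Notation crd v k := (v 0 (inord k)).
Local Notation r2 := (Num.sqrt (2 : R)).

Let r20 := sqrt2_gt0 R.
Let r22 := sqrt2_sqr R.

(** The angular speed of the spherical part, on a sphere of radius sqrt 2. The sign [sg] tells over
    which pole the base point e0 lies. *)
Definition omega (v : 'rV[R]_4) : R := Num.sqrt (crd v 2 ^+ 2 + crd v 3 ^+ 2) / r2.
Definition gam_n (v : 'rV[R]_4) (t : R) (k : nat) : R := match k with
  | 0 => crd e0 0 + t * crd v 0 | 1 => crd e0 1 + t * crd v 1
  | 2 => sin (t * omega v) / omega v * crd v 2 | 3 => sin (t * omega v) / omega v * crd v 3
  | _ => sg * r2 * cos (t * omega v) end.
Definition gamd_n (v : 'rV[R]_4) (t : R) (k : nat) : R := match k with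
  | 0 => crd v 0 | 1 => crd v 1
  | 2 => cos (t * omega v) * crd v 2 | 3 => cos (t * omega v) * crd v 3
  | _ => - (sg * r2 * omega v * sin (t * omega v)) end.
(* The geodesic of R^2 x S^2 from e0 with initial velocity (v, 0); division by
   omega v = 0 is harmless since it only multiplies zero components of v. *)
Definition gam v t : 'rV[R]_5 := \row_k gam_n v t k.
Definition gamd v t : 'rV[R]_5 := \row_k gamd_n v t k.

Lemma omega_ge0 v : 0 <= omega v.
Proof. by rewrite divr_ge0 ?sqrtr_ge0. Qed.

Lemma omega_sqr v : 2 * omega v ^+ 2 = crd v 2 ^+ 2 + crd v 3 ^+ 2.
Proof.
rewrite /omega expr_div_n r22 sqr_sqrtr ?addr_ge0 ?sqr_ge0 //; by field.
Qed.

Lemma omega0 v : omega v = 0 -> crd v 2 = 0 /\ crd v 3 = 0.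
Proof.
move=> h; have := omega_sqr v; rewrite h expr0n mulr0 => /esym/eqP.
by rewrite paddr_eq0 ?sqr_ge0 // !sqrf_eq0 => /andP[/eqP-> /eqP->].
Qed.

Lemma gam_derive v t : curve_der (gam v) t (gamd v t).
Proof.
have L : is_derive t 1 (fun t : R => t * omega v) (omega v).
  have -> : (fun t : R => t * omega v) = omega v \*: (id : R -> R) by apply/funext => s; rewrite /GRing.scale /= mulrC.
  by apply: is_derive_eq (is_deriveZ (omega v) (is_derive_id t 1)) _; rewrite /GRing.scale /= mulr1.
have S := @is_derive1_comp R sin (fun t : R => t * omega v) t _ _ (is_derive_sin (t * omega v)) L.
have C := @is_derive1_comp R cos (fun t : R => t * omega v) t _ _ (is_derive_cos (t * omega v)) L.
have lin (a b : R) : is_derive t 1 (fun t : R => a + t * b) b.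
  have H := is_deriveD (is_derive_cst a t 1) (is_deriveZ b (is_derive_id t 1)).
  have -> : (fun t : R => a + t * b) = cst a + b \*: id by apply/funext => s; rewrite /= /GRing.scale /= mulrC.
  by apply: is_derive_eq H _; rewrite add0r /GRing.scale /= mulr1.
have sn (b : R) : (omega v = 0 -> b = 0) -> is_derive t 1 (fun t : R => sin (t * omega v) / omega v * b) (cos (t * omega v) * b).
  move=> hb; have -> : (fun t : R => sin (t * omega v) / omega v * b) = ((omega v)^-1 * b) \*: (sin \o (fun t => t * omega v)).
    by apply/funext => s; rewrite /GRing.scale /= -mulrA mulrC.
  apply: is_derive_eq (is_deriveZ ((omega v)^-1 * b) S) _; rewrite /GRing.scale /=.
  have [w0|w0] := eqVneq (omega v) 0; first by rewrite hb // !mulr0 !mul0r.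
  by field.
have cs : is_derive t 1 (fun t : R => sg * r2 * cos (t * omega v)) (- (sg * r2 * omega v * sin (t * omega v))).
  have -> : (fun t : R => sg * r2 * cos (t * omega v)) = (sg * r2) \*: (cos \o (fun t => t * omega v)) by [].
  by apply: is_derive_eq (is_deriveZ (sg * r2) C) _; rewrite /GRing.scale /=; ring.
move=> i k; have -> : (fun s => gam v s i k) = (fun s => gam_n v s k) by apply/funext => s; rewrite mxE.
rewrite mxE; case: k => [[|[|[|[|[|//]]]]] ?] /=; rewrite /gam_n /gamd_n.
- exact: lin.
- exact: lin.
- by apply: sn => /omega0[].
- by apply: sn => /omega0[].
- exact: cs.
Qed.

Lemma gamd_derive v t : curve_der (gamd v) t (- (omega v ^+ 2) *: (gam v t *m Psph)).
Proof.
have L : is_derive t 1 (fun t : R => t * omega v) (omega v).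
  have -> : (fun t : R => t * omega v) = omega v \*: (id : R -> R) by apply/funext => s; rewrite /GRing.scale /= mulrC.
  by apply: is_derive_eq (is_deriveZ (omega v) (is_derive_id t 1)) _; rewrite /GRing.scale /= mulr1.
have S := @is_derive1_comp R sin (fun t : R => t * omega v) t _ _ (is_derive_sin (t * omega v)) L.
have C := @is_derive1_comp R cos (fun t : R => t * omega v) t _ _ (is_derive_cos (t * omega v)) L.
have cs (b : R) : (omega v = 0 -> b = 0) -> is_derive t 1 (fun t : R => cos (t * omega v) * b) (- omega v ^+ 2 * (sin (t * omega v) / omega v * b * 1)).
  move=> hb; have -> : (fun t : R => cos (t * omega v) * b) = b \*: (cos \o (fun t => t * omega v)).
    by apply/funext => s; rewrite /GRing.scale /= mulrC.
  apply: is_derive_eq (is_deriveZ b C) _; rewrite /GRing.scale /=.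
  have [w0|w0] := eqVneq (omega v) 0; first by rewrite hb // !mulr0 !mul0r mulr0.
  by field.
have sn : is_derive t 1 (fun t : R => - (sg * r2 * omega v * sin (t * omega v))) (- omega v ^+ 2 * (sg * r2 * cos (t * omega v) * 1)).
  pose K := - (sg * r2 * omega v).
  have -> : (fun t : R => - (sg * r2 * omega v * sin (t * omega v))) = K \*: (sin \o (fun t => t * omega v)).
    by apply/funext => s; exact: esym (mulNr _ _).
  by apply: is_derive_eq (is_deriveZ K S) _; rewrite /GRing.scale /= /K; ring.
move=> i k; have -> : (fun s => gamd v s i k) = (fun s => gamd_n v s k) by apply/funext => s; rewrite mxE.
have -> : (- (omega v ^+ 2) *: (gam v t *m Psph)) i k = - omega v ^+ 2 * (gam_n v t k * (2 <= k)%N%:R).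
  by rewrite [LHS]mxE mul_Psph [gam v t i k]mxE.
case: k => [[|[|[|[|[|//]]]]] ?] /=; rewrite /gam_n /gamd_n ?mulr0.
- exact: is_derive_cst.
- exact: is_derive_cst.
- by apply: cs => /omega0[].
- by apply: cs => /omega0[].
- exact: sn.
Qed.

Lemma gamd_speed v t : ((gamd v t *m Psph) *m (gamd v t *m Psph)^T) 0 0 = 2 * omega v ^+ 2.
Proof.
have E k : (gamd v t *m Psph) 0 k = gamd_n v t k * (2 <= k)%N%:R by rewrite mul_Psph mxE.
rewrite mxE; under eq_bigr => k _ do rewrite [(_)^T _ _]mxE E.
rewrite !big_ord_recl big_ord0 /= !mulr0 !mulr1 !addr0 !add0r.
have := omega_sqr v; have := cos2Dsin2 (t * omega v).
move: (cos (t * omega v)) (sin (t * omega v)) => c s; move: (omega v) (v 0 (inord 2)) (v 0 (inord 3)) => w x y cs w2.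
have -> : c * x * (c * x) + (c * y * (c * y) + - (sg * r2 * w * s) * - (sg * r2 * w * s)) =
  c ^+ 2 * (x ^+ 2 + y ^+ 2) + sg ^+ 2 * r2 ^+ 2 * w ^+ 2 * s ^+ 2 by ring.
rewrite -w2 sg2 r22; transitivity (2 * w ^+ 2 * (c ^+ 2 + s ^+ 2)); first by ring.
by rewrite cs mulr1.
Qed.

Lemma gam_0 v : crd e0 2 = 0 -> crd e0 3 = 0 -> crd e0 4 = sg * r2 -> gam v 0 = e0.
Proof.
move=> h2 h3 h4; apply/rowP => k; rewrite mxE -[k in RHS]inord_val.
case: k => [[|[|[|[|[|//]]]]] ?] /=; rewrite /gam_n !mul0r ?sin0 ?cos0 ?mul0r ?mulr1 ?addr0 //.
Qed.

Let ocont (v : 'rV[R]_4) k : {for v, continuous (fun v : 'rV[R]_4 => crd v k)}.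
Proof. exact: coord_continuous. Qed.

Lemma omega_continuous : continuous omega.
Proof.
move=> v.
have cq k := continuousM (@ocont v k) (@ocont v k).
have cs : {for v, continuous (fun v : 'rV[R]_4 => Num.sqrt (crd v 2 ^+ 2 + crd v 3 ^+ 2))}.
  have H := continuousD (cq 2) (cq 3).
  apply: (@continuous_comp _ _ _ (fun v : 'rV[R]_4 => crd v 2 ^+ 2 + crd v 3 ^+ 2) Num.sqrt v H).
  exact: sqrt_continuous.
have cc : {for v, continuous (fun v : 'rV[R]_4 => r2^-1)} by exact: cst_continuous.
exact: (continuousM cs cc).
Qed.

Lemma gam_continuous v t (eps : R) : 0 < eps -> exists2 d, 0 < d &
  forall v' u, `|v' - v| < d -> `|u - t| < d -> `|gam v' u - gam v t| < eps.
Proof.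
move=> eps0.
pose z0 : 'rV[R]_4 * R := (v, t).
have cf : {for z0, continuous (fun z : 'rV[R]_4 * R => z.1)} by exact: cvg_fst.
have c1 k : {for z0, continuous (fun z : 'rV[R]_4 * R => crd z.1 k)}.
  have H := @continuous_comp _ _ _ (fun z : 'rV[R]_4 * R => z.1) (fun v : 'rV[R]_4 => crd v k) z0 cf (@ocont z0.1 k).
  exact: H.
have cw : {for z0, continuous (fun z : 'rV[R]_4 * R => omega z.1)}.
  have H := @continuous_comp _ _ _ (fun z : 'rV[R]_4 * R => z.1) omega z0 cf (@omega_continuous z0.1).
  exact: H.
have ct : {for z0, continuous (fun z : 'rV[R]_4 * R => z.2 : R)} by exact: cvg_snd.
have ctw : {for z0, continuous (fun z : 'rV[R]_4 * R => z.2 * omega z.1 : R)} by exact: (continuousM ct cw).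
have cc (a : R) : {for z0, continuous (fun z : 'rV[R]_4 * R => a)} by exact: cst_continuous.
have csin : {for z0, continuous (fun z : 'rV[R]_4 * R => sin (z.2 * omega z.1) : R)}.
  exact: (@continuous_comp _ _ _ (fun z : 'rV[R]_4 * R => z.2 * omega z.1 : R) sin z0 ctw (@continuous_sin R _)).
have ccos : {for z0, continuous (fun z : 'rV[R]_4 * R => cos (z.2 * omega z.1) : R)}.
  exact: (@continuous_comp _ _ _ (fun z : 'rV[R]_4 * R => z.2 * omega z.1 : R) cos z0 ctw (@continuous_cos R _)).
(* The delicate case is omega v = 0, where the quotient alone is not controlled; the bound on the
   coordinate dominates the product by sqrt 2 |sin|, which tends to 0. *)
have csn k : (forall v : 'rV[R]_4, `|crd v k| <= r2 * omega v) -> {for z0, continuous (fun z : 'rV[R]_4 * R => sin (z.2 * omega z.1) / omega z.1 * crd z.1 k : R)}.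
  move=> hk; have [w0|w0] := eqVneq (omega v) 0; last first.
    have cV : {for z0, continuous (fun z : 'rV[R]_4 * R => (omega z.1)^-1)} by exact: (@continuousV _ _ (fun z : 'rV[R]_4 * R => omega z.1) z0 w0 cw).
    have c2 := continuousM csin cV; have c3 := continuousM c2 (c1 k); exact: c3.
  have v0 : crd v k = 0 by apply/eqP; rewrite -normr_le0; apply: (le_trans (hk v)); rewrite w0 mulr0.
  pose F (z : 'rV[R]_4 * R) := sin (z.2 * omega z.1) / omega z.1 * crd z.1 k.
  have F0 : F z0 = 0 by rewrite /F /z0 /= v0 mulr0.
  suff L : F z @[z --> z0] --> (0 : R).
    have L' : F z @[z --> z0] --> F z0 by rewrite F0.
    exact: L'.
  have C0 : (fun z : 'rV[R]_4 * R => r2 * `|sin (z.2 * omega z.1)|) z @[z --> z0] --> (0 : R).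
    pose F1 (z : 'rV[R]_4 * R) := r2 * `|sin (z.2 * omega z.1)|.
    have F10 : F1 z0 = 0 by rewrite /F1 /z0 /= w0 mulr0 sin0 normr0 mulr0.
    have H := @continuous_comp _ _ _ (fun z : 'rV[R]_4 * R => sin (z.2 * omega z.1) : R) (fun x : R => `|x|) z0 csin (@norm_continuous _ _ _).
    have H2 : F1 z @[z --> z0] --> F1 z0 := continuousM (cc r2) H.
    by rewrite F10 in H2.
  apply: norm_cvg0; apply: (squeeze_cvgr _ (cvg_cst 0) C0); apply: nearW => z.
  rewrite normr_ge0 /F /= normrM normrM mulrC mulrA normfV (ger0_norm (omega_ge0 _)).
  have [wz|wz] := eqVneq (omega z.1) 0; first by rewrite wz invr0 mulr0 mulr_ge0 // ltW.
  rewrite mulrAC ler_wpM2r // ler_pdivrMr ?hk // lt_neqAle eq_sym wz omega_ge0 //.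
have hk (k : nat) : k = 2%N \/ k = 3%N -> forall v : 'rV[R]_4, `|crd v k| <= r2 * omega v.
  move=> hk v'; have -> : r2 * omega v' = Num.sqrt (crd v' 2 ^+ 2 + crd v' 3 ^+ 2).
    by rewrite /omega mulrC divfK // lt0r_neq0.
  rewrite -sqrtr_sqr ler_wsqrtr //.
  by case: hk => ->; rewrite ?lerDl ?lerDr sqr_ge0.
have cg (k : 'I_5) : {for z0, continuous (fun z : 'rV[R]_4 * R => gam_n z.1 z.2 k)}.
  case: k => [[|[|[|[|[|//]]]]] ?] /=; rewrite /gam_n.
  - exact: (continuousD (cc _) (continuousM ct (c1 0))).
  - exact: (continuousD (cc _) (continuousM ct (c1 1))).
  - by apply: csn; apply: hk; left.
  - by apply: csn; apply: hk; right.
  - exact: (continuousM (cc _) ccos).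
have N (k : 'I_5) : \forall z \near z0, `|gam_n z.1 z.2 k - gam_n v t k| < eps / 2.
  have := cg k; rewrite /continuous_at => /cvgrPdist_lt /(_ (eps / 2)); rewrite divr_gt0 // => /(_ isT).
  by apply: filterS => z; rewrite distrC.
have N5 : \forall z \near z0, forall k : 'I_5, `|gam_n z.1 z.2 k - gam_n v t k| < eps / 2.
  exact: (@filter_forall _ _ (fun (k : 'I_5) z => `|gam_n z.1 z.2 k - gam_n v t k| < eps / 2) (nbhs z0) _ N).
have /nbhs_ballP[d d0 Hd] := N5; exists d => // v' u hv hu.
have e2 : eps / 2 < eps by rewrite ltr_pdivrMr // ltr_pMr // ltr1n.
apply: (le_lt_trans _ e2); apply: norm_rV_le => [|k]; first by rewrite divr_ge0 // ltW.
have bz : ball z0 d (v', u).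
  by split; rewrite -ball_normE /= distrC.
by have := Hd _ bz k; rewrite !mxE /= => /ltW.
Qed.

End ModelGeodesic.

Section Orthogonal.
Variables (R : realType) (g : 'M[R]_5).
Hypothesis gg : g *m g^T = 1%:M.

Lemma orth_tr : g^T *m g = 1%:M.
Proof. exact: mulmx1C. Qed.

Lemma orth_entry i j : `|g i j| <= 1.
Proof.
have := congr1 (fun X : 'M[R]_5 => X i i) gg; rewrite [RHS]mxE eqxx mxE (bigD1 j) //= [_^T _ _]mxE => E.
have : g i j ^+ 2 <= 1.
  by rewrite -[X in _ <= X]E expr2 lerDl; apply: sumr_ge0 => k _; rewrite [_^T _ _]mxE -expr2 sqr_ge0.
by rewrite -(real_normK (num_real (g i j))) expr_le1.
Qed.

(** Row vectors carry the sup norm, which orthogonal matrices preserve only up to a factor; 5 comes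
    from bounding their entries by 1. *)
Lemma orth_norm (u : 'rV[R]_5) : `|u| <= 5%:R * `|u *m g|.
Proof.
have {1}-> : u = (u *m g) *m g^T by rewrite -mulmxA gg mulmx1.
move: (u *m g) => w; apply: norm_rV_le => [|k]; first by rewrite mulr_ge0.
rewrite -[`|w|]mulr1; apply: mulmx_bound => [a j|j l]; rewrite ?(ord1 a) ?coord_le_norm // mxE.
exact: orth_entry.
Qed.

End Orthogonal.

Section Logarithm.
Variables (R : realType) (e0 : 'rV[R]_5) (sg : R).
Hypothesis sg2 : sg ^+ 2 = 1.
Local Notation crd v k := (v 0 (inord k)).
Local Notation r2 := (Num.sqrt (2 : R)).
Let r20 := sqrt2_gt0 R.
Let r22 := sqrt2_sqr R.

Definition rad (e : 'rV[R]_5) : R := Num.sqrt (crd e 2 ^+ 2 + crd e 3 ^+ 2).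
(* Twice the arctangent of the stereographic radius is the polar angle. *)
Definition angle (e : 'rV[R]_5) : R := 2 * atan (rad e / (r2 + sg * crd e 4)).
(** The logarithm at e0: the velocity of the geodesic that reaches e at time 1. It makes sense away
    from the points over the opposite pole. *)
Definition lam_n (e : 'rV[R]_5) (k : nat) : R := match k with
  | 0 => crd e 0 - crd e0 0 | 1 => crd e 1 - crd e0 1
  | 2 => r2 * angle e / rad e * crd e 2 | _ => r2 * angle e / rad e * crd e 3 end.
Definition lam e : 'rV[R]_4 := \row_k lam_n e k.

Lemma onE_crd (e : 'rV[R]_5) : onE e -> crd e 2 ^+ 2 + crd e 3 ^+ 2 + crd e 4 ^+ 2 = 2.
Proof.
move=> /(congr1 (fun X : 'M[R]_1 => X 0 0)); rewrite [RHS]mxE eqxx mulr1n mxE.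
have E (k : 'I_5) : (e *m Psph) 0 k = crd e k * (2 <= k)%N%:R by rewrite mul_Psph inord_val.
under eq_bigr => k _ do rewrite [(_)^T _ _]mxE E.
rewrite !big_ord_recl big_ord0 /= !mulr0 !mulr1 !addr0 !add0r => <-.
by rewrite !expr2 -addrA.
Qed.

Lemma rad_ge0 e : 0 <= rad e. Proof. exact: sqrtr_ge0. Qed.

Lemma rad_sqr e : rad e ^+ 2 = crd e 2 ^+ 2 + crd e 3 ^+ 2.
Proof. by rewrite /rad sqr_sqrtr // addr_ge0 ?sqr_ge0. Qed.

Lemma rad_bound (e : 'rV[R]_5) (k : nat) : k = 2 \/ k = 3 -> `|crd e k| <= rad e.
Proof. by move=> hk; rewrite -sqrtr_sqr ler_wsqrtr //; case: hk => ->; rewrite ?lerDl ?lerDr sqr_ge0. Qed.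

Section AtPoint.
Variable e : 'rV[R]_5.
Hypothesis eE : onE e.
Hypothesis ne : sg * crd e 4 != - r2.

Let h := r2 + sg * crd e 4.
Let tau := rad e / h.

Lemma height_pos : 0 < h.
Proof.
rewrite lt_neqAle /h; apply/andP; split.
  by rewrite eq_sym addrC -[X in _ + X]opprK subr_eq0.
have : `|sg * crd e 4| <= r2.
  rewrite -(@ler_pXn2r _ 2) ?nnegrE ?(ltW r20) // real_normK ?num_real // exprMn sg2 mul1r r22.
  by rewrite -(onE_crd eE) lerDr addr_ge0 ?sqr_ge0.
by rewrite ler_norml => /andP[h1 _]; move: h1; lra.
Qed.

Lemma tau_sqr : (1 + tau ^+ 2) * h = 2 * r2.
Proof.
have h0 := lt0r_neq0 height_pos; rewrite mulrDl mul1r /tau expr_div_n.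
have -> : rad e ^+ 2 / h ^+ 2 * h = rad e ^+ 2 / h by field.
have E : rad e ^+ 2 = 2 - crd e 4 ^+ 2 by rewrite rad_sqr -(onE_crd eE); ring.
apply: (mulIf h0); rewrite mulrDl divfK // E.
have -> : crd e 4 ^+ 2 = sg ^+ 2 * crd e 4 ^+ 2 by rewrite sg2 mul1r.
have -> : 2 - sg ^+ 2 * crd e 4 ^+ 2 = r2 ^+ 2 - sg ^+ 2 * crd e 4 ^+ 2 by rewrite r22.
by rewrite /h; ring.
Qed.

Lemma angle_sin_cos : sin (angle e) = rad e / r2 /\ cos (angle e) = sg * crd e 4 / r2.
Proof.
have h0 := lt0r_neq0 height_pos; have t0 := tau_sqr; have rr := lt0r_neq0 r20.
rewrite /angle -/h -/tau; set x := atan tau; have T : tan x = tau by exact: atanK.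
have C2 : cos x ^+ 2 * (1 + tau ^+ 2) = 1.
  rewrite /x cos_atan exprVn sqr_sqrtr ?mulVf ?lt0r_neq0 // ?addr_ge0 ?sqr_ge0 //.
  by rewrite ltr_pwDl ?ltr01 // sqr_ge0.
have c0 : cos x != 0 by apply/eqP => c0; move: C2; rewrite c0 expr0n mul0r => /eqP; rewrite eq_sym oner_eq0.
have S : sin x = tau * cos x by rewrite -T /tan divfK.
have C3 : cos x ^+ 2 = h / (2 * r2).
  have q0 : 1 + tau ^+ 2 != 0 by apply/eqP => q0; move: C2; rewrite q0 mulr0 => /eqP; rewrite eq_sym oner_eq0.
  by rewrite -t0 -[LHS](mulfK q0) C2; field; rewrite q0 h0.
have -> : 2 * x = x *+ 2 by rewrite mulr_natl.
split; first rewrite sin_mulr2n S -mulr_natl.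
  transitivity (2 * (tau * cos x ^+ 2)); first by ring.
  by rewrite C3 /tau; field; rewrite h0 rr.
rewrite cos_mulr2n C3 -mulr_natl /h; by field.
Qed.

Lemma angle_ge0 : 0 <= angle e.
Proof. by rewrite /angle mulr_ge0 // -atan0 le_atan // divr_ge0 ?rad_ge0 // ltW // height_pos. Qed.

Lemma angle_eq0 : rad e != 0 -> angle e != 0.
Proof.
move=> r0; apply/eqP => a0; have [S _] := angle_sin_cos; move: S; rewrite a0 sin0 => /esym/eqP.
by rewrite mulf_eq0 invr_eq0 (negbTE r0) (negbTE (lt0r_neq0 r20)).
Qed.

Lemma angle_rad0 : rad e = 0 -> angle e = 0.
Proof. by move=> r0; rewrite /angle r0 mul0r atan0 mulr0. Qed.

Lemma rad0_crd : rad e = 0 -> crd e 2 = 0 /\ crd e 3 = 0.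
Proof.
move=> r0; have := rad_bound e (or_introl erefl); have := rad_bound e (or_intror erefl).
by rewrite r0 !normr_le0 => /eqP -> /eqP ->.
Qed.

Lemma lam_crd k : (k < 4)%N -> crd (lam e) k = lam_n e k.
Proof. by move=> k4; rewrite mxE inordK. Qed.

Lemma omega_lam : omega (lam e) = angle e.
Proof.
rewrite /omega !lam_crd // /lam_n; have a0 := angle_ge0; have ar := angle_rad0.
move: (angle e) a0 ar => a a0 ar; rewrite !exprMn -mulrDr -rad_sqr exprVn.
have [r0|r0] := eqVneq (rad e) 0.
  by rewrite r0 expr0n mulr0 sqrtr0 mul0r ar.
rewrite divfK ?expf_neq0 // -exprMn sqrtr_sqr ger0_norm ?mulr_ge0 ?(ltW r20) //.
by rewrite mulrC mulKf // lt0r_neq0.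
Qed.

Lemma gam_lam : gam e0 sg (lam e) 1 = e.
Proof.
have [S C] := angle_sin_cos; have rr := lt0r_neq0 r20.
have sn (b : R) : (rad e = 0 -> b = 0) -> sin (1 * omega (lam e)) / omega (lam e) * (r2 * angle e / rad e * b) = b.
  move=> hb; rewrite mul1r omega_lam S; have [r0|r0] := eqVneq (rad e) 0; first by rewrite hb // !mulr0.
  by have a0 := angle_eq0 r0; field; rewrite r0 a0 rr.
apply/rowP => k; rewrite mxE -[k in RHS]inord_val.
case: k => [[|[|[|[|[|//]]]]] ?] /=; rewrite /gam_n ?lam_crd // /lam_n.
- by rewrite mul1r addrC subrK.
- by rewrite mul1r addrC subrK.
- by apply: sn => /rad0_crd[].
- by apply: sn => /rad0_crd[].
rewrite mul1r omega_lam C.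
transitivity (sg ^+ 2 * crd e 4); [by field | by rewrite sg2 mul1r].
Qed.

Lemma lam_continuous : {for e, continuous lam}.
Proof.
have co k : {for e, continuous (fun e : 'rV[R]_5 => crd e k)} by exact: coord_continuous.
have cc (a : R) : {for e, continuous (fun e : 'rV[R]_5 => a)} by exact: cst_continuous.
have cr : {for e, continuous rad}.
  have H := continuousD (continuousM (co 2) (co 2)) (continuousM (co 3) (co 3)).
  have H2 := @continuous_comp _ _ _ (fun e : 'rV[R]_5 => crd e 2 ^+ 2 + crd e 3 ^+ 2) Num.sqrt e H (@sqrt_continuous R _).
  exact: H2.
have ch : {for e, continuous (fun e : 'rV[R]_5 => r2 + sg * crd e 4)}.
  exact: (continuousD (cc r2) (continuousM (cc sg) (co 4))).
have ca : {for e, continuous angle}.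
  have cV : {for e, continuous (fun e : 'rV[R]_5 => (r2 + sg * crd e 4)^-1)} by exact: (@continuousV _ _ (fun e : 'rV[R]_5 => r2 + sg * crd e 4) e (lt0r_neq0 height_pos) ch).
  have H := continuousM cr cV.
  have H2 := @continuous_comp _ _ _ (fun e : 'rV[R]_5 => rad e / (r2 + sg * crd e 4)) atan e H (@continuous_atan R _).
  exact: (continuousM (cc 2) H2).
have ck k : k = 2 \/ k = 3 -> {for e, continuous (fun e : 'rV[R]_5 => r2 * angle e / rad e * crd e k)}.
  move=> hk; have [r0|r0] := eqVneq (rad e) 0; last first.
    have cV : {for e, continuous (fun e : 'rV[R]_5 => (rad e)^-1)} by exact: (@continuousV _ _ rad e r0 cr).
    have c2 := continuousM (cc r2) ca; have c3 := continuousM c2 cV; have c4 := continuousM c3 (co k); exact: c4.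
  have e0k : crd e k = 0 by have [h2 h3] := rad0_crd r0; case: hk => ->.
  pose H (z : 'rV[R]_5) : R := r2 * angle z / rad z * crd z k.
  have H0 : H e = 0 by rewrite /H e0k mulr0.
  have C0 : (fun z : 'rV[R]_5 => r2 * `|angle z|) z @[z --> e] --> (0 : R).
    have H2 := @continuous_comp _ _ _ angle (fun x : R => `|x|) e ca (@norm_continuous _ _ _).
    pose F1 (z : 'rV[R]_5) : R := r2 * `|angle z|.
    have F10 : F1 e = 0 by rewrite /F1 angle_rad0 // normr0 mulr0.
    have H3 : F1 z @[z --> e] --> F1 e := continuousM (cc r2) H2.
    by rewrite F10 in H3.
  have S (z : 'rV[R]_5) : 0 <= `|H z| <= r2 * `|angle z|.
    rewrite normr_ge0 /H /= !normrM (ger0_norm (ltW r20)) normfV (ger0_norm (rad_ge0 _)).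
    have [rz|rz] := eqVneq (rad z) 0; first by rewrite rz invr0 mulr0 mul0r mulr_ge0 // ltW.
    have rz0 : 0 < rad z by rewrite lt_neqAle eq_sym rz rad_ge0.
    rewrite mulrAC ler_pdivrMr // ler_wpM2l ?mulr_ge0 ?(ltW r20) //; exact: rad_bound.
  suff : {for e, continuous H} by [].
  apply: continuous_at_dist => eps eps0.
  have /cvgrPdist_lt /(_ eps eps0) /nbhs_rV_ball[d d0 Hd] := C0; exists d => // y yd.
  rewrite H0 sub0r normrN; apply: (le_trans (andP (S y)).2); apply: ltW.
  by have := Hd y yd; rewrite sub0r normrN; apply: le_lt_trans; exact: ler_norm.
apply: rV_continuous => k.
have -> : (fun y => lam y 0 k) = (fun y => lam_n y k) by apply/funext => y; rewrite mxE.
case: k => [[|[|[|[|//]]]] ?] /=; rewrite /lam_n.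
- exact: (continuousB (co 0) (cc _)).
- exact: (continuousB (co 1) (cc _)).
- by apply: ck; left.
- by apply: ck; right.
Qed.

End AtPoint.
End Logarithm.

(** * Developing geodesics into the model *)

Section Development.
Variables (R : realType) (M : riemannian_data R 4) (f : M -> R).
Hypothesis sol : shrinking_gradient_ricci_soliton f.
Hypothesis scal : constant_scalar_curvature M 1.
Let rM := sol_riemannian sol.
Let mM := sol_manifold sol.
Local Notation crd v k := (v 0 (inord k)).
Variables (e0 : 'rV[R]_5) (sg : R).
Hypothesis sg2 : sg ^+ 2 = 1.
Local Notation gam := (gam e0 sg).
Local Notation gamd := (gamd sg).

(** Once the spherical speed is known to be constant, each coordinate of the developed geodesic and
    of [gam] solves the same oscillator equation, so agreement to first order at s spreads over the
    interval. *)
Lemma geodesic_model O psi (c : R -> M) v (t eta s : R) : good f O psi -> geodesic c ->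
  (forall u, `|u - t| < eta -> O (c u)) -> `|s - t| < eta ->
  psi (c s) = gam v s -> curve_der (fun s => psi (c s)) s (gamd v s) ->
  forall u, `|u - t| < eta -> psi (c u) = gam v u /\ curve_der (fun s => psi (c s)) u (gamd v u).
Proof.
move=> gd gc Oc st Es Ds.
pose X' u : 'rV[R]_5 := \row_k derive1 (fun s => psi (c s) 0 k) u.
have G u (ut : `|u - t| < eta) := good_geodesic sol scal gd gc (Oc u ut).
pose W u := X' u *m Psph; pose q u := (W u *m (W u)^T) 0 0.
have dX u : `|u - t| < eta -> curve_der (fun s => psi (c s)) u (X' u).
  by move=> ut i k; rewrite (ord1 i); have [_ /(_ k)[]] := G u ut.
have dX' u : `|u - t| < eta -> curve_der X' u (- (q u / 2) *: (psi (c u) *m Psph)).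
  move=> ut i k; rewrite (ord1 i); have [_ /(_ k)[_ h]] := G u ut.
  have -> : (- (q u / 2) *: (psi (c u) *m Psph)) 0 k = - (q u / 2) * (psi (c u) *m Psph) 0 k by rewrite [LHS]mxE.
  by apply: is_derive_eq h _; rewrite mulNr.
(* The acceleration is a multiple of the spherical position, to which the velocity is orthogonal. *)
have dq u : `|u - t| < eta -> is_derive u 1 q 0.
  move=> ut; have dW := curve_derM (dX' u ut) (curve_der_const Psph u).
  have [perp _] := G u ut.
  have Z : (- (q u / 2) *: (psi (c u) *m Psph) *m Psph + X' u *m 0) *m (W u)^T = 0.
    rewrite mulmx0 addr0 -!scalemxAl -(mulmxA _ Psph Psph) Psph_idem /W trmx_mul tr_Psph.
    rewrite mulmxA -(mulmxA _ Psph Psph) Psph_idem.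
    have -> : psi (c u) *m Psph *m (X' u)^T = 0 by rewrite -[LHS]trmxK trmx_mul trmxK perp trmx0.
    by rewrite scaler0.
  have := curve_derM dW (curve_der_tr dW) 0 0; rewrite [X in X + _]Z.
  have -> : X' u *m Psph *m (- (q u / 2) *: (psi (c u) *m Psph) *m Psph + X' u *m 0)^T = 0.
    by rewrite -[LHS]trmxK trmx_mul trmxK Z trmx0.
  by rewrite addr0 [(0 : 'M[R]_1) 0 0]mxE.
have X's : X' s = gamd v s by exact: curve_der_unique (dX s st) Ds.
have qs u : `|u - t| < eta -> q u = 2 * omega v ^+ 2.
  by move=> ut; rewrite (constant_on_ball dq ut st) /q /W X's; exact: gamd_speed.
pose kk (k : 'I_5) : R := omega v ^+ 2 * (2 <= k)%N%:R.
have kk0 k : 0 <= kk k by rewrite mulr_ge0 ?sqr_ge0.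
have H k u : `|u - t| < eta ->
   is_derive u 1 (fun u => psi (c u) 0 k - gam v u 0 k) (X' u 0 k - gamd v u 0 k) /\
   is_derive u 1 (fun u => X' u 0 k - gamd v u 0 k) (- kk k * (psi (c u) 0 k - gam v u 0 k)).
  move=> ut; split; first exact: is_deriveB (dX u ut 0 k) (gam_derive e0 sg v u 0 k).
  apply: is_derive_eq (is_deriveB (dX' u ut 0 k) (gamd_derive e0 sg v u 0 k)) _.
  have E (a : R) (X : 'rV[R]_5) : (a *: (X *m Psph)) 0 k = a * (X 0 k * (2 <= k)%N%:R) by rewrite [LHS]mxE mul_Psph.
  rewrite !E qs // /kk; by field.
have Z k u (ut : `|u - t| < eta) : psi (c u) 0 k - gam v u 0 k = 0 /\ X' u 0 k - gamd v u 0 k = 0.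
  by apply: (oscillator_unique (kk0 k) (H k) st _ _ ut); rewrite ?Es ?X's subrr.
move=> u ut; split.
  by apply/rowP => k; apply/eqP; rewrite -subr_eq0; apply/eqP; have [] := Z k u ut.
have -> : gamd v u = X' u.
  by apply/rowP => k; apply/esym/eqP; rewrite -subr_eq0; apply/eqP; have [] := Z k u ut.
exact: dX.
Qed.

Variable c : 'rV[R]_4 -> R -> M.
Hypothesis gc : forall v, geodesic (c v).

Definition agree (O : set M) (psi : M -> 'rV[R]_5) v t :=
  [/\ O (c v t), psi (c v t) = gam v t & curve_der (fun s => psi (c v s)) t (gamd v t)].
Definition agree_near O psi v t := exists2 d, 0 < d & forall v', `|v' - v| < d -> agree O psi v' t.

Lemma curve_in (v : 'rV[R]_4) t (V : set M) : open V -> V (c v t) -> exists2 eta, 0 < eta & forall u, `|u - t| < eta -> V (c v u).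
Proof.
move=> oV Vt; have := curve_near_open (geodesic_continuous (gc v)) oV Vt.
move=> /nbhs_ballP[d d0 Hd]; exists d => // u ut; apply: Hd.
by rewrite -ball_normE /= distrC.
Qed.

(** Continuous dependence of the geodesics on v is obtained here, not assumed. While the curve of a
    nearby v' agrees with the model, its image under psi stays close to that of [c v t], so the
    curve stays in a closed set inside O and cannot leave O; agreement is therefore locally constant
    in time. The rotation g is universally quantified after eta, for the sake of chart changes. *)
Lemma agree_local O psi v t : good f O psi -> O (c v t) -> exists2 eta, 0 < eta &
  forall g : 'M[R]_5, g *m g^T = 1%:M -> g *m Psph = Psph *m g -> forall s s' : R, `|s - t| < eta -> `|s' - t| < eta ->
    agree_near O (fun q => psi q *m g) v s -> agree_near O (fun q => psi q *m g) v s'.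
Proof.
move=> gd Ot; have [eps [B [eps0 cB BO HB]]] := good_barrier sol gd Ot.
have [eta1 eta10 H1] := curve_in (good_open sol gd) Ot.
have e5 : 0 < eps / 5%:R by rewrite divr_gt0.
have [d1 d10 H2] := gam_continuous e0 sg v t e5.
exists (Num.min eta1 d1); first by rewrite lt_min eta10 d10.
move=> g g1 g2 s s'; rewrite !lt_min => /andP[s1 s2] /andP[s1' s2'] [d d0 A].
have gg := good_rot gd g1 g2.
have vv (e : R) : 0 < e -> `|v - v| < e by rewrite subrr normr0.
have [Os Es Ds] := A v (vv _ d0).
have t1 : `|t - t| < eta1 by rewrite subrr normr0.
have [Et _] := geodesic_model gg (gc v) H1 s1 Es Ds t1.
exists (Num.min d d1); first by rewrite lt_min d0 d10.
move=> v'; rewrite lt_min => /andP[v1 v2].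
pose a := Num.min s s'; pose b := Num.max s s'.
have ab u : a <= u <= b -> `|u - t| < d1.
  rewrite /a /b ge_min le_max => /andP[h1 h2]; move: s2 s2'; rewrite !ltr_norml => /andP[? ?] /andP[? ?].
  by case/orP: h1 => ?; case/orP: h2 => ?; apply/andP; split; lra.
have sab : a <= s <= b by rewrite /a /b ge_min le_max lexx.
have sab' : a <= s' <= b by rewrite /a /b ge_min le_max lexx !orbT.
apply: (locally_constant (P := agree O (fun q => psi q *m g) v') (a := a) (b := b) _ sab sab'); last exact: A.
move=> u uab; have [Ou|nOu] := pselect (O (c v' u)).
  have [eta eta0 He] := curve_in (good_open sol gd) Ou; exists eta => // r r' _ _ ru ru' [_ Er Dr].
  have [Er' Dr'] := geodesic_model gg (gc v') He ru Er Dr ru'.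
  by split=> //; exact: He.
have nB : (~` B) (c v' u) by move=> /BO.
have oB : open (~` B) by rewrite openC.
have [eta eta0 He] := curve_in oB nB; exists eta => // r r' rab _ ru _ [Or Er _].
exfalso; apply: (He r ru); apply: HB => //; apply: (le_trans (orth_norm g1 _)).
rewrite mulmxBl Er Et mulrC -ler_pdivlMr //; apply: ltW; exact: H2 v2 (ab r rab).
Qed.

Definition develops v t := exists O psi, good f O psi /\ agree_near O psi v t.

(** At each time a good pair around the current point is rotated so as to match the previous one on
    the overlap; [agree_local] then moves the agreement along. *)
Lemma develops_all v t : 0 <= t <= 1 -> develops v 0 -> develops v t.
Proof.
move=> t01; apply: (locally_constant (P := develops v) (a := 0) (b := 1)) => //; last by rewrite lexx ler01.
move=> u u01; have sq2 := sqrt2_sqr R.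
have [D' [psi' [gd' Ou _]]] := good_exists sol scal (c v u) sq2.
have [eta1 eta10 H1] := agree_local gd' Ou.
have [eta2 eta20 H2] := curve_in (good_open sol gd') Ou.
exists (Num.min eta1 eta2); first by rewrite lt_min eta10 eta20.
move=> s s' _ _; rewrite !lt_min => /andP[s1 s2] /andP[s1' s2'] [D [psi [gd [d d0 A]]]].
have vv (e : R) : 0 < e -> `|v - v| < e by rewrite subrr normr0.
have [Os Es Ds] := A v (vv _ d0).
have [g [g1 g2 N]] := good_transition sol scal gd' gd (H2 s s2) Os.
exists D', (fun q => psi' q *m g); split; first exact: good_rot.
apply: (H1 g g1 g2 s s' s1 s1').
pose V := [set q | psi q = psi' q *m g /\ D' q].
have NV : nbhs (c v s) V^°.
  apply: nbhs_interior; apply: filterI N _; exact: open_nbhs_nbhs (conj (good_open sol gd') (H2 s s2)).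
have [e e0' He] := good_near sol gd Os NV.
have [d1 d10 Hd1] := gam_continuous e0 sg v s e0'.
exists (Num.min d d1); first by rewrite lt_min d0 d10.
move=> v'; rewrite lt_min => /andP[v1 v2]; have [Os' Es' Ds'] := A v' v1.
have ss : `|s - s| < d1 by rewrite subrr normr0.
have Vi : V^° (c v' s) by apply: He => //; rewrite Es' Es; exact: Hd1.
have [E1 O1] := interior_subset Vi; split=> //; first by rewrite -E1.
apply: curve_der_near Ds'; have := curve_near_open (geodesic_continuous (gc v')) (@open_interior _ V) Vi.
by apply: filterS => r Vr; have [] := interior_subset Vr.
Qed.

End Development.

Section Exponential.
Variables (R : realType) (M : riemannian_data R 4) (f : M -> R).
Hypothesis sol : shrinking_gradient_ricci_soliton f.
Hypothesis scal : constant_scalar_curvature M 1.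
Let rM := sol_riemannian sol.
Let mM := sol_manifold sol.
Local Notation crd v k := (v 0 (inord k)).
Variables (e0 : 'rV[R]_5) (sg : R).
Hypothesis sg2 : sg ^+ 2 = 1.
Hypothesis e02 : crd e0 2 = 0.
Hypothesis e03 : crd e0 3 = 0.
Hypothesis e04 : crd e0 4 = sg * Num.sqrt 2.
Local Notation gam := (gam e0 sg).
Local Notation gamd := (gamd sg).
Variables (O0 : set M) (psi0 : M -> 'rV[R]_5) (p0 : M).
Hypothesis gd0 : good f O0 psi0.
Hypothesis Op0 : O0 p0.
Hypothesis Ep0 : psi0 p0 = e0.

Lemma initial_perp v : gamd v 0 *m (e0 *m Psph)^T = 0.
Proof.
apply/matrixP => i j; rewrite (ord1 i) (ord1 j) [RHS]mxE mxE.
have E (k : 'I_5) : (e0 *m Psph)^T k 0 = crd e0 k * (2 <= k)%N%:R by rewrite mxE mul_Psph inord_val.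
under eq_bigr => k _ do rewrite E mxE.
rewrite !big_ord_recl big_ord0 /= !mulr0 !mulr1 e02 e03 !mulr0 mul0r sin0 mulr0 oppr0 mul0r.
by rewrite !addr0.
Qed.

(** K v is the time 1 value of the geodesic with developed velocity v. For v near 0 the initial pair
    itself is shown to work up to time 1: at v = 0 the model curve is constant, so agreement and
    injectivity of psi0 force the geodesic to stay at p0. *)
Lemma exponential : exists K : 'rV[R]_4 -> M,
  (forall v, exists O psi, good f O psi /\ exists2 d, 0 < d & forall v', `|v' - v| < d -> O (K v') /\ psi (K v') = gam v' 1) /\
  exists2 d, 0 < d & forall v', `|v'| < d -> O0 (K v') /\ psi0 (K v') = gam v' 1.
Proof.
have Hc v : exists c : R -> M, [/\ geodesic c, c 0 = p0 & curve_der (fun s => psi0 (c s)) 0 (gamd v 0)].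
  have perp : gamd v 0 *m (psi0 p0 *m Psph)^T = 0 by rewrite Ep0; exact: initial_perp.
  have [c [g1 g2 g3]] := good_velocity sol scal gd0 Op0 perp.
  by exists c; split=> // i k; rewrite (ord1 i).
have [c Pc] := choice Hc.
have gc v : geodesic (c v) by have [] := Pc v.
have A0 v : agree e0 sg c O0 psi0 v 0.
  have [_ c0 D] := Pc v; split; rewrite ?c0 ?gam_0 //.
exists (fun v => c v 1); split=> [v|].
  have D0 : develops f e0 sg c v 0.
    by exists O0, psi0; split=> //; exists 1; [exact: ltr01|move=> v' _; exact: A0].
  have l11 : 0 <= (1 : R) <= 1 by rewrite ler01 lexx.
  have [D [psi [gd [d d0 A]]]] := develops_all sol scal sg2 gc l11 D0.
  by exists D, psi; split=> //; exists d => // v' /A[].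
have l11 : 0 <= (1 : R) <= 1 by rewrite ler01 lexx.
have l00 : 0 <= (0 : R) <= 1 by rewrite ler01 lexx.
have gz t : gam 0 t = e0.
  have w0 : omega (0 : 'rV[R]_4) = 0 by rewrite /omega !mxE expr0n addr0 sqrtr0 mul0r.
  rewrite -[RHS](gam_0 (sg := sg) (0 : 'rV[R]_4) e02 e03 e04); apply/rowP => k; rewrite !mxE.
  by case: k => [[|[|[|[|[|//]]]]] ?]; rewrite /gam_n /= ?w0 ?mulr0 ?mxE ?mulr0.
suff [d d0 A] : agree_near e0 sg c O0 psi0 0 1.
  by exists d => // v' v'd; have [] : agree e0 sg c O0 psi0 v' 1 by apply: A; rewrite subr0.
apply: (locally_constant (P := agree_near e0 sg c O0 psi0 0) _ l00 l11); last first.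
  by exists 1; [exact: ltr01|move=> v' _; exact: A0].
move=> t _; have [Ot|nOt] := pselect (O0 (c 0 t)).
  have [eta eta0 H] := agree_local sol scal e0 sg2 gc gd0 Ot; exists eta => // s s' _ _ st s't.
  have one : (1%:M : 'M[R]_5) *m 1%:M^T = 1%:M by rewrite trmx1 mulmx1.
  have oneP : (1%:M : 'M[R]_5) *m Psph = Psph *m 1%:M by rewrite mulmx1 mul1mx.
  have := H _ one oneP s s' st s't.
  by have -> : (fun q => psi0 q *m 1%:M) = psi0 by apply/funext => q; rewrite mulmx1.
have np : (~` [set p0]) (c 0 t) by move=> /= E; apply: nOt; rewrite E.
have op : open (~` [set p0]).
  rewrite openC; apply: accessible_closed_set1; apply: hausdorff_accessible; exact: manifold_hausdorff mM.
have [eta eta0 H] := curve_in gc op np; exists eta => // s s' _ _ st _ [d d0 A].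
have [Os Es _] : agree e0 sg c O0 psi0 0 s by apply: A; rewrite subrr normr0.
exfalso; apply: (H s st) => /=; apply: (good_inj sol gd0 Os Op0).
by rewrite Es gz Ep0.
Qed.

End Exponential.

Lemma onE_mul (R : realType) (e : 'rV[R]_5) (g : 'M[R]_5) : g *m g^T = 1%:M -> g *m Psph = Psph *m g ->
  onE e -> onE (e *m g).
Proof.
move=> g1 g2; rewrite /onE => E.
have -> : e *m g *m Psph = e *m Psph *m g by rewrite -mulmxA g2 mulmxA.
by rewrite (trmx_mul _ g) mulmxA -(mulmxA _ g) g1 mulmx1.
Qed.

Lemma lam_near (R : realType) (e0 e : 'rV[R]_5) (sg eps : R) : sg ^+ 2 = 1 -> onE e ->
  sg * e 0 (inord 4) != - Num.sqrt 2 -> 0 < eps -> exists2 d, 0 < d &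
  forall e', onE e' -> `|e' - e| < d -> [/\ sg * e' 0 (inord 4) != - Num.sqrt 2,
    `|lam e0 sg e' - lam e0 sg e| < eps & gam e0 sg (lam e0 sg e') 1 = e'].
Proof.
move=> sg2 eE ne eps0; have := @lam_continuous R e0 sg sg2 e eE ne.
move=> /cvgrPdist_lt /(_ eps eps0) /nbhs_rV_ball[d d0 Hd].
have hp := height_pos sg2 eE ne.
have sg1 : `|sg| = 1.
  by apply/eqP; rewrite -(@eqrXn2 _ 2) // expr1n real_normK ?num_real // sg2.
exists (Num.min d (Num.sqrt 2 + sg * e 0 (inord 4))); first by rewrite lt_min d0 hp.
move=> e' e'E; rewrite lt_min => /andP[h1 h2].
have ne' : sg * e' 0 (inord 4) != - Num.sqrt 2.
  apply/eqP => E; have := coord_le_norm (e' - e) (inord 4); rewrite mx_addE mx_oppE => h.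
  have : `|sg * (e' 0 (inord 4) - e 0 (inord 4))| < Num.sqrt 2 + sg * e 0 (inord 4).
    by rewrite normrM sg1 mul1r; exact: le_lt_trans h h2.
  rewrite mulrBr E -opprD normrN => h3; have := ler_norm (Num.sqrt 2 + sg * e 0 (inord 4)).
  by move: h3; lra.
split=> //; first by rewrite distrC; exact: Hd.
exact: gam_lam.
Qed.

Lemma half_angle_tangent (F : numFieldType) (r c s : F) : r != 0 -> c != 0 ->
  r * (c * s *+ 2) / (r + r * (c ^+ 2 *+ 2 - 1)) = s / c.
Proof.
move=> r0 c0; have n2 : 2 != 0 :> F by rewrite pnatr_eq0.
have -> : r + r * (c ^+ 2 *+ 2 - 1) = 2 * r * c * c by rewrite -mulr_natl; ring.
have -> : r * (c * s *+ 2) = s * (2 * r * c) by rewrite -mulr_natl; ring.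
by field; rewrite ?r0 ?c0.
Qed.

Lemma segment_between (F : realFieldType) (p x a t : F) : 0 < x < p -> 0 < a < p -> 0 <= t <= 1 ->
  0 < x + t * (a - x) < p.
Proof.
move=> /andP[x1 x2] /andP[a1 a2] /andP[t0 t1].
have -> : x + t * (a - x) = (1 - t) * x + t * a by ring.
have [->|tn] := eqVneq t 0; first by rewrite subr0 mul1r mul0r addr0 x1.
have tp : 0 < t by rewrite lt_neqAle eq_sym tn t0.
have t1' : 0 <= 1 - t by rewrite subr_ge0.
apply/andP; split; first by rewrite ltr_wpDl ?mulr_ge0 ?(ltW x1) // mulr_gt0.
have -> : p = (1 - t) * p + t * p by ring.
by rewrite ler_ltD // ?ltr_pM2l // ler_wpM2l // ltW.
Qed.

(** * Sections of the covering over the model *)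

Section Spherical.
Variable R : realType.
Local Notation crd v k := (v 0 (inord k)).
Local Notation r2 := (Num.sqrt (2 : R)).

Definition sph_n (w : R * R) (a th : R) (k : nat) : R := match k with
  | 0 => w.1 | 1 => w.2 | 2 => r2 * sin a * cos th | 3 => r2 * sin a * sin th | _ => r2 * cos a end.
Definition sph w a th : 'rV[R]_5 := \row_k sph_n w a th k.

Lemma sph_crd w a th (k : nat) : (k < 5)%N -> crd (sph w a th) k = sph_n w a th k.
Proof. by move=> k5; rewrite mxE inordK. Qed.

Lemma onE_of_crd (e : 'rV[R]_5) : crd e 2 ^+ 2 + crd e 3 ^+ 2 + crd e 4 ^+ 2 = 2 -> onE e.
Proof.
move=> H; apply/matrixP => i j; rewrite (ord1 i) (ord1 j) [RHS]mxE eqxx mulr1n -H mxE.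
have E (k : 'I_5) : (e *m Psph) 0 k = crd e k * (2 <= k)%N%:R by rewrite mul_Psph inord_val.
under eq_bigr => k _ do rewrite [(_)^T _ _]mxE E.
rewrite !big_ord_recl big_ord0 /= !mulr0 !mulr1 !addr0 !add0r.
by rewrite !expr2 -addrA.
Qed.

Lemma sph_onE w a th : onE (sph w a th).
Proof.
apply: onE_of_crd; rewrite !sph_crd // /sph_n.
transitivity (r2 ^+ 2 * (sin a ^+ 2 * (cos th ^+ 2 + sin th ^+ 2) + cos a ^+ 2)); first by ring.
by rewrite cos2Dsin2 mulr1 addrC cos2Dsin2 mulr1 sqrt2_sqr.
Qed.

Lemma sph_surj (e : 'rV[R]_5) : onE e -> exists w a th, [/\ e = sph w a th, 0 <= a <= pi &
  crd e 4 != r2 -> crd e 4 != - r2 -> 0 < a < pi].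
Proof.
move=> eE; have H := onE_crd eE; have r20 := sqrt2_gt0 R; have rr := lt0r_neq0 r20.
have r22 := sqrt2_sqr R.
pose x := crd e 4 / r2.
have x2 : x ^+ 2 = 1 - rad e ^+ 2 / 2.
  rewrite /x expr_div_n r22 rad_sqr; have -> : crd e 4 ^+ 2 = 2 - (crd e 2 ^+ 2 + crd e 3 ^+ 2) by rewrite -H; ring.
  by field.
have x1 : -1 <= x <= 1.
  rewrite -ler_norml -(@expr_le1 _ 2) // real_normK ?num_real // x2.
  by have := sqr_ge0 (rad e); lra.
have [a0 ca] := acos_def x1; pose a := acos x.
have sa : r2 * sin a = rad e.
  rewrite /a sin_acos // x2.
  have -> : 1 - (1 - rad e ^+ 2 / 2) = (rad e / r2) ^+ 2 by rewrite expr_div_n r22; ring.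
  rewrite sqrtr_sqr ger0_norm ?divr_ge0 ?rad_ge0 ?(ltW r20) //; by field.
have [th [t1 t2]] : exists th, rad e * cos th = crd e 2 /\ rad e * sin th = crd e 3.
  have [r0|r0] := eqVneq (rad e) 0.
    by exists 0; rewrite r0 !mul0r; have [] := rad0_crd r0.
  have rp : 0 < rad e by rewrite lt_neqAle eq_sym r0 rad_ge0.
  pose y := crd e 2 / rad e.
  have y2 : 1 - y ^+ 2 = (crd e 3 / rad e) ^+ 2.
    rewrite /y !expr_div_n; have -> : crd e 3 ^+ 2 = rad e ^+ 2 - crd e 2 ^+ 2 by rewrite rad_sqr; ring.
    by field.
  have y1 : -1 <= y <= 1.
    rewrite -ler_norml -(@expr_le1 _ 2) // real_normK ?num_real //.
    by have := sqr_ge0 (crd e 3 / rad e); rewrite -y2; lra.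
  have [_ cy] := acos_def y1.
  have sy : sin (acos y) = `|crd e 3 / rad e| by rewrite sin_acos // y2 sqrtr_sqr.
  have Ey : rad e * y = crd e 2 by rewrite /y mulrC divfK.
  have [p3|n3] := leP 0 (crd e 3).
    exists (acos y); rewrite cy sy Ey ger0_norm ?divr_ge0 ?rad_ge0 //; split=> //.
    by rewrite mulrC divfK.
  exists (- acos y); rewrite cosN sinN cy sy Ey ltr0_norm ?opprK; first by split=> //; rewrite mulrC divfK.
  by rewrite pmulr_llt0 // invr_gt0.
exists (crd e 0, crd e 1), a, th; split=> //.
  apply/rowP => k; rewrite mxE -[k in LHS]inord_val.
  case: k => [[|[|[|[|[|//]]]]] ?] //=; rewrite ?sa ?t1 ?t2 //.
  by rewrite /a ca /x mulrC divfK.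
move=> n1 n2; have /andP[xl xu] := x1; apply/andP; split.
  apply: acos_gt0; rewrite xl lt_neqAle xu andbT.
  by apply: contra_neq n1 => E; rewrite -[LHS](divfK rr) -/x E mul1r.
apply: acos_ltpi; rewrite xu lt_neqAle xl !andbT eq_sym.
by apply: contra_neq n2 => E; rewrite -[LHS](divfK rr) -/x E mulN1r.
Qed.

Lemma sph_path_continuous (w w' : R * R) (a a' th th' : R) :
  forall t : R, {for t, continuous (fun t : R => sph (w.1 + t * w'.1, w.2 + t * w'.2) (a + t * a') (th + t * th'))}.
Proof.
move=> t; pose p (t : R) := sph (w.1 + t * w'.1, w.2 + t * w'.2) (a + t * a') (th + t * th').
have cl (x y : R) : {for t, continuous (fun t : R => x + t * y)}.
  have c1 : {for t, continuous (fun t : R => x)} by exact: cst_continuous.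
  have c2 : {for t, continuous (fun t : R => t)} by apply: cvg_id.
  have c3 : {for t, continuous (fun t : R => y)} by exact: cst_continuous.
  exact: (continuousD c1 (continuousM c2 c3)).
have cr : {for t, continuous (fun t : R => r2)} by exact: cst_continuous.
have cs (x y : R) : {for t, continuous (fun t : R => sin (x + t * y))}.
  have H := @continuous_comp _ _ _ (fun t : R => x + t * y) sin t (cl x y) (@continuous_sin R _); exact: H.
have cc (x y : R) : {for t, continuous (fun t : R => cos (x + t * y))}.
  have H := @continuous_comp _ _ _ (fun t : R => x + t * y) cos t (cl x y) (@continuous_cos R _); exact: H.
suff : {for t, continuous p} by [].
apply: rV_continuous => k.
have -> : (fun t => p t 0 k) = (fun t => sph_n (w.1 + t * w'.1, w.2 + t * w'.2) (a + t * a') (th + t * th') k).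
  by apply/funext => s; rewrite mxE.
case: k => [[|[|[|[|[|//]]]]] ?] /=.
- exact: cl.
- exact: cl.
- have H := continuousM (continuousM cr (cs a a')) (cc th th'); exact: H.
- have H := continuousM (continuousM cr (cs a a')) (cs th th'); exact: H.
have H := continuousM cr (cc a a'); exact: H.
Qed.

End Spherical.

Section Sections.
Variables (R : realType) (M : riemannian_data R 4) (f : M -> R).
Hypothesis sol : shrinking_gradient_ricci_soliton f.
Hypothesis scal : constant_scalar_curvature M 1.
Let rM := sol_riemannian sol.
Let mM := sol_manifold sol.
Local Notation crd v k := (v 0 (inord k)).
Local Notation r2 := (Num.sqrt (2 : R)).

(** Phi is a local right inverse of psi near e, tested on points of the model only. A [sect] is a
    map that inverts some good pair near each of its points; such maps are the candidates for the
    covering. *)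
Definition inverts (O : set M) (psi : M -> 'rV[R]_5) (Phi : 'rV[R]_5 -> M) e :=
  exists2 d, 0 < d & forall e', onE e' -> `|e' - e| < d -> O (Phi e') /\ psi (Phi e') = e'.
Definition sect (D : set 'rV[R]_5) (Phi : 'rV[R]_5 -> M) := forall e, onE e -> D e ->
  exists O psi, good f O psi /\ inverts O psi Phi e.
Definition agree_at (Phi Phi' : 'rV[R]_5 -> M) e :=
  exists2 d, 0 < d & forall e', onE e' -> `|e' - e| < d -> Phi e' = Phi' e'.

Lemma inverts_near O psi Phi e V : good f O psi -> onE e -> inverts O psi Phi e -> nbhs (Phi e) V ->
  exists2 d, 0 < d & forall e', onE e' -> `|e' - e| < d -> [/\ O (Phi e'), psi (Phi e') = e' & V (Phi e')].
Proof.
move=> gd eE [d d0 H] NV; have ee : `|e - e| < d by rewrite subrr normr0.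
have [Oe Ee] := H e eE ee; have [r r0 Hr] := good_near sol gd Oe NV.
exists (Num.min d r); first by rewrite lt_min d0 r0.
move=> e' e'E; rewrite lt_min => /andP[h1 h2]; have [Oe' Ee'] := H e' e'E h1.
by split=> //; apply: Hr => //; rewrite Ee' Ee.
Qed.

(** If the values at e differ, the Hausdorff property separates the maps near e. If they coincide,
    the two good pairs differ by a rotation g near that value; agreement around a single e1 forces g
    = 1 by rigidity, hence agreement around every e2. *)
Lemma sect_local D D' Phi Phi' e : sect D Phi -> sect D' Phi' -> onE e -> D e -> D' e ->
  exists2 d, 0 < d & forall e1 e2, onE e1 -> onE e2 -> `|e1 - e| < d -> `|e2 - e| < d ->
    agree_at Phi Phi' e1 -> agree_at Phi Phi' e2.
Proof.
move=> sP sP' eE De D'e; have [U [psi [gd I]]] := sP e eE De; have [U' [psi' [gd' I']]] := sP' e eE D'e.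
have [E|nE] := pselect (Phi e = Phi' e); last first.
  have [[A [B [NA NB AB]]]|H] := pselect (exists A B, [/\ nbhs (Phi e) A, nbhs (Phi' e) B & ~ (A `&` B !=set0)]); last first.
    exfalso; apply: nE; apply: (manifold_hausdorff mM) => A B NA NB.
    by apply: contrapT => AB; apply: H; exists A, B.
  have [d1 d10 H1] := inverts_near gd eE I NA; have [d2 d20 H2] := inverts_near gd' eE I' NB.
  exists (Num.min d1 d2); first by rewrite lt_min d10 d20.
  move=> e1 e2 e1E _; rewrite lt_min => /andP[h1 h2] _ [r r0 Hr].
  exfalso; apply: AB; exists (Phi e1); split; first by have [] := H1 e1 e1E h1.
  by rewrite Hr // ?subrr ?normr0 //; have [] := H2 e1 e1E h2.
have ee (d : R) : 0 < d -> `|e - e| < d by rewrite subrr normr0.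
have Up : U (Phi e) by have [d d0 H] := I; have [] := H e eE (ee d d0).
have U'p : U' (Phi e) by rewrite E; have [d d0 H] := I'; have [] := H e eE (ee d d0).
have [g [g1 g2 N]] := good_transition sol scal gd gd' Up U'p.
pose V := [set q | psi' q = psi q *m g /\ U q].
have NV : nbhs (Phi e) V by apply: filterI N _; exact: open_nbhs_nbhs (conj (good_open sol gd) Up).
have NV' : nbhs (Phi' e) V by rewrite -E.
have [d1 d10 H1] := inverts_near gd eE I NV; have [d2 d20 H2] := inverts_near gd' eE I' NV'.
pose d := Num.min d1 d2; have d0 : 0 < d by rewrite lt_min d10 d20.
have dd e' : `|e' - e| < d -> `|e' - e| < d1 /\ `|e' - e| < d2 by rewrite lt_min => /andP[].
exists d => // e1 e2 e1E e2E h1 h2 [r r0 Hr].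
have [h11 h12] := dd _ h1; have [Uq1 Eq1 _] := H1 e1 e1E h11.
have g11 : g = 1%:M.
  apply: (good_rigid sol scal gd Uq1 g2).
  have op : open [set x : 'rV[R]_5 | `|x - e1| < Num.min r (d - `|e1 - e|)] by exact: rV_ball_open.
  have N1 : nbhs (Phi e1) (psi @^-1` [set x : 'rV[R]_5 | `|x - e1| < Num.min r (d - `|e1 - e|)]).
    apply: (good_continuous sol gd Uq1); apply: open_nbhs_nbhs; split=> //.
    by rewrite /= Eq1 subrr normr0 lt_min r0 subr_gt0.
  apply: filterS2 N1 (open_nbhs_nbhs (conj (good_open sol gd) Uq1)) => q /=.
  rewrite lt_min => /andP[q1 q2] Uq; pose e' := psi q.
  have e'E : onE e' by exact: good_onE gd Uq.
  have e'd : `|e' - e| < d.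
    have -> : e' - e = (e' - e1) + (e1 - e) by rewrite addrA subrK.
    by apply: (le_lt_trans (ler_normD _ _)); move: q2; rewrite -/e'; lra.
  have [e'1 e'2] := dd _ e'd; have [Ue' Ee' _] := H1 e' e'E e'1; have [_ E2 [E3 _]] := H2 e' e'E e'2.
  have Eq : Phi e' = q by apply: (good_inj sol gd).
  by rewrite -{1}Eq (Hr e' e'E q1) -E3 E2.
exists (d - `|e2 - e|); first by rewrite subr_gt0.
move=> e' e'E e'2; have e'd : `|e' - e| < d.
  have -> : e' - e = (e' - e2) + (e2 - e) by rewrite addrA subrK.
  by apply: (le_lt_trans (ler_normD _ _)); move: e'2; lra.
have [e'3 e'4] := dd _ e'd; have [Ue' Ee' _] := H1 e' e'E e'3; have [_ E2 [E3 U3]] := H2 e' e'E e'4.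
by apply: (good_inj sol gd) => //; rewrite Ee' -[psi (Phi' e')]mulmx1 -g11 -E3 E2.
Qed.

Lemma sect_path D D' Phi Phi' (p : R -> 'rV[R]_5) : sect D Phi -> sect D' Phi' ->
  (forall t, {for t, continuous p}) ->
  (forall t, 0 <= t <= 1 -> [/\ onE (p t), D (p t) & D' (p t)]) ->
  agree_at Phi Phi' (p 0) -> agree_at Phi Phi' (p 1).
Proof.
move=> sP sP' cp H; apply: (locally_constant (P := fun t => agree_at Phi Phi' (p t)) (a := 0) (b := 1)).
- move=> t t01; have [Ee De D'e] := H t t01; have [d d0 Hd] := sect_local sP sP' Ee De D'e.
  have := cp t => /cvgrPdist_lt /(_ d d0) /nbhs_ballP[eta eta0 He]; exists eta => // s s' s01 s'01 st s't.
  have b u : `|u - t| < eta -> `|p u - p t| < d.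
    by move=> ut; rewrite distrC; apply: He; rewrite -ball_normE /= distrC.
  by apply: Hd; [have [] := H s s01|have [] := H s' s'01|exact: b|exact: b].
- by rewrite lexx ler01.
- by rewrite lexx ler01.
Qed.

Lemma agree_at_eq Phi Phi' e : onE e -> agree_at Phi Phi' e -> Phi e = Phi' e.
Proof. by move=> eE [d d0 H]; apply: H => //; rewrite subrr normr0. Qed.

(** Any two points of the model are joined by an affine path in spherical coordinates. *)
Lemma sect_unique Phi Phi' e e' : sect setT Phi -> sect setT Phi' -> onE e -> onE e' ->
  agree_at Phi Phi' e -> agree_at Phi Phi' e'.
Proof.
move=> sP sP' eE e'E.
have [w [a [th [-> _ _]]]] := sph_surj eE; have [w' [a' [th' [-> _ _]]]] := sph_surj e'E.
pose p (t : R) := sph (w.1 + t * (w'.1 - w.1), w.2 + t * (w'.2 - w.2)) (a + t * (a' - a)) (th + t * (th' - th)).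
have p0 : p 0 = sph w a th by rewrite /p !mul0r !addr0; case: w {p}.
have p1 : p 1 = sph w' a' th' by rewrite /p !mul1r ![_ + (_ - _)]addrC !subrK; case: w' {p p0}.
rewrite -p0 -p1; apply: (sect_path sP sP') => [t|t _]; last by split=> //; exact: sph_onE.
by have H := @sph_path_continuous R w (w'.1 - w.1, w'.2 - w.2) a (a' - a) th (th' - th) t; exact H.
Qed.

Definition half (sg : R) : set 'rV[R]_5 := [set e | sg * crd e 4 != - r2].

(** Phi is the exponential map composed with the logarithm. The last clause keeps track of it near
    every velocity v, also those ending over the opposite pole, where the logarithm breaks down;
    this is needed for gluing. *)
Lemma half_section U psi p (e0 : 'rV[R]_5) sg : sg ^+ 2 = 1 -> crd e0 2 = 0 -> crd e0 3 = 0 -> crd e0 4 = sg * r2 ->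
  good f U psi -> U p -> psi p = e0 -> exists Phi, [/\ sect (half sg) Phi, inverts U psi Phi e0 &
    forall v, exists U1 psi1, good f U1 psi1 /\ (exists p1, U1 p1 /\ psi1 p1 = gam e0 sg v 1) /\
      exists2 d, 0 < d & forall e, onE e -> half sg e -> `|lam e0 sg e - v| < d -> U1 (Phi e) /\ psi1 (Phi e) = e].
Proof.
move=> sg2 e02 e03 e04 gd Up Ep.
have e0E : onE e0 by rewrite -Ep; exact: good_onE gd Up.
have [K [HK [d d0 HK0]]] := exponential sol scal sg2 e02 e03 e04 gd Up Ep.
exists (fun e => K (lam e0 sg e)); split.
- move=> e eE he; have [U1 [psi1 [gd1 [d1 d10 H1]]]] := HK (lam e0 sg e).
  exists U1, psi1; split=> //; have [d2 d20 H2] := lam_near e0 sg2 eE he d10.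
  by exists d2 => // e' e'E h; have [_ h1 h2] := H2 e' e'E h; have [] := H1 _ h1; rewrite h2.
- have he0 : sg * crd e0 4 != - r2.
    rewrite e04 mulrA -expr2 sg2 mul1r; apply/eqP => E; have := sqrt2_gt0 R; move: E; lra.
  have l0 : lam e0 sg e0 = 0.
    apply/rowP => k; rewrite !mxE; case: k => [[|[|[|[|//]]]] ?] /=; by rewrite ?subrr ?e02 ?e03 ?mulr0.
  have [d2 d20 H2] := lam_near e0 sg2 e0E he0 d0; exists d2 => // e' e'E h.
  have [_ h1 h2] := H2 e' e'E h; rewrite l0 subr0 in h1.
  by have [] := HK0 _ h1; rewrite h2.
move=> v; have [U1 [psi1 [gd1 [d1 d10 H1]]]] := HK v; exists U1, psi1; split=> //; split.
  by exists (K v); apply: H1; rewrite subrr normr0.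
exists d1 => // e eE he hv; have [] := H1 _ hv; rewrite gam_lam //.
Qed.

(** Two half sections are glued. The second is based at the far end of a meridian from the first
    base point, with the good pair psi1 found there, so that both invert psi1 near a point shortly
    before that end; uniqueness along paths extends their agreement to the points over neither
    pole. *)
Lemma global_section U psi p : good f U psi -> U p -> psi p *m Psph = r2 *: delta_mx 0 ord_max ->
  exists2 Phi, sect setT Phi & inverts U psi Phi (psi p).
Proof.
move=> gd Up Ep; set e0 := psi p.
have r20 := sqrt2_gt0 R; have rr := lt0r_neq0 r20.
have ec (k : 'I_5) : (2 <= k)%N -> e0 0 k = r2 * (k == ord_max)%:R.
  move=> k2; have := congr1 (fun X : 'rV[R]_5 => X 0 k) Ep; rewrite mul_Psph k2 mulr1 => ->.
  by rewrite !mxE eqxx.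
have e02 : crd e0 2 = 0 by rewrite ec ?inordK // -val_eqE /= inordK // mulr0.
have e03 : crd e0 3 = 0 by rewrite ec ?inordK // -val_eqE /= inordK // mulr0.
have e04 : crd e0 4 = 1 * r2 by rewrite ec ?inordK // -val_eqE /= inordK // mulr1 mul1r.
have one2 : (1 : R) ^+ 2 = 1 by rewrite expr1n.
have [Phi0 [s0 i0 H0]] := half_section one2 e02 e03 e04 gd Up erefl.
pose vb (x : R) : 'rV[R]_4 := \row_k (if (k == 2 :> nat) then r2 * x else 0).
have vbc x (k : nat) : (k < 4)%N -> crd (vb x) k = if k == 2 then r2 * x else 0 by move=> k4; rewrite mxE inordK.
have wb x : 0 <= x -> omega (vb x) = x.
  move=> x0; rewrite /omega !vbc //= expr0n addr0 sqrtr_sqr ger0_norm ?mulr_ge0 ?(ltW r20) //.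
  by rewrite mulrC mulKf.
(* The meridian of angular speed pi reaches the opposite pole at time 1. *)
have [U1 [psi1 [gd1 [[p1 [Up1 Ep1]] [d d0 H1]]]]] := H0 (vb pi).
set e1 := gam e0 1 (vb pi) 1 in Ep1.
have pp : 0 <= pi :> R by exact: pi_ge0.
have gc (v : 'rV[R]_4) k : (k < 5)%N -> crd (gam e0 1 v 1) k = gam_n e0 1 v 1 k by move=> k5; rewrite mxE inordK.
have e12 : crd e1 2 = 0 by rewrite /e1 gc // /gam_n wb // mul1r sinpi mul0r mul0r.
have e13 : crd e1 3 = 0 by rewrite /e1 gc // /gam_n wb // mul1r sinpi mul0r mul0r.
have e14 : crd e1 4 = -1 * r2 by rewrite /e1 gc // /gam_n wb // !mul1r cospi mulrN1 mulN1r.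
have mone2 : (-1 : R) ^+ 2 = 1 by rewrite sqrrN expr1n.
have [Phi1 [s1 [d1 d10 i1] _]] := half_section mone2 e12 e13 e14 gd1 Up1 Ep1.
have [d2 d20 G] := gam_continuous e0 1 (vb pi) 1 d10.
pose m := Num.min d d2; have m0 : 0 < m by rewrite lt_min d0 d20.
(* Stopping at angle pi - eta keeps the velocity within m / 2 of [vb pi], and the endpoint [eb]
   within d1 of [e1]. *)
pose eta := Num.min (pi / 2) (m / (2 * r2)).
have eta0 : 0 < eta by rewrite lt_min !divr_gt0 ?pi_gt0 // mulr_gt0.
have eta1 : eta <= pi / 2 by rewrite ge_min lexx.
have eta2 : r2 * eta <= m / 2.
  have : eta <= m / (2 * r2) by rewrite ge_min lexx orbT.
  move=> /(ler_wpM2l (ltW r20)) h; apply: (le_trans h).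
  by rewrite le_eqVlt; apply/orP; left; apply/eqP; field.
pose x := pi - eta.
have x0 : 0 < x < pi by have := pi_gt0 R; move: eta0 eta1; rewrite /x; lra.
have sx : 0 < sin x by exact: sin_gt0_pi.
have vx : `|vb x - vb pi| <= m / 2.
  apply: norm_rV_le => [|k]; first by rewrite divr_ge0 // ltW.
  rewrite !mxE; case: ifP => _; last by rewrite subrr normr0 divr_ge0 // ltW.
  have -> : r2 * x - r2 * pi = - (r2 * eta) by rewrite /x; ring.
  by rewrite normrN ger0_norm // mulr_ge0 // ltW.
pose eb := sph (crd e0 0, crd e0 1) x 0.
have radb : rad eb = r2 * sin x.
  rewrite /rad !sph_crd // /sph_n cos0 sin0 mulr0 mulr1 expr0n addr0 sqrtr_sqr ger0_norm //.
  by rewrite mulr_ge0 // ltW.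
have angb : angle 1 eb = x.
  rewrite /angle radb sph_crd // /sph_n mul1r; pose y := x / 2.
  have yP : - (pi / 2) < y < pi / 2 by move: x0; rewrite /y; lra.
  have cy : 0 < cos y by apply: cos_gt0_pihalf.
  have xy : x = y *+ 2 by rewrite -mulr_natr /y divfK.
  have E : r2 * sin x / (r2 + r2 * cos x) = tan y.
    by rewrite xy sin_mulr2n cos_mulr2n /tan; exact: half_angle_tangent rr (lt0r_neq0 cy).
  by rewrite E tanK ?in_itv // /y mulrC divfK.
have Lb : lam e0 1 eb = vb x.
  apply/rowP => k; rewrite !mxE; case: k => [[|[|[|[|//]]]] ?] /=; rewrite !sph_crd //= ?subrr //.
    by rewrite angb radb cos0 mulr1; field; rewrite (lt0r_neq0 sx) rr.
  by rewrite sin0 !mulr0.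
have halfS w a th sg : 0 < a < pi -> sg ^+ 2 = 1 -> half sg (sph w a th).
  move=> a0 sg2; rewrite /half /= sph_crd // /sph_n; apply/eqP => E.
  have : (sg * (r2 * cos a)) ^+ 2 = r2 ^+ 2 by rewrite E sqrrN.
  rewrite !exprMn sg2 mul1r => h.
  have C : cos a ^+ 2 = 1 by apply: (mulfI (expf_neq0 2 rr)); rewrite mulr1.
  have := cos2Dsin2 a; rewrite C -[X in _ = X]addr0 => /addrI /eqP; rewrite sqrf_eq0 => /eqP s0'.
  by have := sin_gt0_pi a0; rewrite s0' ltxx.
have ebE : onE eb by exact: sph_onE.
have hb : half 1 eb by exact: halfS.
have Eb : gam e0 1 (vb x) 1 = eb by rewrite -Lb gam_lam.
have ebn : `|eb - e1| < d1.
  rewrite -Eb; apply: G; last by rewrite subrr normr0.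
  apply: (le_lt_trans vx); apply: (@lt_le_trans _ _ m); last by rewrite ge_min lexx orbT.
  by rewrite ltr_pdivrMr // ltr_pMr // ltr1n.
(* Around [eb] both maps take values in U1 and are inverted there by the injective map psi1. *)
have Ab : agree_at Phi0 Phi1 eb.
  have m20 : 0 < m / 2 by rewrite divr_gt0.
  have [d3 d30 H3] := lam_near e0 one2 ebE hb m20.
  exists (Num.min d3 (d1 - `|eb - e1|)); first by rewrite lt_min d30 subr_gt0.
  move=> e' e'E; rewrite lt_min => /andP[h1 h2]; have [he' l' _] := H3 e' e'E h1.
  have lv : `|lam e0 1 e' - vb pi| < d.
    have -> : lam e0 1 e' - vb pi = (lam e0 1 e' - lam e0 1 eb) + (vb x - vb pi) by rewrite Lb addrA subrK.
    apply: (le_lt_trans (ler_normD _ _)); apply: (@lt_le_trans _ _ m); last by rewrite ge_min lexx.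
    by move: l' vx; lra.
  have [Ua Ea] := H1 e' e'E he' lv.
  have [Uc Ec] : U1 (Phi1 e') /\ psi1 (Phi1 e') = e'.
    apply: i1 => //; have -> : e' - e1 = (e' - eb) + (eb - e1) by rewrite addrA subrK.
    by apply: (le_lt_trans (ler_normD _ _)); move: h2; lra.
  by apply: (good_inj sol gd1) => //; rewrite Ea Ec.
have Aov e : onE e -> crd e 4 != r2 -> crd e 4 != - r2 -> Phi0 e = Phi1 e.
  move=> eE n1 n2; apply: (agree_at_eq eE).
  have [w' [a' [th' [E _ aP]]]] := sph_surj eE; have a0' := aP n1 n2.
  pose w := (crd e0 0, crd e0 1).
  pose q (t : R) := sph (w.1 + t * (w'.1 - w.1), w.2 + t * (w'.2 - w.2)) (x + t * (a' - x)) (0 + t * (th' - 0)).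
  have q0 : q 0 = eb by rewrite /q !mul0r !addr0.
  have lin (u v : R) : u + 1 * (v - u) = v by rewrite mul1r addrC subrK.
  have q1 : q 1 = e by rewrite E /q !lin; case: w' {E q q0}.
  rewrite -q1; apply: (sect_path s0 s1 (p := q)); last by rewrite q0.
    by move=> t; by have H := @sph_path_continuous R w (w'.1 - w.1, w'.2 - w.2) x (a' - x) 0 (th' - 0) t; exact H.
  move=> t t01; have at0 : 0 < x + t * (a' - x) < pi.
    by exact: segment_between.
  by split; [exact: sph_onE|exact: halfS|exact: halfS].
(* Phi1 is used over the opposite pole alone; agreement on the overlap makes Phi coincide with Phi1
   in a whole neighbourhood of those points. *)
pose Phi (e : 'rV[R]_5) := if crd e 4 == - r2 then Phi1 e else Phi0 e.
have near0 (e : 'rV[R]_5) : crd e 4 != - r2 -> exists2 s, 0 < s & forall e' : 'rV[R]_5, `|e' - e| < s -> Phi e' = Phi0 e'.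
  move=> n2; exists `|crd e 4 + r2|; first by rewrite normr_gt0 addr_eq0.
  move=> e' h; rewrite /Phi; case: eqP => // E; exfalso.
  have := coord_le_norm (e' - e) (inord 4); rewrite mx_addE mx_oppE E -opprD normrN addrC => h'.
  by have := le_lt_trans h' h; rewrite ltxx.
exists Phi.
  move=> e eE _; have [E|n2] := eqVneq (crd e 4) (- r2); last first.
    have h1 : half 1 e by rewrite /half /= mul1r.
    have [U2 [psi2 [gd2 [d4 d40 H4]]]] := s0 e eE h1; have [s s0' Hs] := near0 e n2.
    exists U2, psi2; split=> //; exists (Num.min d4 s); first by rewrite lt_min d40 s0'.
    by move=> e' e'E; rewrite lt_min => /andP[h2 h3]; rewrite Hs //; exact: H4.
  have h1 : half (-1) e by rewrite /half /= E mulN1r opprK; apply/eqP => E'; move: r20 E'; lra.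
  have [U2 [psi2 [gd2 [d4 d40 H4]]]] := s1 e eE h1.
  exists U2, psi2; split=> //; exists (Num.min d4 r2); first by rewrite lt_min d40 r20.
  move=> e' e'E; rewrite lt_min => /andP[h2 h3].
  have n1 : crd e' 4 != r2.
    apply/eqP => E'; have := coord_le_norm (e' - e) (inord 4); rewrite mx_addE mx_oppE E E' opprK.
    rewrite ger0_norm ?addr_ge0 ?(ltW r20) // => h'; have := le_lt_trans h' h3; move: r20; lra.
  have -> : Phi e' = Phi1 e' by rewrite /Phi; case: eqP => // /eqP n2; exact: Aov.
  exact: H4.
have n2 : crd e0 4 != - r2 by rewrite e04 mul1r; apply/eqP => E'; move: r20 E'; lra.
have [s s0' Hs] := near0 e0 n2; have [d4 d40 H4] := i0.
exists (Num.min d4 s); first by rewrite lt_min d40 s0'.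
by move=> e' e'E; rewrite lt_min => /andP[h2 h3]; rewrite Hs //; exact: H4.
Qed.

End Sections.

(** * Deck transformations *)

Section Axis.
Variables (R : realType).

Lemma normalize (y : 'rV[R]_5) : y *m Psph = y -> y != 0 -> exists s : R, onE (s *: y).
Proof.
move=> yP y0; pose q := (y *m y^T) 0 0.
have Eq : q = \sum_k y 0 k ^+ 2 by rewrite /q mxE; apply: eq_bigr => k _; rewrite mxE expr2.
have q0 : 0 < q.
  rewrite lt_neqAle Eq sumr_ge0 ?andbT; last by move=> k _; exact: sqr_ge0.
  rewrite eq_sym; apply: contra y0; rewrite psumr_eq0; last by move=> k _; exact: sqr_ge0.
  move=> /allP H; apply/eqP/rowP => k; rewrite [RHS]mxE.
  by have := H k (mem_index_enum k); rewrite /= sqrf_eq0 => /eqP.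
exists (Num.sqrt (2 / q)); rewrite /onE -scalemxAl yP linearZ /= -scalemxAl -scalemxAr scalerA -expr2.
rewrite sqr_sqrtr ?divr_ge0 ?(ltW q0) // [y *m y^T]mx11_scalar -/q scale_scalar_mx divfK ?lt0r_neq0 //.
Qed.

Definition sphere_incl : 'M[R]_(3, 5) := \matrix_(i, j) ((j : nat) == (i + 2)%N)%:R.
Local Notation L := sphere_incl.

Lemma incl_tr : L *m L^T = 1%:M.
Proof.
apply/matrixP => i j; rewrite !mxE !big_ord_recl big_ord0 !mxE.
case: i => [[|[|[|//]]] ?]; case: j => [[|[|[|//]]] ?]; rewrite /=.
all: by rewrite ?(mulr0, mul0r, mulr1, mul1r, addr0, add0r).
Qed.

Lemma tr_incl : L^T *m L = Psph.
Proof.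
apply/matrixP => i j; rewrite !mxE !big_ord_recl big_ord0 !mxE.
case: i => [[|[|[|[|[|//]]]]] ?]; case: j => [[|[|[|[|[|//]]]]] ?]; rewrite /=.
all: by rewrite ?(mulr0, mul0r, mulr1, mul1r, addr0, add0r).
Qed.

Lemma incl_proj : L *m Psph = L.
Proof. by rewrite -tr_incl mulmxA incl_tr mul1mx. Qed.

(* A rotation of R^3 has an axis; det (c - 1) = - det (c - 1) for c in SO(3). *)
Lemma square_axis (g : 'M[R]_5) : g *m g^T = 1%:M -> g *m Psph = Psph *m g ->
  exists x, onE x /\ x *m g *m g = x.
Proof.
(* The block b of g on R^3 may reverse orientation; its square c has determinant 1. *)
move=> g1 g2; pose b := L *m g *m L^T; pose c := b *m b.
have bL : L *m g = b *m L by rewrite /b -!mulmxA tr_incl g2 !mulmxA incl_proj.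
have bb : b *m b^T = 1%:M.
  have bT : b^T = L *m g^T *m L^T by rewrite /b !trmx_mul trmxK mulmxA.
  by rewrite bT !mulmxA -bL -(mulmxA L g) g1 mulmx1 incl_tr.
have db : \det b ^+ 2 = 1 by rewrite expr2 -{2}det_tr -det_mulmx bb det1.
have dc : \det c = 1 by rewrite det_mulmx -expr2.
have cc : c *m c^T = 1%:M by rewrite /c trmx_mul mulmxA -(mulmxA b) bb mulmx1.
have D : \det (c - 1%:M) = 0.
  have E : c - 1%:M = c *m (1%:M - c^T) by rewrite mulmxBr mulmx1 cc.
  have : \det (c - 1%:M) = - \det (c - 1%:M).
    rewrite {1}E det_mulmx dc mul1r -[1%:M - c^T]trmxK det_tr linearB /= trmx1 trmxK.
    by rewrite -opprB -scaleN1r detZ -signr_odd /= expr1 mulN1r.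
  by move=> /eqP; rewrite -addr_eq0 -mulr2n mulrn_eq0 /= => /eqP.
have /det0P[v v0 vc] : \det (c - 1%:M) == 0 by rewrite D.
have vc' : v *m c = v by apply/eqP; rewrite -subr_eq0 -[X in _ - X]mulmx1 -mulmxBr vc.
have yP : v *m L *m Psph = v *m L by rewrite -mulmxA incl_proj.
have y0 : v *m L != 0.
  apply/eqP => E; move: v0; rewrite -[v]mulmx1 -incl_tr mulmxA E mul0mx eqxx //.
have [s sE] := normalize yP y0; exists (s *: (v *m L)); split=> //.
rewrite -!scalemxAl; congr (_ *: _).
by rewrite -(mulmxA v) bL mulmxA -(mulmxA _ L g) bL mulmxA -(mulmxA v) -/c vc'.
Qed.

End Axis.

Section Deck.
Variables (R : realType) (M : riemannian_data R 4) (f : M -> R).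
Hypothesis sol : shrinking_gradient_ricci_soliton f.
Hypothesis scal : constant_scalar_curvature M 1.
Let rM := sol_riemannian sol.
Let mM := sol_manifold sol.

Lemma orth_dist (g : 'M[R]_5) (u : 'rV[R]_5) : g *m g^T = 1%:M -> `|u *m g| <= 5%:R * `|u|.
Proof.
move=> g1; have h : g^T *m g^T^T = 1%:M by rewrite trmxK; exact: orth_tr.
by have := orth_norm h (u *m g); rewrite -mulmxA g1 mulmx1.
Qed.

Lemma orth_near (g : 'M[R]_5) (e : 'rV[R]_5) (d : R) : g *m g^T = 1%:M -> 0 < d ->
  forall e', `|e' - e| < d / 5%:R -> `|e' *m g - e *m g| < d.
Proof.
move=> g1 d0 e' h; rewrite -mulmxBl; apply: (le_lt_trans (orth_dist _ g1)).
by rewrite mulrC -ltr_pdivlMr.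
Qed.

Lemma sect_rot Phi (g : 'M[R]_5) : g *m g^T = 1%:M -> g *m Psph = Psph *m g ->
  sect f setT Phi -> sect f setT (fun e => Phi (e *m g)).
Proof.
move=> g1 g2 sP e eE _; have [U [psi [gd [d d0 H]]]] := sP (e *m g) (onE_mul g1 g2 eE) I.
have t1 : g^T *m g^T^T = 1%:M by rewrite trmxK; exact: orth_tr.
have t2 : g^T *m Psph = Psph *m g^T by rewrite -{1}tr_Psph -trmx_mul -g2 trmx_mul tr_Psph.
exists U, (fun q => psi q *m g^T); split; first exact: good_rot.
exists (d / 5%:R); first by rewrite divr_gt0.
move=> e' e'E h; have [h1 h2] := H _ (onE_mul g1 g2 e'E) (orth_near g1 d0 h).
by rewrite h2 -mulmxA g1 mulmx1.
Qed.

(** The transition g between the good pairs inverted at the common value carries e to e'. Near e the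
    sections Phi and x |-> Phi' (x g) agree, hence everywhere. *)
Lemma sect_meet Phi Phi' e e' : sect f setT Phi -> sect f setT Phi' -> onE e -> onE e' -> Phi e = Phi' e' ->
  exists g : 'M[R]_5, [/\ g *m g^T = 1%:M, g *m Psph = Psph *m g, e' = e *m g & forall x, onE x -> Phi' (x *m g) = Phi x].
Proof.
move=> sP sP' eE e'E E; have [U [psi [gd Iv]]] := sP e eE I; have [U' [psi' [gd' [d' d'0 H']]]] := sP' e' e'E I.
have zz (x : 'rV[R]_5) (r : R) : 0 < r -> `|x - x| < r by rewrite subrr normr0.
have [Up Ep] : U (Phi e) /\ psi (Phi e) = e by have [d d0 H] := Iv; apply: H => //; exact: zz.
have [U'p E'p] := H' e' e'E (zz _ _ d'0); rewrite -E in U'p E'p.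
have [g [g1 g2 N]] := good_transition sol scal gd gd' Up U'p.
have eg : e' = e *m g by have := nbhs_singleton N; rewrite E'p Ep.
exists g; split=> // x xE; apply/esym; apply: (agree_at_eq (Phi := Phi) (Phi' := fun x => Phi' (x *m g)) xE).
apply: (sect_unique sol scal sP (sect_rot g1 g2 sP') eE xE).
pose V := [set q | psi' q = psi q *m g /\ U' q].
have NV : nbhs (Phi e) V by apply: filterI N _; exact: open_nbhs_nbhs (conj (good_open sol gd') U'p).
have [d d0 H] := inverts_near sol gd eE Iv NV.
exists (Num.min d (d' / 5%:R)); first by rewrite lt_min d0 divr_gt0.
move=> y yE; rewrite lt_min => /andP[h1 h2]; have [_ Ey [Vy U'y]] := H y yE h1.
have := orth_near g1 d'0 h2; rewrite -eg => h3; have [U'z Ez] := H' _ (onE_mul g1 g2 yE) h3.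
by apply: (good_inj sol gd') => //; rewrite Vy Ey Ez.
Qed.

Lemma image_open Phi : sect f setT Phi -> open [set p | exists2 e, onE e & Phi e = p].
Proof.
move=> sP; rewrite openE => p [e eE Ep]; have [U [psi [gd [d d0 H]]]] := sP e eE I.
have [Up Pp] : U (Phi e) /\ psi (Phi e) = e by apply: H => //; rewrite subrr normr0.
have op : open [set x : 'rV[R]_5 | `|x - e| < d] by exact: rV_ball_open.
have N1 : nbhs (Phi e) (psi @^-1` [set x : 'rV[R]_5 | `|x - e| < d]).
  by apply: (good_continuous sol gd Up); apply: open_nbhs_nbhs; split=> //; rewrite /= Pp subrr normr0.
rewrite /interior -Ep; apply: filterS2 N1 (open_nbhs_nbhs (conj (good_open sol gd) Up)) => q /= qd Uq.
have qE := good_onE gd Uq; exists (psi q) => //; have [h1 h2] := H _ qE qd.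
exact: (good_inj sol gd).
Qed.

(** The image is open. It is closed because a global section passes through any point q, with open
    image; if the two images meet, the sections differ by a rotation of the model and q is a value
    of Phi. Connectedness of M concludes. *)
Lemma sect_onto Phi : sect f setT Phi -> forall p, exists2 e, onE e & Phi e = p.
Proof.
move=> sP p; have [_ cM _ _ _] := sol.
have : [set p | exists2 e, onE e & Phi e = p] = [set: M].
  apply: cM.
  - by exists (Phi (sph (0, 0) 0 0)), (sph (0, 0) 0 0) => //; exact: sph_onE.
  - by exists [set p | exists2 e, onE e & Phi e = p]; [exact: image_open|rewrite setTI].
  exists [set p | exists2 e, onE e & Phi e = p]; last by rewrite setTI.
  rewrite -openC openE => q nq; have [U [psi [gd Uq Eq]]] := good_exists sol scal q (sqrt2_sqr R).
  have [Phi' sP' [d d0 H]] := global_section sol scal gd Uq Eq.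
  have qE := good_onE gd Uq.
  have [h1 h2] : U (Phi' (psi q)) /\ psi (Phi' (psi q)) = psi q by apply: H => //; rewrite subrr normr0.
  have Pq : Phi' (psi q) = q by exact: (good_inj sol gd).
  have N : nbhs q [set p | exists2 e, onE e & Phi' e = p].
    by apply: open_nbhs_nbhs; split; [exact: image_open|exists (psi q)].
  apply: filterS N => r [e' e'E E'] [e eE E]; apply: nq.
  have EE : Phi e = Phi' e' by rewrite E.
  have [g [g1 g2 _ H3]] := sect_meet sP sP' eE e'E EE.
  have t1 : g^T *m g^T^T = 1%:M by rewrite trmxK; exact: orth_tr.
  have t2 : g^T *m Psph = Psph *m g^T by rewrite -{1}tr_Psph -trmx_mul -g2 trmx_mul tr_Psph.
  exists (psi q *m g^T); first exact: onE_mul.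
  by rewrite -H3; [rewrite -mulmxA orth_tr // mulmx1|exact: onE_mul].
by move=> /(congr1 (fun A : set M => A p)) => H; have : [set: M] p by []; rewrite -H.
Qed.

Variable Phi : 'rV[R]_5 -> M.
Hypothesis sP : sect f setT Phi.

Definition deck (g : 'M[R]_5) := [/\ g *m g^T = 1%:M, g *m Psph = Psph *m g & forall x, onE x -> Phi (x *m g) = Phi x].

(** For q near Phi x, the points psi q and psi q g have the same image under Phi and both lie where
    psi inverts Phi, so they are equal; rigidity gives g = 1. *)
Lemma deck_free g x : deck g -> onE x -> x *m g = x -> g = 1%:M.
Proof.
move=> [g1 g2 g3] xE xg; have [U [psi [gd [d d0 H]]]] := sP xE I.
have [Up Pp] : U (Phi x) /\ psi (Phi x) = x by apply: H => //; rewrite subrr normr0.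
apply: (good_rigid sol scal gd Up g2).
have op : open [set y : 'rV[R]_5 | `|y - x| < d / 5%:R] by exact: rV_ball_open.
have d5 : 0 < d / 5%:R by rewrite divr_gt0.
have N1 : nbhs (Phi x) (psi @^-1` [set y : 'rV[R]_5 | `|y - x| < d / 5%:R]).
  by apply: (good_continuous sol gd Up); apply: open_nbhs_nbhs; split=> //; rewrite /= Pp subrr normr0.
apply: filterS2 N1 (open_nbhs_nbhs (conj (good_open sol gd) Up)) => q /= qd Uq.
have qE := good_onE gd Uq.
have qd' : `|psi q - x| < d by apply: (lt_le_trans qd); rewrite ler_pdivrMr // ler_peMr ?(ltW d0) // ler1n.
have [h1 h2] := H _ qE qd'; have Eq : Phi (psi q) = q by exact: (good_inj sol gd).
have := orth_near g1 d0 qd; rewrite xg => h3; have [_ h4] := H _ (onE_mul g1 g2 qE) h3.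
by rewrite -h4 g3 // Eq.
Qed.

Lemma deck_mul g h : deck g -> deck h -> deck (g *m h).
Proof.
move=> [g1 g2 g3] [h1 h2 h3]; split.
- by rewrite trmx_mul mulmxA -(mulmxA g) h1 mulmx1.
- by rewrite -mulmxA h2 mulmxA g2 mulmxA.
by move=> x xE; rewrite mulmxA h3 ?g3 //; exact: onE_mul.
Qed.

(** The square has a fixed point on the model by [square_axis], and it is a deck transformation. *)
Lemma deck_square g : deck g -> g *m g = 1%:M.
Proof.
move=> dg; have [g1 g2 _] := dg; have [x [xE xg]] := square_axis g1 g2.
by apply: (deck_free (deck_mul dg dg) xE); rewrite mulmxA.
Qed.

(** As g is an involution it fixes y g + y; if this vector of R^3 were nonzero, a multiple of it
    would be a fixed point on the model. *)
Lemma deck_antipodal g (y : 'rV[R]_5) : deck g -> g != 1%:M -> y *m Psph = y -> y *m g = - y.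
Proof.
move=> dg gn yP; have [g1 g2 _] := dg; have gg := deck_square dg; apply/eqP; rewrite -addr_eq0.
apply: contraNT gn => n0; apply/eqP.
have zP : (y *m g + y) *m Psph = y *m g + y by rewrite mulmxDl -mulmxA g2 mulmxA yP.
have [s sE] := normalize zP n0; apply: (deck_free dg sE).
by rewrite -scalemxAl mulmxDl -mulmxA gg mulmx1 addrC.
Qed.

(** Both act as -1 on R^3, so their product fixes a point of the model and is trivial; both are
    involutions. *)
Lemma deck_two g h : deck g -> deck h -> g != 1%:M -> h != 1%:M -> g = h.
Proof.
move=> dg dh gn hn; pose y : 'rV[R]_5 := sph (0, 0) 0 0; have yE : onE y by exact: sph_onE.
have yP : y *m Psph = y.
  apply/rowP => k; rewrite mul_Psph !mxE; case: k => [[|[|[|[|[|//]]]]] ?] /=; by rewrite ?mulr1 ?mulr0 ?mul0r.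
have E : y *m (g *m h) = y by rewrite mulmxA (deck_antipodal dg gn yP) mulNmx (deck_antipodal dh hn yP) opprK.
have := deck_free (deck_mul dg dh) yE E => gh.
by rewrite -[g]mulmx1 -(deck_square dh) mulmxA gh mul1mx.
Qed.

(** A single matrix describes both cases: g = 1 stands for the trivial group, any other g for a
    group of order 2. *)
Lemma deck_group : exists g : 'M[R]_5, [/\ deck g, g *m g = 1%:M,
  g != 1%:M -> forall x, onE x -> x *m g != x &
  forall x x', onE x -> onE x' -> (Phi x = Phi x' <-> x' = x \/ x' = x *m g)].
Proof.
have d1 : deck 1%:M by split; rewrite ?trmx1 ?mulmx1 ?mul1mx // => x _; rewrite mulmx1.
have [g [dg gP]] : exists g, deck g /\ forall h, deck h -> h = 1%:M \/ h = g.
  have [[g [dg gn]]|H] := pselect (exists g, deck g /\ g != 1%:M).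
    exists g; split=> // h dh; have [->|hn] := eqVneq h 1%:M; [by left|right; exact: deck_two].
  exists 1%:M; split=> // h dh; left; apply: contrapT => hn; apply: H; exists h; split=> //.
  by apply/eqP.
exists g; split=> //; first exact: deck_square.
- by move=> gn x xE; apply: contra gn => /eqP xg; apply/eqP; exact: deck_free dg xE xg.
move=> x x' xE x'E; split=> [E|[->|->]]; last 2 first.
- by [].
- by have [_ _ H] := dg; rewrite H.
have [h [h1 h2 -> h3]] := sect_meet sP sP xE x'E E.
have dh : deck h by split.
by have [->|->] := gP h dh; [left; rewrite mulmx1|right].
Qed.

End Deck.

(** * Stereographic charts and the product R^2 x S^2 *)

Section SmoothnessTools.
Variables (R : realType).

Lemma partial_coord n (a k : 'I_n) (x : 'rV[R]_n) :
  is_derive x (delta_mx 0 a) (fun y : 'rV[R]_n => y 0 k) (k == a)%:R.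
Proof.
apply: derive_along_line.
have -> : (fun s : R => (x + s *: delta_mx 0 a) 0 k) = cst (x 0 k) + (k == a)%:R \*: id.
  by apply/funext => s; rewrite !mxE eqxx /= /GRing.scale /= mulrC.
apply: is_derive_eq (is_deriveD (is_derive_cst (x 0 k) (0 : R) (1 : R)) (is_deriveZ ((k == a)%:R : R) (is_derive_id (0 : R) (1 : R)))) _.
by rewrite add0r /GRing.scale /= mulr1.
Qed.

Lemma partial_coordE n (a k : 'I_n) : partial a (fun y : 'rV[R]_n => y 0 k) = cst (k == a)%:R.
Proof. by apply/funext => x; rewrite /partial (@derive_val _ _ _ _ _ _ _ (partial_coord a k x)). Qed.

Lemma smooth_coord n (U : set 'rV[R]_n) (k : 'I_n) : open U -> smooth_on U (fun x => x 0 k).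
Proof.
move=> oU j; case: j => [|j]; first by split=> // x _; exact: coord_continuous.
split=> [x _|a]; first exact: coord_continuous.
split=> [x _|]; first by have [] := partial_coord a k x.
by rewrite partial_coordE; exact: Ck_cst.
Qed.

Lemma Ck_local n k (U : set 'rV[R]_n) (F : 'rV[R]_n -> R) :
  (forall x, U x -> exists2 V, open V & V x /\ Ck_on k V F) -> Ck_on k U F.
Proof.
elim: k F => [|k IH] F H.
  by split=> // x /H[V oV [Vx [c _]]]; exact: c.
split=> [x /H[V oV [Vx [c _]]]|a]; first exact: c.
split=> [x /H[V oV [Vx [_ /(_ a)[d _]]]]|]; first exact: d.
by apply: IH => x /H[V oV [Vx [_ /(_ a)[_ c]]]]; exists V.
Qed.

Lemma jacobian_comp m n p (U : set 'rV[R]_n) (V : set 'rV[R]_m) (psi : 'rV[R]_n -> 'rV[R]_p)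
    (iota : 'rV[R]_m -> 'rV[R]_p) (K : 'rV[R]_m -> 'rV[R]_n) x :
  open U -> open V -> (forall k, smooth_on U (fun x => psi x 0 k)) -> (forall k, smooth_on V (fun x => K x 0 k)) ->
  (forall x, V x -> U (K x)) -> (forall x, V x -> psi (K x) = iota x) -> V x ->
  jacobian_mx K x *m jacobian_mx psi (K x) = jacobian_mx iota x.
Proof.
move=> oU oV sp sK KU pK Vx; apply/matrixP => a k; rewrite mxE [RHS]mxE.
have H := partial_comp a oV oU (sp k 1%N) (fun l => sK l 1%N) Vx (KU x Vx).
have -> : partial a (fun y => iota y 0 k) x = partial a ((fun y => psi y 0 k) \o K) x.
  by apply: (partial_eq_on _ oV _ Vx) => y Vy; rewrite /= pK.
rewrite /partial (@derive_val _ _ _ _ _ _ _ H); apply: eq_bigr => l _; by rewrite !mxE.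
Qed.

End SmoothnessTools.

Section Stereographic.
Variables (R : realType) (r : R).
Hypothesis r0 : 0 < r.

Lemma stereo_den (q : R) : 0 <= q -> q + r ^+ 2 != 0.
Proof. by move=> q0; rewrite lt0r_neq0 // ltr_wpDl // exprn_gt0. Qed.

Lemma stereo_invK (s : bool) (y : 'rV[R]_(2 + 1)) : sqnorm y = r ^+ 2 -> height s y != r ->
  stereo_inv r s (stereo r s y) = y.
Proof.
move=> yr hr; set h := height s y in hr; have d0 : r - h != 0 by rewrite subr_eq0 eq_sym.
have rn := lt0r_neq0 r0.
have yh : y 0 (rshift 2 0) = (-1) ^+ s * h by rewrite /h /height mulrA -expr2 sqrr_sign mul1r.
have zq : sqnorm (lsubmx y) = r ^+ 2 - h ^+ 2.
  have : sqnorm y = sqnorm (lsubmx y) + y 0 (rshift 2 0) ^+ 2.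
    rewrite /sqnorm big_split_ord big_ord1 /=; congr (_ + _).
    by apply: eq_bigr => k _; rewrite mxE.
  by rewrite yr yh exprMn sqrr_sign mul1r => ->; rewrite addrK.
have qE : sqnorm (stereo r s y) = r ^+ 2 * (r + h) / (r - h).
  have -> : sqnorm (stereo r s y) = (r / (r - h)) ^+ 2 * sqnorm (lsubmx y).
    by rewrite /sqnorm mulr_sumr; apply: eq_bigr => k _; rewrite /stereo -/h [X in X ^+ 2]mxE exprMn.
  by rewrite zq; field.
have D : sqnorm (stereo r s y) + r ^+ 2 = 2 * r ^+ 3 / (r - h) by rewrite qE; field.
have n2 : 2 != 0 :> R by rewrite pnatr_eq0.
rewrite /stereo_inv D qE; apply/rowP => k; rewrite mxE.
case: (split_ordP k) => j ->.
  have E1 : ((2 * r ^+ 2) *: stereo r s y) 0 j = 2 * r ^+ 2 * (r / (r - h) * y 0 (lshift 1 j)).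
    by rewrite mxE /stereo mxE [lsubmx _ _ _]mxE.
  rewrite row_mxEl E1.
  by field; rewrite ?rn ?d0 ?n2.
rewrite row_mxEr (ord1 j) mxE eqxx mulr1n yh.
by move: ((-1) ^+ s) => e; field; rewrite ?rn ?d0 ?n2.
Qed.

Lemma sqnorm_smooth n (U : set 'rV[R]_n) : open U -> smooth_on U (fun u : 'rV[R]_n => sqnorm u).
Proof.
move=> oU k; apply: Ck_sum => // j; have c := @smooth_coord R n U j oU k.
have H := CkM oU c c; apply: (Ck_ext oU _ H) => y _; by rewrite expr2.
Qed.

Lemma stereo_inv_smooth (s : bool) (k : 'I_(2 + 1)) : smooth_on setT (fun u : 'rV[R]_2 => stereo_inv r s u 0 k).
Proof.
have oT : open [set: 'rV[R]_2] by exact: openT.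
move=> j; have q := @sqnorm_smooth 2 setT oT j.
have cc (c : R) : Ck_on j [set: 'rV[R]_2] (cst c) by exact: Ck_cst.
have i : Ck_on j [set: 'rV[R]_2] (fun u => (sqnorm u + r ^+ 2)^-1).
  apply: Ck_inv => [|x _|]; [exact: oT|exact: (stereo_den (sqnorm_ge0 x))|exact: CkD q (cc (r ^+ 2))].
case: (split_ordP k) => l ->.
  have H := CkM oT i (CkM oT (cc (2 * r ^+ 2)) (@smooth_coord R 2 setT l oT j)).
  apply: (Ck_ext oT _ H) => y _; rewrite /stereo_inv [RHS]mxE row_mxEl; congr (_ * _).
  by rewrite [RHS]mxE.
have H := CkM oT i (CkM oT (cc ((-1) ^+ s * r)) (CkD oT q (cc (- r ^+ 2)))).
apply: (Ck_ext oT _ H) => y _; rewrite /stereo_inv [RHS]mxE row_mxEr (ord1 l); congr (_ * _).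
by rewrite [RHS]mxE eqxx mulr1n.
Qed.

Definition cyl (s : bool) (x : 'rV[R]_(2 + 2)) : 'rV[R]_(2 + (2 + 1)) := row_mx (lsubmx x) (stereo_inv r s (rsubmx x)).

Lemma cyl_smooth (s : bool) k : smooth_on setT (fun x => cyl s x 0 k).
Proof.
have oT n : open [set: 'rV[R]_n] by exact: openT.
move=> j; case: (split_ordP k) => l ->.
  apply: (Ck_ext (oT _) _ (@smooth_coord R _ setT (lshift 2 l) (oT _) j)) => y _.
  by rewrite /cyl row_mxEl mxE.
have sr i : Ck_on j [set: 'rV[R]_(2 + 2)] (fun x => rsubmx x 0 i).
  apply: (Ck_ext (oT _) _ (@smooth_coord R _ setT (rshift 2 i) (oT _) j)) => y _; by rewrite mxE.
have H := Ck_comp (oT _) (oT _) (stereo_inv_smooth s l j) sr (fun _ _ => I).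
by apply: (Ck_ext (oT _) _ H) => y _; rewrite /cyl row_mxEr.
Qed.

Lemma cyl_jacobian (s : bool) x : jacobian_mx (cyl s) x =
  block_mx 1%:M 0 0 (jacobian_mx (fun u => stereo_inv r s u) (rsubmx x)).
Proof.
have oT n : open [set: 'rV[R]_n] by exact: openT.
have sr i j : Ck_on j [set: 'rV[R]_(2 + 2)] (fun x => rsubmx x 0 i).
  apply: (Ck_ext (oT _) _ (@smooth_coord R _ setT (rshift 2 i) (oT _) j)) => y _; by rewrite mxE.
have pr a l : partial a (fun y : 'rV[R]_(2 + 2) => rsubmx y 0 l) = cst (rshift 2 l == a)%:R.
  by rewrite -partial_coordE; congr (partial a _); apply/funext => y; rewrite mxE.
apply/matrixP => a k; rewrite [LHS]mxE.
case: (split_ordP k) => l ->.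
  have -> : (fun y => cyl s y 0 (lshift (2 + 1) l)) = (fun y => y 0 (lshift 2 l)).
    by apply/funext => y; rewrite /cyl row_mxEl mxE.
  rewrite partial_coordE /=; case: (split_ordP a) => b ->.
    by rewrite block_mxEul [RHS]mxE (inj_eq (@lshift_inj _ _)) eq_sym.
  by rewrite block_mxEdl [RHS]mxE eq_lrshift.
have -> : (fun y => cyl s y 0 (rshift 2 l)) = (fun u => stereo_inv r s u 0 l) \o (fun y : 'rV[R]_(2 + 2) => rsubmx y).
  by apply/funext => y; rewrite /cyl row_mxEr.
have H := partial_comp a (oT _) (oT _) (stereo_inv_smooth s l 1%N) (fun i => sr i 1%N) (I : setT x) (I : setT (rsubmx x)).
rewrite /partial (@derive_val _ _ _ _ _ _ _ H); under eq_bigr => i _ do rewrite pr.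
case: (split_ordP a) => b ->.
  rewrite block_mxEur [RHS]mxE big1 // => i _.
  by rewrite /= eq_rlshift mul0r.
rewrite block_mxEdr [RHS]mxE (bigD1 b) //= eqxx mul1r big1 ?addr0 // => i ib.
by rewrite (inj_eq (@rshift_inj _ _)) (negbTE ib) mul0r.
Qed.

Lemma stereo_smooth (s : bool) (W : set 'rV[R]_(2 + 2)) (w : 'rV[R]_(2 + 2) -> 'rV[R]_(2 + 1)) k : open W ->
  (forall k, smooth_on W (fun x => w x 0 k)) -> (forall x, W x -> height s (w x) != r) ->
  smooth_on W (fun x => stereo r s (w x) 0 k).
Proof.
move=> oW sw hW j; have cc (c : R) : Ck_on j W (cst c) by exact: Ck_cst.
have h : Ck_on j W (fun x => r - height s (w x)).
  have H := CkD oW (cc r) (CkM oW (cc (- (-1) ^+ s)) (sw (rshift 2 0) j)).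
  apply: (Ck_ext oW _ H) => y _; rewrite /height; exact: (congr1 (fun z => r + z) (mulNr _ _)).
have i' : Ck_on j W (fun x => (r - height s (w x))^-1).
  by apply: (Ck_inv oW _ h) => x Wx; rewrite subr_eq0 eq_sym hW.
have H := CkM oW (CkM oW (cc r) i') (sw (lshift 1 k) j).
by apply: (Ck_ext oW _ H) => y _; rewrite /stereo [RHS]mxE [lsubmx _ _ _]mxE.
Qed.

End Stereographic.

Section Cylinder.
Variable R : realType.
Local Notation r2 := (Num.sqrt (2 : R)).
Local Notation N := (riemannian_product (euclidean R 2) (round_sphere 2 r2)).

Definition cyl_pt (p : N) : 'rV[R]_5 := row_mx (p.1 : 'rV[R]_2) (val p.2 : 'rV[R]_(2 + 1)).

Lemma cyl_norm (w : 'rV[R]_2) (y : 'rV[R]_(2 + 1)) :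
  (((row_mx w y : 'rV[R]_5) *m Psph) *m ((row_mx w y : 'rV[R]_5) *m Psph)^T) 0 0 = sqnorm y.
Proof.
rewrite mxE; have E (k : 'I_5) : ((row_mx w y : 'rV[R]_5) *m Psph) 0 k = (row_mx w y : 'rV[R]_5) 0 k * (2 <= k)%N%:R by rewrite mul_Psph.
under eq_bigr => k _ do rewrite [(_)^T _ _]mxE E.
rewrite (@big_split_ord _ _ _ 2 3) /= [X in X + _]big1 ?add0r; last first.
  by move=> k _; have -> : (1 < k)%N = false; [by apply/negbTE; rewrite -leqNgt -ltnS; case: k|rewrite !mulr0].
rewrite /sqnorm; apply: eq_bigr => k _; rewrite mulr1 -expr2; congr (_ ^+ 2); exact: row_mxEr.
Qed.

Lemma cyl_onE (p : N) : onE (cyl_pt p).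
Proof.
have := set_mem (valP p.2) => h.
rewrite /onE [LHS]mx11_scalar cyl_norm; congr (_%:M); rewrite -[RHS](sqrt2_sqr R); exact: h.
Qed.

Lemma cyl_inj : injective cyl_pt.
Proof.
move=> [w y] [w' y'] E.
have := congr1 (@lsubmx R 1 2 3) E; rewrite /cyl_pt !row_mxKl /= => ->.
have := congr1 (@rsubmx R 1 2 3) E; rewrite /cyl_pt !row_mxKr /= => E2.
by congr (_, _); exact: val_inj.
Qed.

Lemma cyl_surj (e : 'rV[R]_5) : onE e -> exists p : N, cyl_pt p = e.
Proof.
move=> eE; pose w := lsubmx (e : 'rV[R]_(2 + 3)); pose y := rsubmx (e : 'rV[R]_(2 + 3)).
have E : e = row_mx w y by rewrite hsubmxK.
have Y : y \in @sphere_set R 2 r2.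
  apply/mem_set; have := congr1 (fun X : 'M[R]_1 => X 0 0) eE; rewrite E cyl_norm [RHS]mxE eqxx mulr1n => h.
  by rewrite /sphere_set /= h sqrt2_sqr.
by exists (w, exist _ y Y); rewrite /cyl_pt /= E.
Qed.

Lemma cyl_continuous : continuous cyl_pt.
Proof.
move=> p; apply: rV_continuous => k; rewrite -[k]/(k : 'I_(2 + 3)).
have c1 : {for p, continuous (fun q : N => q.1 : 'rV[R]_2)} by exact: cvg_fst.
have c2 : {for p, continuous (fun q : N => val q.2 : 'rV[R]_(2 + 1))}.
  have c3 : {for p, continuous (fun q : N => q.2)} by exact: cvg_snd.
  have c4 : {for p.2, continuous (fun y : round_sphere 2 r2 => val y : 'rV[R]_(2 + 1))} by exact: initial_continuous.
  exact: (@continuous_comp _ _ _ (fun q : N => q.2) (fun y : round_sphere 2 r2 => val y : 'rV[R]_(2 + 1)) p c3 c4).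
case: (@split_ordP 2 3 k) => l ->.
  have -> : (fun q => cyl_pt q 0 (lshift 3 l)) = (fun q : N => (q.1 : 'rV[R]_2) 0 l).
    by apply/funext => q; rewrite /cyl_pt; exact: row_mxEl.
  have c5 : {for (p.1 : 'rV[R]_2), continuous (fun y : 'rV[R]_2 => y 0 l)} by exact: coord_continuous.
  exact: (@continuous_comp _ _ _ (fun q : N => q.1 : 'rV[R]_2) (fun y : 'rV[R]_2 => y 0 l) p c1 c5).
have -> : (fun q => cyl_pt q 0 (rshift 2 l)) = (fun q : N => (val q.2 : 'rV[R]_(2 + 1)) 0 l).
  by apply/funext => q; rewrite /cyl_pt; exact: row_mxEr.
have c5 : {for (val p.2 : 'rV[R]_(2 + 1)), continuous (fun y : 'rV[R]_(2 + 1) => y 0 l)} by exact: coord_continuous.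
exact: (@continuous_comp _ _ _ (fun q : N => val q.2 : 'rV[R]_(2 + 1)) (fun y : 'rV[R]_(2 + 1) => y 0 l) p c2 c5).
Qed.

(** The sphere carries the initial topology of its inclusion, so continuity into the product can be
    tested in R^5. *)
Lemma to_cyl_continuous (T : topologicalType) (F : T -> N) : continuous (fun t => cyl_pt (F t)) -> continuous F.
Proof.
move=> cF.
have co k : continuous (fun t => cyl_pt (F t) 0 k).
  move=> t; have c5 : {for cyl_pt (F t), continuous (fun y : 'rV[R]_5 => y 0 k)} by exact: coord_continuous.
  exact: (@continuous_comp _ _ _ (fun t => cyl_pt (F t)) (fun y : 'rV[R]_5 => y 0 k) t (cF t) c5).
have c1 : continuous (fun t => (F t).1 : 'rV[R]_2).
  move=> t; apply: rV_continuous => k; have := co (@lshift 2 3 k) t.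
  have -> // : (fun t => cyl_pt (F t) 0 (@lshift 2 3 k)) = (fun t => ((F t).1 : 'rV[R]_2) 0 k).
  by apply/funext => s; rewrite /cyl_pt; exact: row_mxEl.
have c2 : continuous (fun t => val (F t).2 : 'rV[R]_(2 + 1)).
  move=> t; apply: rV_continuous => k; have := co (@rshift 2 3 k) t.
  have -> // : (fun t => cyl_pt (F t) 0 (@rshift 2 3 k)) = (fun t => (val (F t).2 : 'rV[R]_(2 + 1)) 0 k).
  by apply/funext => s; rewrite /cyl_pt; exact: row_mxEr.
have c3 : continuous (fun t => (F t).2).
  by apply: continuous_comp_initial; exact: c2.
move=> t; have H := cvg_pair (c1 t) (c3 t).
have -> : F = (fun t => ((F t).1, (F t).2)) by apply/funext => s; case: (F s).
exact: H.
Qed.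

Lemma cyl_param (i : chart_index N) (x : 'rV[R]_(2 + 2)) : cyl_pt (param i x) = cyl r2 i.2 x.
Proof. by []. Qed.

Lemma cyl_chart (i : chart_index N) (p : N) : dom i p -> cyl r2 i.2 (chart i p) = cyl_pt p.
Proof.
move=> [_ h]; have r20 := sqrt2_gt0 R; have := set_mem (valP p.2) => hp.
rewrite /cyl /cyl_pt /= row_mxKl row_mxKr; congr row_mx; exact: (stereo_invK r20 hp h).
Qed.

Lemma cyl_metric (i : chart_index N) x : metric i x = jacobian_mx (cyl r2 i.2) x *m (jacobian_mx (cyl r2 i.2) x)^T.
Proof.
rewrite (cyl_jacobian (sqrt2_gt0 R)) tr_block_mx mulmx_block !trmx0 trmx1.
by rewrite !mulmx0 !mul0mx mulmx1 !addr0 add0r.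
Qed.

Lemma cyl_local_dom n (Q : riemannian_data R n) (F : N -> Q) (i : chart_index N) (j : chart_index Q) x :
  local_dom F i j x -> dom j (F (param i x)) /\ chart j (F (param i x)) = local_expr F i j x.
Proof.
move=> [p [ip jp] E]; have -> : param i x = p.
  by apply: cyl_inj; rewrite cyl_param -E cyl_chart.
by split=> //; rewrite /local_expr /= -E; congr (chart j (F _)); apply: cyl_inj; rewrite cyl_param cyl_chart.
Qed.

Lemma rotated_gram (G G' L : 'M[R]_4) (A B : 'M[R]_(4, 5)) (h : 'M[R]_5) : h *m h^T = 1%:M ->
  G = A *m A^T -> G' = B *m B^T -> L *m B = A *m h -> G = L *m G' *m L^T.
Proof.
move=> h1 -> -> E; have -> : L *m (B *m B^T) *m L^T = (L *m B) *m (L *m B)^T by rewrite trmx_mul !mulmxA.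
by rewrite E trmx_mul mulmxA -(mulmxA A) h1 mulmx1.
Qed.

(** In all charts the metric is the Gram matrix of the Jacobian of [cyl]. The chain rule expresses
    the Jacobian of F through those of [cyl], up to the orthogonal factor h, which drops out of Gram
    matrices. *)
Lemma rotation_local_isometry (h : 'M[R]_5) (F : N -> N) : h *m h^T = 1%:M ->
  (forall p, cyl_pt (F p) = cyl_pt p *m h) -> local_isometry F.
Proof.
move=> h1 FP; have r20 := sqrt2_gt0 R.
have oT n : open [set: 'rV[R]_n] by exact: openT.
pose w (i : chart_index N) (x : 'rV[R]_(2 + 2)) : 'rV[R]_(2 + (2 + 1)) := (cyl r2 i.2 x : 'rV[R]_5) *m h.
have wE i x : cyl_pt (F (param i x)) = w i x by rewrite FP cyl_param.
have sw i k : smooth_on setT (fun x => w i x 0 k).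
  move=> n; have -> : (fun x => w i x 0 k) = (fun x => \sum_j (cyl r2 i.2 x : 'rV[R]_5) 0 j * h j k).
    by apply/funext => x; rewrite mxE.
  apply: Ck_sum => // j; apply: CkM => //; [exact: (cyl_smooth r20)|exact: Ck_cst].
have wl i x : (F (param i x)).1 = lsubmx (w i x) by rewrite -wE /cyl_pt; apply/esym/row_mxKl.
have wr i x : val (F (param i x)).2 = rsubmx (w i x) by rewrite -wE /cyl_pt; apply/esym/row_mxKr.
have LE i j x : local_expr F i j x = row_mx (lsubmx (w i x)) (stereo r2 j.2 (rsubmx (w i x))).
  by rewrite /local_expr /= wl wr.
pose W i (j : chart_index N) : set 'rV[R]_(2 + 2) := [set x | height j.2 (rsubmx (w i x)) != r2].
have dW i j x : W i j x <-> dom j (F (param i x)).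
  by rewrite /W /= -wr; split=> [H|[]//]; split.
have srw i k : smooth_on setT (fun x => rsubmx (w i x) 0 k).
  have -> : (fun x => rsubmx (w i x) 0 k) = (fun x => w i x 0 (rshift 2 k)) by apply/funext => x; rewrite mxE.
  exact: sw.
have slw i k : smooth_on setT (fun x => lsubmx (w i x) 0 k).
  have -> : (fun x => lsubmx (w i x) 0 k) = (fun x => w i x 0 (lshift (2 + 1) k)) by apply/funext => x; rewrite mxE.
  exact: sw.
have oW i j : open (W i j).
  pose hh x := height j.2 (rsubmx (w i x)).
  have ch : continuous hh.
    move=> x; have c1 : {for x, continuous (fun x => rsubmx (w i x) 0 (rshift 2 0))}.
      by have [c _] := srw i (rshift 2 0) 0%N; exact: c.
    have c2 : {for x, continuous (fun x : 'rV[R]_(2 + 2) => (-1 : R) ^+ j.2)} by exact: cst_continuous.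
    exact: (continuousM c2 c1).
  have -> : W i j = hh @^-1` (~` [set r2]).
    by apply/funext => x; apply/propext; rewrite /W /hh /=; split=> /eqP.
  apply: open_comp => [x _|]; first exact: ch.
  by rewrite openC; exact: closed_eq.
have sL i j k : smooth_on (W i j) (fun x => local_expr F i j x 0 k).
  have sub n G : Ck_on n setT G -> Ck_on n (W i j) G by move=> H; apply: Ck_sub H => x _.
  case: (split_ordP k) => l -> n.
    have -> : (fun x => local_expr F i j x 0 (lshift 2 l)) = (fun x => lsubmx (w i x) 0 l).
      by apply/funext => x; rewrite LE row_mxEl.
    by apply: sub; exact: slw.
  have -> : (fun x => local_expr F i j x 0 (rshift 2 l)) = (fun x => stereo r2 j.2 (rsubmx (w i x)) 0 l).
    by apply/funext => x; rewrite LE row_mxEr.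
  have s1 k' : smooth_on (W i j) (fun x => rsubmx (w i x) 0 k') by move=> m; exact: sub (srw i k' m).
  have hW x : W i j x -> height j.2 (rsubmx (w i x)) != r2 by [].
  exact: (@stereo_smooth R r2 j.2 (W i j) (fun x => rsubmx (w i x)) l (oW i j) s1 hW n).
split; first split.
- apply: to_cyl_continuous => p; have -> : (fun t => cyl_pt (F t)) = (fun t => cyl_pt t *m h) by apply/funext => t.
  apply: rV_continuous => k.
  have -> : (fun t => (cyl_pt t *m h) 0 k) = \sum_j (fun t => cyl_pt t 0 j * h j k).
    by apply/funext => t; rewrite mxE fct_sumE.
  have cj j : {for p, continuous (fun t => cyl_pt t 0 j * h j k)}.
    have c5 : {for cyl_pt p, continuous (fun y : 'rV[R]_5 => y 0 j)} by exact: coord_continuous.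
    have c6 := @continuous_comp _ _ _ cyl_pt (fun y : 'rV[R]_5 => y 0 j) p (@cyl_continuous p) c5.
    have c7 : {for p, continuous (fun t : N => h j k)} by exact: cst_continuous.
    exact: (continuousM c6 c7).
  elim/big_ind: _ => [|F1 F2 H1 H2|j _]; [exact: cst_continuous|exact: (continuousD H1 H2)|exact: cj].
- move=> i j k; have sub : local_dom F i j `<=` W i j.
    by move=> x /cyl_local_dom[H _]; apply/dW.
  by move=> n; apply: Ck_sub sub (sL i j k n).
move=> i j x Lx; have [jx Ex] := cyl_local_dom Lx.
have Wx : W i j x by apply/dW.
have pK y : W i j y -> cyl r2 j.2 (local_expr F i j y) = w i y.
  by move=> /dW jy; rewrite -wE -(cyl_chart jy).
have J := jacobian_comp (oT _) (oW i j) (cyl_smooth r20 j.2) (sL i j) (fun _ _ => I) pK Wx.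
have Jw : jacobian_mx (w i) x = (jacobian_mx (cyl r2 i.2) x : 'M[R]_(4, 5)) *m h.
  exact: (@jacobian_mulmx R setT (cyl r2 i.2) h x (oT _) I (cyl_smooth r20 i.2)).
rewrite Jw in J.
exact: (rotated_gram h1 (cyl_metric i x) (cyl_metric j (local_expr F i j x)) J).
Qed.

Lemma rotation_exists (h : 'M[R]_5) : h *m h^T = 1%:M -> h *m Psph = Psph *m h ->
  exists F : N -> N, forall p, cyl_pt (F p) = cyl_pt p *m h.
Proof.
move=> h1 h2; have H (p : N) : exists q : N, cyl_pt q = cyl_pt p *m h.
  by apply: cyl_surj; apply: onE_mul => //; exact: cyl_onE.
by have [F FP] := choice H; exists F.
Qed.

Lemma rotation_isometry (h : 'M[R]_5) (F : N -> N) : h *m h^T = 1%:M -> h *m Psph = Psph *m h ->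
  (forall p, cyl_pt (F p) = cyl_pt p *m h) -> isometry F.
Proof.
move=> h1 h2 FP; have t1 : h^T *m h^T^T = 1%:M by rewrite trmxK; exact: orth_tr.
have t2 : h^T *m Psph = Psph *m h^T by rewrite -{1}tr_Psph -trmx_mul -h2 trmx_mul tr_Psph.
split; first exact: rotation_local_isometry FP.
have [F' F'P] := rotation_exists t1 t2; exists F'; split.
- by move=> p; apply: cyl_inj; rewrite F'P FP -mulmxA h1 mulmx1.
- by move=> p; apply: cyl_inj; rewrite FP F'P -mulmxA orth_tr // mulmx1.
exact: rotation_local_isometry F'P.
Qed.

End Cylinder.

(** * The projection and the conclusion *)

Section Projection.
Variables (R : realType) (M : riemannian_data R 4) (f : M -> R).
Hypothesis sol : shrinking_gradient_ricci_soliton f.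
Hypothesis scal : constant_scalar_curvature M 1.
Let rM := sol_riemannian sol.
Let mM := sol_manifold sol.
Local Notation r2 := (Num.sqrt (2 : R)).
Local Notation N := (riemannian_product (euclidean R 2) (round_sphere 2 r2)).

Lemma good_in_chart U psi q j : good f U psi -> U q -> dom j q -> exists2 rho, 0 < rho &
  (forall x, `|x - chart j q| < rho -> cod j x) /\
  dev_chart [set x | `|x - chart j q| < rho] (metric j) (f \o param j) (psi \o param j).
Proof.
move=> [i [x0 [r [C [phi [P -> ->]]]]]] Uq jq.
have [rho rho0 [H d]] := dev_change sol scal jq Uq (patch_sub P) (patch_dev P).
exists rho => //; split=> // x /H /(chart_imageP mM)[]; by [].
Qed.

Variable Phi : 'rV[R]_5 -> M.
Hypothesis sP : sect f setT Phi.

Lemma sect_comp_continuous (T : topologicalType) (e : T -> 'rV[R]_5) : (forall t, onE (e t)) ->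
  continuous e -> continuous (fun t => Phi (e t)).
Proof.
move=> eE ce t V NV; have [U [psi [gd Iv]]] := sP (eE t) I.
have [d d0 H] := inverts_near sol gd (eE t) Iv NV.
have op : open [set x : 'rV[R]_5 | `|x - e t| < d] by exact: rV_ball_open.
have tt : [set x : 'rV[R]_5 | `|x - e t| < d] (e t) by rewrite /= subrr normr0.
have N1 : nbhs t (e @^-1` [set x : 'rV[R]_5 | `|x - e t| < d]) by exact: (ce t _ (open_nbhs_nbhs (conj op tt))).
suff : nbhs t ((fun t => Phi (e t)) @^-1` V) by [].
by apply: filterS N1 => s /= sd; have [] := H _ (eE s) sd.
Qed.

(** In coordinates Phi is a continuous lift of [cyl] through the immersion psi, so smoothness and
    the Jacobian come from the lifting lemmas; both metrics are Gram matrices in R^5. *)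
Lemma projection_local (i : chart_index N) (j : chart_index M) x : dom j (Phi (cyl r2 i.2 x)) ->
  exists2 V, open V & [/\ V x, forall k, smooth_on V (fun y => chart j (Phi (cyl r2 i.2 y)) 0 k) &
    jacobian_mx (cyl r2 i.2) x *m (jacobian_mx (cyl r2 i.2) x)^T =
    jacobian_mx (fun y => chart j (Phi (cyl r2 i.2 y))) x *m metric j (chart j (Phi (cyl r2 i.2 x))) *m
    (jacobian_mx (fun y => chart j (Phi (cyl r2 i.2 y))) x)^T].
Proof.
move=> jx; have r20 := sqrt2_gt0 R; pose iota y : 'rV[R]_5 := cyl r2 i.2 y.
have iE y : onE (iota y) by rewrite /iota -cyl_param; exact: cyl_onE.
have oT n : open [set: 'rV[R]_n] by exact: openT.
have ci : continuous iota.
  by move=> y; apply: rV_continuous => k; have [c _] := cyl_smooth r20 i.2 k 0%N; exact: c.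
have cP : continuous (fun y => Phi (iota y)) by exact: sect_comp_continuous.
have [U [psi [gd Iv]]] := sP (iE x) I.
have Ux : U (Phi (iota x)) by have [d d0 H] := Iv; have [] := H _ (iE x); rewrite // subrr normr0.
have [rho rho0 [rc dv]] := good_in_chart gd Ux jx.
pose B := [set z : 'rV[R]_4 | `|z - chart j (Phi (iota x))| < rho].
have oB : open B by exact: rV_ball_open.
have NW : nbhs (Phi (iota x)) [set q | dom j q /\ B (chart j q)].
  apply: filterI (dom_near mM jx) _; apply: (chart_continuous mM jx); apply: open_nbhs_nbhs; split=> //.
  by rewrite /B /= subrr normr0.
have [d d0 H] := inverts_near sol gd (iE x) Iv NW.
pose V := [set y : 'rV[R]_4 | `|iota y - iota x| < d].
have oV : open V.
  have -> : V = iota @^-1` [set e : 'rV[R]_5 | `|e - iota x| < d] by [].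
  by apply: open_comp => [y _|]; [exact: ci|exact: rV_ball_open].
have Vx : V x by rewrite /V /= subrr normr0.
pose K y := chart j (Phi (iota y)).
have VP y : V y -> [/\ dom j (Phi (iota y)), B (K y) & psi (param j (K y)) = iota y].
  move=> Vy; have [_ E [jy By]] := H _ (iE y) Vy; split=> //.
  by rewrite /K (chartK mM jy).
have sc := sol_chart sol scal j.
pose Bi z : 'M[R]_(5, 4) := (jacobian_mx (psi \o param j) z)^T *m invmx (metric j z).
have sBi : smooth_mx B Bi.
  apply: smooth_mxM => //; last by move=> a b k; apply: Ck_sub (sc_smooth_inv sc a b k).
  apply: smooth_mx_tr => a k l; have -> : (fun z => jacobian_mx (psi \o param j) z a k) = partial a (fun z => (psi \o param j) z 0 k).
    by apply/funext => z; rewrite mxE.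
  by have [_ /(_ a)[]] := dc_smooth dv k l.+1.
have JB z : B z -> jacobian_mx (psi \o param j) z *m Bi z = 1%:M.
  by move=> Bz; rewrite /Bi mulmxA (dc_gram dv Bz) mulmxV // (sc_unit sc (rc _ Bz)).
have KB y : V y -> B (K y) by move=> /VP[].
have cK y : V y -> {for y, continuous K}.
  move=> /VP[jy _ _]; exact: (@continuous_comp _ _ _ (fun y => Phi (iota y)) (chart j) y (cP y) (chart_continuous mM jy)).
have sI k : smooth_on V (fun y => iota y 0 k).
  by move=> n; have sub : V `<=` setT by []; exact: Ck_sub sub (cyl_smooth r20 i.2 k n).
have pK y : V y -> (psi \o param j) (K y) = iota y by move=> /VP[].
exists V => //; split=> //.
  move=> k; exact: (lift_smooth oB (dc_smooth dv) sBi JB oV KB cK sI pK k).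
have J := lift_jacobian oB (dc_smooth dv) sBi JB oV KB cK sI pK Vx.
have E : jacobian_mx iota x *m (jacobian_mx iota x)^T = jacobian_mx K x *m metric j (K x) *m (jacobian_mx K x)^T.
  by rewrite -J; exact: (change_gram erefl (dc_gram dv (KB x Vx))).
exact: E.
Qed.

Lemma projection_local_isometry : local_isometry (fun p : N => Phi (cyl_pt p)).
Proof.
have cP : continuous (fun p : N => Phi (cyl_pt p)).
  by apply: sect_comp_continuous; [exact: cyl_onE|exact: cyl_continuous].
split; first split=> //.
  move=> i j k n; apply: Ck_local => x /cyl_local_dom[jx _].
  have [V oV [Vx sV _]] := projection_local (i := i) jx; exists V => //; split=> //.
  exact: sV.
move=> i j x /cyl_local_dom[jx _]; have [V _ [_ _ E]] := projection_local (i := i) jx.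
have /= := cyl_metric i x; move: (metric i x) => G ->; exact: E.
Qed.

End Projection.


Theorem theorem1p6 (R : realType) (M : riemannian_data R 4) (f : M -> R) :
  shrinking_gradient_ricci_soliton f ->
  ~ compact [set: M] ->
  constant_scalar_curvature M 1 ->
  exists Q : riemannian_data R 4,
    finite_quotient
      (riemannian_product (euclidean R 2) (round_sphere 2 (Num.sqrt 2 : R))) Q
    /\ isometric M Q.
Proof.
(* The quotient is M itself: it only remains to exhibit the group and the projection. *)
move=> sol nc scal; have rM := sol_riemannian sol; exists M; split; last first.
  have li : local_isometry (@id M) by have [mM _ _ pm] := rM; have [_ _ _ _ sm] := mM.
  by exists id; split=> //; exists id.
(* A base point exists because the empty space is compact. *)
have [p _] : exists p : M, True.
  apply: contrapT => H; apply: nc; have -> : [set: M] = set0; last exact: compact0.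
  by apply/funext => p; apply/propext; split=> // _; apply: H; exists p.
have [U [psi [gd Up Ep]]] := good_exists sol scal p (sqrt2_sqr R).
have [Phi sP _] := global_section sol scal gd Up Ep.
have [g [[g1 g2 _] gg gfree gP]] := deck_group sol scal sP.
have [F FP] := rotation_exists g1 g2.
have FF q : F (F q) = q by apply: cyl_inj; rewrite !FP -mulmxA gg mulmx1.
(* The acting group is the cyclic group ['I_n.+1], of order 1 or 2 according to whether g is
   trivial. *)
pose n := nat_of_bool (g != 1%:M).
pose to (q : riemannian_product (euclidean R 2) (round_sphere 2 (Num.sqrt 2 : R))) (a : 'I_n.+1) :=
  if a == ord0 then q else F q.
have to1 : to^~ 1%g =1 id by move=> q.
have toM q : act_morph to q.
  move=> a b; rewrite /to; move: a b; rewrite /n; case: (g != 1%:M) => a b.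
    by case: a => [[|[|//]] ?]; case: b => [[|[|//]] ?] //=; rewrite FF.
  by rewrite !ord1.
exists 'I_n.+1, (TotalAction to1 toM), (fun q => Phi (cyl_pt q)); split.
- exact: rM.
- move=> a; have [a0|a0] := eqVneq a ord0.
    have := @rotation_isometry R 1%:M (fun q => to q a); apply; rewrite ?trmx1 ?mulmx1 ?mul1mx // => q.
    by rewrite /to a0 eqxx mulmx1.
  by apply: (rotation_isometry (h := g)) => // q; rewrite /= /to (negbTE a0).
- move=> a q; rewrite /= /to; case: eqP => [-> //|/eqP a0 E].
  have gn : g != 1%:M.
    by move: a a0 E; rewrite /n; case: (g != 1%:M) => // a; rewrite ord1.
  by have := gfree gn _ (cyl_onE q); rewrite -FP E eqxx.
split; first exact: (projection_local_isometry sol scal sP).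
  move=> q; have [e eE E] := sect_onto sol scal sP q; have [q' Eq'] := cyl_surj eE.
  by exists q'; rewrite Eq'.
move=> q q'; split=> [E|[a ->]].
  have [/(_ E)[] E' _] := gP _ _ (cyl_onE q) (cyl_onE q').
    by exists ord0; apply: cyl_inj; rewrite /= /to eqxx.
  have [g11|gn] := eqVneq g 1%:M.
    by exists ord0; apply: cyl_inj; rewrite /= /to eqxx E' g11 mulmx1.
  have n1 : (1 < n.+1)%N by rewrite /n gn.
  by exists (Ordinal n1); apply: cyl_inj; rewrite /= /to /= FP.
apply/gP; [exact: cyl_onE|exact: cyl_onE|].
by rewrite /= /to; case: eqP => _; [left|right; rewrite FP].
Qed.
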